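(* Let $\xi^*:I\to\mathbb{R}$ and $Q,R:\Omega\to\mathbb{R}$ be limits along some sequence $\varepsilon\to0$ in the sense that $$\xi^*_\varepsilon\to\xi^*\ \text{in } L^\infty(I),\qquad Q_\varepsilon\to Q\ \text{in }L^\infty(\Omega),\qquad R_{1,\varepsilon}\to R\ \text{in }L^\infty(\Omega),$$ and set $P:=Q+R$ (so that, along the same sequence, $P_\varepsilon\to P$ in $L^s_{\rm loc}(\Omega)$ for any $1\le s<\infty$). Then $(P,Q,R,\xi^* )$ satisfies: 1. $\Xi^*:=\{(\tau,\xi^*(\tau)):\tau\in I\}$ is a Lipschitz curve in $\Omega$; the functions $Q$, $R$ and $P=Q+R$ are bounded and locally Hölder continuous in $\Omega$; furthermore $R\in L^\infty(I;L^1(\mathbb{R}))$ and $\partial_\xi R\in L^\infty(I;L^2(\mathbb{R}))$. 2. $Q$ is a solution of the heat equation $\partial_\tau Q=\partial_\xi^2Q$ in $\Omega$ with initial data $P(0,\cdot)$. 3. $(P,\xi^* )$ is a distributional solution of $$\partial_\tau P=\partial_\xi^2P\ \text{ in }\Omega\setminus\Xi^*,\qquad [\![P]\!]=0\ \text{ and }\ 2\,\tfrac{\mathrm d}{\mathrm d\tau}\xi^*=[\![\partial_\xi P]\!]\ \text{ on }\Xi^*,$$ with initial data $(P(0,\cdot),\xi^*(0))$ attained in $L^\infty(\mathbb{R})\times\mathbb{R}$. Moreover, $$P(\tau,\xi)\ge-1\ \text{ for all }(\tau,\xi)\in\Omega,\qquad P(\tau,\xi)\le1\ \text{ if }\xi\ge\xi^*(\tau),$$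 which implies $P\in[-1,1]$ on $\Xi^*$, and the movement of the interface is determined by $$\tfrac{\mathrm d}{\mathrm d\tau}\xi^*(\tau)\ge0\ \text{ for almost all }\tau\in I,\qquad \tfrac{\mathrm d}{\mathrm d\tau}\xi^*(\tau)=0\ \text{ if }P(\tau,\xi^*(\tau))\ne1 .$$
   Context: Lattice. Set $\Phi'(u)=u-\operatorname{sgn}u$, where $\operatorname{sgn}u=-1$ for $u<0$ and $\operatorname{sgn}u=+1$ for $u\ge0$. Write $\nabla_+p_j=p_{j+1}-p_j$ and $\Delta p_j=p_{j+1}-2p_j+p_{j-1}$. For $k\in\mathbb{Z}$ let $$X_k=\Big\{u\in\ell^\infty(\mathbb{Z}):\ 0<\inf_{j<k}u_j\le\sup_{j<k}u_j<\infty,\ -2<\inf_{j\ge k}u_j\le\sup_{j\ge k}u_j<0\Big\}.$$ For initial data $u(0)\in X_1$ the single-interface solution is the (unique, globally existing) continuous $u:[0,\infty)\to\ell^\infty(\mathbb{Z})$ for which there is a sequence of phase transition times $(t^*_k)_{k\ge1}\subset(0,\infty]$ such that, with $t^*_0:=0$: (1) for all $k\ge1$, either $t^*_{k-1}=\infty$ or $t^*_{k-1}<t^*_k$; (2) $\dot u_j=\Delta\Phi'(u_j)$ for all $t\in[0,\infty)\setminus\{t^*_k:k\ge1\}$; (3) $u_k(t^*_k)=0$ and $\lim_{t\searrow t^*_k}\dot u_k(t)>0$ whenever $t^*_k<\infty$; (4) $u$ takes values in $X_k$ on $(t^*_{k-1},t^*_k)$ whenever $t^*_{k-1}<\infty$.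 Set $p_j(t)=\Phi'(u_j(t))$. The discrete heat kernel is $g_j(t)=\frac1{2\pi}\int_{-\pi}^{\pi}e^{-2(1-\cos\kappa)t}\cos(j\kappa)\,\mathrm d\kappa$, i.e. the bounded solution of $\dot g_j=\Delta g_j$, $g_j(0)=\delta_j^0$. One has $p=q+r$, where $q$ is the bounded solution of $\dot q_j=\Delta q_j$ with $q_j(0)=p_j(0)$ and $r_j(t)=-2\sum_{k\ge1,\ t^*_k\le t}g_{j-k}(t-t^*_k)$. Standing assumption on initial data (macroscopic single-interface initial data). For each scaling parameter $\varepsilon>0$ initial data $u(0)\in X_1$ (depending on $\varepsilon$) are given such that $p(0)=\Phi'(u(0))$ satisfies $$|\Delta p_0(0)|\le\beta\varepsilon,\qquad \sup_{j\in\mathbb{Z}}|\nabla_+p_j(0)|\le\alpha\varepsilon,\qquad \sup_{j\ne0}|\Delta p_j(0)|\le\alpha\varepsilon^2,$$ with constants $\alpha,\beta$ independent of $\varepsilon$; $u$, $p$, $q$, $r$, $t^*_k$ denote the corresponding $\varepsilon$-dependent objects. Macroscopic quantities. Fix $0<\tau_{\rm fin}<\infty$, $I=[0,\tau_{\rm fin}]$, $\Omega=I\times\mathbb{R}$. Define $P_\varepsilon(\tau,\xi+\zeta)=p_{\xi/\varepsilon}(\tau/\varepsilon^2)$ for $\tau\ge0$, $\xi\in\varepsilon\mathbb{Z}$, $\zeta\in[-\varepsilon/2,\varepsilon/2)$, and define $Q_\varepsilon,R_\varepsilon,G_\varepsilon$ in the same way from $q,r,g$. Let $\xi^*_\varepsilon(\tau)=\varepsilon\sum_{k\ge1}k\,\chi_{[t^*_k,t^*_{k+1})}(\tau/\varepsilon^2)$,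 $\tau^*_{k,\varepsilon}=\varepsilon^2t^*_k$, and let $K_\varepsilon$ be the number of $k\ge1$ with $\tau^*_{k,\varepsilon}<\tau_{\rm fin}$. Fix constants $d_*>0$ and $0<\varepsilon_*\le1$, depending only on $\alpha,\beta,\tau_{\rm fin}$, such that for all $0<\varepsilon\le\varepsilon_*$: $K_\varepsilon\le\tau_{\rm fin}/(2d_*\varepsilon)$ and $\tau^*_{k+1,\varepsilon}-\tau^*_{k,\varepsilon}\ge2d_*\varepsilon$ for $k=1,\dots,K_\varepsilon$ (such constants exist). Define $H_\varepsilon(\tau,\xi)=0$ for $\tau\le0$, $H_\varepsilon(\tau,\xi)=\frac{\tau}{d_*\varepsilon}G_\varepsilon(d_*\varepsilon,\xi)$ for $0\le\tau\le d_*\varepsilon$, $H_\varepsilon(\tau,\xi)=G_\varepsilon(\tau,\xi)$ for $\tau\ge d_*\varepsilon$, and $$R_{1,\varepsilon}(\tau,\xi)=-2\sum_{k=1}^{K_\varepsilon}H_\varepsilon(\tau-\tau^*_{k,\varepsilon},\xi-\varepsilon k),\qquad R_{2,\varepsilon}=R_\varepsilon-R_{1,\varepsilon}.$$ Conventions. $[\![\cdot]\!]$ is the jump across $\Xi^*$ (value at $\xi^*(\tau)+0$ minus value at $\xi^*(\tau)-0$). That $(P,\xi^* )$ is a distributional solution of the free boundary problem means that $$-\int_0^{\tau_{\rm fin}}\!\!\int_{\mathbb{R}}(P+\mu)\,\partial_\tau\psi\,\mathrm d\xi\,\mathrm d\tau=\int_0^{\tau_{\rm fin}}\!\!\int_{\mathbb{R}}P\,\partial_\xi^2\psi\,\mathrm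 d\xi\,\mathrm d\tau\qquad\text{for all }\psi\in C^\infty_c((0,\tau_{\rm fin})\times\mathbb{R}),$$ where $\mu(\tau,\xi)=\operatorname{sgn}(\xi^*(\tau)-\xi)$. Limit functions are identified with their continuous representatives. *)

(* Defs.v *)
From HB Require Import structures.
From mathcomp Require Import all_boot all_order all_algebra finmap.
From mathcomp Require Import all_classical all_reals all_analysis.

Set Implicit Arguments.
Unset Strict Implicit.
Unset Printing Implicit Defensive.

Import Order.TTheory GRing.Theory Num.Def Num.Theory.
Import numFieldNormedType.Exports.

Local Open Scope classical_set_scope.
Local Open Scope ring_scope.

Section Lattice.
Context {R : realType}.
Implicit Types (u v p : int -> R) (ts : nat -> \bar R).

(* [Num.sg] is not used because it vanishes at 0. *)
Definition sgnp (x : R) : R := if x < 0 then -1 else 1.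

Definition dPhi (x : R) : R := x - sgnp x.

Definition nablap p (j : int) : R := p (j + 1) - p j.

Definition lapl p (j : int) : R := p (j + 1) - 2 * p j + p (j - 1).

(* Derivative relative to a set, so that it is one-sided at the end points of
   an interval. *)
Definition is_derive_within (D : set R) (f : R -> R) (t l : R) : Prop :=
  (f s - f t) / (s - t) @[s --> within D t^'] --> l.

(* [phase_state k u] is u in X_k; the bounds also make u bounded. *)
Definition phase_state (k : int) u : Prop :=
  [/\ (0 < ereal_inf [set (u j)%:E | j in [set j : int | (j < k)%R]])%E,
      (ereal_sup [set (u j)%:E | j in [set j : int | (j < k)%R]] < +oo)%E,
      ((-2)%:E < ereal_inf [set (u j)%:E | j in [set j : int | (k <= j)%R]])%E &
      (ereal_sup [set (u j)%:E | j in [set j : int | (k <= j)%R]] < 0)%E].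

(* Continuity into the space of bounded sequences is continuity for the
   topology of uniform convergence, together with boundedness of the values. *)
Definition linfty_continuous (u : R -> int -> R) : Prop :=
  (forall t, 0 <= t -> bounded_fun (u t)) /\
  {within `[0, +oo[, continuous (u : R -> {uniform int -> R})}.

(* [u t j] is u_j(t), and [ts k] is the k-th phase transition time, [+oo] being
   allowed. *)
Definition single_interface_solution (u : R -> int -> R) ts : Prop :=
  [/\ [/\ phase_state 1 (u 0), linfty_continuous u, ts 0%N = 0%E &
         forall k, (0 < ts k.+1)%E],
      forall k, ts k = +oo%E \/ (ts k < ts k.+1)%E,
      forall t, 0 <= t -> (forall k, t%:E <> ts k.+1) ->
        forall j, is_derive_within `[0, +oo[ (u ^~ j) t
                    (lapl (dPhi \o u t) j),
      forall k, (ts k.+1 < +oo)%E ->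
        u (fine (ts k.+1)) k.+1%:Z = 0 /\
        exists2 l : R, 0 < l &
          derive1 (u ^~ k.+1%:Z) t @[t --> (fine (ts k.+1))^'+] --> l &
      forall k, (ts k < +oo)%E ->
        forall t, (ts k < t%:E < ts k.+1)%E -> phase_state k.+1%:Z (u t)].

Definition heat_kernel (t : R) (j : int) : R :=
  (2 * pi)^-1 * \int[lebesgue_measure]_(x in `[- pi, pi])
    (expR (- 2 * (1 - cos x) * t) * cos (j%:~R * x)).

Definition bounded_heat_solution (p0 : int -> R) (q : R -> int -> R) : Prop :=
  [/\ exists M, forall t j, 0 <= t -> `|q t j| <= M,
      forall t j, 0 <= t ->
        is_derive_within `[0, +oo[ (q ^~ j) t (lapl (q t) j) &
      q 0 = p0].

Definition macroscopic_data (alpha beta eps : R) p : Prop :=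
  [/\ `|lapl p 0| <= beta * eps,
      forall j, `|nablap p j| <= alpha * eps &
      forall j, j != 0 -> `|lapl p j| <= alpha * eps ^+ 2].

End Lattice.

Section Scaling.
Context {R : realType}.
Implicit Types (z : R * R) (ts : nat -> \bar R).

(* The macroscopic coordinates are z = (tau, xi). If xi = eps * j + zeta with
   zeta in [-eps/2, eps/2), then j is the floor of xi / eps + 1/2. *)
Definition macro (eps : R) (v : R -> int -> R) z : R :=
  v (z.1 / eps ^+ 2) (Num.floor (z.2 / eps + 2^-1)).

Definition interface_position (eps : R) ts (tau : R) : R :=
  eps * limn (fun n => \sum_(1 <= k < n |
    (ts k <= (tau / eps ^+ 2)%:E)%E && ((tau / eps ^+ 2)%:E < ts k.+1)%E)
      (k%:R : R)).

Definition macro_time (eps : R) ts (k : nat) : \bar R :=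
  ((eps ^+ 2)%:E * ts k)%E.

Definition transitions (tfin eps : R) ts : set nat :=
  [set k | (1 <= k)%N /\ (macro_time eps ts k < tfin%:E)%E].

(* This is the number K_eps only when [transitions] is finite; finiteness is
   part of [transition_bounds]. *)
Definition transition_count (tfin eps : R) ts : nat :=
  #|` fset_set (transitions tfin eps ts)|.

Definition transition_bounds (tfin d eps : R) ts : Prop :=
  [/\ finite_set (transitions tfin eps ts),
      (transition_count tfin eps ts)%:R <= tfin / (2 * d * eps) &
      forall k, (1 <= k <= transition_count tfin eps ts)%N ->
        ((2 * d * eps)%:E <= macro_time eps ts k.+1 - macro_time eps ts k)%E].

Definition regularized_kernel (d eps : R) z : R :=
  if z.1 <= 0 then 0
  else if z.1 <= d * eps
    then z.1 / (d * eps) * macro eps heat_kernel (d * eps, z.2)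
    else macro eps heat_kernel z.

(* The function R_{1,eps}. *)
Definition regular_fluctuation (tfin d eps : R) ts z : R :=
  - 2 * \sum_(1 <= k < (transition_count tfin eps ts).+1)
    regularized_kernel d eps
      (z.1 - fine (macro_time eps ts k), z.2 - eps * k%:R).

End Scaling.

Notation leb1 := lebesgue_measure.
Notation leb2 := (lebesgue_measure \x lebesgue_measure)%E.

Section Continuum.
Context {R : realType}.
Implicit Types (f g : R * R -> R) (z : R * R).

Definition Itau (tfin : R) : set R := `[0, tfin].
Definition Omega (tfin : R) : set (R * R) := Itau tfin `*` setT.
Definition Omega_int (tfin : R) : set (R * R) := `]0, tfin[ `*` setT.

Definition cvg_Linfty d (T : measurableType d)
    (mu : {measure set T -> \bar R}) (D : set T) (fn : nat -> T -> R)
    (f : T -> R) : Prop :=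
  measurable_fun D f /\
  ('N[mu]_+oo [EFin \o ((fun x => (fn n x - f x)%R) \_ D)] @[n --> \oo] --> 0)%E.

Definition cvg_Lsloc (s : R) (D : set (R * R)) (fn : nat -> R * R -> R) f :
    Prop :=
  forall K, compact K -> K `<=` D ->
  ('N[leb2]_(s%:E) [EFin \o ((fun x => (fn n x - f x)%R) \_ K)] @[n --> \oo] --> 0)%E.

(* The class C^{0,gamma}_loc for some gamma, the same for all compact sets. *)
Definition locally_holder (D : set (R * R)) f : Prop :=
  exists2 gamma : R, 0 < gamma <= 1 &
  forall K, compact K -> K `<=` D ->
  exists C : R, forall x y, K x -> K y -> `|f x - f y| <= C * `|x - y| `^ gamma.

Definition bounded_locally_holder (D : set (R * R)) f : Prop :=
  [bounded f z | z in D] /\ locally_holder D f.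

(* The space L^oo(I; L^p(R)). *)
Definition Linfty_Lp (tfin : R) (p : \bar R) f : Prop :=
  measurable_fun (Omega tfin) f /\
  exists M : R, \forall tau \ae leb1, Itau tfin tau ->
    ('N[leb1]_p [EFin \o (fun x => f (tau, x))] <= M%:E)%E.

Definition dtau f z : R := 'D_((1, 0) : R * R) f z.
Definition dxi f z : R := 'D_((0, 1) : R * R) f z.

Fixpoint Cdiff (n : nat) f : Prop :=
  if n is m.+1 then
    [/\ forall z, derivable f z ((1, 0) : R * R),
        forall z, derivable f z ((0, 1) : R * R),
        Cdiff m (dtau f) & Cdiff m (dxi f)]
  else continuous f.

Definition test_function (tfin : R) (psi : R * R -> R) : Prop :=
  (forall n, Cdiff n psi) /\
  exists K, [/\ compact K, K `<=` Omega_int tfin & forall z, ~ K z -> psi z = 0].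

Definition weak_dxi (tfin : R) f g : Prop :=
  forall psi, test_function tfin psi ->
  (\int[leb1]_(tau in `[0, tfin]) \int[leb1]_x
      (f (tau, x) * dxi psi (tau, x))) =
  - (\int[leb1]_(tau in `[0, tfin]) \int[leb1]_x
      (g (tau, x) * psi (tau, x))).

(* A classical solution in the interior of Omega; continuity up to tau = 0 is
   not part of it. *)
Definition heat_solution (tfin : R) f : Prop :=
  forall z, Omega_int tfin z ->
  [/\ [/\ derivable f z ((1, 0) : R * R), derivable f z ((0, 1) : R * R) &
         derivable (dxi f) z ((0, 1) : R * R)],
      {for z, continuous (dtau f)} & dtau f z = dxi (dxi f) z].

(* The identity which, by definition, expresses that (P, xi) is a distributional
   solution of the free boundary problem
     d_tau P = d_xi^2 P off the interface, [[P]] = 0 and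
     2 (d/dtau) xi = [[d_xi P]] on the interface. *)
Definition fbp_distributional_solution (tfin : R) (P : R * R -> R)
    (xi : R -> R) : Prop :=
  let mu tau x := sgnp (xi tau - x) in
  forall psi, test_function tfin psi ->
  - (\int[leb1]_(tau in `[0, tfin]) \int[leb1]_x
      ((P (tau, x) + mu tau x) * dtau psi (tau, x))) =
  (\int[leb1]_(tau in `[0, tfin]) \int[leb1]_x
      (P (tau, x) * dxi (dxi psi) (tau, x))).

Definition initial_data_attained (P : R * R -> R) (xi : R -> R) : Prop :=
  ('N[leb1]_+oo [EFin \o (fun x => (P (tau, x) - P (0, x))%R)]
     @[tau --> 0^'+] --> 0)%E /\
  xi tau @[tau --> 0^'+] --> xi 0.

End Continuum.

(* Main.v *)
(* As bounded solutions of the lattice heat equation are unique, p is q minus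
   twice a sum of heat kernels started at the transition times. The maximum
   principle and Bernstein's method give the decay of the differences of q, and
   of the heat kernel in sup, l^1 and l^2 norms. The resulting bounds for
   the summands of R_1 are weights max(s, d / eps)^(-3/4); as transitions are at
   least 2 d / eps apart, telescoping the fourth root bounds the sum of these
   weights by C eps^(1/2). This gives moduli of continuity of Q_eps, R_1 and
   xi_eps which are uniform up to errors converging to 0, so that the L^oo limits
   have continuous representatives, converge uniformly, and inherit the
   inequalities satisfied by p.

   At every time at most one summand of R_2 is nonzero, and R_2 is small off
   windows of total length O(eps^(1/2)). It therefore disappears in L^s and in the
   weak formulation, which is obtained site by site from integration by parts in
   time, the discrete Laplacian being moved to the test function.

   The second differences of R with step h are O(h^(3/2)) in L^1, so its dyadic
   difference quotients converge absolutely in L^1, and they are bounded in L^2.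
   Finally xi is monotone and Lipschitz, hence a distribution function with a
   bounded density, and differentiable at the Lebesgue points of this density. *)
Require Import Defs.
From HB Require Import structures.
From mathcomp Require Import all_boot all_order all_algebra finmap.
From mathcomp Require Import all_classical all_reals all_analysis.
From mathcomp Require Import measurable_realfun ess_sup_inf ring lra zify.

Set Implicit Arguments.
Unset Strict Implicit.
Unset Printing Implicit Defensive.
Import Order.TTheory GRing.Theory Num.Def Num.Theory.
Import numFieldNormedType.Exports.
Local Open Scope classical_set_scope.
Local Open Scope ring_scope.

(** * Bounded solutions of the lattice heat equation *)

Section lattice_heat.
Context {R : realType}.
Implicit Types (a b t M : R) (j : int) (w v : R -> int -> R).

(** At a transition p drops by 2 at a single site, so p has no modulus of continuity that is uniform
    in eps; this is why compactness is sought for q + R_1. The ramp of the regularized kernel starts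
    at 0 and lasts d / eps, half of the guaranteed gap. Hence at the k-th transition its own summand
    is still 0 and all earlier ramps are complete: q + R_1 is exactly 1 at site k, which forces P =
    1 wherever the interface moves. Moreover there are quiet times between transitions at which R_2
    vanishes, so the inequalities for p carry over to q + R_1.

    The exponent -3/4 is the decay of the l^2 norm of the gradient of the kernel. Space differences
    of order 1/2, time differences of order 1/4 and l^1 norms of second differences of order 3/2
    interpolate between two decay rates so that the same weight comes out each time, and one bound
    on its sum serves them all. With T of order eps^(-2) and gaps c of order 1 / eps this sum is of
    order T^(1/4) / c = eps^(1/2), the power which parabolic scaling turns into bounds independent
    of eps. *)

Definition heat_sub a b w :=
  [/\ exists M, forall t j, a <= t <= b -> `|w t j| <= M,
      forall j, {within `[a, b], continuous (w ^~ j)} &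
      forall t j, a < t < b ->
        exists2 l : R, is_derive t 1 (w ^~ j) l & l <= lapl (w t) j].

(** Continuity is asked up to the end points but the equation only inside, because solutions on
    consecutive phases are joined through their one-sided limits at the transition times. *)
Definition heat_sol a b w :=
  [/\ exists M, forall t j, a <= t <= b -> `|w t j| <= M,
      forall j, {within `[a, b], continuous (w ^~ j)} &
      forall t j, a < t < b -> is_derive t 1 (w ^~ j) (lapl (w t) j)].

Lemma within_continuousD (A : set R) (f g : R -> R) :
  {within A, continuous f} -> {within A, continuous g} ->
  {within A, continuous (fun x => f x + g x)}.
Proof. by move=> cf cg x; exact: (cvgD (cf x) (cg x)). Qed.

Lemma within_continuousM (A : set R) (f g : R -> R) :
  {within A, continuous f} -> {within A, continuous g} ->
  {within A, continuous (fun x => f x * g x)}.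
Proof. by move=> cf cg x; exact: (cvgM (cf x) (cg x)). Qed.

Lemma within_continuousN (A : set R) (f : R -> R) :
  {within A, continuous f} -> {within A, continuous (fun x => - f x)}.
Proof. by move=> cf x; exact: (cvgN (cf x)). Qed.

Lemma within_continuous_cst (A : set R) (c : R) :
  {within A, continuous (fun=> c)}.
Proof. by move=> x; exact: cvg_cst. Qed.

Lemma continuous_within (A : set R) (f : R -> R) :
  continuous f -> {within A, continuous f}.
Proof. exact: continuous_subspaceT. Qed.

Lemma is_derive_continuous (f : R -> R) (x l : R) :
  is_derive x 1 f l -> {for x, continuous f}.
Proof. by move=> [df _]; exact/differentiable_continuous/derivable1_diffP. Qed.

(* Bounding both neighbours by M, the function e^{2t}(w_j - M) is nonincreasing,
   which improves the bound M by the factor 1 - e^{-2(b-a)}. *)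
Lemma heat_sub_improve a b w M : heat_sub a b w -> 0 <= M ->
  (forall t j, a <= t <= b -> w t j <= M) -> (forall j, w a j <= 0) ->
  forall t j, a <= t <= b -> w t j <= (1 - expR (- (2 * (b - a)))) * M.
Proof.
move=> [_ cw dw] M0 wM wa t j /andP[at_ tb].
pose f s := expR (2 * s) * (w s j + - M).
have dexp (s : R) : is_derive s 1 (fun s : R => expR (2 * s)) (2 * expR (2 * s)).
  have h : is_derive s 1 (fun s : R => 2 * s) 2.
    have h0 : is_derive s 1 (2 *: id : R -> R) (2 *: (1 : R)) by exact: is_deriveZ.
    by rewrite [X in is_derive _ _ _ X](_ : 2 = 2 *: (1 : R))// /GRing.scale/= mulr1.
  apply: (is_derive_eq (is_derive1_comp _ _)).
  by rewrite /GRing.scale/= mulrC.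
have fdrv s : a < s < b -> exists2 l : R, is_derive s 1 f l & l <= 0.
  move=> asb; have [l dl ll] := dw s j asb.
  exists (expR (2 * s) * l + (w s j + - M) * (2 * expR (2 * s))).
    have h : is_derive s 1 (fun s => w s j + - M) l.
      have := is_deriveD dl (is_derive_cst (- M) s 1); rewrite addr0; exact.
    apply: (is_derive_eq (is_deriveM _ _)).
    by rewrite /GRing.scale/=.
  rewrite [X in X <= _](_ : _ = expR (2 * s) * (l + 2 * (w s j - M))); last by ring.
  rewrite pmulr_rle0 ?expR_gt0//; move: ll; rewrite /lapl.
  have /wM h1 : a <= s <= b by case/andP: asb => /ltW -> /ltW ->.
  have := h1 (j + 1); have := h1 (j - 1); lra.
have cf : {within `[a, b], continuous f}.
  apply: within_continuousM.
    by apply: continuous_within => s; exact: is_derive_continuous (dexp s).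
  by apply: within_continuousD; [exact: cw|exact: within_continuous_cst].
have : f t <= f a.
  apply: (@ler0_derive1_le_cc _ f a b) => //; rewrite ?in_itv/= ?lexx ?at_ ?tb//.
  - by move=> s; rewrite in_itv/= => /fdrv[l [dl _] _].
  - move=> s; rewrite in_itv/= => /fdrv[l dl l0]; rewrite derive1E.
    by rewrite derive_val.
  - by rewrite (le_trans at_).
rewrite /f => h.
have h2 : w t j + - M <= expR (2 * (a - t)) * (w a j + - M).
  rewrite -(ler_pM2l (expR_gt0 (2 * t))) (le_trans h)// mulrA -expRD.
  by rewrite le_eqVlt; apply/orP; left; apply/eqP; congr (expR _ * _); ring.
have h3 : expR (2 * (a - t)) * (w a j + - M) <= expR (2 * (a - t)) * - M.
  by rewrite ler_pM2l ?expR_gt0// gerDr.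
have h4 : expR (- (2 * (b - a))) <= expR (2 * (a - t)) by rewrite ler_expR; lra.
have := ler_wpM2r M0 h4; lra.
Qed.

(** The improvement is iterated on the whole of [[a, b]], where its factor stays the same, so the
    bound tends to 0. Boundedness replaces the existence of a maximal site, which may fail on the
    infinite lattice. *)
Lemma heat_sub_le0 a b w : heat_sub a b w -> (forall j, w a j <= 0) ->
  forall t j, a <= t <= b -> w t j <= 0.
Proof.
move=> hw wa t j atb; have [[M0 wM] _ _] := hw.
have ab : a <= b by case/andP: atb; exact: le_trans.
pose M := `|M0|; pose rho : R := 1 - expR (- (2 * (b - a))).
have rho0 : 0 <= rho.
  by rewrite /rho subr_ge0 -[leRHS]expR0 ler_expR oppr_le0 mulr_ge0// subr_ge0.
have rho1 : rho < 1 by rewrite /rho gtrBl expR_gt0.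
have step n s i : a <= s <= b -> w s i <= rho ^+ n * M.
  elim: n s i => [|n IH] s i asb.
    by rewrite expr0 mul1r (le_trans (ler_norm _))// (le_trans (wM _ _ asb))// ler_norm.
  rewrite exprS -mulrA; apply: (heat_sub_improve hw) => //.
  exact: mulr_ge0 (exprn_ge0 _ rho0) (normr_ge0 _).
have cv : (fun n => rho ^+ n * M) @ \oo --> (0 * M : R).
  by apply: cvgMl; apply: cvg_expr; rewrite ger0_norm.
rewrite mul0r in cv.
by apply: (cvgr_to_ge cv); apply: nearW => n; exact: step.
Qed.

Lemma laplD (p q : int -> R) j : lapl (fun i => p i + q i) j = lapl p j + lapl q j.
Proof. by rewrite /lapl; ring. Qed.

Lemma laplZ (c : R) (p : int -> R) j : lapl (fun i => c * p i) j = c * lapl p j.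
Proof. by rewrite /lapl; ring. Qed.

Lemma heat_subW a b w : heat_sol a b w -> heat_sub a b w.
Proof.
by move=> [bw cw dw]; split => // t j /(dw t j) h; exists (lapl (w t) j).
Qed.

Lemma heat_solD a b w v : heat_sol a b w -> heat_sol a b v ->
  heat_sol a b (fun t j => w t j + v t j).
Proof.
move=> [[M wM] cw dw] [[N vN] cv dv]; split.
- exists (M + N) => t j atb.
  by rewrite (le_trans (ler_normD _ _))// lerD// ?wM ?vN.
- by move=> j; apply: within_continuousD.
- move=> t j atb; rewrite laplD; have := dw t j atb; have := dv t j atb => h1 h2.
  exact: is_deriveD.
Qed.

Lemma heat_solZ a b w (c : R) : heat_sol a b w ->
  heat_sol a b (fun t j => c * w t j).
Proof.
move=> [[M wM] cw dw]; split.
- by exists (`|c| * M) => t j atb; rewrite normrM ler_wpM2l ?wM.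
- by move=> j; apply: within_continuousM => //; exact: within_continuous_cst.
- move=> t j atb; rewrite laplZ; have := dw t j atb => h.
  exact: is_deriveZ.
Qed.

Lemma heat_solN a b w : heat_sol a b w -> heat_sol a b (fun t j => - w t j).
Proof.
move=> /(heat_solZ (-1)); congr heat_sol.
by apply/funext => t; apply/funext => j; rewrite mulN1r.
Qed.

Lemma heat_solB a b w v : heat_sol a b w -> heat_sol a b v ->
  heat_sol a b (fun t j => w t j - v t j).
Proof. by move=> hw hv; apply: heat_solD => //; exact: heat_solN. Qed.

Lemma heat_sol_cst a b (c : R) : heat_sol a b (fun _ _ => c).
Proof.
split; first by exists `|c|.
- by move=> j; exact: within_continuous_cst.
- move=> t j _; rewrite [lapl _ _](_ : _ = 0); first exact: is_derive_cst.
  by rewrite /lapl; ring.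
Qed.

Lemma heat_sol_shift a b w (m : int) : heat_sol a b w ->
  heat_sol a b (fun t j => w t (j + m)).
Proof.
move=> [[M wM] cw dw]; split.
- by exists M => t j; exact: wM.
- by move=> j; exact: cw.
- move=> t j atb; rewrite [lapl _ _](_ : _ = lapl (w t) (j + m)); first exact: dw.
  by rewrite /lapl; congr (w _ _ - _ + w _ _); rewrite addrAC.
Qed.

Lemma heat_sol_sum a b (n : nat) (W : nat -> R -> int -> R) :
  (forall i, heat_sol a b (W i)) ->
  heat_sol a b (fun t j => \sum_(i < n) W i t j).
Proof.
move=> hW; elim: n => [|n IH].
  have := heat_sol_cst a b 0; congr heat_sol.
  by apply/funext => t; apply/funext => j; rewrite big_ord0.
have := heat_solD IH (hW n); congr heat_sol.
by apply/funext => t; apply/funext => j; rewrite big_ord_recr.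
Qed.

Lemma heat_sol_sub a b a' b' w : a <= a' -> b' <= b -> heat_sol a b w ->
  heat_sol a' b' w.
Proof.
move=> aa bb [[M wM] cw dw]; split.
- exists M => t j /andP[at_ tb]; apply: wM.
  by rewrite (le_trans aa)// (le_trans tb).
- move=> j; apply: continuous_subspaceW (cw j) => t/=.
  by rewrite !in_itv/= => /andP[at_ tb]; rewrite (le_trans aa)// (le_trans tb).
- move=> t j /andP[at_ tb]; apply: dw.
  by rewrite (le_lt_trans aa)// (lt_le_trans tb).
Qed.

Lemma heat_sol_le a b w M : heat_sol a b w -> (forall j, w a j <= M) ->
  forall t j, a <= t <= b -> w t j <= M.
Proof.
move=> hw wa t j atb; rewrite -subr_le0.
have /heat_subW h := heat_solB hw (heat_sol_cst a b M).
by apply: (heat_sub_le0 h) => // i; rewrite subr_le0.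
Qed.

Lemma heat_sol_ge a b w M : heat_sol a b w -> (forall j, M <= w a j) ->
  forall t j, a <= t <= b -> M <= w t j.
Proof.
move=> /heat_solN hw wa t j atb; rewrite -lerN2.
by apply: (heat_sol_le hw) => // i; rewrite lerN2.
Qed.

Lemma heat_sol_norm_le a b w M : heat_sol a b w -> (forall j, `|w a j| <= M) ->
  forall t j, a <= t <= b -> `|w t j| <= M.
Proof.
move=> hw wa t j atb; rewrite ler_norml; apply/andP; split.
  by apply: (heat_sol_ge hw) => // i; have := wa i; rewrite ler_norml => /andP[].
by apply: (heat_sol_le hw) => // i; have := wa i; rewrite ler_norml => /andP[].
Qed.

Lemma heat_sol_unique a b w v : heat_sol a b w -> heat_sol a b v ->
  (forall j, w a j = v a j) -> forall t j, a <= t <= b -> w t j = v t j.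
Proof.
move=> hw hv wv t j atb; apply/eqP; rewrite -subr_eq0 -normr_le0.
apply: (heat_sol_norm_le (heat_solB hw hv)) => // i.
by rewrite wv subrr normr0.
Qed.

Lemma heat_sol_nablap a b w : heat_sol a b w ->
  heat_sol a b (fun t => nablap (w t)).
Proof. by move=> hw; apply: heat_solB => //; exact: heat_sol_shift. Qed.

(* Bernstein's method: (t - a)(grad w)^2 + w^2 is a subsolution. *)
Lemma bernstein a b w M : heat_sol a b w -> (forall j, `|w a j| <= M) ->
  forall t j, a <= t <= b -> (t - a) * nablap (w t) j ^+ 2 <= M ^+ 2.
Proof.
move=> hw wa t j atb.
have [[N wN] cw dw] := hw.
have [_ cz dz] := heat_sol_nablap hw.
pose v t j := (t - a) * nablap (w t) j ^+ 2 + (w t j ^+ 2 - M ^+ 2).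
have ab : a <= b by case/andP: atb; exact: le_trans.
have sq (x y : R) : `|x| <= y -> x ^+ 2 <= y ^+ 2.
  by move=> xy; rewrite -real_normK ?num_real// ler_pXn2r ?nnegrE// (le_trans _ xy).
have zN s i : a <= s <= b -> `|nablap (w s) i| <= N + N.
  by move=> asb; rewrite (le_trans (ler_normB _ _))// lerD ?wN.
have hv : heat_sub a b v.
  split.
  - exists ((b - a) * (N + N) ^+ 2 + (N ^+ 2 + M ^+ 2)) => s i asb.
    have /andP[as_ sb] := asb.
    rewrite (le_trans (ler_normD _ _))// lerD//.
      rewrite normrM ler_pM// ?ger0_norm ?subr_ge0// ?exprn_even_ge0//.
        by rewrite lerB.
      exact/sq/zN.
    rewrite (le_trans (ler_normB _ _))// lerD//; last first.
      by rewrite ger0_norm// exprn_even_ge0.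
    by rewrite ger0_norm ?exprn_even_ge0//; exact/sq/wN.
  - move=> i; apply: within_continuousD.
      apply: within_continuousM.
        by apply: continuous_within => x; apply: cvgB; [exact: cvg_id|exact: cvg_cst].
      by apply: within_continuousM; exact: cz.
    apply: within_continuousD; last exact: within_continuous_cst.
    by apply: within_continuousM; exact: cw.
  - move=> s i asb; have h1 := dw s i asb; have h2 := dz s i asb.
    set W := w s in h1 *; set Z := nablap (w s) in h2 *.
    exists (Z i ^+ 2 + (s - a) * (2 * Z i * lapl Z i) + 2 * W i * lapl W i).
      apply: is_derive_eq; rewrite /GRing.scale/= !(scaler0, addr0, subr0, mulr1) /Z /W.
      ring.
    have -> : lapl (v s) i = (s - a) * lapl (fun i => Z i ^+ 2) i
         + lapl (fun i => W i ^+ 2) i by rewrite /lapl /v -/W -/Z; ring.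
    (* The Laplacian of w^2 produces the squared differences over both edges at site [i]; the one
       over the forward edge pays for the derivative of the factor [s - a], the other one has the
       good sign. *)
    have -> : lapl (fun i => W i ^+ 2) i = 2 * W i * lapl W i
        + (Z i ^+ 2 + Z (i - 1) ^+ 2).
      by rewrite /Z /nablap -/W /lapl subrK; ring.
    have h3 : 2 * Z i * lapl Z i <= lapl (fun i => Z i ^+ 2) i.
      rewrite -subr_ge0 [X in 0 <= X](_ : _ = (Z (i + 1) - Z i) ^+ 2 + (Z i - Z (i - 1)) ^+ 2).
        by rewrite addr_ge0// exprn_even_ge0.
      by rewrite /lapl; ring.
    have sa : 0 <= s - a by rewrite subr_ge0; case/andP: asb => /ltW.
    have := ler_wpM2l sa h3; have : 0 <= Z (i - 1) ^+ 2 by rewrite exprn_even_ge0.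
    lra.
have : v t j <= 0.
  apply: (heat_sub_le0 hv) => // i; rewrite /v subrr mul0r add0r subr_le0.
  exact: sq.
have : 0 <= w t j ^+ 2 by rewrite exprn_even_ge0.
by rewrite /v; lra.
Qed.

Lemma heat_grad_le a b w M : heat_sol a b w -> (forall j, `|w a j| <= M) ->
  forall t j, a < t <= b -> `|nablap (w t) j| <= M / Num.sqrt (t - a).
Proof.
move=> hw wa t j /andP[at_ tb].
have M0 : 0 <= M by rewrite (le_trans _ (wa 0)).
have := bernstein hw wa j (_ : a <= t <= b); rewrite (ltW at_) tb => /(_ isT) h.
rewrite ler_pdivlMr ?sqrtr_gt0 ?subr_gt0//.
rewrite -(@ler_pXn2r _ 2) ?nnegrE ?mulr_ge0 ?sqrtr_ge0//.
have ta : 0 <= t - a by rewrite subr_ge0 ltW.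
by rewrite exprMn sqr_sqrtr// real_normK ?num_real// mulrC.
Qed.

Lemma heat_sol_iter_nablap a b w n : heat_sol a b w ->
  heat_sol a b (fun t => iter n nablap (w t)).
Proof. by move=> hw; elim: n => [//|n IH]; exact: heat_sol_nablap. Qed.

(** Each further difference is gained by the gradient bound over a time of length [s], started from
    the bound for the previous difference. *)
Lemma heat_iter_grad_le a b w M (s : R) n : heat_sol a b w ->
  (forall j, `|w a j| <= M) -> 0 < s ->
  forall t j, a + n%:R * s <= t <= b ->
    `|iter n nablap (w t) j| <= M / Num.sqrt s ^+ n.
Proof.
move=> hw wa s0; elim: n => [|n IH] t j /andP[at_ tb].
  rewrite expr0 divr1/= (heat_sol_norm_le hw wa)// tb.
  by move: at_; rewrite mul0r addr0 => ->.
have q0 : 0 < Num.sqrt s by rewrite sqrtr_gt0.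
have M0 : 0 <= M by rewrite (le_trans _ (wa 0)).
have an : a <= a + n%:R * s by rewrite lerDl mulr_ge0// ltW.
move: at_; rewrite mulrSr mulrDl mul1r addrA => at_.
have ant : a + n%:R * s < t by rewrite (lt_le_trans _ at_)// ltrDl.
have hz := heat_sol_sub an (lexx b) (heat_sol_iter_nablap n hw).
rewrite exprSr invfM mulrA.
apply: (le_trans (heat_grad_le hz _ j _)); last 2 first.
- by rewrite ant.
- apply: ler_wpM2l; first by rewrite divr_ge0// exprn_ge0// ltW.
  rewrite lef_pV2 ?posrE// ?sqrtr_gt0 ?subr_gt0//.
  by rewrite ler_wsqrtr// lerBrDl.
move=> i; apply: IH; rewrite lexx/= (le_trans _ tb)//.
exact: ltW.
Qed.

End lattice_heat.

Lemma Rintegral_cst_itv {R : realType} (a b r : R) : a <= b ->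
  \int[lebesgue_measure]_(x in `[a, b]) r = r * (b - a).
Proof.
move=> ab; rewrite Rintegral_cst//= lebesgue_measure_itv/= lte_fin.
by case: ltgtP ab => //= -> _; rewrite subrr.
Qed.

(** * The discrete heat kernel *)

Section heat_kernel_basic.
Context {R : realType}.
Implicit Types (t x : R) (j : int).

Let kern j t x : R := expR (- 2 * (1 - cos x) * t) * cos (j%:~R * x).
Let dkern j t x : R := - 2 * (1 - cos x) * kern j t x.

Let continuous_cosM j : continuous (fun x : R => cos (j%:~R * x)).
Proof.
move=> x; apply: continuous_comp; last exact: continuous_cos.
by apply: cvgM; [exact: cvg_cst|exact: cvg_id].
Qed.

Let continuous_1Bcos : continuous (fun x : R => - 2 * (1 - cos x)).
Proof.
move=> x; apply: cvgM; first exact: cvg_cst.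
by apply: cvgB; [exact: cvg_cst|exact: continuous_cos].
Qed.

Let continuous_kern j t : continuous (kern j t).
Proof.
move=> x; apply: cvgM; last exact: continuous_cosM.
apply: (@continuous_comp _ _ _ (fun x => - 2 * (1 - cos x) * t) expR).
  by apply: cvgM; [exact: continuous_1Bcos|exact: cvg_cst].
exact: continuous_expR.
Qed.

Lemma integrable_continuous_itv (f : R -> R) (a b : R) : continuous f ->
  lebesgue_measure.-integrable `[a, b] (EFin \o f).
Proof.
move=> cf; apply: continuous_compact_integrable; first exact: segment_compact.
exact: continuous_within.
Qed.

Let is_derive_kern j x t : is_derive t 1 (fun t => kern j t x) (dkern j t x).
Proof.
have h : is_derive t 1 ((- 2 * (1 - cos x)) *: id : R -> R)
    ((- 2 * (1 - cos x)) *: (1 : R)) by exact: is_deriveZ.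
have h1 : is_derive t 1 (fun t : R => expR (- 2 * (1 - cos x) * t))
   (- 2 * (1 - cos x) * expR (- 2 * (1 - cos x) * t)).
  apply: (is_derive_eq (is_derive1_comp _ h)).
  by rewrite /GRing.scale/= mulr1 mulrC.
have h2 : is_derive t 1 (fun t : R => cos (j%:~R * x)) 0 by exact: is_derive_cst.
apply: (is_derive_eq (is_deriveM h1 h2)).
by rewrite scaler0 add0r /GRing.scale/= /dkern /kern; ring.
Qed.

Let kern_bound j t x : `|kern j t x| <= expR (4 * `|t|).
Proof.
rewrite normrM -[leRHS]mulr1 ler_pM//; last first.
  by rewrite ler_norml cos_geN1 cos_le1.
rewrite ger0_norm ?expR_ge0// ler_expR.
have h1 := cos_geN1 x; have h2 := cos_le1 x.
have h3 : `|- 2 * (1 - cos x)| <= 4 by rewrite ler_norml; lra.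
by rewrite (le_trans (ler_norm _))// normrM ler_wpM2r.
Qed.

Let is_derive_Ikern j t : is_derive t 1
  (fun t => \int[lebesgue_measure]_(x in `[- pi, pi]) kern j t x)
  (\int[lebesgue_measure]_(x in `[- pi, pi]) dkern j t x).
Proof.
have It : `]t - 1, t + 1[%classic t.
  by rewrite /= in_itv/= ltrBlDr !ltrDl ltr01.
have intf s : `]t - 1, t + 1[%classic s ->
    lebesgue_measure.-integrable `[- pi, pi] (EFin \o kern j s).
  by move=> _; exact: integrable_continuous_itv.
have derf s x : `]t - 1, t + 1[%classic s -> `[- pi, pi]%classic x ->
    derivable ((kern j) ^~ x) s 1.
  by move=> _ _; have [] := is_derive_kern j x s.
(* A bound for the time derivative at all times within 1 of [t]; it has to grow exponentially
   because [t] may be negative. *)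
pose G (x : R) : R := 4 * expR (4 * (`|t| + 1)).
have G0 x : 0 <= G x by rewrite /G mulr_ge0// expR_ge0.
have intG : lebesgue_measure.-integrable `[- pi, pi] (EFin \o G).
  by apply: integrable_continuous_itv => x; exact: cvg_cst.
have G_ub s x : `]t - 1, t + 1[%classic s -> `[- pi, pi]%classic x ->
    `|partial1of2 (kern j) s x| <= G x.
  rewrite /= in_itv/= => /andP[s1 s2] _.
  have h := is_derive_kern j x s.
  rewrite partial1of2E derive_val /dkern normrM ler_pM//.
    have h1 := cos_geN1 x; have h2 := cos_le1 x.
    by rewrite ler_norml; lra.
  rewrite (le_trans (kern_bound _ _ _))// ler_expR ler_pM2l//.
  rewrite -lerBlDl (le_trans (lerB_dist _ _))//.
  by rewrite ler_norml; lra.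
have E : \int[lebesgue_measure]_(x in `[- pi, pi]) dkern j t x =
   \int[lebesgue_measure]_(x in `[- pi, pi]) (partial1of2 (kern j) t x).
  apply: eq_Rintegral => x _; have h := is_derive_kern j x t.
  by rewrite partial1of2E derive_val.
split.
  apply: (derivable_under_integral _ It intf derf G0 intG G_ub); exact: measurable_itv.
rewrite -derive1E E.
apply: (differentiation_under_integral _ It intf derf G0 intG G_ub); exact: measurable_itv.
Qed.

Let twopi_neq0 : (2 * pi : R) != 0.
Proof. by rewrite mulf_neq0// gt_eqF// pi_gt0. Qed.

(** Under the integral, cos((j+1)x) + cos((j-1)x) = 2 cos x cos(jx) identifies the multiplier -2(1 -
    cos x) with the discrete Laplacian. *)
Lemma heat_kernel_derive j t :
  is_derive t 1 (fun t => heat_kernel t j) (lapl (heat_kernel t) j).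
Proof.
have h := is_deriveZ (2 * pi)^-1 (is_derive_Ikern j t).
apply: (is_derive_eq h).
rewrite /GRing.scale/= /lapl /heat_kernel -/(kern _ _ _).
have ik i : lebesgue_measure.-integrable `[- (pi : R), pi] (EFin \o kern i t).
  exact: integrable_continuous_itv.
set c := (2 * pi)^-1.
rewrite mulrCA -mulrBr -mulrDr; congr (_ * _).
have ck i : continuous (kern i t) by exact: continuous_kern.
have i2 : lebesgue_measure.-integrable `[- (pi : R), pi] (EFin \o (fun x => 2 * kern j t x)).
  by apply: integrable_continuous_itv => x; apply: cvgM; [exact: cvg_cst|exact: ck].
have i3 : lebesgue_measure.-integrable `[- (pi : R), pi]
    (EFin \o (fun x => kern (j + 1) t x - 2 * kern j t x)).
  apply: integrable_continuous_itv => x; apply: cvgB; first exact: ck.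
  by apply: cvgM; [exact: cvg_cst|exact: ck].
rewrite -(RintegralZl _ _ (ik j)); last exact: measurable_itv.
rewrite -(RintegralB _ (ik _) i2); last exact: measurable_itv.
rewrite -(RintegralD _ i3 (ik _)); last exact: measurable_itv.
apply: eq_Rintegral => x _; rewrite /dkern /kern.
rewrite rmorphD rmorphB/= mulrDl mulrBl !mul1r cosD cosB; ring.
Qed.

Lemma heat_kernel_norm_le1 j t : 0 <= t -> `|heat_kernel t j| <= 1.
Proof.
move=> t0; rewrite /heat_kernel normrM.
have p0 : 0 < (2 * pi : R) by rewrite mulr_gt0// pi_gt0.
rewrite [X in X * _]ger0_norm ?invr_ge0 ?(ltW p0)// -[leRHS](mulVf twopi_neq0) ler_pM2l ?invr_gt0//.
have ik : lebesgue_measure.-integrable `[- (pi : R), pi] (EFin \o kern j t).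
  exact: integrable_continuous_itv.
rewrite (le_trans (le_normr_Rintegral _ _))//.
have -> : 2 * pi = \int[lebesgue_measure]_(x in `[- (pi : R), pi]) (1 : R).
  by rewrite Rintegral_cst_itv; [ring|have := @pi_ge0 R; lra].
apply: le_Rintegral => //.
- apply: (integrable_continuous_itv (f := fun x => `|kern j t x|)) => x.
  by apply: cvg_norm; exact: continuous_kern.
- by apply: (integrable_continuous_itv (f := fun=> 1)) => x; exact: cvg_cst.
- move=> x _; rewrite /kern normrM -[leRHS]mulr1 ler_pM//; last first.
    by rewrite ler_norml cos_geN1 cos_le1.
  rewrite ger0_norm ?expR_ge0// -[leRHS]expR0 ler_expR.
  rewrite mulr_le0_ge0// mulNr oppr_le0 mulr_ge0// subr_ge0; exact: cos_le1.
Qed.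

Lemma sin_intMpi j : sin (j%:~R * pi : R) = 0.
Proof.
have H n : sin (n%:R * pi : R) = 0.
  elim: n => [|n IH]; first by rewrite mul0r sin0.
  by rewrite mulrSr mulrDl mul1r sinDpi IH oppr0.
case: j => n; first exact: H.
by rewrite NegzE rmorphN/= mulNr sinN H oppr0.
Qed.

Lemma heat_kernel0 j : heat_kernel 0 j = (j == 0)%:R :> R.
Proof.
rewrite /heat_kernel.
have -> : \int[lebesgue_measure]_(x in `[- (pi : R), pi])
    (expR (- 2 * (1 - cos x) * 0) * cos (j%:~R * x)) =
  \int[lebesgue_measure]_(x in `[- (pi : R), pi]) cos (j%:~R * x).
  by apply: eq_Rintegral => x _; rewrite mulr0 expR0 mul1r.
have pp : - pi < pi :> R by rewrite gtrN ?pi_gt0.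
have [->|j0] := eqVneq j 0.
  have -> : \int[lebesgue_measure]_(x in `[- (pi : R), pi]) cos (0%:~R * x) = 2 * pi.
    under eq_Rintegral do rewrite mul0r cos0.
    rewrite Rintegral_cst//= lebesgue_measure_itv/= lte_fin pp/=; ring.
  by rewrite mulVf.
have jr0 : j%:~R != 0 :> R by rewrite intr_eq0.
pose F x : R := j%:~R^-1 * sin (j%:~R * x).
have dF x : is_derive x 1 F (cos (j%:~R * x)).
  have h : is_derive x 1 ((j%:~R) *: id : R -> R) ((j%:~R) *: (1 : R)).
    exact: is_deriveZ.
  have h1 : is_derive x 1 (fun x : R => sin (j%:~R * x)) (j%:~R * cos (j%:~R * x)).
    apply: (is_derive_eq (is_derive1_comp _ h)).
    by rewrite /GRing.scale/= mulr1 mulrC.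
  apply: (is_derive_eq (is_deriveZ j%:~R^-1 h1)).
  by rewrite /GRing.scale/= mulrA mulVf// mul1r.
have cF : continuous F by move=> x; exact: is_derive_continuous (dF x).
rewrite /Rintegral (@continuous_FTC2 _ _ F)//=.
- by rewrite /F mulrN sinN sin_intMpi oppr0 !mulr0 subrr mulr0.
- exact: continuous_within.
- split.
  + by move=> x _; have [] := dF x.
  + by apply: cvg_at_right_filter; exact: cF.
  + by apply: cvg_at_left_filter; exact: cF.
- by move=> x _; rewrite derive1E; have h := dF x; rewrite derive_val.
Qed.

Lemma heat_sol_heat_kernel (b : R) : heat_sol 0 b heat_kernel.
Proof.
split.
- by exists 1 => t j /andP[t0 _]; exact: heat_kernel_norm_le1.
- move=> j; apply: continuous_within => t.
  exact: is_derive_continuous (heat_kernel_derive j t).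
- by move=> t j _; exact: heat_kernel_derive.
Qed.

End heat_kernel_basic.

(** * Decay of the differences of the heat kernel *)

Section heat_kernel_bounds.
Context {R : realType}.
Implicit Types (t B : R) (j b : int) (F p : int -> R).

(** An l^1 bound in terms of finite segments of the lattice, so that no summability has to be
    established. *)
Definition l1_le F B :=
  forall b n, \sum_(i < n) `|F (b + (i : nat)%:Z)| <= B.

Lemma l1_le_rev F B :
  (forall b n, \sum_(i < n) `|F (b - (i : nat)%:Z)| <= B) -> l1_le F B.
Proof.
move=> h b n; have := h (b + n%:Z - 1) n.
rewrite (reindex_inj rev_ord_inj)/=; congr (_ <= _).
apply: eq_bigr => i _; congr (`|F _|).
have := ltn_ord i; lia.
Qed.

Lemma iter_nablap_sum m n (c : nat -> R) (s : nat -> int) p j :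
  iter m nablap (fun j => \sum_(i < n) c i * p (j + s i)) j =
  \sum_(i < n) c i * iter m nablap p (j + s i).
Proof.
elim: m j => [//|m IH] j; rewrite !iterS {1}/nablap !IH -sumrB.
by apply: eq_bigr => i _; rewrite -mulrBr addrAC.
Qed.

Lemma sum_indic_le1 j (n : nat) (s : nat -> int) : injective s ->
  \sum_(i < n) (j + s i == 0)%:R <= 1 :> R.
Proof.
move=> sI; have [[i /eqP ji]|h] := pselect (exists i : 'I_n, j + s i == 0).
  rewrite (bigD1 i)//= ji eqxx big1 ?addr0// => k ki.
  case: eqP => // jk; move/eqP : ki; case; apply/val_inj/sI.
  by apply: (@addrI _ j); rewrite ji jk.
rewrite big1// => i _; case: eqP => // ji; exfalso; apply: h; exists i.
exact/eqP.
Qed.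

Lemma heat_kernel_ge0 t j : 0 <= t -> 0 <= heat_kernel t j.
Proof.
move=> t0; apply: (heat_sol_ge (heat_sol_heat_kernel t)); last by rewrite t0 lexx.
by move=> i; rewrite heat_kernel0 ler0n.
Qed.

Lemma heat_sol_heat_kernel_sum n (c : nat -> R) (s : nat -> int) (b : R) :
  heat_sol 0 b (fun t j => \sum_(i < n) c i * heat_kernel t (j + s i)).
Proof.
apply: (@heat_sol_sum _ _ _ n (fun i t j => c i * heat_kernel t (j + s i))) => i.
exact/heat_solZ/heat_sol_shift/heat_sol_heat_kernel.
Qed.

(** A combination with distinct shifts and coefficients of modulus at most 1 has initial values of
    modulus at most 1, whatever its length. The gradient bound is applied [m] times over steps of
    length t / m; for m = 0 this is the maximum principle. *)
Lemma heat_kernel_sum_grad_le m n (c : nat -> R) (s : nat -> int) t j :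
  (forall i, `|c i| <= 1) -> injective s -> 0 < t ->
  `|\sum_(i < n) c i * iter m nablap (heat_kernel t) (j + s i)| <=
    (Num.sqrt (t / m%:R) ^+ m)^-1.
Proof.
move=> c1 sI t0.
have init i : `|\sum_(k < n) c k * heat_kernel 0 (i + s k)| <= 1.
  rewrite (le_trans (ler_norm_sum _ _ _))// (le_trans _ (sum_indic_le1 i n sI))//.
  apply: ler_sum => k _; rewrite normrM heat_kernel0 normr_nat.
  by rewrite ler_piMl.
have hs := heat_sol_heat_kernel_sum n c s t.
rewrite -iter_nablap_sum; case: m => [|m].
  rewrite expr0 invr1/=.
  by apply: (heat_sol_norm_le hs init); rewrite (ltW t0) lexx.
have := @heat_iter_grad_le _ _ _ _ _ (t / m.+1%:R) m.+1 hs init _ t j.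
rewrite add0r [m.+1%:R * _]mulrC divfK ?pnatr_eq0// lexx div1r; apply => //.
by rewrite divr_gt0.
Qed.

(** Duality: with the signs of the values as coefficients, the bound for a combination at one site
    becomes an l^1 bound. *)
Lemma heat_kernel_l1 m t : 0 < t ->
  l1_le (iter m nablap (heat_kernel t)) (Num.sqrt (t / m%:R) ^+ m)^-1.
Proof.
move=> t0; apply: l1_le_rev => b n.
pose F := iter m nablap (heat_kernel t).
pose c i : R := Num.sg (F (b - i%:Z)).
have c1 i : `|c i| <= 1.
  by rewrite normr_sg; case: (_ != _).
have sI : injective (fun i : nat => - i%:Z) by move=> x y /oppr_inj [].
apply: le_trans (heat_kernel_sum_grad_le m n b c1 sI t0).
rewrite le_eqVlt; apply/orP; left; apply/eqP.
transitivity (\sum_(i < n) c i * F (b - (i : nat)%:Z)).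
  by apply: eq_bigr => i _; rewrite /c normrEsg.
rewrite ger0_norm// sumr_ge0// => i _; rewrite /c -/F -normrEsg; exact: normr_ge0.
Qed.

Lemma ler_addV_nat (x C B : R) : 0 <= B ->
  (forall n, x <= C + B / n.+1%:R) -> x <= C.
Proof.
move=> B0 h; apply/ler_addgt0Pl => e e0.
have /cvgrPdist_lt /(_ (e / (B + 1))) := @cvg_harmonic R.
case; first by rewrite divr_gt0// ltr_wpDl.
move=> N _ /(_ N (leqnn _))/=; rewrite sub0r normrN ger0_norm; last first.
  by rewrite invr_ge0.
rewrite ltr_pdivlMr ?ltr_wpDl// => hN.
rewrite (le_trans (h N))// addrC lerD2r (le_trans _ (ltW hN))//.
by rewrite mulrC ler_wpM2l ?invr_ge0// lerDl.
Qed.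

Lemma l1_le_small F B b n : l1_le F B ->
  exists2 i : nat, (i <= n)%N & `|F (b + i%:Z)| <= B / n.+1%:R.
Proof.
move=> hF; apply: contrapT => h.
have : \sum_(i < n.+1) B / n.+1%:R < \sum_(i < n.+1) `|F (b + (i : nat)%:Z)|.
  apply: ltr_sum => //; first by apply/hasP; exists ord0; rewrite ?mem_index_enum.
  move=> i _; rewrite ltNge; apply/negP => hi; apply: h; exists i => //.
  by rewrite -ltnS.
rewrite sumr_const card_ord -(mulr_natr (B / _)) divfK ?pnatr_eq0//.
by rewrite ltNge hF.
Qed.

(* The partial sums of g are bounded solutions whose gradient is the difference
   of two values of g, one of which tends to 0. *)
Lemma heat_kernel_sup m t j : 0 < t ->
  `|iter m nablap (heat_kernel t) j| <= (Num.sqrt (t / m.+1%:R) ^+ m.+1)^-1.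
Proof.
move=> t0; pose F := iter m nablap (heat_kernel t).
have l1 := heat_kernel_l1 m t0.
apply: (@ler_addV_nat _ _ (Num.sqrt (t / m%:R) ^+ m)^-1).
  by rewrite invr_ge0 exprn_ge0// sqrtr_ge0.
move=> n; have [i _ hi] := l1_le_small (j + 1) n l1.
have sI : injective (fun i : nat => i%:Z) by move=> x y [].
have c1 (k : nat) : `|(1 : R)| <= 1 by rewrite normr1.
have := heat_kernel_sum_grad_le m.+1 i.+1 j c1 sI t0.
have -> : \sum_(k < i.+1) 1 * iter m.+1 nablap (heat_kernel t) (j + (k : nat)%:Z) =
    F (j + 1 + i%:Z) - F j.
  have -> : j + 1 + i%:Z = j + i.+1%:Z by lia.
  elim: i.+1 => [|k IH]; first by rewrite big_ord0 addr0 subrr.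
  rewrite big_ord_recr/= IH mul1r /nablap -/F.
  have -> : j + k%:Z + 1 = j + k.+1%:Z by lia.
  by ring.
move=> h2.
rewrite -/F (_ : F j = F (j + 1 + i%:Z) - (F (j + 1 + i%:Z) - F j)); last by ring.
by rewrite (le_trans (ler_normB _ _))// addrC lerD.
Qed.

End heat_kernel_bounds.

(** * The fourth root *)

Section quartic_root.
Context {R : realType}.
Implicit Types x y : R.

(** All rates below are integer powers of the fourth root of time, so that interpolating between
    them amounts to polynomial identities. *)
Definition qroot x : R := Num.sqrt (Num.sqrt x).

Lemma qroot_ge0 x : 0 <= qroot x. Proof. exact: sqrtr_ge0. Qed.

Lemma qroot_gt0 x : 0 < x -> 0 < qroot x.
Proof. by move=> x0; rewrite !sqrtr_gt0. Qed.

Lemma qroot_exp2 x : qroot x ^+ 2 = Num.sqrt x.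
Proof. by rewrite sqr_sqrtr ?sqrtr_ge0. Qed.

Lemma qroot_exp4 x : 0 <= x -> qroot x ^+ 4 = x.
Proof. by move=> x0; rewrite (exprM _ 2 2) qroot_exp2 sqr_sqrtr. Qed.

Lemma ler_qroot x y : x <= y -> qroot x <= qroot y.
Proof. by move=> xy; do 2 apply: ler_wsqrtr. Qed.

Lemma qrootM x y : 0 <= x -> qroot (x * y) = qroot x * qroot y.
Proof. by move=> x0; rewrite /qroot sqrtrM// sqrtrM ?sqrtr_ge0. Qed.

Lemma qroot_le x y : 0 <= y -> x <= y ^+ 4 -> qroot x <= y.
Proof.
move=> y0 xy; rewrite (le_trans (ler_qroot xy))//.
by rewrite /qroot (exprM _ 2 2) sqrtr_sqr ger0_norm ?exprn_ge0// sqrtr_sqr ger0_norm.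
Qed.

End quartic_root.

(** * Norms of lattice functions and of their differences *)

Section l1_norms.
Context {R : realType}.
Implicit Types (A B : R) (j b : int) (F G : int -> R).

Definition diff (m : nat) F j := F (j + m%:Z) - F j.

Lemma l1_le_ge0 F B : l1_le F B -> 0 <= B.
Proof. by move=> /(_ 0 0%N); rewrite big_ord0. Qed.

Lemma l1_leW F A B : A <= B -> l1_le F A -> l1_le F B.
Proof. by move=> AB h b n; rewrite (le_trans (h b n)). Qed.

Lemma l1_leZ (c : R) F B : l1_le F B -> l1_le (fun j => c * F j) (`|c| * B).
Proof.
move=> h b n; under eq_bigr do rewrite normrM.
by rewrite -mulr_sumr ler_wpM2l.
Qed.

Lemma l1_leD F G A B : l1_le F A -> l1_le G B ->
  l1_le (fun j => F j + G j) (A + B).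
Proof.
move=> hF hG b n; rewrite (le_trans _ (lerD (hF b n) (hG b n)))// -big_split/=.
by apply: ler_sum => i _; exact: ler_normD.
Qed.

Lemma l1_le_sum (n : nat) (W : nat -> int -> R) (B : nat -> R) (r : seq nat) :
  (forall k, l1_le (W k) (B k)) ->
  l1_le (fun j => \sum_(k <- r) W k j) (\sum_(k <- r) B k).
Proof.
move=> h; elim: r => [|k r IH].
  move=> b m; rewrite big_nil big1// => i _; by rewrite big_nil normr0.
rewrite big_cons => b m; apply: le_trans (l1_leD (h k) IH b m).
by under eq_bigr do rewrite big_cons.
Qed.

Lemma l1_le_shift m F B : l1_le F B -> l1_le (fun j => F (j + m)) B.
Proof.
move=> h b n; apply: le_trans (h (b + m) n); apply: ler_sum => i _.
by rewrite addrAC.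
Qed.

Lemma diff_telescope m F j : diff m F j = \sum_(0 <= i < m) nablap F (j + i%:Z).
Proof.
rewrite /diff; elim: m => [|m IH]; first by rewrite big_nil addr0 subrr.
rewrite big_nat_recr//= -IH /nablap; have -> : j + m.+1%:Z = j + m%:Z + 1 by lia.
ring.
Qed.

Lemma l1_le_diff m F B : l1_le (nablap F) B -> l1_le (diff m F) (m%:R * B).
Proof.
move=> h b n.
have := @l1_le_sum 0 (fun i j => nablap F (j + i%:Z)) (fun=> B) (index_iota 0 m).
move=> /(_ (fun i => l1_le_shift _ h) b n).
rewrite big_const_nat subn0 iter_addr_0 -[B *+ m]mulr_natl.
by under eq_bigr do rewrite -diff_telescope.
Qed.

(** The norm is at most 2 m A by the first differences and at most m^2 B by the second ones. The
    geometric mean has the power m^(3/2); that this exponent exceeds 1 makes the dyadic difference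
    quotients of R summable later. *)
Lemma l1_le_diff2 m F (A B : R) : l1_le (nablap F) A ->
  l1_le (iter 2 nablap F) B ->
  l1_le (diff m (diff m F)) (Num.sqrt (2 * m%:R ^+ 3 * (A * B))).
Proof.
move=> h1 h2.
have A0 := l1_le_ge0 h1; have B0 := l1_le_ge0 h2.
have l1 : l1_le (diff m (diff m F)) (2 * (m%:R * A)).
  have := l1_leD (l1_le_shift m%:Z (l1_le_diff m h1)) (l1_leZ (-1) (l1_le_diff m h1)).
  rewrite normrN normr1 mul1r -mulr2n -(mulr_natl (m%:R * A) 2) => h b n.
  rewrite (le_trans _ (h b n))//; apply: ler_sum => i _.
  by rewrite mulN1r.
have l2 : l1_le (diff m (diff m F)) (m%:R * (m%:R * B)).
  apply: l1_le_diff.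
  have := l1_le_diff m h2; congr l1_le; apply/funext => j.
  by rewrite /diff /nablap (addrAC j m%:Z 1); ring.
move=> b n; have := l1 b n; have := l2 b n.
set x := \sum_(i < n) _ => x2 x1.
have x0 : 0 <= x by apply: sumr_ge0.
rewrite -(ger0_norm x0) -sqrtr_sqr; apply: ler_wsqrtr.
rewrite expr2 (le_trans (ler_pM x0 x0 x1 x2))// le_eqVlt; apply/orP; left; apply/eqP.
by ring.
Qed.

Lemma l1_le_sqr F A B b n : l1_le F B -> (forall j, `|F j| <= A) ->
  \sum_(i < n) F (b + (i : nat)%:Z) ^+ 2 <= A * B.
Proof.
move=> h hA.
have A0 : 0 <= A by rewrite (le_trans _ (hA 0)).
apply: le_trans (_ : A * \sum_(i < n) `|F (b + (i : nat)%:Z)| <= _).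
  rewrite mulr_sumr; apply: ler_sum => i _.
  by rewrite -real_normK ?num_real// expr2 ler_wpM2r.
by rewrite ler_wpM2l.
Qed.

End l1_norms.

(** * The regularized kernel *)

Section kernel_rates.
Context {R : realType}.
Implicit Types (t c s : R) (j b : int).

Lemma heat_kernel_le t j : 0 < t -> heat_kernel t j <= (qroot t ^+ 2)^-1.
Proof.
move=> t0; rewrite (le_trans (ler_norm _))// qroot_exp2.
by have := heat_kernel_sup 0 j t0; rewrite divr1 expr1.
Qed.

Lemma nablap_heat_kernel_le t j : 0 < t ->
  `|nablap (heat_kernel t) j| <= 2 * (qroot t ^+ 4)^-1.
Proof.
move=> t0; rewrite qroot_exp4 ?(ltW t0)//.
by have := heat_kernel_sup 1 j t0; rewrite sqr_sqrtr ?invf_div ?divr_ge0// (ltW t0).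
Qed.

Lemma lapl_iter_nablap (p : int -> R) j : lapl p j = iter 2 nablap p (j - 1).
Proof. by rewrite /lapl/= /nablap subrK; ring. Qed.

Lemma lapl_heat_kernel_le t j : 0 < t ->
  `|lapl (heat_kernel t) j| <= 6 * (qroot t ^+ 6)^-1.
Proof.
move=> t0; have t0' := ltW t0; rewrite lapl_iter_nablap.
apply: (le_trans (heat_kernel_sup 2 (j - 1) t0)).
rewrite -[leRHS]invf_div lef_pV2 ?posrE ?divr_gt0 ?exprn_gt0 ?qroot_gt0 ?sqrtr_gt0 ?divr_gt0//.
rewrite (exprM _ 2 3) qroot_exp2 exprSr [leRHS]exprSr !sqr_sqrtr// ?divr_ge0//.
(* This encodes 3^(3/2) <= 6, where the 3 comes from three gradient steps of length t / 3. *)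
have : Num.sqrt (t / 4) <= Num.sqrt (t / 3%:R) by apply: ler_wsqrtr; lra.
rewrite sqrtrM// sqrtrV// (_ : 4 = 2 ^+ 2) ?sqrtr_sqr ?ger0_norm//; last by rewrite -natrX.
move=> h; have := ler_wpM2l (divr_ge0 t0' (_ : 0 <= 3%:R)) h => /(_ (ler0n _ _)).
lra.
Qed.

Lemma nablap_heat_kernel_l1 t : 0 < t ->
  l1_le (nablap (heat_kernel t)) (qroot t ^+ 2)^-1.
Proof.
move=> t0; have := heat_kernel_l1 1 t0.
by rewrite divr1 expr1 qroot_exp2.
Qed.

Lemma nablap2_heat_kernel_l1 t : 0 < t ->
  l1_le (iter 2 nablap (heat_kernel t)) (2 * (qroot t ^+ 4)^-1).
Proof.
move=> t0; have := heat_kernel_l1 2 t0.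
by rewrite sqr_sqrtr ?invf_div ?divr_ge0 ?(ltW t0)// qroot_exp4// ltW.
Qed.

(* In microscopic variables and with c = d / eps, [hreg c] is the kernel of which
   R_1 is composed; the weight [hwt c s] is max(s, c)^(-3/4) for s > 0. *)
Definition hlam c s : R := if s <= 0 then 0 else if s <= c then s / c else 1.
Definition hreg c s j : R := hlam c s * heat_kernel (Num.max s c) j.
Definition hrho c s : R := qroot (Num.max s c).
Definition hwt c s : R := if s <= 0 then 0 else (hrho c s ^+ 3)^-1.

Section fixed_c.
Variables (c : R) (c0 : 0 < c).

Lemma hlam_itv s : 0 <= hlam c s <= 1.
Proof.
rewrite /hlam; case: ifPn => [_|]; first by rewrite lexx ler01.
rewrite -ltNge => s0; case: ifPn => sc; last by rewrite lexx ler01.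
by rewrite divr_ge0 ?(ltW s0) ?(ltW c0)//= ler_pdivrMr// mul1r.
Qed.

Lemma hlam_mid s : 0 < s -> s <= c -> hlam c s = s / c.
Proof. by rewrite /hlam ltNge => /negbTE -> ->. Qed.

Lemma max_gt0 s : 0 < Num.max s c.
Proof. by rewrite lt_max c0 orbT. Qed.

Lemma hrho_gt0 s : 0 < hrho c s.
Proof. exact/qroot_gt0/max_gt0. Qed.

Lemma hwt_ge0 s : 0 <= hwt c s.
Proof.
by rewrite /hwt; case: ifP => // _; rewrite invr_ge0 exprn_ge0// ltW ?hrho_gt0.
Qed.

Lemma hwt_gt0E s : 0 < s -> hwt c s = (hrho c s ^+ 3)^-1.
Proof. by rewrite ltNge /hwt => /negbTE ->. Qed.

Lemma hwt_le s : hwt c s <= (qroot c ^+ 3)^-1.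
Proof.
rewrite /hwt; case: ifP => _; first by rewrite invr_ge0 exprn_ge0// qroot_ge0.
rewrite lef_pV2 ?posrE ?exprn_gt0 ?hrho_gt0 ?qroot_gt0//.
by rewrite lerXn2r ?nnegrE ?qroot_ge0// ler_qroot// le_max lexx orbT.
Qed.

Lemma hreg_le0 s j : s <= 0 -> hreg c s j = 0.
Proof. by rewrite /hreg /hlam => ->; rewrite mul0r. Qed.

Lemma hreg_ge s j : c <= s -> hreg c s j = heat_kernel s j.
Proof.
move=> cs; rewrite /hreg /hlam (_ : (s <= 0) = false) ?max_l//; last first.
  by apply/negbTE; rewrite -ltNge (lt_le_trans c0 cs).
case: ifPn => [sc|]; last by rewrite mul1r.
have -> : s = c by apply/eqP; rewrite eq_le sc.
by rewrite divff ?gt_eqF// mul1r.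
Qed.

Lemma hreg_ge0 s j : 0 <= hreg c s j.
Proof.
rewrite mulr_ge0 ?heat_kernel_ge0 ?(ltW (max_gt0 s))//.
by case/andP: (hlam_itv s).
Qed.

Lemma hlamM_le s x y : 0 <= x -> (0 < s -> x <= y) -> (s <= 0 -> 0 <= y) ->
  hlam c s * x <= y.
Proof.
move=> x0 xy y0; have [s0|s0] := leP s 0; first by rewrite /hlam s0 mul0r y0.
have /andP[l0 l1] := hlam_itv s.
by rewrite (le_trans _ (xy s0))// ler_piMl.
Qed.

Lemma hreg_le s j : hreg c s j <= hrho c s * hwt c s.
Proof.
apply: hlamM_le => [|s0|s0].
- by rewrite heat_kernel_ge0 ?(ltW (max_gt0 s)).
- rewrite hwt_gt0E// (le_trans (heat_kernel_le _ (max_gt0 s)))// -/(hrho c s).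
  rewrite le_eqVlt; apply/orP; left; apply/eqP; field.
  by rewrite gt_eqF// hrho_gt0.
- by rewrite mulr_ge0 ?hwt_ge0// ltW// hrho_gt0.
Qed.

(** On the ramp s / c <= (s / c)^(1/4). A summand that has just started is therefore as small as the
    fourth root of its age, which gives the Hölder bound across its start. *)
Lemma hreg_le_qroot s j : hreg c s j <= qroot s * hwt c s.
Proof.
have [s0|s0] := leP s 0.
  by rewrite hreg_le0// mulr_ge0 ?qroot_ge0// hwt_ge0.
have [cs|sc] := leP c s.
  by have := hreg_le s j; rewrite /hrho max_l.
rewrite /hreg max_r ?(ltW sc)// hwt_gt0E// /hrho max_r ?(ltW sc)//.
rewrite hlam_mid ?(ltW sc)//.
have cg := qroot_gt0 c0.
apply: (@le_trans _ _ (s / c * (qroot c ^+ 2)^-1)).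
  by apply: ler_wpM2l; [rewrite divr_ge0// ltW|exact: heat_kernel_le].
have h : s / c <= qroot s / qroot c.
  rewrite -{1}(qroot_exp4 (ltW s0)) -{1}(qroot_exp4 (ltW c0)) -expr_div_n.
  set z := qroot s / qroot c.
  have z0 : 0 <= z by rewrite divr_ge0 ?qroot_ge0.
  have z1 : z <= 1 by rewrite ler_pdivrMr// mul1r ler_qroot// ltW.
  by rewrite exprS ler_piMr// exprn_ile1.
rewrite (_ : _ / qroot c ^+ 3 = qroot s / qroot c / qroot c ^+ 2); last first.
  by rewrite (exprS _ 2) invfM mulrA.
by rewrite ler_wpM2r// invr_ge0 exprn_ge0// qroot_ge0.
Qed.

Lemma nablap_hreg s j :
  nablap (hreg c s) j = hlam c s * nablap (heat_kernel (Num.max s c)) j.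
Proof. by rewrite /nablap -mulrBr. Qed.

Lemma hreg_l1 s : l1_le (hreg c s) 1.
Proof.
have := l1_leZ (hlam c s) (heat_kernel_l1 0 (max_gt0 s)).
rewrite expr0 invr1 mulr1; apply: l1_leW.
by have /andP[h0 h1] := hlam_itv s; rewrite ger0_norm.
Qed.

Lemma nablap_hreg_le s j :
  `|nablap (hreg c s) j| <= 2 * (hrho c s ^+ 4)^-1 * (0 < s)%R%:R.
Proof.
rewrite nablap_hreg normrM ger0_norm; last by case/andP: (hlam_itv s).
apply: hlamM_le => // [s0|s0].
- by rewrite s0 mulr1; exact/nablap_heat_kernel_le/max_gt0.
- by rewrite mulr_ge0// mulr_ge0// invr_ge0 exprn_ge0// ltW// hrho_gt0.
Qed.

Lemma nablap_hreg_l1 s :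
  l1_le (nablap (hreg c s)) ((hrho c s ^+ 2)^-1 * (0 < s)%R%:R).
Proof.
have [s0|s0] := leP s 0.
  move=> b n; rewrite mulr0 big1// => i _.
  by rewrite /nablap !hreg_le0// subrr normr0.
have := l1_leZ (hlam c s) (nablap_heat_kernel_l1 (max_gt0 s)).
rewrite mulr1 (_ : (fun j => _) = nablap (hreg c s)); last first.
  by apply/funext => j; rewrite nablap_hreg.
apply: l1_leW; have /andP[h0 h1] := hlam_itv s.
by rewrite ger0_norm// ler_piMl// invr_ge0 exprn_ge0// ltW// hrho_gt0.
Qed.

Lemma nablap2_hreg_l1 s :
  l1_le (iter 2 nablap (hreg c s)) (2 * (hrho c s ^+ 4)^-1 * (0 < s)%R%:R).
Proof.
have E j : iter 2 nablap (hreg c s) j =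
    hlam c s * iter 2 nablap (heat_kernel (Num.max s c)) j.
  by rewrite /= /nablap /hreg; ring.
have [s0|s0] := leP s 0.
  move=> b n; rewrite mulr0 big1// => i _.
  by rewrite E /hlam s0 mul0r normr0.
have := l1_leZ (hlam c s) (nablap2_heat_kernel_l1 (max_gt0 s)).
rewrite mulr1 (_ : (fun j => _) = iter 2 nablap (hreg c s)); last first.
  by apply/funext => j; rewrite E.
apply: l1_leW; have /andP[h0 h1] := hlam_itv s.
by rewrite ger0_norm// ler_piMl// mulr_ge0// invr_ge0 exprn_ge0// ltW// hrho_gt0.
Qed.

(** The squared l^2 norm is at most the l^1 norm times the supremum, of orders s^(-1/2) and s^(-1);
    the product is the square of the weight. *)
Lemma nablap_hreg_l2 s b n :
  \sum_(i < n) nablap (hreg c s) (b + (i : nat)%:Z) ^+ 2 <= 2 * hwt c s ^+ 2.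
Proof.
apply: (le_trans (l1_le_sqr b n (nablap_hreg_l1 s) (nablap_hreg_le s))).
have [s0|s0] := leP s 0; first by rewrite /= !(mulr0, mul0r) mulr_ge0// exprn_ge0// hwt_ge0.
rewrite (_ : true%:R = 1 :> R)// !mulr1 hwt_gt0E// le_eqVlt; apply/orP; left; apply/eqP.
by field; rewrite gt_eqF// hrho_gt0.
Qed.

(** First and second differences have l^1 norms of orders s^(-1/2) and s^(-1), whose geometric mean
    is the weight again. *)
Lemma diff2_hreg_l1 s m :
  l1_le (diff m (diff m (hreg c s))) (2 * (Num.sqrt m%:R) ^+ 3 * hwt c s).
Proof.
apply: l1_leW (l1_le_diff2 m (nablap_hreg_l1 s) (nablap2_hreg_l1 s)).
have w0 := hwt_ge0 s.
rewrite -[leRHS]ger0_norm ?mulr_ge0 ?exprn_ge0 ?sqrtr_ge0// -sqrtr_sqr.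
apply: ler_wsqrtr.
rewrite (_ : (2 * _ * _) ^+ 2 = 4 * (Num.sqrt m%:R ^+ 2) ^+ 3 * hwt c s ^+ 2); last by ring.
rewrite sqr_sqrtr//.
have [s0|s0] := leP s 0.
  by rewrite /= !mulr0 mulr_ge0 ?sqr_ge0// mulr_ge0// ?exprn_ge0// -natrX.
rewrite (_ : true%:R = 1 :> R)// !mulr1 hwt_gt0E// le_eqVlt; apply/orP; left; apply/eqP.
by field; rewrite gt_eqF// hrho_gt0.
Qed.

(** On the ramp the slope is the kernel at time [c] divided by [c], of order c^(-3/2). Beyond the
    ramp it is the Laplacian of the kernel, of order s^(-3/2). The two pieces are joined at [c]. *)
Lemma hreg_lipschitz s s' j : 0 < s -> s <= s' ->
  `|hreg c s' j - hreg c s j| <= 6 * (hrho c s ^+ 6)^-1 * (s' - s).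
Proof.
move=> s0 ss'.
have tail x y : c <= x -> x <= y ->
    `|hreg c y j - hreg c x j| <= 6 * (qroot x ^+ 6)^-1 * (y - x).
  move=> cx xy; have x0 : 0 < x := lt_le_trans c0 cx.
  rewrite !hreg_ge//; last exact: le_trans xy.
  have ck : {within `[x, y], continuous (heat_kernel ^~ j : R -> R)}.
    apply: continuous_within => z.
    exact: is_derive_continuous (heat_kernel_derive j z).
  have [z] := MVT_segment xy (fun z _ => heat_kernel_derive j z) ck.
  rewrite in_itv/= => /andP[xz zy] ->.
  have z0 : 0 < z := lt_le_trans x0 xz.
  rewrite normrM (ger0_norm (_ : 0 <= y - x)) ?subr_ge0//.
  rewrite ler_wpM2r ?subr_ge0// (le_trans (lapl_heat_kernel_le j z0))//.
  rewrite ler_pM2l// lef_pV2 ?posrE ?exprn_gt0 ?qroot_gt0//.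
  by rewrite lerXn2r ?nnegrE ?qroot_ge0// ler_qroot.
have head x y : 0 < x -> x <= y -> y <= c ->
    `|hreg c y j - hreg c x j| <= 6 * (qroot c ^+ 6)^-1 * (y - x).
  move=> x0 xy yc; have y0 := lt_le_trans x0 xy; have xc := le_trans xy yc.
  rewrite /hreg !hlam_mid// !max_r// -mulrBl -mulrBl.
  rewrite normrM (ger0_norm (heat_kernel_ge0 _ (ltW c0))).
  rewrite ger0_norm; last by rewrite mulr_ge0 ?subr_ge0// invr_ge0 ltW.
  rewrite [leRHS]mulrC -mulrA ler_wpM2l ?subr_ge0//.
  have q0 := qroot_gt0 c0.
  apply: (@le_trans _ _ (c^-1 * (qroot c ^+ 2)^-1)).
    by rewrite ler_wpM2l ?invr_ge0 ?(ltW c0)// heat_kernel_le.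
  rewrite -{1}(qroot_exp4 (ltW c0)) -invfM -exprD ler_peMl ?ler1n//.
  by rewrite invr_ge0 exprn_ge0// ltW.
have [cs|sc] := leP c s; first by rewrite /hrho max_l// tail.
rewrite /hrho max_r ?(ltW sc)//.
have [s'c|cs'] := leP s' c; first exact: head.
have -> : hreg c s' j - hreg c s j =
  (hreg c s' j - hreg c c j) + (hreg c c j - hreg c s j) by rewrite addrA subrK.
rewrite (le_trans (ler_normD _ _))//.
rewrite (le_trans (lerD (tail c s' (lexx c) (ltW cs')) (head s c s0 (ltW sc) (lexx c))))//.
by rewrite -mulrDr addrA subrK.
Qed.

(** Let a = s' - s and s > 0. If a <= max(s, c), then a^(3/4) is at most the cube of [hrho], which
    turns the Lipschitz bound into the desired one. If a is larger, both values are already of order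
    a^(1/4) times their weights. *)
Lemma hreg_holder s s' j : s <= s' ->
  `|hreg c s' j - hreg c s j| <= 6 * qroot (s' - s) * (hwt c s + hwt c s').
Proof.
move=> ss'; set a := s' - s; have a0 : 0 <= a by rewrite subr_ge0.
have q0 := qroot_ge0 a.
have w0 := hwt_ge0 s; have w0' := hwt_ge0 s'.
have [s0|s0] := leP s 0.
  rewrite (hreg_le0 j s0) subr0 ger0_norm ?hreg_ge0//.
  apply: (le_trans (hreg_le_qroot _ _)).
  have h : qroot s' <= 6 * qroot a.
    by rewrite (@le_trans _ _ (qroot a)) ?ler_qroot ?ler_peMl ?ler1n// /a; lra.
  by rewrite (le_trans (ler_wpM2r w0' h))// ler_wpM2l ?mulr_ge0// lerDr.
have s0' := lt_le_trans s0 ss'.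
have [am|ma] := leP a (Num.max s c).
  apply: (le_trans (hreg_lipschitz j s0 ss')).
  apply: (@le_trans _ _ (6 * qroot a * hwt c s)); last first.
    by rewrite ler_wpM2l ?mulr_ge0// lerDl.
  rewrite hwt_gt0E// -/a -!mulrA ler_pM2l// -{1}(qroot_exp4 a0).
  have rg := hrho_gt0 s.
  rewrite ler_pdivrMl ?exprn_gt0//.
  rewrite (_ : _ * (qroot a / _) = qroot a * hrho c s ^+ 3); last first.
    by field; rewrite gt_eqF.
  rewrite (exprS _ 3) ler_wpM2l// lerXn2r ?nnegrE ?(ltW rg)//.
  exact: ler_qroot.
have h1 : hreg c s j <= qroot a * hwt c s.
  rewrite (le_trans (hreg_le _ _))// ler_wpM2r// ler_qroot//; exact: ltW.
have h2 : hreg c s' j <= 2 * qroot a * hwt c s'.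
  rewrite (le_trans (hreg_le _ _))// ler_wpM2r//.
  apply: qroot_le; first by rewrite mulr_ge0.
  rewrite exprMn qroot_exp4//; move: ma; rewrite gt_max => /andP[sa ca].
  by rewrite ge_max; apply/andP; split; rewrite -natrX; rewrite /a in sa ca *; lra.
rewrite (le_trans (ler_normB _ _))// !ger0_norm ?hreg_ge0//.
have : 0 <= qroot a * hwt c s by rewrite mulr_ge0.
have : 0 <= qroot a * hwt c s' by rewrite mulr_ge0.
lra.
Qed.

(* b^4 - a^4 <= 4 b^3 (b - a) for b^4 = x, a^4 = y. *)
Lemma hwt_telescope (x y : R) : 0 <= y -> y + 2 * c <= x ->
  hwt c x <= 2 / c * (qroot x - qroot y).
Proof.
have := c0 => c0'; move=> y0 yx; have cx : c <= x by lra.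
have x0 : 0 < x by lra.
rewrite hwt_gt0E// /hrho max_l//.
have b0 := qroot_gt0 x0; have a0 := qroot_ge0 y.
have ab : qroot y <= qroot x by rewrite ler_qroot//; lra.
have := qroot_exp4 (ltW x0); have := qroot_exp4 y0.
set b := qroot x in b0 ab *; set a := qroot y in a0 ab * => ea eb.
rewrite invf_ple ?posrE ?exprn_gt0//; last first.
  rewrite mulr_gt0 ?divr_gt0// subr_gt0 lt_neqAle ab andbT.
  by apply: contraPneq yx => ab'; move: ea eb; rewrite /= ab'; lra.
rewrite -[leLHS]mul1r ler_pdivrMr; last first.
  rewrite mulr_gt0 ?divr_gt0// subr_gt0 lt_neqAle ab andbT.
  by apply: contraPneq yx => ab'; move: ea eb; rewrite /= ab'; lra.
rewrite (_ : b ^+ 3 * _ = 2 * (b ^+ 3 * (b - a)) / c); last first.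
  by field; rewrite gt_eqF.
rewrite ler_pdivlMr// mul1r.
have h : b ^+ 4 - a ^+ 4 <= 4 * (b ^+ 3 * (b - a)).
  rewrite -subr_ge0 (_ : _ - _ = (b - a) * ((b - a) * (3 * b ^+ 2 + 2 * a * b + a ^+ 2))); last by ring.
  have ba : 0 <= b - a by rewrite subr_ge0.
  by do 2 apply: mulr_ge0 => //; rewrite !addr_ge0 ?mulr_ge0 ?exprn_ge0// ltW.
rewrite ea eb in h; lra.
Qed.

(** Summands that have not started have weight 0. Of the others, all but the last are absorbed by
    the telescoping fourth root, and the last one is bounded by the maximal weight c^(-3/4). *)
Lemma sum_hwt_le (t T : R) (S : nat -> R) (K : nat) :
  (forall k, (1 <= k < K)%N -> 2 * c <= S k.+1 - S k) ->
  ((1 <= K)%N -> t - S 1%N <= T) ->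
  \sum_(1 <= k < K.+1) hwt c (t - S k) <= 2 / c * qroot T + (qroot c ^+ 3)^-1.
Proof.
case: K => [|K] gap tT.
  rewrite big_geq// addr_ge0 ?mulr_ge0 ?invr_ge0 ?exprn_ge0 ?qroot_ge0//.
  exact: ltW.
have {tT} tT := tT isT.
have c2 : 0 <= 2 / c by rewrite divr_ge0// ltW.
(* [A] keeps the last summand apart, since a weight can be telescoped only when the next transition
   has also occurred before [t]; [B] is the claim. *)
suff [A B] : (S K.+1 < t -> \sum_(1 <= k < K.+2) hwt c (t - S k) <=
     2 / c * (qroot T - qroot (t - S K.+1)) + hwt c (t - S K.+1)) /\
   \sum_(1 <= k < K.+2) hwt c (t - S k) <= 2 / c * qroot T + (qroot c ^+ 3)^-1.
  exact: B.
elim: K gap => [|K IH] gap.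
  rewrite !big_nat1; split => [_|].
    by rewrite lerDr mulr_ge0// subr_ge0 ler_qroot.
  by rewrite (le_trans (hwt_le _))// lerDr mulr_ge0// qroot_ge0.
have [|A B] := IH.
  move=> k /andP[k1 k2]; by apply: gap; rewrite k1 ltnS ltnW.
have gK := gap K.+1 (_ : (1 <= K.+1 < K.+2)%N); rewrite ltnSn in gK.
have {}gK := gK isT; have := c0 => c0'.
rewrite big_nat_recr//=; have [tS|St] := leP t (S K.+2).
  split => //.
  by rewrite [hwt c (t - S K.+2)]/hwt subr_le0 tS addr0.
have A' : \sum_(1 <= k < K.+2) hwt c (t - S k) + hwt c (t - S K.+2) <=
    2 / c * (qroot T - qroot (t - S K.+2)) + hwt c (t - S K.+2).
  rewrite lerD2r; have /A h : S K.+1 < t by lra.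
  rewrite (le_trans h)//.
  have := @hwt_telescope (t - S K.+1) (t - S K.+2).
  have -> : 0 <= t - S K.+2 by lra.
  have -> : t - S K.+2 + 2 * c <= t - S K.+1 by lra.
  by move=> /(_ isT isT); lra.
split => //; rewrite (le_trans A')// lerD ?hwt_le// ler_wpM2l//.
by rewrite lerBlDr lerDl qroot_ge0.
Qed.

End fixed_c.
End kernel_rates.

(** * Single-interface solutions *)

Section eps_delta.
Context {R : realType}.
Implicit Types (A D : set R) (f : R -> R).

Lemma within_epsP A f : {within A, continuous f} <->
  forall x, A x -> forall e : R, 0 < e -> exists2 d : R, 0 < d &
    forall y, A y -> `|y - x| < d -> `|f y - f x| < e.
Proof.
split=> [cf x Ax e e0|h].
  have /subspace_continuousP /(_ x Ax) /cvgrPdist_lt /(_ e e0) := cf.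
  rewrite /within/= => -[d d0 hd]; exists d => // y Ay yx; rewrite distrC.
  by apply: hd => //=; rewrite distrC.
apply/subspace_continuousP => x Ax; apply/cvgrPdist_lt => e e0.
have [d d0 hd] := h x Ax e e0.
exists d => // y /=; rewrite distrC => yx Ay; rewrite distrC; exact: hd.
Qed.

Lemma within_uniform_eps A (u : R -> int -> R) :
  {within A, continuous (u : R -> {uniform int -> R})} ->
  forall x, A x -> forall e : R, 0 < e -> exists2 d : R, 0 < d &
    forall y, A y -> `|y - x| < d -> forall j, `|u y j - u x j| < e.
Proof.
move=> cu x Ax e e0.
have /subspace_continuousP /(_ x Ax) := cu.
move=> /(_ [set h | forall j, `|u x j - h j| < e]).
case.
  apply/uniform_nbhs; exists [set xy | ball xy.1 e xy.2]; split.
    exact: (entourage_ball _ (PosNum e0)).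
  by move=> h /= hh j; exact: hh.
move=> d /= d0 hd; exists d => // y Ay yx j; rewrite distrC.
by apply: hd => //=; rewrite distrC.
Qed.

Lemma is_derive_within_continuous D f t l : is_derive_within D f t l ->
  forall e : R, 0 < e -> exists2 d : R, 0 < d &
    forall y, D y -> `|y - t| < d -> `|f y - f t| < e.
Proof.
move=> /cvgrPdist_lt /(_ 1 ltr01) h e e0.
have L0 : 0 < `|l| + 1 by rewrite ltr_wpDl.
move: h; rewrite /within/= => -[d d0 hd].
exists (Num.min d (e / (`|l| + 1))); first by rewrite lt_min d0 divr_gt0.
move=> y Dy; rewrite lt_min => /andP[yd ye].
have [->|yt] := eqVneq y t; first by rewrite subrr normr0.
have := hd y; rewrite /= distrC => /(_ yd yt Dy) => h.
have yt0 : 0 < `|y - t| by rewrite normr_gt0 subr_eq0.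
have h2 : `|(f y - f t) / (y - t)| < `|l| + 1.
  rewrite (_ : _ / _ = l - (l - (f y - f t) / (y - t))); last by rewrite opprB addrCA subrr addr0.
  by rewrite (le_lt_trans (ler_normB _ _))// ltrD2l.
rewrite normrM normfV ltr_pdivrMr// in h2.
rewrite (lt_le_trans h2)// mulrC -ler_pdivlMr//; exact: ltW.
Qed.

Lemma is_derive_within_is_derive D f (t l : R) : nbhs t D ->
  is_derive_within D f t l -> is_derive t 1 f l.
Proof.
move=> Dt h.
have H : h0^-1 *: (f (h0 *: 1 + t) - f t) @[h0 --> 0^'] --> l.
  apply/cvgrPdist_lt => e e0.
  move: h => /cvgrPdist_lt /(_ e e0); rewrite /within/= => -[d d0 hd].
  have [d1 /= d10 hd1] := Dt.
  exists (Num.min d d1); first by rewrite /= lt_min d0 d10.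
  move=> s /=; rewrite sub0r normrN lt_min => /andP[sd sd1] s0.
  rewrite [s *: 1](_ : _ = s); last by rewrite /GRing.scale/= mulr1.
  have := hd (s + t); rewrite addrK mulrC; apply.
  - by rewrite /= opprD addrCA subrr addr0 normrN.
  - by rewrite -subr_eq0 addrK.
  - by apply: hd1; rewrite /= opprD addrCA subrr addr0 normrN.
split; first by apply/cvg_ex; exists l.
by apply: cvg_lim.
Qed.

End eps_delta.

Section solution_regularity.
Context {R : realType}.
Implicit Types (a b c t : R) (j : int) (k : nat).

Lemma bounded_heat_solution_sol (p0 : int -> R) (q : R -> int -> R) (b : R) :
  bounded_heat_solution p0 q -> heat_sol 0 b q.
Proof.
move=> [[M qM] dq q0]; split.
- by exists M => t j /andP[t0 _]; exact: qM.
- move=> j; apply/within_epsP => x; rewrite /= in_itv/= => /andP[x0 xb] e e0.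
  have [d d0 hd] := is_derive_within_continuous (dq x j x0) e0.
  exists d => // y; rewrite in_itv/= => /andP[y0 _] yx; apply: hd => //.
  by rewrite /= in_itv/= y0.
- move=> t j /andP[t0 tb].
  apply: (@is_derive_within_is_derive _ `[0, +oo[) => //; last exact/dq/ltW.
  exists t => //= x /=; rewrite in_itv/= andbT ltr_norml => /andP[_ h].
  by rewrite -(lerD2l t) addr0 -subr_ge0 -opprB subr_ge0 in h *; lra.
Qed.

Lemma phase_stateP k (v : int -> R) : phase_state k%:Z v ->
  (forall j, (j < k%:Z)%R -> 0 < v j) /\
  (forall j, (k%:Z <= j)%R -> -2 < v j /\ v j < 0).
Proof.
move=> [h1 _ h3 h4]; split => j jk.
  rewrite -lte_fin (lt_le_trans h1)//; apply: ereal_inf_lbound.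
  by exists j.
split.
  by rewrite -lte_fin (lt_le_trans h3)//; apply: ereal_inf_lbound; exists j.
by rewrite -lte_fin (le_lt_trans _ h4)//; apply: ereal_sup_ubound; exists j.
Qed.

(** The continuity is uniform in the sites, so the supremum of |u_j(t)| over j is a continuous
    function of t and attains its maximum on the compact time interval. *)
Lemma linfty_continuous_bounded (u : R -> int -> R) b : linfty_continuous u ->
  exists M, forall t j, 0 <= t <= b -> `|u t j| <= M.
Proof.
move=> [bu cu].
have bu' t : 0 <= t -> exists M, forall j, `|u t j| <= M.
  move=> t0; have [M [_ hM]] := bu t t0.
  exists (M + 1) => j; apply: (hM (M + 1)) => //; by rewrite ltrDl.
have [b0|b0] := ltP b 0.
  by exists 0 => t j /andP[t0 tb]; have := le_lt_trans (le_trans t0 tb) b0; rewrite ltxx.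
pose N t := sup (range (fun j => `|u t j|)).
have hN t j : 0 <= t -> `|u t j| <= N t.
  move=> t0; apply: ub_le_sup; last by exists j.
  by have [M hM] := bu' t t0; exists M => _ [i _ <-].
have cN : {within `[0, b], continuous N}.
  apply/within_epsP => x; rewrite /= in_itv/= => /andP[x0 xb] e e0.
  have e2 : 0 < e / 2 by rewrite divr_gt0.
  have [|d d0 hd] := within_uniform_eps cu (x := x) _ e2.
    by rewrite /= in_itv/= x0.
  exists d => // y; rewrite /= in_itv/= => /andP[y0 yb] yx.
  have {}hd := hd y (_ : `[0, +oo[%classic y) yx.
  rewrite /= in_itv/= y0 in hd; have {}hd := hd isT.
  have le s t : 0 <= s -> (forall j, `|u t j - u s j| < e / 2) -> N t <= N s + e / 2.
    move=> s0 hst; apply: ge_sup; first by exists `|u t 0|, 0.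
    move=> _ [j _ <-]; have -> : u t j = u s j + (u t j - u s j) by rewrite addrC subrK.
    by rewrite (le_trans (ler_normD _ _))// lerD ?hN// ltW.
  have h1 := le x y x0 hd.
  have h2 := le y x y0 (fun j => ltac:(rewrite distrC; exact: hd)).
  by rewrite ltr_norml; apply/andP; split; lra.
have [c _ hc] := EVT_max b0 cN.
exists (N c) => t j /andP[t0 tb]; rewrite (le_trans (hN _ _ t0))// hc//.
by rewrite in_itv/= t0.
Qed.

End solution_regularity.

(** * Order of the transitions and the equation within a phase *)

Section single_interface.
Context {R : realType}.
Variables (u : R -> int -> R) (ts : nat -> \bar R).
Hypothesis sol : single_interface_solution u ts.
Implicit Types (a b t s : R) (j : int) (k n m i : nat).

Let S k := fine (ts k).

(** The sign pattern shared by all states in X_n. Subtracting it from u yields p inside a phase and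
    the one-sided limits of p at its ends. *)
Definition psgn n j : R := if (j < n%:Z)%R then 1 else -1.

Lemma ts_ge0 k : (0 <= ts k)%E.
Proof. by case: sol => -[_ _ t0 tS] _ _ _ _; case: k => [|k]; [rewrite t0|exact: ltW]. Qed.

Lemma tsE k : (ts k < +oo)%E -> ts k = (S k)%:E.
Proof. by move=> h; rewrite /S fineK// ge0_fin_numE// ts_ge0. Qed.

Lemma phase_cover n t : 0 <= t -> (t%:E < ts n)%E ->
  exists2 i, (i < n)%N & (ts i <= t%:E)%E && (t%:E < ts i.+1)%E.
Proof.
move=> t0; elim: n => [|n IH] tn.
  by case: sol => -[_ _ e _] _ _ _ _; move: tn; rewrite e lte_fin ltNge t0.
have [/IH [i ni hi]|nt] := ltP (t%:E)%E (ts n).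
  by exists i => //; rewrite ltnS ltnW.
by exists n => //; rewrite nt tn.
Qed.

(** At a transition time some site vanishes, whereas inside a phase no site does. Hence the equation
    is available at every interior time of a phase. *)
Lemma phase_neq_ts n t k : (ts n < t%:E)%E && (t%:E < ts n.+1)%E -> t%:E <> ts k.+1.
Proof.
move=> /[dup] tn /andP[tn1 tn2] tk.
case: sol => _ _ _ h4 h5.
have /phase_stateP [hp hm] := h5 n (lt_trans tn1 (ltry t)) t tn.
have [] := h4 k; first by rewrite -tk ltry.
rewrite -tk/= => uk _.
have [kn|kn] := ltP (k.+1%:Z) n.+1%:Z.
  by have := hp _ kn; rewrite uk ltxx.
by have [_] := hm _ kn; rewrite uk ltxx.
Qed.

Lemma u_derive n t j : (ts n < t%:E)%E && (t%:E < ts n.+1)%E ->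
  is_derive t 1 (u ^~ j) (lapl (dPhi \o u t) j).
Proof.
move=> /[dup] tn /andP[tn1 tn2].
have t0 : 0 < t by rewrite -lte_fin (le_lt_trans (ts_ge0 n)).
apply: (@is_derive_within_is_derive _ `[0, +oo[).
  exists t => //= x /=; rewrite in_itv/= andbT ltr_norml => /andP[_ h]; lra.
case: sol => _ _ h3 _ _; apply: h3; first exact: ltW.
by move=> k; exact: (phase_neq_ts tn).
Qed.

Lemma u_within_continuous b j : {within `[0, b], continuous (u ^~ j)}.
Proof.
case: sol => -[_ [_ cu] _ _] _ _ _ _.
apply/within_epsP => x; rewrite /= in_itv/= => /andP[x0 xb] e e0.
have [|d d0 hd] := within_uniform_eps cu (x := x) _ e0; first by rewrite /= in_itv/= x0.
exists d => // y; rewrite in_itv/= => /andP[y0 yb] yx; apply: hd => //.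
by rewrite /= in_itv/= y0.
Qed.

(* Condition (3) excludes transition times which are finite after an infinite
   one: u_k cannot become positive while u stays in X_i with i <= k. *)
Lemma ts_finite_before k : (ts k < +oo)%E -> forall i, (i <= k)%N -> (ts i < +oo)%E.
Proof.
move=> tk i ik; rewrite ltNge leye_eq; apply/negP => /eqP tiy.
have {}ik : (i < k)%N.
  by rewrite ltn_neqAle ik andbT; apply: contraTneq tk => <-; rewrite tiy ltxx.
case: k => [//|k] in tk ik *.
set t := S k.+1; have tkE : ts k.+1 = t%:E by exact: tsE.
have t0 : 0 < t.
  by case: sol => -[_ _ _ h] _ _ _ _; rewrite -lte_fin -tkE.
have [|m mi /andP[mt tm]] := @phase_cover i t (ltW t0); first by rewrite tiy ltry.
have mk : (m.+1%:Z <= k.+1%:Z)%R by have := leq_trans mi (ltnW ik); lia.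
case: (sol) => _ _ _ h4 h5.
have [uk [l l0 dl]] := h4 k tk; rewrite -/(S k.+1) -/t in uk dl.
have ph s : t < s -> (s%:E < ts m.+1)%E -> (ts m < s%:E)%E && (s%:E < ts m.+1)%E.
  by move=> ts1 ->; rewrite andbT (le_lt_trans mt)// lte_fin.
have neg s : t < s -> (s%:E < ts m.+1)%E -> u s k.+1%:Z < 0.
  move=> ts1 sm; have /h5 h := le_lt_trans mt (ltry t).
  by have /phase_stateP[_ /(_ _ mk) []] := h s (ph s ts1 sm).
move/cvgrPdist_lt : dl => /(_ l l0) [d /= d0 hd].
have [s1 [ts1 sd sm]] : exists s1, [/\ t < s1, s1 < t + d & (s1%:E < ts m.+1)%E].
  have [tmy|] := eqVneq (ts m.+1) +oo%E.
    by exists (t + d / 2); split; [lra|lra|rewrite tmy ltry].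
  rewrite -ltey => /tsE e; rewrite e lte_fin in tm.
  exists (t + Num.min (d / 2) ((S m.+1 - t) / 2)).
  have h : 0 < Num.min (d / 2) ((S m.+1 - t) / 2).
    by rewrite lt_min !divr_gt0// subr_gt0.
  have h1 : Num.min (d / 2) ((S m.+1 - t) / 2) <= d / 2 by rewrite ge_min lexx.
  have h2 : Num.min (d / 2) ((S m.+1 - t) / 2) <= (S m.+1 - t) / 2.
    by rewrite ge_min lexx orbT.
  by rewrite e lte_fin; split; lra.
have ud s : s \in `]t, s1[ -> is_derive s 1 (u ^~ k.+1%:Z) (lapl (dPhi \o u s) k.+1%:Z).
  rewrite in_itv/= => /andP[ss1 ss2]; apply: (@u_derive m); apply: ph => //.
  by rewrite (lt_trans _ sm)// lte_fin.
have cu : {within `[t, s1], continuous (u ^~ k.+1%:Z)}.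
  apply: continuous_subspaceW (@u_within_continuous s1 k.+1%:Z) => x /=.
  by rewrite !in_itv/= => /andP[x1 ->]; rewrite (le_trans (ltW t0)).
(* As u_k is negative at [s1] and 0 at [t], its derivative is negative somewhere between them,
   although it is close to l > 0 there. *)
have [z zt] := MVT ts1 ud cu; rewrite uk subr0 => E.
have := neg s1 ts1 sm; rewrite E pmulr_llt0 ?subr_gt0// ltNge.
move/negP; apply; have dz := ud z zt.
have := hd z; rewrite /= => h.
move: zt; rewrite in_itv/= => /andP[tz zs1].
have {h} := h _ tz; rewrite derive1E derive_val.
have -> : `|t - z| < d by rewrite ltr_norml; apply/andP; split; lra.
move=> /(_ isT); rewrite ltr_norml => /andP[_]; lra.
Qed.

Lemma ts_lt i k : (i < k)%N -> (ts k < +oo)%E -> (ts i < ts k)%E.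
Proof.
move=> ik tk; case: sol => _ h2 _ _ _.
elim: k ik tk => [//|k IH]; rewrite ltnS leq_eqVlt => /predU1P[->|ik] tk.
  by have [h|//] := h2 k; have := ts_finite_before tk (leqnSn k); rewrite h ltxx.
have tk' := ts_finite_before tk (leqnSn k).
rewrite (lt_trans (IH ik tk'))//.
by have [h|//] := h2 k; rewrite h ltxx in tk'.
Qed.

Lemma dPhi_phase n (v : int -> R) j : phase_state n%:Z v ->
  dPhi (v j) = v j - psgn n j.
Proof.
move=> /phase_stateP [hp hm]; rewrite /dPhi /sgnp /psgn.
have [jn|jn] := ltP j n%:Z; first by rewrite ltNge ltW// hp.
by have [_ ->] := hm _ jn.
Qed.

(** The sign pattern is frozen during a phase, so the nonlinear equation for u becomes the linear
    one. At a final transition time the function takes the left limit of p and not its value. *)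
Lemma phase_heat_sol n b : (ts n < +oo)%E -> (b%:E <= ts n.+1)%E ->
  heat_sol (S n) b (fun t j => u t j - psgn n.+1 j).
Proof.
move=> tn bn; have Sn0 : 0 <= S n by rewrite fine_ge0// ts_ge0.
have ps j : `|psgn n.+1 j| <= 1.
  by rewrite /psgn; case: ifP; rewrite ?normrN normr1.
case: (sol) => -[_ lc _ _] _ _ _ h5; split.
- have [M hM] := linfty_continuous_bounded b lc.
  exists (M + 1) => t j /andP[t1 t2].
  by rewrite (le_trans (ler_normB _ _))// lerD// hM// t2 (le_trans Sn0).
- move=> j; apply: within_continuousD; last exact: within_continuous_cst.
  apply: continuous_subspaceW (@u_within_continuous b j) => x /=.
  by rewrite !in_itv/= => /andP[x1 ->]; rewrite (le_trans Sn0).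
- move=> t j /andP[t1 t2].
  have tn' : (ts n < t%:E)%E && (t%:E < ts n.+1)%E.
    by rewrite (tsE tn) lte_fin t1 (lt_le_trans _ bn)// lte_fin.
  have ph := h5 n tn t tn'.
  have du := u_derive j tn'.
  have -> : lapl (fun j => u t j - psgn n.+1 j) j = lapl (dPhi \o u t) j.
    by rewrite /lapl /= !(dPhi_phase _ ph).
  have := is_deriveB du (is_derive_cst (psgn n.+1 j) t 1).
  by rewrite subr0.
Qed.

End single_interface.

(** * The representation of p by heat kernels *)

Section representation.
Context {R : realType}.
Variables (u q : R -> int -> R) (ts : nat -> \bar R).
Hypothesis sol : single_interface_solution u ts.
Hypothesis qsol : bounded_heat_solution (dPhi \o u 0) q.
Implicit Types (a b c t s : R) (j l : int) (k n m i : nat).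

Let S k := fine (ts k).

Lemma shifted_kernel_sol a b c l : c <= a ->
  heat_sol a b (fun t j => heat_kernel (t - c) (j - l)).
Proof.
move=> ca.
have dk t j : is_derive t 1 (fun t => heat_kernel (t - c) j)
    (lapl (heat_kernel (t - c)) j).
  have h : is_derive t 1 (fun t : R => t - c) 1.
    have := is_deriveB (is_derive_id t 1) (is_derive_cst c t 1); rewrite subr0; exact.
  have := @is_derive1_comp _ (fun t => heat_kernel t j) (fun t => t - c) t _ _
    (heat_kernel_derive j (t - c)) h.
  by rewrite mulr1.
split.
- exists 1 => t j /andP[at_ _]; apply: heat_kernel_norm_le1.
  by rewrite subr_ge0 (le_trans ca).
- move=> j; apply: continuous_within => t; exact: is_derive_continuous (dk t (j - l)).
- move=> t j _; have -> : lapl (fun j => heat_kernel (t - c) (j - l)) j =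
    lapl (heat_kernel (t - c)) (j - l).
    by rewrite /lapl; congr (heat_kernel _ _ - _ + heat_kernel _ _); rewrite addrAC.
  exact: dk.
Qed.

(** Induction over the phases. At its transition site n+1 is the only one where the sign pattern
    changes, from -1 to 1. This subtracts twice a Kronecker delta, which is the new kernel at time
    0, and uniqueness of bounded solutions continues the identity through the phase. *)
Lemma representation n b : (ts n < +oo)%E -> (b%:E <= ts n.+1)%E ->
  forall t j, S n <= t <= b -> u t j - psgn n.+1 j =
    q t j - 2 * \sum_(1 <= l < n.+1) heat_kernel (t - S l) (j - l%:Z).
Proof.
elim: n b => [|n IH] b tn bn t j tb.
  have h0 : S 0 = 0 by case: sol => -[_ _ e _] _ _ _ _; rewrite /S e.
  have hu := phase_heat_sol sol tn bn; rewrite -/(S 0) h0 in hu.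
  have hq := bounded_heat_solution_sol b qsol.
  rewrite big_geq// mulr0 subr0; rewrite h0 in tb.
  apply: (heat_sol_unique hu hq) tb => i.
  case: qsol => _ _ ->; case: sol => -[ph _ _ _] _ _ _ _.
  by rewrite /= (dPhi_phase _ ph).
have tn' := ts_finite_before sol tn (leqnSn n).
have hu := phase_heat_sol sol tn bn; rewrite -/(S n.+1) in hu.
have Sn0 i : 0 <= S i by rewrite fine_ge0// (ts_ge0 sol).
have Sle i : (i <= n.+1)%N -> S i <= S n.+1.
  rewrite leq_eqVlt => /predU1P[->//|ii].
  by rewrite -lee_fin -!(tsE sol)// ?(ts_finite_before sol tn (ltnW ii))// ltW// (ts_lt sol).
have hk : heat_sol (S n.+1) b (fun t j =>
   \sum_(1 <= l < n.+2) heat_kernel (t - S l) (j - l%:Z)).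
  (* [heat_sol_sum] wants a solution for every index, and kernels of later transitions need not be
     one on this interval; they are replaced by 0. *)
  have := @heat_sol_sum _ (S n.+1) b n.+1 (fun i t j =>
     if (i < n.+1)%N then heat_kernel (t - S i.+1) (j - i.+1%:Z) else 0).
  have h i : heat_sol (S n.+1) b (fun t j =>
     if (i < n.+1)%N then heat_kernel (t - S i.+1) (j - i.+1%:Z) else 0).
    have [ii|ii] := boolP (i < n.+1)%N; last exact: heat_sol_cst.
    exact/shifted_kernel_sol/Sle.
  move=> /(_ h); congr heat_sol; apply/funext => s; apply/funext => i.
  rewrite big_add1/= big_mkord; apply: eq_bigr => k _.
  by rewrite ltn_ord.
have hq := heat_sol_sub (Sn0 n.+1) (lexx b) (bounded_heat_solution_sol b qsol).
apply: (heat_sol_unique hu (heat_solB hq (heat_solZ 2 hk))) tb => {}j.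
have := IH (S n.+1) tn' _ (S n.+1) j.
rewrite -(tsE sol tn) lexx => /(_ isT).
rewrite Sle// lexx => /(_ isT) => E.
rewrite (big_nat_recr n.+1)//= subrr heat_kernel0 mulrDr opprD addrA -E.
rewrite /psgn subr_eq0; have [->|jn] := eqVneq j n.+1%:Z.
  by rewrite ltxx (_ : (n.+1%:Z < n.+2%:Z)%R = true) /=; [ring|lia].
rewrite /= mulr0 subr0; congr (_ - _).
by rewrite (_ : (j < n.+2%:Z)%R = (j < n.+1%:Z)%R)//; lia.
Qed.

End representation.

(** * What is needed of one microscopic solution *)

Section micro_structure.
Context {R : realType}.
Implicit Types (t s : R) (j : int) (k n m i : nat).

(* Extended by zero to negative times, so that the sum in the representation of
   p runs over all transitions. *)
Definition zkernel t j : R := if t < 0 then 0 else heat_kernel t j.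

(** It turns the cardinality by which the number of transitions is defined into the index of the
    last transition. *)
Lemma initial_segment_card (A : set nat) : finite_set A ->
  (forall k, A k -> (1 <= k)%N) ->
  (forall i k, (1 <= i)%N -> (i < k)%N -> A k -> A i) ->
  forall k, A k <-> (1 <= k <= #|` fset_set A|)%N.
Proof.
move=> fA A1 dA k.
have memA i : (i \in fset_set A) = (i \in A) by rewrite in_fset_set.
split=> [Ak|/andP[k1 kK]].
  rewrite (A1 _ Ak)/=; have := @uniq_leq_size _ (iota 1 k) (fset_set A) (iota_uniq _ _).
  rewrite size_iota; apply => i; rewrite mem_iota add1n ltnS => /andP[i1 ik].
  rewrite memA inE; move: ik; rewrite leq_eqVlt => /predU1P[->//|ik].
  exact: dA Ak.
apply: contrapT => nAk.
have := @uniq_leq_size _ (fset_set A) (iota 1 k.-1) (fset_uniq _).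
rewrite size_iota => h; have /h : {subset fset_set A <= iota 1 k.-1}.
  move=> i; rewrite memA inE mem_iota add1n prednK// => Ai.
  rewrite (A1 _ Ai)/= ltnNge; apply/negP; rewrite leq_eqVlt => /predU1P[ki|ki].
    by apply: nAk; rewrite ki.
  by apply: nAk; exact: dA Ai.
by move: kK; rewrite leqNgt => /negP kK h'; apply: kK; rewrite (leq_ltn_trans h')// prednK.
Qed.

(** [S] lists the transition times before the final time as reals. [md_repr] stays away from these
    times; [md_transition] gives the left limit of p_k at the k-th one, which is 1 because u_k = 0
    while the sign is still -1. *)
Record micro_data (tfin d eps : R) (ts : nat -> \bar R) (p q : R -> int -> R)
    (K : nat) (S : nat -> R) : Prop := {
  md_count : transition_count tfin eps ts = K;
  md_time : forall k, (1 <= k <= K)%N -> macro_time eps ts k = (eps ^+ 2 * S k)%:E;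
  md_itv : forall k, (1 <= k <= K)%N -> 0 < S k < tfin / eps ^+ 2;
  md_gap : forall k, (1 <= k < K)%N -> 2 * (d / eps) <= S k.+1 - S k;
  md_bound : K%:R <= tfin / (2 * d * eps);
  md_position : forall tau, 0 <= tau < tfin ->
    interface_position eps ts tau =
    eps * \sum_(1 <= k < K.+1) (S k <= tau / eps ^+ 2)%R%:R;
  md_repr : forall t, 0 <= t < tfin / eps ^+ 2 ->
    (forall k, (1 <= k <= K)%N -> S k <> t) -> forall j,
    [/\ p t j = q t j - 2 * \sum_(1 <= k < K.+1) zkernel (t - S k) (j - k%:Z),
        -1 <= p t j &
        \sum_(1 <= k < K.+1) (S k <= t)%R%:R < j%:~R :> R -> p t j <= 1];
  md_transition : forall k, (1 <= k <= K)%N ->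
    q (S k) k%:Z - 2 * \sum_(1 <= l < k) heat_kernel (S k - S l) (k%:Z - l%:Z) = 1 }.

Lemma sum_nat_prefix n K (F G : nat -> R) : (n <= K)%N ->
  (forall k, (1 <= k <= n)%N -> F k = G k) ->
  (forall k, (n < k <= K)%N -> F k = 0) ->
  \sum_(1 <= k < K.+1) F k = \sum_(1 <= k < n.+1) G k.
Proof.
move=> nK FG F0; rewrite (big_cat_nat (n := n.+1))//= [X in _ + X](_ : _ = 0) ?addr0.
  by apply: eq_big_nat => k; rewrite ltnS => /FG.
rewrite big_nat_cond big1// => k; rewrite andbT ltnS; exact: F0.
Qed.

Lemma micro_dataP (tfin d eps : R) u ts q : 0 < tfin -> 0 < d -> 0 < eps ->
  single_interface_solution u ts ->
  bounded_heat_solution (dPhi \o u 0) q ->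
  transition_bounds tfin d eps ts ->
  exists K S, micro_data tfin d eps ts (fun t j => dPhi (u t j)) q K S.
Proof.
move=> tf0 d0 e0 sol qsol [fin cnt gap].
set K := transition_count tfin eps ts in cnt gap.
pose S k := fine (ts k).
have e20 : 0 < eps ^+ 2 by rewrite exprn_gt0.
have mt k : (ts k < +oo)%E -> macro_time eps ts k = (eps ^+ 2 * S k)%:E.
  by move=> /(tsE sol) e; rewrite /macro_time e.
have mty k : ts k = +oo%E -> macro_time eps ts k = +oo%E.
  by move=> e; rewrite /macro_time e mulry gtr0_sg// mul1e.
have mtlt k : (macro_time eps ts k < +oo)%E -> (ts k < +oo)%E.
  by rewrite !ltey; apply: contraNN => /eqP/mty ->.
have trE k : transitions tfin eps ts k <-> (1 <= k <= K)%N.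
  apply: initial_segment_card => // [{}k []//|i {}k i1 ik [k1 hk]].
  split=> //; have tk : (ts k < +oo)%E by apply/mtlt/(lt_trans hk)/ltry.
  have ti := ts_finite_before sol tk (ltnW ik).
  rewrite mt// (lt_trans _ hk)// mt// lte_fin ltr_pM2l//.
  by have := ts_lt sol ik tk; rewrite (tsE sol tk) (tsE sol ti) lte_fin.
have tsfin k : (k <= K)%N -> (ts k < +oo)%E.
  case: k => [_|k kK]; first by case: sol => -[_ _ -> _] _ _ _ _; exact: ltry.
  have /trE[_ h] : (1 <= k.+1 <= K)%N by [].
  by apply/mtlt/(lt_trans h)/ltry.
have tsK t : t < tfin / eps ^+ 2 -> (t%:E < ts K.+1)%E.
  move=> tT; rewrite ltNge; apply/negP => h.
  have tk : (ts K.+1 < +oo)%E by rewrite (le_lt_trans h)// ltry.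
  have : (1 <= K.+1 <= K)%N.
    apply/trE; split => //; rewrite mt// lte_fin mulrC -ltr_pdivlMr//.
    by rewrite (le_lt_trans _ tT)// -lee_fin -(tsE sol tk).
  by rewrite ltnn andbF.
have Slt i k : (i < k)%N -> (k <= K)%N -> S i < S k.
  move=> ik kK; have := ts_lt sol ik (tsfin _ kK).
  rewrite (tsE sol (tsfin _ kK)) (tsE sol (tsfin _ (leq_trans (ltnW ik) kK))).
  by rewrite lte_fin.
have cover t : 0 <= t -> t < tfin / eps ^+ 2 -> exists n,
    [/\ (n <= K)%N, (ts n <= t%:E)%E, (t%:E < ts n.+1)%E &
     forall k, (1 <= k <= K)%N -> (S k <= t) = (k <= n)%N].
  move=> t0 /tsK /(phase_cover sol t0)[n nK /andP[n1 n2]].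
  exists n; split => // k /andP[k1 kK].
  rewrite -lee_fin -(tsE sol (tsfin _ kK)).
  have [kn|nk] := leqP k n.
    rewrite (le_trans _ n1)//; move: kn; rewrite leq_eqVlt => /predU1P[->//|kn].
    exact/ltW/(ts_lt sol kn)/tsfin.
  apply/negbTE; rewrite -ltNge (lt_le_trans n2)//.
  move: nk; rewrite leq_eqVlt => /predU1P[->//|nk].
  exact/ltW/(ts_lt sol nk)/tsfin.
have cntN t n : (n <= K)%N -> (forall k, (1 <= k <= K)%N -> (S k <= t) = (k <= n)%N) ->
    \sum_(1 <= k < K.+1) (S k <= t)%R%:R = n%:R :> R.
  move=> nK hn; rewrite (sum_nat_prefix (n := n) (G := fun=> 1))//.
  - by rewrite sumr_const_nat subn1.
  - by move=> k /andP[k1 kn]; rewrite hn ?kn// k1 (leq_trans kn).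
  - by move=> k /andP[nk kK]; rewrite hn ?kK ?(leq_ltn_trans _ nk)// leqNgt nk.
exists K, S; split => //.
- by move=> k /andP[_ kK]; exact/mt/tsfin.
- move=> k /andP[k1 kK]; have /trE[_] : (1 <= k <= K)%N by rewrite k1.
  rewrite mt ?tsfin// lte_fin mulrC -ltr_pdivlMr// => ->; rewrite andbT.
  have := Slt 0%N k k1 kK; rewrite {1}/S; case: sol => -[_ _ -> _] _ _ _ _; exact.
- move=> k /andP[k1 kK]; have := gap k; rewrite k1 (ltnW kK) => /(_ isT).
  rewrite !mt ?tsfin ?(ltnW kK)// lee_fin -mulrBr => h.
  rewrite -(ler_pM2l e20) (le_trans _ h)//.
  by rewrite le_eqVlt; apply/orP; left; apply/eqP; field; rewrite gt_eqF.
- move=> tau /andP[tau0 taut]; rewrite /interface_position.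
  set t := tau / eps ^+ 2.
  have [||n [nK n1 n2 hn]] := cover t.
  + by rewrite divr_ge0// ltW.
  + by rewrite ltr_pM2r// invr_gt0.
  rewrite (cntN t n)//; congr (_ * _); apply: cvg_lim => //.
  apply: cvg_near_cst; exists n.+1 => // m /= nm.
  rewrite big_mkcond/=.
  have uniqn k : ((ts k <= t%:E)%E && (t%:E < ts k.+1)%E) = (k == n).
    have [->|kn] := eqVneq k n; first by rewrite n1 n2.
    apply/negbTE/negP => /andP[k1 k2].
    have tk : (ts k < +oo)%E by rewrite (le_lt_trans k1)// ltry.
    move: kn; rewrite neq_ltn => /orP[kn|nk].
      move: kn; rewrite leq_eqVlt => /predU1P[kn|kn].
        by move: n1; rewrite -kn leNgt k2.
      have := ts_lt sol kn (tsfin _ nK); rewrite ltNge => /negP; apply.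
      by rewrite (le_trans n1)// ltW.
    move: nk; rewrite leq_eqVlt => /predU1P[nk|nk].
      by move: k1; rewrite -nk leNgt n2.
    have := ts_lt sol nk tk; rewrite ltNge => /negP; apply.
    by rewrite (le_trans k1)// ltW.
  under eq_bigr do rewrite uniqn.
  rewrite -big_mkcond/=; have [->|n0] := posnP n.
    rewrite big_nat_cond big1// => k /andP[/andP[k1 _] /eqP k0].
    by rewrite k0.
  by rewrite big_nat1_eq n0 nm.
- move=> t /andP[t0 tT] tS j.
  have [n [nK n1 n2 hn]] := cover t t0 tT.
  have tn := tsfin _ nK.
  have ph : phase_state n.+1%:Z (u t).
    case: sol => -[ph0 _ z _] _ _ _ h5.
    have [t00|tn0] := eqVneq t 0.
      suff -> : n = 0%N by rewrite t00.
      apply/eqP; rewrite -leqn0 leqNgt; apply/negP => n0.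
      have := Slt 0%N n n0 nK; rewrite {1}/S z ltNge/= => /negP; apply.
      by rewrite -t00 hn ?n0// leqnn.
    apply: (h5 n tn); rewrite n2 andbT lt_neqAle n1 andbT.
    apply/eqP => E; case: (posnP n) => [n0|n0].
      by move: E tn0; rewrite n0 z => -[<-]; rewrite eqxx.
    by apply: (tS n); rewrite ?n0// /S E.
  have tn' : S n <= t <= t by rewrite lexx andbT -lee_fin -(tsE sol tn).
  have := representation sol qsol tn (ltW n2) j tn'.
  rewrite -(dPhi_phase _ ph) => E.
  have [hp hm] := phase_stateP ph.
  split.
  + rewrite E; congr (_ - 2 * _); apply/esym/sum_nat_prefix => // k /andP[k1 k2].
      rewrite /zkernel ltNge subr_ge0 hn ?k2// k1; exact: leq_trans nK.
    rewrite /zkernel ltNge subr_ge0 hn ?k2 ?(leq_ltn_trans _ k1)//.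
    by rewrite leqNgt k1.
  + rewrite (dPhi_phase _ ph) /psgn; have [jn|jn] := ltP j n.+1%:Z.
      by have := hp _ jn; lra.
    by have [] := hm _ jn; lra.
  + rewrite (cntN t n)// => nj; rewrite (dPhi_phase _ ph) /psgn.
    have nj' : (n.+1%:Z <= j)%R.
      by move: nj; rewrite -[n%:R]/(n%:Z%:~R) ltr_int; clear; lia.
    rewrite ltNge nj'/=; have [] := hm _ nj'; lra.
- move=> k /andP[k1 kK]; case: k => [//|k] in k1 kK *.
  have tk := tsfin _ kK; have tk' := tsfin _ (ltnW kK).
  have Sk : S k <= S k.+1 <= S k.+1 by rewrite lexx ltW// Slt.
  have := representation sol qsol tk' (_ : ((S k.+1)%:E <= ts k.+1)%E) k.+1%:Z Sk.
  rewrite -(tsE sol tk) lexx => /(_ isT) <-.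
  case: sol => _ _ _ h4 _; have [uk _] := h4 k tk.
  by rewrite /S uk /psgn ltxx opprK add0r.
Qed.

End micro_structure.

(** * Bounds on the fluctuations *)

Section fluctuation_bounds.
Context {R : realType}.
Implicit Types (t s x y : R) (j b : int) (k n m i : nat).

Lemma qroot_sqr x : 0 <= x -> qroot (x ^+ 2) = Num.sqrt x.
Proof. by move=> x0; rewrite /qroot sqrtr_sqr ger0_norm. Qed.

Lemma normN2M x : `|- 2 * x| = 2 * `|x|.
Proof. by rewrite normrM normrN (ger0_norm (ler0n _ 2)). Qed.

(** Geometric mean of hrho^(-2), which bounds the values, and 2 m hrho^(-4), which comes from [m]
    gradients. *)
Lemma diff_hreg_le (c : R) m s j : 0 < c ->
  `|diff m (hreg c s) j| <= Num.sqrt (2 * m%:R) * hwt c s.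
Proof.
move=> c0; have w0 := hwt_ge0 c0 s.
have [s0|s0] := leP s 0.
  by rewrite /diff !hreg_le0// subrr normr0 mulr_ge0// sqrtr_ge0.
have r0 := hrho_gt0 c0 s.
have A : `|diff m (hreg c s) j| <= (hrho c s ^+ 2)^-1.
  have h (i : int) : 0 <= hreg c s i <= (hrho c s ^+ 2)^-1.
    rewrite hreg_ge0//= (le_trans (hreg_le c0 s i))// hwt_gt0E//.
    by rewrite le_eqVlt; apply/orP; left; apply/eqP; field; rewrite gt_eqF.
  by rewrite /diff; have := h (j + m%:Z); have := h j; rewrite ler_norml; lra.
have B : `|diff m (hreg c s) j| <= m%:R * (2 * (hrho c s ^+ 4)^-1).
  rewrite diff_telescope (le_trans (ler_norm_sum _ _ _))//.
  apply: (@le_trans _ _ (\sum_(0 <= i < m) 2 * (hrho c s ^+ 4)^-1)).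
    apply: ler_sum => i _; have := nablap_hreg_le c0 s (j + i%:Z).
    by rewrite s0 (_ : true%:R = 1 :> R)// mulr1.
  by rewrite sumr_const_nat subn0 -[leLHS]mulr_natl.
rewrite -[leLHS]ger0_norm// -sqrtr_sqr -[X in _ * X](ger0_norm w0) -(sqrtr_sqr (hwt c s)).
rewrite -sqrtrM ?mulr_ge0//; apply: ler_wsqrtr.
rewrite expr2 (le_trans (ler_pM (normr_ge0 _) (normr_ge0 _) A B))// hwt_gt0E//.
by rewrite le_eqVlt; apply/orP; left; apply/eqP; field; rewrite gt_eqF.
Qed.

(* Minkowski's inequality; the pairs are treated with AM-GM:
   2 x_k x_l <= (w_l / w_k) x_k^2 + (w_k / w_l) x_l^2. *)
Lemma sum_sqr_sum_le (r : seq nat) n (x : nat -> nat -> R) (w : nat -> R) (B : R) :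
  (forall k, 0 <= w k) ->
  (forall k, \sum_(i < n) x k i ^+ 2 <= B * w k ^+ 2) ->
  \sum_(i < n) (\sum_(k <- r) x k i) ^+ 2 <= B * (\sum_(k <- r) w k) ^+ 2.
Proof.
move=> w0 hx.
have pair k l : \sum_(i < n) x k i * x l i <= B * (w k * w l).
  have z k' : w k' = 0 -> forall i : 'I_n, x k' i = 0.
    move=> wk i; have := hx k'; rewrite wk expr0n mulr0 => h.
    apply/eqP; rewrite -sqrf_eq0 eq_le exprn_even_ge0// andbT (le_trans _ h)//.
    by rewrite (bigD1 i)//= lerDl sumr_ge0// => k'' _; rewrite exprn_even_ge0.
  have [wk|wk] := eqVneq (w k) 0.
    by rewrite wk mul0r mulr0 big1// => i _; rewrite (z k)// mul0r.
  have [wl|wl] := eqVneq (w l) 0.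
    by rewrite wl !mulr0 big1// => i _; rewrite (z l)// mulr0.
  have {}wk : 0 < w k by rewrite lt_neqAle eq_sym wk w0.
  have {}wl : 0 < w l by rewrite lt_neqAle eq_sym wl w0.
  apply: (@le_trans _ _ (\sum_(i < n)
      (w l / w k / 2 * x k i ^+ 2 + w k / w l / 2 * x l i ^+ 2))).
    apply: ler_sum => i _; rewrite -subr_ge0.
    rewrite (_ : _ - _ = (w l * x k i - w k * x l i) ^+ 2 / (2 * w k * w l)).
      by rewrite divr_ge0 ?exprn_even_ge0// !mulr_ge0// ltW.
    by field; rewrite !gt_eqF.
  rewrite big_split/= -!mulr_sumr.
  have h1 := ler_wpM2l (_ : 0 <= w l / w k / 2) (hx k).
  have h2 := ler_wpM2l (_ : 0 <= w k / w l / 2) (hx l).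
  apply: (le_trans (lerD (h1 _) (h2 _))); rewrite ?divr_ge0 ?(ltW wk) ?(ltW wl)//.
  by rewrite le_eqVlt; apply/orP; left; apply/eqP; field; rewrite !gt_eqF.
have -> : \sum_(i < n) (\sum_(k <- r) x k i) ^+ 2 =
    \sum_(k <- r) \sum_(l <- r) \sum_(i < n) x k i * x l i.
  transitivity (\sum_(i < n) \sum_(k <- r) \sum_(l <- r) x k i * x l i).
    by apply: eq_bigr => i _; rewrite expr2 big_distrlr.
  by rewrite exchange_big/=; apply: eq_bigr => k _; rewrite exchange_big.
rewrite expr2 big_distrlr/= mulr_sumr; apply: ler_sum => k _.
by rewrite mulr_sumr; apply: ler_sum => l _.
Qed.

Section fixed_eps.
Variables (tfin d eps : R) (K : nat) (S : nat -> R).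
Hypotheses (tfin_gt0 : 0 < tfin) (d_gt0 : 0 < d) (eps_gt0 : 0 < eps) (eps_le1 : eps <= 1).
Hypothesis S_gt0 : forall k, (1 <= k <= K)%N -> 0 < S k.
Hypothesis S_gap : forall k, (1 <= k < K)%N -> 2 * (d / eps) <= S k.+1 - S k.

Let c := d / eps.
Let c_gt0 : 0 < c. Proof. exact: divr_gt0. Qed.
Let T := tfin / eps ^+ 2.

(* R_1 in microscopic variables. *)
Definition fluct t j : R := - 2 * \sum_(1 <= k < K.+1) hreg c (t - S k) (j - k%:Z).

Definition wconst : R := 2 * qroot tfin / d + (qroot d ^+ 3)^-1.

Let wsum t := \sum_(1 <= k < K.+1) hwt c (t - S k).

Lemma wconst_ge0 : 0 <= wconst.
Proof.
by rewrite addr_ge0 ?divr_ge0 ?mulr_ge0 ?invr_ge0 ?exprn_ge0 ?qroot_ge0// ltW.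
Qed.

Lemma wsum_ge0 t : 0 <= wsum t.
Proof. by apply: sumr_ge0 => k _; exact: hwt_ge0. Qed.

Lemma qroot_div_sqr x : 0 <= x -> qroot (x / eps ^+ 2) = qroot x / Num.sqrt eps.
Proof.
move=> x0; rewrite qrootM// -exprVn qroot_sqr ?invr_ge0 ?(ltW eps_gt0)//.
by rewrite sqrtrV// ltW.
Qed.

(** With c = d / eps and T = tfin / eps^2, the term (2 / c) T^(1/4) equals 2 tfin^(1/4) / d times
    eps^(1/2). The term c^(-3/4) is d^(-3/4) eps^(3/4), and eps^(3/4) <= eps^(1/2) as eps <= 1. The
    two coefficients make up [wconst]. *)
Lemma wsum_le t : t <= T -> wsum t <= wconst * Num.sqrt eps.
Proof.
move=> tT; have se0 : 0 < Num.sqrt eps by rewrite sqrtr_gt0.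
have := @sum_hwt_le _ c c_gt0 t T S K S_gap.
move=> /(_ _)/le_trans; apply.
  by move=> K1; have := S_gt0 (k := 1%N); rewrite K1 => /(_ isT); lra.
rewrite /wconst [leRHS]mulrDl; apply: lerD.
  rewrite /T qroot_div_sqr ?(ltW tfin_gt0)// le_eqVlt; apply/orP; left; apply/eqP.
  have e : eps = Num.sqrt eps ^+ 2 by rewrite sqr_sqrtr// ltW.
  rewrite /c [X in d / X]e; field.
  by rewrite !gt_eqF.
rewrite /c qrootM ?(ltW d_gt0)// exprMn invfM ler_wpM2l ?invr_ge0 ?exprn_ge0 ?qroot_ge0//.
have -> : qroot eps^-1 = (qroot eps)^-1.
  by rewrite /qroot !sqrtrV ?sqrtr_ge0 ?(ltW eps_gt0).
rewrite exprVn invrK exprS -qroot_exp2 ler_piMl ?exprn_ge0 ?qroot_ge0//.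
by apply: qroot_le; rewrite ?expr1n.
Qed.

(** A summand is at most [hrho] times its weight, and [hrho] is at most (tfin + d)^(1/4) eps^(-1/2);
    this power of eps is regained from the sum of the weights. *)
Lemma fluct_bounded t j : t <= T ->
  `|fluct t j| <= 2 * qroot (tfin + d) * wconst.
Proof.
move=> tT; rewrite /fluct normN2M -mulrA ler_pM2l//.
have se0 : 0 < Num.sqrt eps by rewrite sqrtr_gt0.
have c0 := c_gt0.
rewrite (le_trans (ler_norm_sum _ _ _))//.
apply: (@le_trans _ _ (qroot (tfin + d) / Num.sqrt eps * wsum t)); last first.
  rewrite -mulrA ler_wpM2l ?qroot_ge0// mulrC ler_pdivrMr//.
  exact: wsum_le.
rewrite mulr_sumr [leLHS]big_nat_cond [leRHS]big_nat_cond.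
apply: ler_sum => k; rewrite andbT ltnS => kK.
rewrite ger0_norm ?hreg_ge0// (le_trans (hreg_le _ _ _))//.
rewrite ler_wpM2r ?hwt_ge0// -qroot_div_sqr ?addr_ge0 ?(ltW tfin_gt0) ?(ltW d_gt0)//.
have h1 : d / eps <= d / eps ^+ 2.
  rewrite ler_pM2l// lef_pV2 ?posrE ?exprn_gt0// expr2.
  by rewrite ler_piMl// ltW.
have h2 : 0 <= d / eps ^+ 2 by rewrite divr_ge0 ?exprn_ge0// ltW.
have h3 : 0 <= T by rewrite divr_ge0 ?exprn_ge0// ltW.
have := S_gt0 kK => h4.
apply: ler_qroot; rewrite mulrDl -/T ge_max; apply/andP; split; rewrite /c; lra.
Qed.

Lemma fluct_l1 t : l1_le (fluct t) (2 * K%:R).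
Proof.
have := l1_leZ (- 2) (l1_le_sum 0 (index_iota 1 K.+1)
  (fun k => l1_le_shift (- k%:Z) (hreg_l1 c_gt0 (t - S k)))).
by rewrite sumr_const_nat subn1 normrN ger0_norm.
Qed.

Lemma diff_fluct m t j :
  diff m (fluct t) j = - 2 * \sum_(1 <= k < K.+1) diff m (hreg c (t - S k)) (j - k%:Z).
Proof.
rewrite /diff /fluct -mulrBr -sumrB; congr (_ * _); apply: eq_bigr => k _.
by rewrite addrAC.
Qed.

Lemma fluct_holder_space m t j : t <= T ->
  `|diff m (fluct t) j| <= 2 * wconst * Num.sqrt (2 * (m%:R * eps)).
Proof.
move=> tT; rewrite diff_fluct normN2M -mulrA ler_pM2l//.
rewrite (le_trans (ler_norm_sum _ _ _))//.
apply: (@le_trans _ _ (Num.sqrt (2 * m%:R) * wsum t)).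
  rewrite mulr_sumr; apply: ler_sum => k _; exact: diff_hreg_le.
rewrite [2 * (m%:R * eps)]mulrA [Num.sqrt (2 * m%:R * eps)]sqrtrM ?mulr_ge0// mulrCA ler_wpM2l ?sqrtr_ge0//.
exact: wsum_le.
Qed.

Lemma fluct_holder_time s t j : s <= t -> t <= T ->
  `|fluct t j - fluct s j| <= 24 * wconst * Num.sqrt eps * qroot (t - s).
Proof.
move=> st tT; rewrite /fluct -mulrBr -sumrB normN2M.
apply: (@le_trans _ _ (2 * (6 * qroot (t - s) * (wsum s + wsum t)))).
  rewrite ler_pM2l// (le_trans (ler_norm_sum _ _ _))// -big_split/= mulr_sumr.
  apply: ler_sum => k _.
  have -> : t - s = (t - S k) - (s - S k) by ring.
  by apply: hreg_holder => //; rewrite lerD2r.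
have := wsum_le tT; have := wsum_le (le_trans st tT) => h1 h2.
have := ler_wpM2l (qroot_ge0 (t - s)) (lerD h1 h2).
lra.
Qed.

Lemma fluct_l2 t b n : t <= T ->
  \sum_(i < n) nablap (fluct t) (b + (i : nat)%:Z) ^+ 2 <= 8 * wconst ^+ 2 * eps.
Proof.
move=> tT.
have -> : \sum_(i < n) nablap (fluct t) (b + (i : nat)%:Z) ^+ 2 =
   4 * \sum_(i < n) (\sum_(k <- index_iota 1 K.+1)
     nablap (hreg c (t - S k)) (b + (i : nat)%:Z - k%:Z)) ^+ 2.
  rewrite mulr_sumr; apply: eq_bigr => i _.
  have -> : nablap (fluct t) (b + (i : nat)%:Z) = diff 1 (fluct t) (b + (i : nat)%:Z) by [].
  by rewrite diff_fluct exprMn sqrrN -natrX.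
have := @sum_sqr_sum_le (index_iota 1 K.+1) n
  (fun k i => nablap (hreg c (t - S k)) (b + i%:Z - k%:Z))
  (fun k => hwt c (t - S k)) 2.
move=> /(_ (fun k => hwt_ge0 c_gt0 _)) h.
have {}h := h (fun k => _).
apply: (@le_trans _ _ (4 * (2 * wsum t ^+ 2))).
  rewrite ler_pM2l//; apply: h => k.
  under eq_bigr do rewrite addrAC.
  exact: nablap_hreg_l2.
have w := wsum_le tT; have w0 := wsum_ge0 t.
have -> : 8 * wconst ^+ 2 * eps = 4 * (2 * (wconst * Num.sqrt eps) ^+ 2).
  by rewrite exprMn sqr_sqrtr ?(ltW eps_gt0)//; ring.
by do 2 rewrite ler_pM2l//; rewrite lerXn2r ?nnegrE// (le_trans w0).
Qed.

Lemma diff_fluct_l2 m t b n : t <= T ->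
  \sum_(i < n) diff m (fluct t) (b + (i : nat)%:Z) ^+ 2 <=
  8 * wconst ^+ 2 * eps * m%:R ^+ 2.
Proof.
move=> tT.
have := @sum_sqr_sum_le (index_iota 0 m) n
  (fun k i => nablap (fluct t) (b + i%:Z + k%:Z)) (fun=> 1) (8 * wconst ^+ 2 * eps).
rewrite sumr_const_nat subn0 expr1n mulr1 => /(_ (fun=> ler01)) h.
under eq_bigr do rewrite diff_telescope.
by apply: h => k; under eq_bigr do rewrite addrAC; exact: fluct_l2.
Qed.

Lemma diff2_fluct_l1 m t : t <= T ->
  l1_le (diff m (diff m (fluct t))) (4 * wconst * Num.sqrt m%:R ^+ 3 * Num.sqrt eps).
Proof.
move=> tT.
have := l1_leZ (- 2) (l1_le_sum 0 (index_iota 1 K.+1)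
  (fun k => l1_le_shift (- k%:Z) (diff2_hreg_l1 c_gt0 (t - S k) m))).
rewrite normrN ger0_norm// -mulr_sumr.
rewrite (_ : (fun j => _) = diff m (diff m (fluct t))); last first.
  apply/funext => j.
  transitivity (diff m (fluct t) (j + m%:Z) - diff m (fluct t) j); last by [].
  rewrite !diff_fluct -mulrBr -sumrB.
  by congr (_ * _); apply: eq_bigr => k _; rewrite (addrAC j m%:Z).
apply: l1_leW.
have := ler_wpM2l (_ : 0 <= 4 * Num.sqrt m%:R ^+ 3) (wsum_le tT).
by rewrite mulr_ge0 ?exprn_ge0 ?sqrtr_ge0// => /(_ isT); rewrite /wsum; lra.
Qed.

End fixed_eps.
End fluctuation_bounds.

(** * Moduli of continuity of q *)

Section smooth_part_bounds.
Context {R : realType}.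
Implicit Types (t s x y A : R) (j b : int) (k n m i : nat) (q : R -> int -> R).

Lemma heat_lipschitz_space q A (b0 : R) : heat_sol 0 b0 q ->
  (forall j, `|nablap (q 0) j| <= A) ->
  forall m t j, 0 <= t <= b0 -> `|diff m (q t) j| <= m%:R * A.
Proof.
move=> hq qA m t j tb; rewrite diff_telescope (le_trans (ler_norm_sum _ _ _))//.
apply: (@le_trans _ _ (\sum_(0 <= i < m) A)).
  by apply: ler_sum => i _; apply: (heat_sol_norm_le (heat_sol_nablap hq) qA).
by rewrite sumr_const_nat subn0 -[leLHS]mulr_natl.
Qed.

Lemma heat_lapl_le q A (b0 : R) : heat_sol 0 b0 q ->
  (forall j, `|nablap (q 0) j| <= A) ->
  forall t j, 0 < t <= b0 -> `|lapl (q t) j| <= A / Num.sqrt t.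
Proof.
move=> hq qA t j tb; rewrite lapl_iter_nablap.
by have := heat_grad_le (heat_sol_nablap hq) qA (j - 1) tb; rewrite subr0.
Qed.

(** The Laplacian of q is at most A / sqrt(t), the derivative of 2 A sqrt(t). So both q - 2 A
    sqrt(t) and -q - 2 A sqrt(t) are nonincreasing, even from time 0 on, where the rate is singular
    but integrable. *)
Lemma heat_holder_time q A (b0 : R) : heat_sol 0 b0 q ->
  (forall j, `|nablap (q 0) j| <= A) ->
  forall s t j, 0 <= s -> s <= t -> t <= b0 ->
    `|q t j - q s j| <= 2 * A * Num.sqrt (t - s).
Proof.
move=> hq qA s t j s0 st tb.
have A0 : 0 <= A by rewrite (le_trans _ (qA 0)).
have csqrt : continuous (@Num.sqrt R) by exact: sqrt_continuous.
have [_ cq dq] := hq.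
have cqst : {within `[s, t], continuous (q ^~ j)}.
  apply: continuous_subspaceW (cq j) => x /=; rewrite !in_itv/= => /andP[sx xt].
  by rewrite (le_trans s0)// (le_trans xt).
have aux (sg : R) : (sg = 1) \/ (sg = -1) ->
    sg * (q t j - q s j) <= 2 * A * (Num.sqrt t - Num.sqrt s).
  move=> hsg; pose f x := sg * q x j + - (2 * A) * Num.sqrt x.
  have df x : s < x < t -> is_derive x 1 f
      (sg * lapl (q x) j + - (2 * A) * (2 * Num.sqrt x)^-1).
    move=> /andP[sx xt].
    have h1 := dq x j; rewrite (le_lt_trans s0 sx) (lt_le_trans xt tb) in h1.
    have {}h1 := h1 isT.
    have h2 := is_derive1_sqrt (le_lt_trans s0 sx).
    exact: is_deriveD (is_deriveZ sg h1) (is_deriveZ (- (2 * A)) h2).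
  have cf : {within `[s, t], continuous f}.
    apply: within_continuousD; apply: within_continuousM;
      try exact: within_continuous_cst; first exact: cqst.
    exact: continuous_within.
  have : f t <= f s.
    apply: (@ler0_derive1_le_cc _ f s t) => //; rewrite ?in_itv/= ?lexx ?st//.
    - by move=> x; rewrite in_itv/= => /df[].
    - move=> x; rewrite in_itv/= => sxt; have h := df x sxt.
      rewrite derive1E derive_val.
      have /andP[sx xt] := sxt.
      have x0 := le_lt_trans s0 sx.
      have := heat_lapl_le hq qA j (_ : 0 < x <= b0).
      rewrite x0 (le_trans (ltW xt) tb) => /(_ isT) hl.
      have -> : - (2 * A) * (2 * Num.sqrt x)^-1 = - (A / Num.sqrt x).
        by field; rewrite gt_eqF// sqrtr_gt0.
      have : sg * lapl (q x) j <= A / Num.sqrt x.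
        rewrite (le_trans (ler_norm _))// normrM.
        by case: hsg => ->; rewrite ?normrN normr1 mul1r.
      lra.
  rewrite /f; lra.
have key : `|q t j - q s j| <= 2 * A * (Num.sqrt t - Num.sqrt s).
  by rewrite ler_norml; have := aux 1 (or_introl erefl);
     have := aux (-1) (or_intror erefl); lra.
rewrite (le_trans key)// ler_wpM2l ?mulr_ge0//.
rewrite lerBlDr -[leLHS]ger0_norm ?sqrtr_ge0// -[leRHS]ger0_norm ?addr_ge0 ?sqrtr_ge0//.
rewrite -!sqrtr_sqr ler_wsqrtr// sqrrD !sqr_sqrtr ?subr_ge0// ?(le_trans s0 st)//.
rewrite addrAC subrK lerDl mulrn_wge0// mulr_ge0 ?sqrtr_ge0//.
Qed.

End smooth_part_bounds.

(** * Uniform limits *)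

Section uniform_limit.
Context {R : realType} {T : Type}.
Implicit Types (D G : set T) (om : T -> T -> R).

(* Functions with a common modulus of continuity up to an error converging to 0
   converge everywhere uniformly as soon as they do so on a dense set. *)
Lemma uniform_limit_modulus D G om (f : nat -> T -> R) (f0 : T -> R)
    (kappa eta : nat -> R) :
  kappa n @[n --> \oo] --> (0 : R) -> eta n @[n --> \oo] --> (0 : R) ->
  (forall n z w, D z -> D w -> `|f n z - f n w| <= om z w + kappa n) ->
  (forall n w, D w -> G w -> `|f n w - f0 w| <= eta n) ->
  (forall z, D z -> forall e : R, 0 < e -> exists w, [/\ D w, G w & om z w < e]) ->
  exists g : T -> R, [/\ forall n z, D z -> `|f n z - g z| <= eta n + kappa n,
    forall z w, D z -> D w -> `|g z - g w| <= om z w &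
    forall w, D w -> G w -> g w = f0 w].
Proof.
move=> ck ce hf hG dG.
pose er n := eta n + kappa n.
have cer : er n @[n --> \oo] --> (0 : R).
  by rewrite -[X in _ --> X]addr0; exact: cvgD.
have cau n m z : D z -> `|f n z - f m z| <= er n + er m.
  move=> Dz; apply/ler_addgt0Pl => e e0.
  have [|w [Dw Gw wz]] := dG z Dz (e / 2); first by rewrite divr_gt0.
  have -> : f n z - f m z = (f n z - f n w) + (f n w - f0 w) - (f m w - f0 w)
     - (f m z - f m w) by ring.
  rewrite (le_trans (ler_normB _ _))//.
  have h1 := hf n z w Dz Dw; have h2 := hf m z w Dz Dw.
  have h3 := hG n w Dw Gw; have h4 := hG m w Dw Gw.
  have h5 := ler_normB (f n z - f n w + (f n w - f0 w)) (f m w - f0 w).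
  have h6 := ler_normD (f n z - f n w) (f n w - f0 w).
  rewrite /er; lra.
have cvf z : D z -> cvg (f n z @[n --> \oo]).
  move=> Dz; apply/cauchy_cvgP/cauchy_exP => e e0.
  have e2 : 0 < e / 2 by rewrite divr_gt0.
  have /cvgr0Pnorm_lt /(_ _ e2) [N _ hN] := cer.
  exists (f N z); exists N => // n /= Nn.
  rewrite /ball/= (le_lt_trans (cau _ _ _ Dz))//.
  have := ltr_normlW (hN _ Nn); have := ltr_normlW (hN _ (leqnn N)); lra.
pose g z := limn (fun n => f n z).
have hg z : D z -> f n z @[n --> \oo] --> g z by move=> /cvf.
have fg n z : D z -> `|f n z - g z| <= er n.
  move=> Dz.
  have h1 : `|f n z - f m z| @[m --> \oo] --> `|f n z - g z|.
    by apply: cvg_norm; apply: cvgB; [exact: cvg_cst|exact: hg].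
  have h2 : er n + er m @[m --> \oo] --> er n + 0.
    by apply: cvgD => //; exact: cvg_cst.
  rewrite -[leRHS]addr0; apply: ler_cvg_to h1 h2 _.
  by apply: nearW => m; exact: cau.
exists g; split => //.
- move=> z w Dz Dw.
  have h1 : `|f n z - f n w| @[n --> \oo] --> `|g z - g w|.
    by apply: cvg_norm; apply: cvgB; exact: hg.
  have h2 : om z w + kappa n @[n --> \oo] --> om z w + 0.
    by apply: cvgD => //; exact: cvg_cst.
  rewrite -[leRHS]addr0; apply: ler_cvg_to h1 h2 _.
  by apply: nearW => n; exact: hf.
- move=> w Dw Gw; apply/eqP; rewrite -subr_eq0 -normr_le0.
  have h1 : `|g w - f n w| + `|f n w - f0 w| @[n --> \oo] --> `|g w - f0 w|.
    have -> : `|g w - f0 w| = `|g w - g w| + `|g w - f0 w|.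
      by rewrite subrr normr0 add0r.
    apply: cvgD; apply: cvg_norm; apply: cvgB;
      by [exact: hg|exact: cvg_cst].
  have h2 : er n + eta n @[n --> \oo] --> (0 + 0 : R) by apply: cvgD.
  rewrite -[leRHS]addr0; apply: ler_cvg_to h1 h2 _.
  by apply: nearW => n; rewrite distrC lerD ?fg ?hG.
Qed.

End uniform_limit.

(** * Almost everywhere statements and essential suprema *)

Section ae_density.
Context {R : realType}.
Implicit Types (a b t x e : R) (P : R -> Prop).

Lemma lebesgue_setT_gt0 : (0 < (lebesgue_measure : set R -> \bar R) setT)%E.
Proof.
apply: (@lt_le_trans _ _ (lebesgue_measure (`[0, 1] : set R))).
  by rewrite lebesgue_measure_itv/= lte_fin ltr01 oppr0 adde0 lte_fin.
by apply: le_measure => //; rewrite inE//; exact: measurable_itv.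
Qed.

Lemma ae_itv_dense (P : R -> Prop) a b : a < b ->
  {ae lebesgue_measure, forall x, P x} -> exists2 x, a < x < b & P x.
Proof.
move=> ab [N [mN N0 PN]]; apply: contrapT => h.
have sub : `]a, b[%classic `<=` N.
  move=> x /=; rewrite in_itv/= => xab; apply: PN => Px; apply: h; by exists x.
have : (lebesgue_measure (`]a, b[%classic : set R) <= lebesgue_measure N)%E.
  by apply: le_measure => //; rewrite inE//; exact: measurable_itv.
rewrite N0 lebesgue_measure_itv/= lte_fin ab -EFinB lee_fin subr_le0.
by rewrite leNgt ab.
Qed.

Lemma lebesgue_measure_oo a b : a < b ->
  lebesgue_measure (`]a, b[%classic : set R) = (b - a)%:E.
Proof. by move=> ab; rewrite lebesgue_measure_itv/= lte_fin ab EFinB. Qed.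

Lemma box_measure a b t x : a < b -> t < x ->
  ((lebesgue_measure \x lebesgue_measure)%E (`]a, b[%classic `*` `]t, x[%classic : set (R * R)))
   = ((b - a) * (x - t))%:E.
Proof.
move=> ab tx; rewrite product_measure1E; [|exact: measurable_itv..].
by rewrite EFinM; congr (_ * _)%E; exact: lebesgue_measure_oo.
Qed.

Lemma ae_box_dense (P : R * R -> Prop) a b t x : a < b -> t < x ->
  {ae (lebesgue_measure \x lebesgue_measure)%E, forall z, P z} ->
  exists z, [/\ a < z.1 < b, t < z.2 < x & P z].
Proof.
move=> ab tx [N [mN N0 PN]]; apply: contrapT => h.
have sub : `]a, b[%classic `*` `]t, x[%classic `<=` N.
  move=> z /= []; rewrite !in_itv/= => z1 z2; apply: PN => Pz; apply: h; by exists z.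
have : ((lebesgue_measure \x lebesgue_measure)%E (`]a, b[%classic `*` `]t, x[%classic : set (R * R))
   <= (lebesgue_measure \x lebesgue_measure)%E N)%E.
  apply: le_measure => //; rewrite inE//; apply: measurableX; exact: measurable_itv.
rewrite N0 box_measure// lee_fin leNgt mulr_gt0// ?subr_gt0//.
Qed.

Lemma lebesgue2_setT_gt0 :
  (0 < (lebesgue_measure \x lebesgue_measure : set (R * R) -> \bar R)%E setT)%E.
Proof.
apply: (@lt_le_trans _ _ ((lebesgue_measure \x lebesgue_measure)%E
   (`]0, 1[%classic `*` `]0, 1[%classic : set (R * R)))).
  by rewrite box_measure// subr0 mulr1 lte_fin.
apply: le_measure => //; rewrite inE//; apply: measurableX; exact: measurable_itv.
Qed.

End ae_density.

Section Linfty_limits.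
Context {R : realType} d (T : measurableType d) (mu : {measure set T -> \bar R}).
Hypothesis mu_gt0 : (0 < mu setT)%E.

Lemma LnormyE (f : T -> \bar R) : ('N[mu]_+oo [f] = ess_sup mu (abse \o f))%E.
Proof. by rewrite unlock /Lnorm mu_gt0. Qed.

(** The norms of the differences need to be finite only from some index [N] on; before it [fine]
    would hide an infinite value. *)
Lemma cvg_Linfty_ae (D : set T) (fn : nat -> T -> R) f : cvg_Linfty mu D fn f ->
  exists N (eta : nat -> R), [/\ eta n @[n --> \oo] --> (0 : R) &
    forall n, (N <= n)%N ->
      {ae mu, forall x, D x -> `|fn n x - f x| <= eta n}].
Proof.
move=> [_ /fine_cvgP [[N _ hN] cN]].
pose nrm n := ('N[mu]_+oo [EFin \o ((fun x => (fn n x - f x)%R) \_ D)])%E.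
exists N, (fun n => fine (nrm n)); split => // n Nn.
have fin : nrm n \is a fin_num by exact: hN.
have := ess_sup_ge mu (abse \o (EFin \o ((fun x => (fn n x - f x)%R) \_ D))).
rewrite -LnormyE -/(nrm n) -(fineK fin); apply: filterS => x /= h Dx.
by move: h; rewrite patchE mem_set// lee_fin.
Qed.

Lemma Lnormy_le (f : T -> R) (M : R) : (forall x, `|f x| <= M) ->
  ('N[mu]_+oo [EFin \o f] <= M%:E)%E.
Proof.
by move=> fM; rewrite LnormyE; apply/ess_supP; apply: nearW => x /=; rewrite lee_fin.
Qed.

Lemma ae_forall_nat (P : nat -> T -> Prop) : (forall n, {ae mu, forall x, P n x}) ->
  {ae mu, forall x, forall n, P n x}.
Proof.
move=> h; have : mu.-negligible (\bigcup_n [set x | ~ P n x]).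
  by apply: negligible_bigcup => n; have := h n.
apply: negligibleS => x /= /existsNP [n nP]; by exists n.
Qed.

End Linfty_limits.

(** * Rounding to the lattice *)

Section rounding.
Context {R : realType}.
Implicit Types (x y eps : R).

(* The index of the lattice cell containing x, as in [macro]. *)
Definition rnd eps x : int := Num.floor (x / eps + 2^-1).

Lemma rnd_itv eps x : 0 < eps ->
  eps * ((rnd eps x)%:~R - 2^-1) <= x < eps * ((rnd eps x)%:~R + 2^-1).
Proof.
move=> e0; have /andP[h1 h2] := floor_itv (x / eps + 2^-1).
have E : x = eps * (x / eps) by rewrite mulrC divfK// gt_eqF.
by rewrite [X in _ <= X < _]E [X in _ && X]ltr_pM2l// ler_pM2l//; rewrite /rnd; rewrite rmorphD/= in h2; lra.
Qed.

Lemma le_rnd eps x y : 0 < eps -> x <= y -> rnd eps x <= rnd eps y.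
Proof. by move=> e0 xy; apply: le_floor; rewrite lerD2r ler_pM2r// invr_gt0. Qed.

Lemma rnd_diff eps x y : 0 < eps -> x <= y ->
  exists2 m : nat, rnd eps y = rnd eps x + m%:Z & m%:R * eps <= y - x + eps.
Proof.
move=> e0 xy; have := le_rnd e0 xy.
case E : (rnd eps y - rnd eps x) => [m|m]; last by move=> h; exfalso; lia.
move=> _; exists m; first by lia.
have := rnd_itv x e0; have := rnd_itv y e0.
have -> : rnd eps y = rnd eps x + m%:Z by lia.
by rewrite rmorphD/=; have -> : (m%:Z)%:~R = m%:R :> R by []; lra.
Qed.

Lemma rnd_nat eps (j : int) : 0 < eps -> rnd eps (eps * j%:~R) = j.
Proof.
move=> e0; have := rnd_itv (eps * j%:~R) e0; rewrite ler_pM2l// ltr_pM2l// => h.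
have h1 : (rnd eps (eps * j%:~R))%:~R < (j + 1)%:~R :> R by rewrite rmorphD/=; lra.
have h2 : (j)%:~R < (rnd eps (eps * j%:~R) + 1)%:~R :> R by rewrite rmorphD/=; lra.
rewrite !ltr_int in h1 h2; lia.
Qed.

Lemma rndB eps x (k : nat) : 0 < eps -> rnd eps (x - eps * k%:R) = rnd eps x - k%:Z.
Proof.
move=> e0; rewrite /rnd mulrBl [eps * _]mulrC mulfK ?gt_eqF//.
have -> : x / eps - k%:R + 2^-1 = x / eps + 2^-1 + (- k%:Z)%:~R by rewrite rmorphN/=; ring.
by rewrite floorDrz// intrKfloor.
Qed.

End rounding.

(** * Moduli of continuity in macroscopic variables *)

Section macro_bounds.
Context {R : realType}.
Implicit Types (x y eps d : R) (z w : R * R).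

Lemma regularized_kernelE d eps tau x (s : R) (k : nat) : 0 < d -> 0 < eps ->
  regularized_kernel d eps (tau - eps ^+ 2 * s, x - eps * k%:R) =
  hreg (d / eps) (tau / eps ^+ 2 - s) (rnd eps x - k%:Z).
Proof.
move=> d0 e0; have e20 : 0 < eps ^+ 2 by rewrite exprn_gt0.
have E : tau - eps ^+ 2 * s = eps ^+ 2 * (tau / eps ^+ 2 - s).
  by field; rewrite gt_eqF.
rewrite /regularized_kernel/= E /macro/= -/(rnd _ _) rndB//.
set t := tau / eps ^+ 2 - s.
rewrite pmulr_rle0// /hreg /hlam; case: (leP t 0) => [|t0]; first by rewrite mul0r.
have c0 : 0 < d / eps by exact: divr_gt0.
have -> : (eps ^+ 2 * t <= d * eps) = (t <= d / eps).
  have -> : eps ^+ 2 * t = t * eps * eps by ring.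
  by rewrite ler_pM2r// ler_pdivlMr.
have -> : d * eps / eps ^+ 2 = d / eps by field; rewrite gt_eqF.
case: (leP t (d / eps)) => tc.
  by congr (_ * _); field; rewrite !gt_eqF.
by rewrite [_ * t / _]mulrAC divff ?gt_eqF// !mul1r.
Qed.

Lemma regular_fluctuationE tfin d eps ts p q K S z : 0 < d -> 0 < eps ->
  micro_data tfin d eps ts p q K S ->
  regular_fluctuation tfin d eps ts z =
  fluct d eps K S (z.1 / eps ^+ 2) (rnd eps z.2).
Proof.
move=> d0 e0 md; rewrite /regular_fluctuation (md_count md) /fluct; congr (_ * _).
apply: eq_big_nat => k; rewrite ltnS => kK.
by rewrite (md_time md kK)/= regularized_kernelE.
Qed.

Lemma sqrtrD_le x y : 0 <= x -> 0 <= y -> Num.sqrt (x + y) <= Num.sqrt x + Num.sqrt y.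
Proof.
move=> x0 y0; rewrite -[leRHS]ger0_norm ?addr_ge0 ?sqrtr_ge0// -sqrtr_sqr ler_wsqrtr//.
by rewrite sqrrD !sqr_sqrtr// addrAC lerDl mulrn_wge0// mulr_ge0 ?sqrtr_ge0.
Qed.

(** The time is changed at a fixed site and the site at a fixed time. Points at distance r lie in
    cells whose indices differ by at most r / eps + 1, hence the additional eps in the space
    modulus. *)
Lemma macro_modulus eps (v : R -> int -> R) (D : set R) (A B : R -> R) :
  0 < eps -> {homo B : x y / x <= y} ->
  (forall s t j, D s -> D t -> s <= t -> `|v (t / eps ^+ 2) j - v (s / eps ^+ 2) j| <= A (t - s)) ->
  (forall t j (m : nat), D t -> `|diff m (v (t / eps ^+ 2)) j| <= B (m%:R * eps)) ->
  forall z w, D z.1 -> D w.1 ->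
  `|v (z.1 / eps ^+ 2) (rnd eps z.2) - v (w.1 / eps ^+ 2) (rnd eps w.2)| <=
  A `|z.1 - w.1| + B (`|z.2 - w.2| + eps).
Proof.
move=> e0 Bm hA hB z w Dz Dw.
have tm j : `|v (z.1 / eps ^+ 2) j - v (w.1 / eps ^+ 2) j| <= A `|z.1 - w.1|.
  have [zw|wz] := leP z.1 w.1.
    by rewrite distrC (ler0_norm (_ : z.1 - w.1 <= 0)) ?subr_le0// opprB hA.
  by rewrite (ger0_norm (_ : 0 <= z.1 - w.1)) ?subr_ge0 ?hA// ltW.
have sp : `|v (w.1 / eps ^+ 2) (rnd eps z.2) - v (w.1 / eps ^+ 2) (rnd eps w.2)| <=
   B (`|z.2 - w.2| + eps).
  have [zw|wz] := leP z.2 w.2.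
    have [m -> hm] := rnd_diff e0 zw.
    rewrite distrC (le_trans (hB w.1 _ m Dw))// Bm// (le_trans hm)// lerD2r.
    by rewrite distrC ler_norm.
  have [m -> hm] := rnd_diff e0 (ltW wz).
  by rewrite (le_trans (hB w.1 _ m Dw))// Bm// (le_trans hm)// lerD2r ler_norm.
rewrite -[X in `|X|](subrKA (v (w.1 / eps ^+ 2) (rnd eps z.2))).
by rewrite (le_trans (ler_normD _ _))// lerD.
Qed.

Lemma macro_heat_modulus eps al q : 0 < eps -> 0 <= al ->
  (forall b, heat_sol 0 b q) -> (forall j, `|nablap (q 0) j| <= al * eps) ->
  forall z w, 0 <= z.1 -> 0 <= w.1 ->
  `|macro eps q z - macro eps q w| <=
  2 * al * Num.sqrt `|z.1 - w.1| + al * (`|z.2 - w.2| + eps).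
Proof.
move=> e0 al0 hq qA z w z0 w0.
apply: (@macro_modulus eps q [set t | 0 <= t] (fun x => 2 * al * Num.sqrt x) (fun x => al * x)) => //.
- by move=> x y xy; exact: ler_wpM2l.
- move=> s t j /= s0 t0 st.
  have st' : s / eps ^+ 2 <= t / eps ^+ 2 by rewrite ler_pM2r ?invr_gt0 ?exprn_gt0.
  rewrite (le_trans (heat_holder_time (hq (t / eps ^+ 2)) qA j _ st' (lexx _)))//.
    by rewrite divr_ge0 ?exprn_ge0// ltW.
  rewrite -mulrBl sqrtrM ?subr_ge0// sqrtrV ?exprn_ge0 ?(ltW e0)// sqrtr_sqr.
  rewrite ger0_norm ?(ltW e0)// le_eqVlt; apply/orP; left; apply/eqP; field.
  by rewrite gt_eqF.
- move=> t j m /= t0.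
  have t0' : 0 <= t / eps ^+ 2 by rewrite divr_ge0 ?exprn_ge0// ltW.
  have := heat_lipschitz_space (hq (t / eps ^+ 2)) qA m j (_ : 0 <= t / eps ^+ 2 <= _).
  by rewrite t0' lexx => /(_ isT); rewrite mulrCA.
Qed.

Lemma macro_fluct_modulus tfin d eps K S : 0 < tfin -> 0 < d -> 0 < eps -> eps <= 1 ->
  (forall k, (1 <= k <= K)%N -> 0 < S k) ->
  (forall k, (1 <= k < K)%N -> 2 * (d / eps) <= S k.+1 - S k) ->
  forall z w, z.1 <= tfin -> w.1 <= tfin ->
  `|fluct d eps K S (z.1 / eps ^+ 2) (rnd eps z.2) -
    fluct d eps K S (w.1 / eps ^+ 2) (rnd eps w.2)| <=
  24 * wconst tfin d * qroot `|z.1 - w.1| +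
  2 * wconst tfin d * Num.sqrt (2 * (`|z.2 - w.2| + eps)).
Proof.
move=> tf0 d0 e0 e1 S0 Sg z w zt wt.
have W0 := wconst_ge0 tfin d0.
apply: (@macro_modulus eps (fluct d eps K S) [set t | t <= tfin]
  (fun x => 24 * wconst tfin d * qroot x)
  (fun x => 2 * wconst tfin d * Num.sqrt (2 * x))) => //.
- by move=> x y xy; rewrite ler_wpM2l ?mulr_ge0// ler_wsqrtr// ler_pM2l.
- move=> s t j /= stf ttf st.
  have st' : s / eps ^+ 2 <= t / eps ^+ 2 by rewrite ler_pM2r ?invr_gt0 ?exprn_gt0.
  have ttf' : t / eps ^+ 2 <= tfin / eps ^+ 2 by rewrite ler_pM2r ?invr_gt0 ?exprn_gt0.
  rewrite (le_trans (fluct_holder_time tf0 d0 e0 e1 S0 Sg j st' ttf'))//.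
  rewrite -mulrBl qroot_div_sqr ?subr_ge0// le_eqVlt; apply/orP; left; apply/eqP; field.
  by rewrite gt_eqF// sqrtr_gt0.
- move=> t j m /= ttf; apply: (fluct_holder_space tf0) => //.
  by rewrite ler_pM2r ?invr_gt0 ?exprn_gt0.
Qed.

Lemma gap_le (c : R) K S : 0 <= c ->
  (forall k, (1 <= k < K)%N -> 2 * c <= S k.+1 - S k) ->
  forall i k, (1 <= i)%N -> (i <= k)%N -> (k <= K)%N ->
  S i + 2 * c * (k - i)%:R <= S k.
Proof.
move=> c0 Sg i k i1; elim: k => [|k IH]; first by rewrite leqn0 => /eqP i0; rewrite i0 in i1.
rewrite leq_eqVlt => /predU1P[<- _|]; first by rewrite subnn mulr0 addr0.
rewrite ltnS => ik kK; have {}IH := IH ik (ltnW kK).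
have := Sg k (_ : (1 <= k < K)%N); rewrite kK (leq_trans i1 ik) => /(_ isT).
by rewrite subSn// -(natr1 (k - i)) mulrDr mulr1; lra.
Qed.

(* The interface position moves by steps of size eps, at times which are at
   least 2 d eps apart. *)
Lemma count_modulus d eps K S s t : 0 < d -> 0 < eps ->
  (forall k, (1 <= k < K)%N -> 2 * (d / eps) <= S k.+1 - S k) -> s <= t ->
  let N x := \sum_(1 <= k < K.+1) (S k <= x)%R%:R : R in
  0 <= N t - N s /\ 2 * (d / eps) * (N t - N s - 1) <= t - s.
Proof.
move=> d0 e0 Sg st N; have c0 : 0 < d / eps by exact: divr_gt0.
have E : N t - N s = \sum_(1 <= k < K.+1) (s < S k <= t)%R%:R.
  rewrite /N -sumrB; apply: eq_bigr => k _.
  case: (leP (S k) s) => [h|h]; first by rewrite (le_trans h st) subrr.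
  by rewrite subr0.
split; first by rewrite E sumr_ge0.
rewrite E; elim: K Sg {E N} => [|K IH] Sg; first by rewrite big_geq//; lra.
rewrite big_nat_recr//=; have [/andP[sS St]|h] := boolP (s < S K.+1 <= t); last first.
  by rewrite /= addr0; apply: IH => k /andP[k1 kK]; apply: Sg; rewrite k1 ltnW.
rewrite (_ : true%:R = 1 :> R)// addrK.
(* The last transition in the interval has been taken off; every earlier one is followed by a full
   gap that ends no later than this last transition. *)
suff : 2 * (d / eps) * \sum_(1 <= k < K.+1) (s < S k <= t)%R%:R <= S K.+1 - s by lra.
elim: K Sg {IH} sS {St} => [|K IH] Sg sS; first by rewrite big_geq// mulr0 subr_ge0 ltW.
rewrite big_nat_recr//=.
have hK := gap_le (ltW c0) Sg.
have c20 : 0 <= 2 * (d / eps) := mulr_ge0 (ler0n R 2) (ltW c0).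
have gK := hK K.+1 K.+2 isT (leqnSn _) (leqnn _); rewrite subSnn mulr1 in gK.
have [sK|sK] := ltP s (S K.+1).
  have h k : (0 < k < K.+1)%N -> 2 * (d / eps) <= S k.+1 - S k.
    by move=> /andP[k1 kK]; apply: Sg; rewrite k1 ltnW.
  have := IH h sK => {}IH; rewrite mulrDr.
  have : 2 * (d / eps) * (true && (S K.+1 <= t)%R)%:R <= 2 * (d / eps).
    by rewrite ler_piMr//; case: (_ && _).
  by lra.
rewrite /= addr0 big_nat_cond big1 ?mulr0 ?subr_ge0 ?(ltW sS)//.
move=> k; rewrite andbT ltnS => /andP[k1 kK].
have := hK k K.+1 k1 (leq_trans kK (leqnSn K)) (leqnSn _).
have : 0 <= 2 * (d / eps) * (K.+1 - k)%:R by exact: mulr_ge0.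
move=> h1 h2; suff /le_gtF -> : S k <= s by [].
by lra.
Qed.

End macro_bounds.

Section almost_everywhere_rules.
Context {R : realType} d (T : measurableType d) (mu : {measure set T -> \bar R}).

Lemma ae_imp (P P' : T -> Prop) : (forall x, P x -> P' x) ->
  {ae mu, forall x, P x} -> {ae mu, forall x, P' x}.
Proof. by move=> h; apply: filterS. Qed.

Lemma ae_imp2 (P Q P' : T -> Prop) : (forall x, P x -> Q x -> P' x) ->
  {ae mu, forall x, P x} -> {ae mu, forall x, Q x} -> {ae mu, forall x, P' x}.
Proof. by move=> h; apply: filterS2. Qed.

End almost_everywhere_rules.

(** * The continuous representatives of the limits *)

Section limit_functions.
Context {R : realType}.
Variables (tfin d al : R) (e : nat -> R) (ts : nat -> nat -> \bar R).
Variables (p q : nat -> R -> int -> R) (K : nat -> nat) (S : nat -> nat -> R).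

Definition limQ n (z : R * R) : R := q n (z.1 / e n ^+ 2) (rnd (e n) z.2).
Definition limR n (z : R * R) : R :=
  fluct d (e n) (K n) (S n) (z.1 / e n ^+ 2) (rnd (e n) z.2).
Definition tcount n (t : R) : R := \sum_(1 <= k < (K n).+1) (S n k <= t)%R%:R.
Definition limX n (tau : R) : R := e n * tcount n (tau / e n ^+ 2).

Record scaled_data : Prop := {
  sd_tfin : 0 < tfin; sd_d : 0 < d; sd_al : 0 <= al;
  sd_e : forall n, 0 < e n; sd_e1 : forall n, e n <= 1;
  sd_cvg : e n @[n --> \oo] --> (0 : R);
  sd_md : forall n, micro_data tfin d (e n) (ts n) (p n) (q n) (K n) (S n);
  sd_q : forall n b, heat_sol 0 b (q n);
  sd_grad : forall n j, `|nablap (q n 0) j| <= al * e n }.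

Definition rconst : R := 24 * wconst tfin d.

(** Convergence at every point of the closed domain, with one error sequence for all three
    functions. The moduli are those of the approximations without their errors. *)
Record limit_data (xi : R -> R) (Q Rf : R * R -> R) (er : nat -> R) : Prop := {
  ld_er : er n @[n --> \oo] --> (0 : R);
  ld_Q : forall n z, Omega tfin z -> `|limQ n z - Q z| <= er n;
  ld_R : forall n z, Omega tfin z -> `|limR n z - Rf z| <= er n;
  ld_X : forall n tau, Itau tfin tau -> `|limX n tau - xi tau| <= er n;
  ld_Qmod : forall z w, Omega tfin z -> Omega tfin w ->
    `|Q z - Q w| <= 2 * al * Num.sqrt `|z.1 - w.1| + al * `|z.2 - w.2|;
  ld_Rmod : forall z w, Omega tfin z -> Omega tfin w ->
    `|Rf z - Rf w| <= rconst * qroot `|z.1 - w.1| + rconst * Num.sqrt `|z.2 - w.2|;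
  ld_Xmod : forall s t, Itau tfin s -> Itau tfin t ->
    `|xi s - xi t| <= (2 * d)^-1 * `|s - t| }.

Lemma Omega_itv z : Omega tfin z <-> 0 <= z.1 <= tfin.
Proof. by rewrite /Omega /Itau /= in_itv/=; split => [[]|]. Qed.

Hypothesis sd : scaled_data.

Let tf0 := sd_tfin sd.
Let d0 := sd_d sd.

Lemma sd_S_gt0 n k : (1 <= k <= K n)%N -> 0 < S n k.
Proof. by move=> kK; have /andP[] := md_itv (sd_md sd n) kK. Qed.

(** The position advances by eps at each transition, and transitions are at least 2 d eps apart in
    macroscopic time; the first one in an interval may come at once, which costs the error eps. *)
Lemma limX_modulus n s t : `|limX n s - limX n t| <= (2 * d)^-1 * `|s - t| + e n.
Proof.
have e0 := sd_e sd n; have dd := d0.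
suff H s' t' : s' <= t' -> `|limX n t' - limX n s'| <= (2 * d)^-1 * (t' - s') + e n.
  have [st|ts'] := leP s t.
    by rewrite distrC (distrC s) (ger0_norm (_ : 0 <= t - s)) ?subr_ge0// H.
  by rewrite (ger0_norm (_ : 0 <= s - t)) ?subr_ge0 ?H// ltW.
move=> st; have st' : s' / e n ^+ 2 <= t' / e n ^+ 2.
  by rewrite ler_pM2r ?invr_gt0 ?exprn_gt0.
have [h1 h2] := count_modulus d0 e0 (md_gap (sd_md sd n)) st'.
rewrite /limX -mulrBr ger0_norm ?mulr_ge0 ?(ltW e0)//.
rewrite -lerBlDr; rewrite -mulrBl in h2.
have := ler_wpM2l (_ : 0 <= e n ^+ 2 / (2 * d)) h2.
rewrite divr_ge0 ?exprn_ge0 ?mulr_ge0 ?(ltW e0) ?(ltW dd)// => /(_ isT).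
have -> : e n ^+ 2 / (2 * d) * ((t' - s') / e n ^+ 2) = (2 * d)^-1 * (t' - s').
  by field; rewrite !gt_eqF.
apply: le_trans; rewrite le_eqVlt; apply/orP; left; apply/eqP.
by rewrite /tcount; field; rewrite !gt_eqF.
Qed.

Lemma limQ_modulus n z w : Omega tfin z -> Omega tfin w ->
  `|limQ n z - limQ n w| <=
  2 * al * Num.sqrt `|z.1 - w.1| + al * `|z.2 - w.2| + al * e n.
Proof.
move=> /Omega_itv/andP[z0 _] /Omega_itv/andP[w0 _].
rewrite -addrA -mulrDr.
exact: (macro_heat_modulus (sd_e sd n) (sd_al sd) (sd_q sd n) (sd_grad sd n) z0 w0).
Qed.

Lemma limR_modulus n z w : z.1 <= tfin -> w.1 <= tfin ->
  `|limR n z - limR n w| <=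
  rconst * qroot `|z.1 - w.1| + rconst * Num.sqrt `|z.2 - w.2| + rconst * Num.sqrt (e n).
Proof.
move=> zt wt; have e0 := sd_e sd n.
have W0 : 0 <= wconst tfin d := wconst_ge0 tfin d0.
apply: (le_trans (macro_fluct_modulus tf0 d0 e0 (sd_e1 sd n) (@sd_S_gt0 n)
  (md_gap (sd_md sd n)) zt wt)).
rewrite -addrA lerD2l -mulrDr /rconst.
have h1 : Num.sqrt (2 * (`|z.2 - w.2| + e n)) <= 2 * (Num.sqrt `|z.2 - w.2| + Num.sqrt (e n)).
  rewrite sqrtrM// ler_pM ?sqrtr_ge0//; last by rewrite sqrtrD_le// ltW.
  by rewrite -[leRHS]ger0_norm// -sqrtr_sqr ler_wsqrtr// -natrX ler_nat.
have := ler_wpM2l (_ : 0 <= 2 * wconst tfin d) h1.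
rewrite mulr_ge0// => /(_ isT) h2; apply: (le_trans h2).
have : 0 <= wconst tfin d * (Num.sqrt `|z.2 - w.2| + Num.sqrt (e n)).
  by rewrite mulr_ge0// addr_ge0// sqrtr_ge0.
by lra.
Qed.

Lemma cvg0_eps (f : R -> R) : {for 0, continuous f} -> f 0 = 0 ->
  f x @[x --> (0 : R)] --> (0 : R).
Proof. by move=> cf f0; rewrite -[X in _ --> X]f0. Qed.

Lemma continuous_qroot : continuous (@qroot R).
Proof.
by move=> x; apply: continuous_comp; exact: sqrt_continuous.
Qed.

Lemma qroot0 : qroot (0 : R) = 0. Proof. by rewrite /qroot !sqrtr0. Qed.

Lemma Omega_dense (P : R * R -> Prop) (om : R -> R -> R) :
  {ae (lebesgue_measure \x lebesgue_measure)%E, forall z, P z} ->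
  (forall ep : R, 0 < ep -> exists2 r : R, 0 < r & forall x y : R, `|x| < r -> `|y| < r -> om `|x| `|y| < ep) ->
  forall z, Omega tfin z -> forall ep : R, 0 < ep ->
  exists w, [/\ Omega tfin w, P w & om `|z.1 - w.1| `|z.2 - w.2| < ep].
Proof.
move=> aP hom z /Omega_itv/andP[z0 zt] ep ep0; have tf := tf0.
have [r r0 hr] := hom ep ep0.
pose a := Num.max 0 (z.1 - r); pose b := Num.min tfin (z.1 + r).
have ab : a < b.
  by rewrite /a /b gt_max !lt_min; apply/andP; split; apply/andP; split; lra.
have [|w [/andP[wa wb] /andP[wt wx] Pw]] := ae_box_dense ab (_ : z.2 - r < z.2 + r) aP.
  by lra.
move: wa wb; rewrite /a /b gt_max lt_min => /andP[wa1 wa2] /andP[wb1 wb2].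
exists w; split => //; first by apply/Omega_itv; rewrite !ltW.
by apply: hr; rewrite ltr_norml; apply/andP; split; lra.
Qed.

Lemma Itau_dense (P : R -> Prop) : {ae lebesgue_measure, forall x, P x} ->
  forall t, Itau tfin t -> forall r : R, 0 < r ->
  exists s, [/\ Itau tfin s, s < tfin, P s & `|t - s| < r].
Proof.
move=> aP t; rewrite /Itau /= in_itv/= => /andP[t0 tt] r r0; have tf := tf0.
pose a := Num.max 0 (t - r); pose b := Num.min tfin (t + r).
have ab : a < b.
  by rewrite /a /b gt_max !lt_min; apply/andP; split; apply/andP; split; lra.
have [s /andP[wa wb] Ps] := ae_itv_dense ab aP.
move: wa wb; rewrite /a /b gt_max lt_min => /andP[wa1 wa2] /andP[wb1 wb2].
exists s; split => //; first by rewrite in_itv/= !ltW.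
by rewrite ltr_norml; apply/andP; split; lra.
Qed.

Lemma small_modulus (A B : R -> R) : {for 0, continuous A} -> {for 0, continuous B} ->
  A 0 = 0 -> B 0 = 0 ->
  forall ep : R, 0 < ep -> exists2 r : R, 0 < r &
    forall x y : R, `|x| < r -> `|y| < r -> A `|x| + B `|y| < ep.
Proof.
move=> cA cB A0 B0 ep ep0.
have e2 : 0 < ep / 2 by rewrite divr_gt0.
have /cvgrPdist_lt /(_ _ e2) [r1 /= r10 h1] := cvg0_eps cA A0.
have /cvgrPdist_lt /(_ _ e2) [r2 /= r20 h2] := cvg0_eps cB B0.
exists (Num.min r1 r2); first by rewrite lt_min r10.
move=> x y; rewrite !lt_min => /andP[x1 _] /andP[_ y2].
have := h1 `|x|; rewrite /= !sub0r !normrN !normr_id => /(_ x1) /ltr_normlW.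
have := h2 `|y|; rewrite /= !sub0r !normrN !normr_id => /(_ y2) /ltr_normlW.
lra.
Qed.

(** The exceptional null sets of all indices are discarded together. The remaining points are dense
    in the domain, its boundary included, so the moduli extend the convergence to every point. *)
Lemma limit_dataP (xi0 : R -> R) (Q0 R0 : R * R -> R) (ex eq_ er_ : nat -> R) :
  ex n @[n --> \oo] --> (0 : R) -> eq_ n @[n --> \oo] --> (0 : R) ->
  er_ n @[n --> \oo] --> (0 : R) ->
  (forall n, {ae lebesgue_measure, forall x, Itau tfin x ->
     `|interface_position (e n) (ts n) x - xi0 x| <= ex n}) ->
  (forall n, {ae (lebesgue_measure \x lebesgue_measure)%E, forall z, Omega tfin z ->
     `|macro (e n) (q n) z - Q0 z| <= eq_ n}) ->
  (forall n, {ae (lebesgue_measure \x lebesgue_measure)%E, forall z, Omega tfin z ->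
     `|regular_fluctuation tfin d (e n) (ts n) z - R0 z| <= er_ n}) ->
  exists xi Q Rf er, limit_data xi Q Rf er /\
   [/\ {ae lebesgue_measure, forall x, Itau tfin x -> xi x = xi0 x},
      {ae (lebesgue_measure \x lebesgue_measure)%E, forall z, Omega tfin z -> Q z = Q0 z} &
      {ae (lebesgue_measure \x lebesgue_measure)%E, forall z, Omega tfin z -> Rf z = R0 z}].
Proof.
move=> cx cq cr hx hq hr.
have {}hx := ae_forall_nat hx; have {}hq := ae_forall_nat hq; have {}hr := ae_forall_nat hr.
have ce := sd_cvg sd.
have cal : al * e n @[n --> \oo] --> (0 : R).
  by rewrite -[X in _ --> X](mulr0 al); apply: cvgM => //; exact: cvg_cst.
have cse : rconst * Num.sqrt (e n) @[n --> \oo] --> (0 : R).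
  rewrite -[X in _ --> X](mulr0 rconst); apply: cvgM; first exact: cvg_cst.
  apply: (@cvg_comp _ _ _ e (@Num.sqrt R)); first exact: ce.
  by apply: cvg0_eps; [exact: sqrt_continuous|exact: sqrtr0].
have ctrM (c : R) (f : R -> R) : {for 0, continuous f} -> {for 0, continuous (fun x => c * f x)}.
  by move=> cf; apply: cvgM; [exact: cvg_cst|exact: cf].
have pA1 : 2 * al * Num.sqrt (0 : R) = 0 by rewrite sqrtr0 mulr0.
have pA2 : rconst * qroot (0 : R) = 0 by rewrite qroot0 mulr0.
have pA3 : rconst * Num.sqrt (0 : R) = 0 by rewrite sqrtr0 mulr0.
have lRm n z w : Omega tfin z -> Omega tfin w -> `|limR n z - limR n w| <=
    rconst * qroot `|z.1 - w.1| + rconst * Num.sqrt `|z.2 - w.2| + rconst * Num.sqrt (e n).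
  by move=> /Omega_itv/andP[_ z1] /Omega_itv/andP[_ w1]; exact: limR_modulus.
have lRG n w : Omega tfin w -> (forall n, Omega tfin w ->
     `|regular_fluctuation tfin d (e n) (ts n) w - R0 w| <= er_ n) ->
     `|limR n w - R0 w| <= er_ n.
  by move=> Dw /(_ n Dw); rewrite (regular_fluctuationE w d0 (sd_e sd n) (sd_md sd n)).
have [Q [Q1 Q2 Q3]] := @uniform_limit_modulus _ _ (Omega tfin)
  [set z | forall n, Omega tfin z -> `|macro (e n) (q n) z - Q0 z| <= eq_ n]
  (fun z w => 2 * al * Num.sqrt `|z.1 - w.1| + al * `|z.2 - w.2|) limQ Q0 _ _ cal cq
  (fun n z w => @limQ_modulus n z w) (fun n w Dw Gw => Gw n Dw)
  (Omega_dense (om := fun x y => 2 * al * Num.sqrt x + al * y) hq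
    (small_modulus (A := fun x => 2 * al * Num.sqrt x) (B := fun y => al * y)
     (ctrM _ _ (@sqrt_continuous _ 0)) (ctrM _ _ (@cvg_id _ _)) pA1 (mulr0 _))).
have [Rf [R1 R2 R3]] := @uniform_limit_modulus _ _ (Omega tfin)
  [set z | forall n, Omega tfin z ->
     `|regular_fluctuation tfin d (e n) (ts n) z - R0 z| <= er_ n]
  (fun z w => rconst * qroot `|z.1 - w.1| + rconst * Num.sqrt `|z.2 - w.2|) limR R0 _ _ cse cr
  lRm lRG
  (Omega_dense (om := fun x y => rconst * qroot x + rconst * Num.sqrt y) hr
    (small_modulus (A := fun x => rconst * qroot x) (B := fun y => rconst * Num.sqrt y)
     (ctrM _ _ (@continuous_qroot 0)) (ctrM _ _ (@sqrt_continuous _ 0))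
     pA2 pA3)).
(* The final time is left out because [md_position] describes the position only before it. *)
pose GX := [set x | x < tfin /\ forall n, Itau tfin x ->
  `|interface_position (e n) (ts n) x - xi0 x| <= ex n].
have gx n w : Itau tfin w -> GX w -> `|limX n w - xi0 w| <= ex n.
  move=> Iw [wt /(_ n Iw)]; rewrite (md_position (sd_md sd n))//.
  by move: Iw; rewrite /Itau /= in_itv/= => /andP[-> _].
have dx z : Itau tfin z -> forall ep : R, 0 < ep ->
    exists w, [/\ Itau tfin w, GX w & (2 * d)^-1 * `|z - w| < ep].
  move=> Iz ep ep0; have [|s [Is st Ps zs]] := Itau_dense hx Iz (_ : 0 < 2 * d * ep).
    by rewrite !mulr_gt0// d0.
  exists s; split => //; rewrite mulrC ltr_pdivrMr 1?mulrC//.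
  by rewrite mulr_gt0// d0.
have [xi [X1 X2 X3]] := @uniform_limit_modulus _ _ (Itau tfin) GX
  (fun s t => (2 * d)^-1 * `|s - t|) limX xi0 _ _ ce cx
  (fun n s t _ _ => limX_modulus n s t) gx dx.
have al0 := sd_al sd; have rc0 : 0 <= rconst by rewrite mulr_ge0// wconst_ge0.
pose er n := `|ex n| + `|e n| + (`|eq_ n| + `|al * e n|) + (`|er_ n| + `|rconst * Num.sqrt (e n)|).
exists xi, Q, Rf, er; split.
  split => //.
  - have n0 (f : nat -> R) : f n @[n --> \oo] --> (0 : R) -> `|f n| @[n --> \oo] --> (0 : R).
      move=> cf; have h : `|f n| @[n --> \oo] --> `|0 : R| by apply: cvg_norm.
      by rewrite normr0 in h.
    have D0 (f g : nat -> R) : f n @[n --> \oo] --> (0 : R) -> g n @[n --> \oo] --> (0 : R) ->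
        f n + g n @[n --> \oo] --> (0 : R).
      move=> cf cg; have h : f n + g n @[n --> \oo] --> (0 + 0 : R) by apply: cvgD.
      by rewrite addr0 in h.
    exact: (D0 _ _ (D0 _ _ (D0 _ _ (n0 _ cx) (n0 _ ce)) (D0 _ _ (n0 _ cq) (n0 _ cal)))
      (D0 _ _ (n0 _ cr) (n0 _ cse))).
  - move=> n z Dz; apply: (le_trans (Q1 n z Dz)).
    have := ler_norm (eq_ n); have := ler_norm (al * e n).
    have := normr_ge0 (ex n); have := normr_ge0 (e n); have := normr_ge0 (er_ n).
    have := normr_ge0 (rconst * Num.sqrt (e n)); rewrite /er; lra.
  - move=> n z Dz; apply: (le_trans (R1 n z Dz)).
    have := ler_norm (er_ n); have := ler_norm (rconst * Num.sqrt (e n)).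
    have := normr_ge0 (ex n); have := normr_ge0 (e n); have := normr_ge0 (eq_ n).
    have := normr_ge0 (al * e n); rewrite /er; lra.
  - move=> n z Dz; apply: (le_trans (X1 n z Dz)).
    have := ler_norm (ex n); have := ler_norm (e n).
    have := normr_ge0 (er_ n); have := normr_ge0 (rconst * Num.sqrt (e n)).
    have := normr_ge0 (eq_ n); have := normr_ge0 (al * e n); rewrite /er; lra.
split.
- have h1 : {ae lebesgue_measure, forall x : R, x != tfin}.
    exists [set tfin]; split.
    + exact: measurable_set1.
    + exact: lebesgue_measure_set1.
    + by move=> x /= /negP; rewrite negbK => /eqP.
  apply: (ae_imp2 _ h1 hx) => x xt Gx Ix; apply: X3 => //; split => //.
  by rewrite lt_neqAle xt; move: Ix; rewrite /Itau /= in_itv/= => /andP[].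
- by apply: (ae_imp _ hq) => z Gz Dz; exact: Q3.
- by apply: (ae_imp _ hr) => z Gz Dz; exact: R3.
Qed.

End limit_functions.

(** * Pointwise properties of the limit *)

Section remainder.
Context {R : realType}.
Implicit Types (c s t B : R) (j : int) (k l m : nat).

Lemma norm_sum_at_most_one K (x : nat -> R) B : 0 <= B ->
  (forall k, (1 <= k <= K)%N -> `|x k| <= B) ->
  (forall k l, (1 <= k <= K)%N -> (1 <= l <= K)%N -> x k != 0 -> x l != 0 -> k = l) ->
  `|\sum_(1 <= k < K.+1) x k| <= B.
Proof.
move=> B0 xB x1.
have [[k [kK xk]]|h] := pselect (exists k, (1 <= k <= K)%N /\ x k != 0).
  rewrite (bigD1_seq k) ?iota_uniq//=; last by rewrite mem_index_iota ltnS.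
  rewrite big_seq_cond big1 ?addr0 ?xB// => l; rewrite mem_index_iota ltnS.
  move=> /andP[lK lk]; apply/eqP; apply: contraNT lk => xl.
  by apply/eqP; exact: x1.
rewrite big_nat_cond big1 ?normr0// => k; rewrite andbT ltnS => kK.
by apply/eqP; apply: contrapT => /negP xk; apply: h; exists k.
Qed.

Definition zdefect c s j : R := zkernel s j - hreg c s j.

Lemma zdefect_eq0 c s j : 0 < c -> s < 0 \/ c <= s -> zdefect c s j = 0.
Proof.
move=> c0 [s0|cs]; rewrite /zdefect /zkernel.
  by rewrite s0 hreg_le0 ?subr0// ltW.
by rewrite ltNge (le_trans (ltW c0) cs)/= hreg_ge// subrr.
Qed.

Lemma hreg_le1 c s j : 0 < c -> hreg c s j <= 1.
Proof.
move=> c0; have /andP[l0 l1] := hlam_itv c0 s.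
have m0 : 0 <= Num.max s c by rewrite ltW// max_gt0.
have g0 := heat_kernel_ge0 j m0.
have g1 := heat_kernel_norm_le1 j m0; rewrite ger0_norm// in g1.
by rewrite /hreg (le_trans _ g1)// ler_piMl.
Qed.

Lemma zdefect_le1 c s j : 0 < c -> `|zdefect c s j| <= 1.
Proof.
move=> c0; have h0 := hreg_ge0 c0 s j; have h1 := hreg_le1 s j c0.
rewrite /zdefect /zkernel; case: ltP => s0; first by rewrite sub0r normrN ger0_norm.
have g0 := heat_kernel_ge0 j s0.
have g1 := heat_kernel_norm_le1 j s0; rewrite ger0_norm// in g1.
by rewrite ler_norml; apply/andP; split; lra.
Qed.

Lemma zdefect_le c s j : 0 < c -> 0 < s -> `|zdefect c s j| <= (Num.sqrt s)^-1.
Proof.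
move=> c0 s0; have h0 := hreg_ge0 c0 s j.
have [cs|sc] := leP c s.
  by rewrite zdefect_eq0 ?normr0 ?invr_ge0 ?sqrtr_ge0//; right.
rewrite /zdefect /zkernel ltNge (ltW s0)/=.
have g0 := heat_kernel_ge0 j (ltW s0).
have g1 := heat_kernel_le j s0; rewrite qroot_exp2 in g1.
have h1 : hreg c s j <= (Num.sqrt s)^-1.
  have /andP[l0 l1] := hlam_itv c0 s.
  have gc0 := heat_kernel_ge0 j (ltW c0).
  rewrite /hreg (max_r (ltW sc)) (@le_trans _ _ (heat_kernel c j)) ?ler_piMl//.
  rewrite (le_trans (heat_kernel_le j c0))// qroot_exp2 lef_pV2 ?posrE ?sqrtr_gt0//.
  by rewrite ler_wsqrtr// ltW.
by rewrite ler_norml; apply/andP; split; lra.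
Qed.

End remainder.

Section pointwise_limits.
Context {R : realType}.
Variables (tfin d al : R) (e : nat -> R) (ts : nat -> nat -> \bar R).
Variables (p q : nat -> R -> int -> R) (K : nat -> nat) (S : nat -> nat -> R).
Implicit Types (t tau x a b w ep : R) (j : int) (n k l : nat) (z : (R * R)%type).

(* R_2 in microscopic variables. *)
Definition defect n t j : R :=
  - 2 * \sum_(1 <= k < (K n).+1) zdefect (d / e n) (t - S n k) (j - k%:Z).

(** The representation of p, used at all times; it is known to agree with p at times before [tfin]
    that are not transition times. *)
Definition limP n (z : R * R) : R :=
  limQ e q n z + limR d e K S n z + defect n (z.1 / e n ^+ 2) (rnd (e n) z.2).

Hypothesis sd : scaled_data tfin d al e ts p q K S.

Let tf0 : 0 < tfin := sd_tfin sd.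
Let d0 : 0 < d := sd_d sd.
Let e0 n : 0 < e n := sd_e sd n.

Lemma scaled_c_gt0 n : 0 < d / e n. Proof. exact: divr_gt0. Qed.
Let c0 := scaled_c_gt0.

Lemma limP_repr n z : limP n z = q n (z.1 / e n ^+ 2) (rnd (e n) z.2) -
  2 * \sum_(1 <= k < (K n).+1) zkernel (z.1 / e n ^+ 2 - S n k) (rnd (e n) z.2 - k%:Z).
Proof.
rewrite /limP /defect /limQ /limR /fluct -addrA -mulrDr -big_split/= mulNr.
congr (_ - 2 * _); apply: eq_bigr => k _; by rewrite /zdefect addrC subrK.
Qed.

Lemma limP_micro n tau x : 0 <= tau < tfin ->
  (forall k, (1 <= k <= K n)%N -> S n k <> tau / e n ^+ 2) ->
  [/\ limP n (tau, x) = p n (tau / e n ^+ 2) (rnd (e n) x), -1 <= limP n (tau, x) &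
      tcount K S n (tau / e n ^+ 2) < (rnd (e n) x)%:~R -> limP n (tau, x) <= 1].
Proof.
move=> /andP[t0 tt] nS; rewrite limP_repr.
have := e0 n => en.
have h : 0 <= tau / e n ^+ 2 < tfin / e n ^+ 2.
  by rewrite divr_ge0 ?exprn_ge0 ?(ltW en)//= ltr_pM2r// invr_gt0 exprn_gt0.
by have [h1 h2 h3] := md_repr (sd_md sd n) h nS (rnd (e n) x); rewrite -h1.
Qed.

Lemma gap_lt n k l : (1 <= k)%N -> (k < l)%N -> (l <= K n)%N ->
  S n k + 2 * (d / e n) <= S n l.
Proof.
move=> k1 kl lK; have cc := c0 n.
apply: le_trans (gap_le (ltW cc) (md_gap (sd_md sd n)) k1 (ltnW kl) lK).
have h : 1 <= (l - k)%:R :> R by rewrite ler1n subn_gt0.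
rewrite lerD2l -[leLHS]mulr1; apply: ler_wpM2l => //.
by rewrite mulr_ge0// ltW.
Qed.

(** A summand lives for the length of its ramp, d / eps, while transitions are twice as far apart,
    so two summands are never nonzero together and the bound does not depend on their number. *)
Lemma defect_le n (t : R) (j : int) (B : R) : 0 <= B ->
  (forall k, (1 <= k <= K n)%N -> `|zdefect (d / e n) (t - S n k) (j - k%:Z)| <= B) ->
  `|defect n t j| <= 2 * B.
Proof.
move=> B0 hB; rewrite /defect normN2M ler_pM2l//; have cc := c0 n.
apply: norm_sum_at_most_one => // k l kK lK xk xl.
have itv i : zdefect (d / e n) (t - S n i) (j - i%:Z) != 0 -> 0 <= t - S n i < d / e n.
  move=> xi; apply/andP; split.
    by rewrite leNgt; apply: contra xi => h; apply/eqP/zdefect_eq0 => //; left.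
  by rewrite ltNge; apply: contra xi => h; apply/eqP/zdefect_eq0 => //; right.
have /andP[k1 k2] := itv _ xk; have /andP[l1 l2] := itv _ xl.
move: kK lK => /andP[k3 k4] /andP[l3 l4].
have [kl|kl|//] := ltngtP k l.
  by exfalso; have := gap_lt k3 kl l4; lra.
by exfalso; have := gap_lt l3 kl k4; lra.
Qed.

Lemma defect_le2 n t j : `|defect n t j| <= 2.
Proof. by rewrite -[leRHS]mulr1 defect_le// => k _; rewrite zdefect_le1. Qed.

Lemma defect_small n t j w : 0 < w ->
  (forall k, (1 <= k <= K n)%N -> t < S n k \/ S n k + w <= t) ->
  `|defect n t j| <= 2 * (Num.sqrt w)^-1.
Proof.
move=> w0 h; apply: defect_le => [|k kK]; first by rewrite invr_ge0 sqrtr_ge0.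
have [tS|St] := h k kK.
  by rewrite zdefect_eq0 ?normr0 ?invr_ge0 ?sqrtr_ge0//; left; lra.
have h1 : w <= t - S n k by lra.
apply: (le_trans (zdefect_le _ (c0 n) (lt_le_trans w0 h1))).
by rewrite lef_pV2 ?posrE ?sqrtr_gt0 ?ler_wsqrtr// (lt_le_trans w0).
Qed.

Lemma defect_eq0 n t j :
  (forall k, (1 <= k <= K n)%N -> t < S n k \/ S n k + d / e n <= t) -> defect n t j = 0.
Proof.
move=> h; apply/eqP; rewrite -normr_le0 -[leRHS](mulr0 2); apply: defect_le => // k kK.
rewrite zdefect_eq0 ?normr0//; have [|] := h k kK; [left|right]; lra.
Qed.

(** At these times R_2 vanishes, and pointwise information on p becomes information on q + R_1. They
    are dense at the scale 2 d / eps, that is, at the scale eps in macroscopic time. *)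
Lemma quiet_time n a : exists2 t, a <= t < a + 2 * (d / e n) &
  forall k, (1 <= k <= K n)%N -> t < S n k \/ S n k + d / e n < t.
Proof.
have cc := c0 n; set c := d / e n in cc *.
have [[k [kK /andP[k1 k2]]]|h] :=
    pselect (exists k, (1 <= k <= K n)%N /\ S n k <= a <= S n k + c).
  (* If [a] lies in the ramp after transition k, this time is past the end of the ramp, at distance
     c, and before the next transition, at distance at least 2 c. *)
  exists (S n k + 3 / 2 * c); first by apply/andP; split; lra.
  move=> l lK; move: kK lK => /andP[k3 k4] /andP[l3 l4].
  have [kl|kl|->] := ltngtP k l.
  - by left; have := gap_lt k3 kl l4; rewrite -/c; lra.
  - by right; have := gap_lt l3 kl k4; rewrite -/c; lra.
  - by right; lra.
exists a; first by apply/andP; split; lra.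
move=> k kK; have [ak|ka] := ltP a (S n k); first by left.
right; rewrite ltNge; apply/negP => h2; apply: h; exists k; split => //.
by apply/andP; split.
Qed.

Lemma quiet_macro n tau : Itau tfin tau -> 2 * d * e n <= tfin -> exists2 tau',
  [/\ 0 <= tau' < tfin, `|tau' - tau| <= 4 * d * e n &
      forall k, (1 <= k <= K n)%N -> S n k <> tau' / e n ^+ 2] &
  forall x, limP n (tau', x) = limQ e q n (tau', x) + limR d e K S n (tau', x).
Proof.
rewrite /Itau /= in_itv/= => /andP[ta tb] eT; have en := e0 n; have dd := d0.
have e2 : 0 < e n ^+ 2 by rewrite exprn_gt0.
(* Near the final time the search starts earlier, so that the quiet time still lies before
   [tfin]. *)
pose b := Num.min tau (tfin - 2 * d * e n).
have [b0 b1 b2] : [/\ 0 <= b, b <= tfin - 2 * d * e n & `|b - tau| <= 2 * d * e n].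
  rewrite /b; have de : 0 <= 2 * d * e n by rewrite !mulr_ge0// ltW.
  have [h|h] := leP tau (tfin - 2 * d * e n).
    by split => //; rewrite subrr normr0.
  by split; [lra|lra|rewrite ler_norml; apply/andP; split; lra].
have [t /andP[t1 t2] th] := quiet_time n (b / e n ^+ 2).
have tE : t = e n ^+ 2 * t / e n ^+ 2 by rewrite mulrAC divff ?mul1r ?gt_eqF.
have h1 : b <= e n ^+ 2 * t by rewrite mulrC -ler_pdivrMr.
have h2 : e n ^+ 2 * t < b + 2 * d * e n.
  have -> : b + 2 * d * e n = e n ^+ 2 * (b / e n ^+ 2 + 2 * (d / e n)).
    by field; rewrite gt_eqF.
  by rewrite ltr_pM2l.
exists (e n ^+ 2 * t).
  split.
  - by apply/andP; split; lra.
  - have := b2; rewrite !ler_norml => /andP[c1 c2]; apply/andP; split; lra.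
  - move=> k kK; rewrite -tE => Sk; have := c0 n; have [] := th k kK; rewrite Sk; lra.
move=> x; rewrite /limP defect_eq0 ?addr0//= => k kK.
by rewrite -tE; have [|/ltW] := th k kK; [left|right].
Qed.

Variables (xi : R -> R) (Q Rf : R * R -> R) (er : nat -> R).
Hypothesis ld : limit_data tfin d al e q K S xi Q Rf er.
Let P z := Q z + Rf z.
Let rc := rconst tfin d.

Definition pmod a b : R := 2 * al * Num.sqrt a + al * b + (rc * qroot a + rc * Num.sqrt b).

Lemma P_mod z z' : Omega tfin z -> Omega tfin z' ->
  `|P z - P z'| <= pmod `|z.1 - z'.1| `|z.2 - z'.2|.
Proof.
move=> Dz Dw; have -> : P z - P z' = (Q z - Q z') + (Rf z - Rf z') by rewrite /P; ring.
by rewrite (le_trans (ler_normD _ _))// lerD// ?(ld_Qmod ld) ?(ld_Rmod ld).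
Qed.

Lemma rc_ge0 : 0 <= rc. Proof. by rewrite mulr_ge0// wconst_ge0. Qed.

Lemma pmod_le a b a' b' : a <= a' -> b <= b' -> pmod a b <= pmod a' b'.
Proof.
move=> aa bb; have r0 := rc_ge0; have al0 := sd_al sd.
rewrite /pmod; apply: lerD; apply: lerD; apply: ler_wpM2l; rewrite ?ler_wsqrtr ?ler_qroot//.
by rewrite mulr_ge0.
Qed.

Lemma pmod_cvg0 (a b : nat -> R) : a n @[n --> \oo] --> (0 : R) ->
  b n @[n --> \oo] --> (0 : R) -> pmod (a n) (b n) @[n --> \oo] --> (0 : R).
Proof.
move=> ca cb.
have sq (f : nat -> R) : f n @[n --> \oo] --> (0 : R) -> Num.sqrt (f n) @[n --> \oo] --> (0 : R).
  move=> cf; apply: (@cvg_comp _ _ _ f (@Num.sqrt R)); first exact: cf.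
  by apply: cvg0_eps; [exact: sqrt_continuous|exact: sqrtr0].
have M0 c (f : nat -> R) : f n @[n --> \oo] --> (0 : R) -> c * f n @[n --> \oo] --> (0 : R).
  by move=> cf; rewrite -[X in _ --> X](mulr0 c); apply: cvgM => //; exact: cvg_cst.
have D0 (f g : nat -> R) : f n @[n --> \oo] --> (0 : R) -> g n @[n --> \oo] --> (0 : R) ->
    f n + g n @[n --> \oo] --> (0 : R).
  move=> cf cg; have h : f n + g n @[n --> \oo] --> (0 + 0 : R) by apply: cvgD.
  by rewrite addr0 in h.
exact: (D0 _ _ (D0 _ _ (M0 _ _ (sq _ ca)) (M0 _ _ cb))
  (D0 _ _ (M0 _ _ (sq _ (sq _ ca))) (M0 _ _ (sq _ cb)))).
Qed.

Lemma pmod_small ep : 0 < ep -> exists2 r : R, 0 < r & pmod r r < ep.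
Proof.
move=> ep0; have h := pmod_cvg0 (@cvg_harmonic R) (@cvg_harmonic R).
have /cvgrPdist_lt /(_ _ ep0) [N _ /(_ N (leqnn _))/=] := h.
by rewrite sub0r normrN => /ltr_normlW ?; exists N.+1%:R^-1.
Qed.

Lemma er_ge0 n : 0 <= er n.
Proof.
apply: le_trans (ld_X ld n (_ : Itau tfin 0)) => //.
by rewrite /Itau /= in_itv/= lexx ltW.
Qed.

Let cM (c : R) : c * e n @[n --> \oo] --> (0 : R).
Proof.
rewrite -[X in _ --> X](mulr0 c); apply: cvgM; first exact: cvg_cst.
exact: (sd_cvg sd).
Qed.

Let near_le (c f : nat -> R) (M : R) : c n @[n --> \oo] --> (0 : R) ->
  (forall n, 2 * d * e n <= tfin -> M <= c n) -> M <= 0.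
Proof.
move=> cc h; rewrite leNgt; apply/negP => M0.
have /cvgrPdist_lt /(_ _ M0) [N1 _ h1] := cc.
have /cvgrPdist_lt /(_ _ tf0) [N2 _ h2] := cM (2 * d).
pose n := maxn N1 N2.
have := h1 n (leq_maxl _ _); have := h2 n (leq_maxr _ _).
rewrite /= !sub0r !normrN => /ltr_normlW/ltW/h a1 /ltr_normlW a2.
by have := le_lt_trans a1 a2; rewrite ltxx.
Qed.

Lemma limQR_le n z : Omega tfin z ->
  `|limQ e q n z + limR d e K S n z - P z| <= 2 * er n.
Proof.
move=> Dz; have -> : limQ e q n z + limR d e K S n z - P z =
  (limQ e q n z - Q z) + (limR d e K S n z - Rf z) by rewrite /P; ring.
rewrite mulr2n mulrDl mul1r (le_trans (ler_normD _ _))// lerD//.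
  exact: (ld_Q ld).
exact: (ld_R ld).
Qed.

Lemma OmegaE tau x : Itau tfin tau -> Omega tfin (tau, x).
Proof. by move=> h; split. Qed.

Let tau_Itau tau : 0 <= tau < tfin -> Itau tfin tau.
Proof. by move=> /andP[a b]; rewrite /Itau /= in_itv/= a ltW. Qed.

(** The inequality for p holds at a quiet time within 4 d eps of [tau]; the modulus of P and the
    uniform convergence bring it back to [tau] with an error that tends to 0. *)
Lemma P_ge tau x : Itau tfin tau -> -1 <= P (tau, x).
Proof.
move=> It; rewrite -subr_le0.
apply: (@near_le (fun n => pmod (4 * d * e n) 0 + 2 * er n) er).
  rewrite -[X in _ --> X](addr0 0) -[X in _ + X](mulr0 2); apply: cvgD.
    by apply: pmod_cvg0; [exact: cM|exact: cvg_cst].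
  by apply: cvgM; [exact: cvg_cst|exact: (ld_er ld)].
move=> n nT; have [t [t1 t2 t3] t4] := quiet_macro It nT.
have It' := tau_Itau t1.
have [_ h1 _] := limP_micro x t1 t3; rewrite t4 in h1.
have h2 := limQR_le n (OmegaE x It'); have h3 := P_mod (OmegaE x It') (OmegaE x It).
have h4 : pmod `|t - tau| `|x - x| <= pmod (4 * d * e n) 0.
  by apply: pmod_le => //; rewrite subrr normr0.
move: h2 h3; rewrite !ler_norml /= => /andP[_ a] /andP[_ b]; lra.
Qed.

Lemma P_le tau x : Itau tfin tau -> xi tau <= x -> P (tau, x) <= 1.
Proof.
move=> It xx; rewrite -subr_le0.
apply: (@near_le (fun n => pmod (4 * d * e n) (4 * e n + er n) + 2 * er n) er).
  rewrite -[X in _ --> X](addr0 0) -[X in _ + X](mulr0 2); apply: cvgD.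
    apply: pmod_cvg0; first exact: cM.
    rewrite -[X in _ --> X](addr0 0); apply: cvgD; [exact: cM|exact: (ld_er ld)].
  by apply: cvgM; [exact: cvg_cst|exact: (ld_er ld)].
move=> n nT; have [t [t1 t2 t3] t4] := quiet_macro It nT.
have It' := tau_Itau t1; have en := e0 n; have ern := er_ge0 n; have dd := d0.
(* The microscopic interface at the quiet time is at most 2 eps + er to the right of [xi tau], and
   rounding [y] loses at most eps / 2; so the cell of [y] lies strictly ahead of the interface. *)
pose y := x + (4 * e n + er n).
have [_ _ h1] := limP_micro y t1 t3; rewrite t4 in h1.
have {}h1 : limQ e q n (t, y) + limR d e K S n (t, y) <= 1.
  apply: h1; have := ld_X ld n It'; have := ld_Xmod ld It' It.
  have h5 : (2 * d)^-1 * `|t - tau| <= 2 * e n.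
    by rewrite mulrC ler_pdivrMr ?mulr_gt0//; lra.
  rewrite !ler_norml /limX => /andP[_ a] /andP[_ b].
  have /andP[_ r2] := rnd_itv y en.
  by rewrite -(ltr_pM2l en); rewrite mulrDr /y in r2; lra.
have h2 := limQR_le n (OmegaE y It'); have h3 := P_mod (OmegaE y It') (OmegaE x It).
have h4 : pmod `|t - tau| `|y - x| <= pmod (4 * d * e n) (4 * e n + er n).
  apply: pmod_le => //; rewrite /y addrAC subrr add0r ger0_norm//.
  by rewrite addr_ge0// mulr_ge0// ltW.
move: h2 h3; rewrite !ler_norml /= => /andP[a _] /andP[b _]; lra.
Qed.

(** At the k-th transition the k-th ramp is only starting and later ones have not begun, while the
    earlier ramps have reached the true kernel. What remains is the left limit of p_k. *)
Lemma transition_value n k : (1 <= k <= K n)%N -> 0 < S n k * e n ^+ 2 < tfin ->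
  limQ e q n (S n k * e n ^+ 2, e n * k%:R) +
  limR d e K S n (S n k * e n ^+ 2, e n * k%:R) = 1.
Proof.
move=> kK _; have en := e0 n; have cc := c0 n.
transitivity (q n (S n k) k%:Z -
  2 * \sum_(1 <= l < k) heat_kernel (S n k - S n l) (k%:Z - l%:Z)); last first.
  exact: (md_transition (sd_md sd n) kK).
rewrite /limQ /limR /= mulfK ?gt_eqF ?exprn_gt0//.
have -> : rnd (e n) (e n * k%:R) = k%:Z by rewrite -(rnd_nat k%:Z en).
rewrite /fluct mulNr; congr (_ - 2 * _).
move: kK => /andP[k1 kK].
rewrite (@sum_nat_prefix _ k.-1 (K n) _
  (fun l => heat_kernel (S n k - S n l) (k%:Z - l%:Z))) ?prednK//.
- by rewrite (leq_trans (leq_pred _)).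
- move=> l /andP[l1 lk]; rewrite hreg_ge// lerBrDl.
  have lk' : (l < k)%N by rewrite -(prednK k1).
  by have := gap_lt l1 lk' kK; lra.
- move=> l /andP[kl lK]; rewrite hreg_le0// subr_le0.
  have : (k <= l)%N by move: kl k1; clear; case: k.
  rewrite leq_eqVlt => /predU1P[->//|kl'].
  by have := gap_lt k1 kl' lK; lra.
Qed.

Lemma tcount_transition n k : (1 <= k <= K n)%N -> tcount K S n (S n k) = k%:R.
Proof.
move=> /andP[k1 kK]; have cc := c0 n.
rewrite /tcount (@sum_nat_prefix _ k (K n) _ (fun=> 1))//.
- by rewrite sumr_const_nat subn1.
- move=> l /andP[l1 lk]; rewrite (_ : S n l <= S n k)//.
  move: lk; rewrite leq_eqVlt => /predU1P[->//|kl'].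
  by have := gap_lt l1 kl' kK; lra.
- move=> l /andP[kl lK]; rewrite (_ : S n l <= S n k = false)//.
  by apply/negbTE; rewrite -ltNge (lt_le_trans _ (gap_lt k1 kl lK))// ltrDl mulr_gt0.
Qed.

Lemma limX_le n s t : s <= t -> limX e K S n s <= limX e K S n t.
Proof.
move=> st; rewrite ler_pM2l ?e0// /tcount; apply: ler_sum => k _.
have st' : s / e n ^+ 2 <= t / e n ^+ 2 by rewrite ler_pM2r ?invr_gt0 ?exprn_gt0.
rewrite ler_nat; case: (leP (S n k) (s / e n ^+ 2)) => // h.
by rewrite (le_trans h st').
Qed.

Lemma limX_jump n s t : limX e K S n s <> limX e K S n t -> s <= t ->
  exists k, (1 <= k <= K n)%N /\ s < S n k * e n ^+ 2 <= t.
Proof.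
move=> st slt; apply: contrapT => h; apply: st; congr (_ * _); rewrite /tcount.
have e2 : 0 < e n ^+ 2 by rewrite exprn_gt0.
have slt' : s / e n ^+ 2 <= t / e n ^+ 2 by rewrite ler_pM2r ?invr_gt0.
rewrite !big_nat; apply: eq_bigr => k; rewrite ltnS => kK.
congr (nat_of_bool _)%:R; apply/idP/idP => h1; first exact: le_trans slt'.
rewrite leNgt; apply/negP => h2; apply: h; exists k; split => //.
by rewrite -ltr_pdivrMr// h2 -ler_pdivlMr.
Qed.

Lemma xi_nondecreasing s t : Itau tfin s -> Itau tfin t -> s <= t -> xi s <= xi t.
Proof.
move=> Is It st; rewrite -subr_le0.
apply: (@near_le (fun n => 2 * er n) er).
  rewrite -[X in _ --> X](mulr0 2).
  by apply: cvgM; [exact: cvg_cst|exact: (ld_er ld)].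
move=> n _; have := ld_X ld n Is; have := ld_X ld n It; have := limX_le n st.
by rewrite !ler_norml => h /andP[a b] /andP[a' b']; lra.
Qed.

(** If xi_eps changed near [tau] along a subsequence, there would be a transition close to (tau, xi
    tau) at which q + R_1 equals 1; this contradicts P < 1 at that point and the moduli of
    continuity. *)
Lemma xi_stationary tau : Itau tfin tau -> P (tau, xi tau) <> 1 ->
  exists2 r : R, 0 < r & forall s, Itau tfin s -> `|s - tau| < r -> xi s = xi tau.
Proof.
move=> It P1.
have Plt : P (tau, xi tau) < 1 by rewrite lt_neqAle (P_le It)// andbT; apply/eqP.
set h := 1 - P (tau, xi tau).
have h0 : 0 < h by rewrite subr_gt0.
have [r r0 hr] := @pmod_small (h / 2) (divr_gt0 h0 (ltr0n _ 2)).
have dd := d0.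
(* During a time r d the interface moves by at most r / 2, because its Lipschitz constant is 1 / (2
   d). *)
pose r1 := Num.min r (r * d).
have r10 : 0 < r1 by rewrite lt_min r0 mulr_gt0.
have r1r : r1 <= r by rewrite /r1 ge_min lexx.
have r1d : (2 * d)^-1 * r1 <= r / 2.
  rewrite mulrC ler_pdivrMr ?mulr_gt0// (_ : r / 2 * (2 * d) = r * d); last by field.
  by rewrite ge_min lexx orbT.
exists r1 => // s Is sr.
have cer := ld_er ld.
have small m : 0 < m -> \forall n \near \oo, er n < m.
  move=> m0; have /cvgrPdist_lt /(_ _ m0) := cer; apply: filterS => n.
  by rewrite /= sub0r normrN => /ltr_normlW.
have h4 : 0 < h / 4 by rewrite divr_gt0.
have r2 : 0 < r / 2 by rewrite divr_gt0.
have key : \forall n \near \oo, limX e K S n s = limX e K S n tau.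
  near=> n; apply: contrapT => neq.
  have e1 : er n < h / 4 by near: n; exact: small.
  have e2 : er n < r / 2 by near: n; exact: small.
  have [k [kK sk1 sk2]] : exists k, [/\ (1 <= k <= K n)%N, Itau tfin (S n k * e n ^+ 2) &
      `|S n k * e n ^+ 2 - tau| < r1].
    move: sr; rewrite ltr_norml => /andP[a b].
    move: Is It; rewrite /Itau /= !in_itv/= => /andP[s0 s1] /andP[t0 t1].
    have [st|/ltW ts'] := leP s tau.
      have [k [kK /andP[k1 k2]]] := limX_jump neq st; exists k; split => //.
        by rewrite in_itv/=; apply/andP; split; lra.
      by rewrite ltr_norml; apply/andP; split; lra.
    have [k [kK /andP[k1 k2]]] := limX_jump (fun E => neq (esym E)) ts'; exists k; split => //.
      by rewrite in_itv/=; apply/andP; split; lra.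
    by rewrite ltr_norml; apply/andP; split; lra.
  set tk := S n k * e n ^+ 2 in sk1 sk2.
  have TV : limQ e q n (tk, e n * k%:R) + limR d e K S n (tk, e n * k%:R) = 1.
    apply: transition_value => //; have en := e0 n.
    have /andP[S0 ST] := md_itv (sd_md sd n) kK.
    by rewrite mulr_gt0 ?exprn_gt0//= -ltr_pdivlMr ?exprn_gt0.
  have h1 := limQR_le n (OmegaE (e n * k%:R) sk1); rewrite TV in h1.
  have h2 := ld_X ld n sk1.
  have XE : limX e K S n tk = e n * k%:R.
    by rewrite /limX /tk mulfK ?gt_eqF ?exprn_gt0// tcount_transition.
  rewrite XE in h2.
  have h3 := ld_Xmod ld sk1 It.
  have h5 : (2 * d)^-1 * `|tk - tau| <= r / 2.
    apply: le_trans r1d; rewrite ler_pM2l ?invr_gt0 ?mulr_gt0//; exact: ltW.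
  have h6 : `|e n * k%:R - xi tau| <= r.
    move: h2 h3; rewrite !ler_norml => /andP[a b] /andP[a' b'].
    by apply/andP; split; lra.
  have h7 := P_mod (OmegaE (e n * k%:R) sk1) (OmegaE (xi tau) It).
  have h8 : pmod `|tk - tau| `|e n * k%:R - xi tau| <= pmod r r.
    by apply: pmod_le => //; rewrite (le_trans (ltW sk2)).
  by move: h1 h7; rewrite !ler_norml /= => /andP[a b] /andP[a' b']; rewrite /h in e1 hr; lra.
apply: contrapT => /eqP; rewrite -subr_eq0 -normr_gt0 => m0.
near \oo => n.
have kn : limX e K S n s = limX e K S n tau by near: n; exact: key.
have en : er n < `|xi s - xi tau| / 2 by near: n; apply: small; rewrite divr_gt0.
have := ld_X ld n Is; have := ld_X ld n It; rewrite kn => a1 a2.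
have : `|xi s - xi tau| <= er n + er n.
  have -> : xi s - xi tau = (limX e K S n tau - xi tau) - (limX e K S n tau - xi s) by ring.
  by rewrite (le_trans (ler_normB _ _))// lerD.
by apply/negP; rewrite -ltNge; lra.
Unshelve. all: by end_near.
Qed.

Lemma xi_derive0 tau : Itau tfin tau -> P (tau, xi tau) <> 1 ->
  is_derive_within (Itau tfin) xi tau 0.
Proof.
move=> It P1; have [r r0 hr] := xi_stationary It P1.
apply: cvg_near_cst.
rewrite 2!near_withinE near_simpl; near=> s => _ Is.
have st : `|s - tau| < r by rewrite distrC; near: s; exact: nbhsx_ballx.
by rewrite (hr s Is st) subrr mul0r.
Unshelve. all: by end_near.
Qed.

(** All transition times are positive and the ramps start at 0, so R_1 vanishes at the initial
    time. *)
Lemma initial_P x : Q (0, x) = P (0, x).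
Proof.
rewrite /P -[LHS]addr0; congr (_ + _); apply/esym/eqP; rewrite -normr_le0.
apply: (@near_le (fun n => er n) er); first exact: (ld_er ld).
move=> n _; have := ld_R ld n (OmegaE x (tau_Itau (_ : 0 <= 0 < tfin))).
rewrite lexx tf0 => /(_ isT); rewrite {1}/limR /fluct big1_seq ?mulr0 ?sub0r ?normrN// => k /andP[_].
rewrite mem_index_iota ltnS /= => kK; rewrite mul0r; apply: hreg_le0.
by rewrite sub0r oppr_le0 ltW// (sd_S_gt0 sd kK).
Qed.

Lemma pmod_cvg_right : pmod t 0 @[t --> 0^'+] --> (0 : R).
Proof.
apply/cvgrPdist_lt => ep ep0; have [r r0 hr] := pmod_small ep0.
near=> t; rewrite sub0r normrN.
have t0 : 0 <= t by [].
have p0 : 0 <= pmod t 0.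
  rewrite /pmod sqrtr0; have := rc_ge0; have := sd_al sd => a0 c0'.
  apply: addr_ge0; apply: addr_ge0; apply: mulr_ge0; rewrite ?sqrtr_ge0 ?qroot_ge0//.
  by rewrite mulr_ge0.
rewrite ger0_norm//; apply: le_lt_trans hr; apply: pmod_le; last exact: ltW.
by near: t; exact: nbhs_right_le.
Unshelve. all: by end_near. Qed.

Lemma P_initial : initial_data_attained P xi.
Proof.
have I0 : Itau tfin 0 by rewrite /Itau /= in_itv/= lexx ltW.
have In : \forall t \near (0 : R)^'+, Itau tfin t.
  near=> t; rewrite /Itau /= in_itv/=; apply/andP; split => //.
  by near: t; exact: nbhs_right_le.
split.
  apply: (@squeeze_cvge _ _ _ _ (fun=> 0%E) _ (fun t => (pmod t 0)%:E)).
  - near=> t; have It : Itau tfin t by near: t.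
    rewrite Lnorm_ge0/=; apply: Lnormy_le; first exact: lebesgue_setT_gt0.
    move=> x; apply: (le_trans (P_mod (OmegaE x It) (OmegaE x I0))).
    apply: pmod_le; rewrite /= ?subrr ?normr0// subr0 ger0_norm//.
  - exact: cvg_cst.
  - by apply: cvg_EFin; [near=> t|exact: pmod_cvg_right].
apply/cvgrPdist_lt => ep ep0; have dd := d0; near=> t.
have It : Itau tfin t by near: t.
apply: (le_lt_trans (ld_Xmod ld I0 It)).
rewrite sub0r normrN ger0_norm// mulrC ltr_pdivrMr ?mulr_gt0//.
by near: t; apply: nbhs_right_lt; rewrite !mulr_gt0.
Unshelve. all: by end_near. Qed.

End pointwise_limits.

(** * Boundedness, Hölder and Lipschitz regularity of the limits *)

Section regularity.
Context {R : realType}.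
Variables (tfin d al : R) (e : nat -> R) (ts : nat -> nat -> \bar R).
Variables (p q : nat -> R -> int -> R) (K : nat -> nat) (S : nat -> nat -> R).
Hypothesis sd : scaled_data tfin d al e ts p q K S.
Variables (xi : R -> R) (Q Rf : R * R -> R) (er : nat -> R).
Hypothesis ld : limit_data tfin d al e q K S xi Q Rf er.

Lemma xi_lipschitz : [lipschitz xi tau | tau in Itau tfin].
Proof.
rewrite /lipschitz_on /=; near=> M; case=> s t /= -[/= Is It].
apply: (le_trans (ld_Xmod ld Is It)).
by rewrite ler_wpM2r//; near: M; exact: nbhs_pinfty_ge.
Unshelve. all: by end_near. Qed.

Lemma Q_bounded : exists M, forall z, Omega tfin z -> `|Q z| <= M.
Proof.
have [[M hM] _ _] := sd_q sd 0 (tfin / e 0 ^+ 2).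
exists (M + er 0) => z Dz; have := ld_Q ld 0 Dz => h.
have -> : Q z = limQ e q 0 z - (limQ e q 0 z - Q z) by ring.
rewrite (le_trans (ler_normB _ _))// lerD// hM//.
have /Omega_itv/andP[z0 zt] := Dz; have e0 := sd_e sd 0.
by rewrite divr_ge0 ?exprn_ge0 ?(ltW e0)//= ler_pM2r// invr_gt0 exprn_gt0.
Qed.

Lemma fluct_le n tau j : tau <= tfin ->
  `|fluct d (e n) (K n) (S n) (tau / e n ^+ 2) j| <= 2 * qroot (tfin + d) * wconst tfin d.
Proof.
move=> tt; have e0 := sd_e sd n.
apply: fluct_bounded; [exact: sd_tfin sd|exact: sd_d sd|exact: e0|exact: sd_e1 sd n| | |].
- by move=> k; exact: (sd_S_gt0 sd).
- exact: (md_gap (sd_md sd n)).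
- by rewrite ler_pM2r// invr_gt0 exprn_gt0.
Qed.

Lemma Rf_bounded : exists M, forall z, Omega tfin z -> `|Rf z| <= M.
Proof.
exists (2 * qroot (tfin + d) * wconst tfin d + er 0) => z Dz; have := ld_R ld 0 Dz => h.
have -> : Rf z = limR d e K S 0 z - (limR d e K S 0 z - Rf z) by ring.
rewrite (le_trans (ler_normB _ _))// lerD// fluct_le//.
by have /Omega_itv/andP[] := Dz.
Qed.

Lemma powR_qroot (x : R) : 0 <= x -> x `^ 4^-1 = qroot x.
Proof.
move=> x0; rewrite /qroot -(powR12_sqrt x0) -powR12_sqrt ?powR_ge0// -powRrM.
by congr (_ `^ _); field.
Qed.

(** At distances up to 1 every term of the modulus is dominated by the fourth root of the distance;
    at larger distances the fourth root exceeds 1 and boundedness suffices. *)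
Lemma quarter_holder (D : set (R * R)) (f : R * R -> R) (M a b c g : R) :
  0 <= a -> 0 <= b -> 0 <= c -> 0 <= g ->
  (forall z, D z -> `|f z| <= M) ->
  (forall z w, D z -> D w -> `|f z - f w| <=
    a * Num.sqrt `|z.1 - w.1| + b * `|z.2 - w.2| +
    (c * qroot `|z.1 - w.1| + g * Num.sqrt `|z.2 - w.2|)) ->
  bounded_locally_holder D f.
Proof.
move=> a0 b0 c0 g0 fM fmod; split.
  rewrite /bounded_near; near=> N => z Dz /=.
  apply: (le_trans (fM z Dz)).
  by near: N; apply: nbhs_pinfty_ge; exact: num_real.
exists 4^-1; first by rewrite invr_gt0 invf_le1 ?ltr0n// ler1n.
move=> C _ CD; exists (a + b + (c + g) + 2 * M) => z w Cz Cw.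
have Dz := CD _ Cz; have Dw := CD _ Cw.
have M0 : 0 <= M by rewrite (le_trans _ (fM z Dz)).
rewrite powR_qroot//; set r := `|z - w|.
have r1 : `|z.1 - w.1| <= r by rewrite /r prod_normE/= le_max lexx.
have r2 : `|z.2 - w.2| <= r by rewrite /r prod_normE/= le_max lexx orbT.
have r0 : 0 <= r by exact: normr_ge0.
have q0 := qroot_ge0 r.
have [rl1|r1l] := leP r 1.
  have q1 : qroot r <= 1 by rewrite qroot_le// expr1n.
  have sq : Num.sqrt r <= qroot r by rewrite -qroot_exp2 expr2 ler_piMl.
  have rq : r <= qroot r.
    by rewrite -[leLHS]qroot_exp4// exprS ler_piMr// exprn_ile1.
  apply: (le_trans (fmod z w Dz Dw)); rewrite mulrDl -[leLHS]addr0; apply: lerD; last first.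
    by rewrite mulr_ge0// mulr_ge0.
  rewrite !mulrDl; apply: lerD; apply: lerD; apply: ler_wpM2l => //.
  - exact: le_trans (ler_wsqrtr r1) sq.
  - exact: le_trans r2 rq.
  - exact: ler_qroot.
  - exact: le_trans (ler_wsqrtr r2) sq.
have q1 : 1 <= qroot r.
  have -> : (1 : R) = qroot 1 by rewrite /qroot !sqrtr1.
  exact/ler_qroot/ltW.
apply: (@le_trans _ _ (2 * M)).
  by rewrite (le_trans (ler_normB _ _))// mulr2n mulrDl !mul1r lerD// fM.
have h : 2 * M <= 2 * M * qroot r by rewrite ler_peMr// mulr_ge0.
apply: (le_trans h); rewrite ler_wpM2r// lerDr !addr_ge0//.
Unshelve. all: by end_near. Qed.

Lemma limit_regularity : [/\ bounded_locally_holder (Omega tfin) Q,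
  bounded_locally_holder (Omega tfin) Rf &
  bounded_locally_holder (Omega tfin) (fun z => Q z + Rf z)].
Proof.
have [M hM] := Q_bounded; have [N hN] := Rf_bounded.
have al0 := sd_al sd; have r0 := rc_ge0 sd.
have a2 : 0 <= 2 * al by rewrite mulr_ge0.
split.
- apply: (@quarter_holder _ Q M (2 * al) al 0 0) => // z w Dz Dw.
  by rewrite !mul0r !addr0; exact: (ld_Qmod ld).
- apply: (@quarter_holder _ Rf N 0 0 (rconst tfin d) (rconst tfin d)) => // z w Dz Dw.
  by rewrite !mul0r !add0r; exact: (ld_Rmod ld).
- apply: (@quarter_holder _ _ (M + N) (2 * al) al (rconst tfin d) (rconst tfin d)) => //.
    by move=> z Dz; rewrite (le_trans (ler_normD _ _))// lerD ?hM ?hN.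
  by move=> z w Dz Dw; exact: (P_mod ld).
Qed.

End regularity.

(** * The heat equation for Q *)

Section difference_quotients.
Context {R : realType}.
Implicit Types (a b c h x y r : R) (f g : R -> R) (F : int -> R) (j : int) (n m : nat).

Lemma derivative_bound f (df : R -> R) a b c : a <= b -> {within `[a, b], continuous f} ->
  (forall x, a < x < b -> is_derive x 1 f (df x)) ->
  (forall x, a < x < b -> `|df x| <= c) ->
  `|f b - f a| <= c * (b - a).
Proof.
move=> ab cf hd hb; move: ab; rewrite le_eqVlt => /predU1P[->|ab].
  by rewrite !subrr normr0 mulr0.
have hd' x : x \in `]a, b[ -> is_derive x 1 f (df x) by rewrite in_itv; exact: hd.
have [x xab ->] := MVT ab hd' cf.
rewrite normrM [X in _ * X]ger0_norm ?subr_ge0 ?(ltW ab)// ler_wpM2r ?subr_ge0 ?(ltW ab)//.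
by apply: hb; move: xab; rewrite in_itv.
Qed.

(** The Taylor estimate is supposed for forward steps only. A backward step from [x] is a forward
    step ending at [x], and the Lipschitz bound replaces the slope at its starting point by
    [g x]. *)
Lemma taylor_is_derive f g x r c : 0 < r ->
  (forall y h, `|y - x| < r -> 0 <= h -> `|y + h - x| < r ->
     `|h * g y - (f (y + h) - f y)| <= c * h ^+ 2) ->
  (forall y, `|y - x| < r -> `|g y - g x| <= c * `|y - x|) ->
  is_derive x 1 f (g x).
Proof.
move=> r0 hf hg.
have x0 : `|x - x| < r by rewrite subrr normr0.
have cf : h^-1 *: ((f \o shift x) (h *: 1) - f x) @[h --> 0^'] --> g x.
  apply/cvgrPdist_le => ep ep0.
  have c0 : 0 < 2 * `|c| + 1 by rewrite ltr_wpDl// mulr_ge0.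
  near=> h.
  have hr : `|h| < r by near: h; apply: dnbhs0_lt.
  have hn : h != 0 by near: h; exact: nbhs_dnbhs_neq.
  have he : `|h| < ep / (2 * `|c| + 1) by near: h; apply: dnbhs0_lt; exact: divr_gt0.
  suff H : `|h * g x - (f (h + x) - f x)| <= 2 * `|c| * `|h| ^+ 2.
    have -> : g x - h^-1 *: ((f \o shift x) (h *: 1) - f x) =
      h^-1 * (h * g x - (f (h + x) - f x)).
      have -> : h *: (1 : R) = h by rewrite /GRing.scale/= mulr1.
      by rewrite /= /GRing.scale/= [in RHS]mulrBr mulKf.
    rewrite normrM normfV mulrC ler_pdivrMr ?normr_gt0// (le_trans H)//.
    rewrite expr2 mulrA ler_wpM2r// (le_trans _ (ltW (_ : (2 * `|c| + 1) * `|h| < ep)))//.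
      by rewrite ler_wpM2r// lerDl.
    by rewrite mulrC -ltr_pdivlMr.
  have [h0|h0] := leP 0 h.
    rewrite [h + x]addrC (le_trans (hf _ _ x0 h0 _))//.
      by rewrite addrAC subrr add0r.
    rewrite (ger0_norm h0); apply: ler_wpM2r; first exact: exprn_ge0.
    apply: (le_trans (ler_norm c)).
    by rewrite mulr2n mulrDl mul1r lerDl.
  have yx : `|h + x - x| < r by rewrite addrK.
  have := hf (h + x) (- h) yx; rewrite oppr_ge0 (ltW h0) (_ : h + x - h = x); last by ring.
  move=> /(_ isT x0) h1; have := hg (h + x) yx; rewrite addrK => h2.
  have -> : h * g x - (f (h + x) - f x) =
    - (h * (g (h + x) - g x)) - (- h * g (h + x) - (f x - f (h + x))) by ring.
  rewrite (le_trans (ler_normB _ _))// normrN normrM.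
  have -> : 2 * `|c| * `|h| ^+ 2 = `|h| * (`|c| * `|h|) + `|c| * `|h| ^+ 2 by ring.
  apply: lerD; first by rewrite ler_wpM2l// (le_trans h2)// ler_wpM2r// ler_norm.
  by rewrite (le_trans h1)// sqrrN real_normK ?num_real// ler_wpM2r ?sqr_ge0// ler_norm.
have dv : derivable f x 1 by apply/cvg_ex; exists (g x).
by apply: DeriveDef => //; exact: cvg_lim cf.
Unshelve. all: by end_near. Qed.

Lemma nablapZ c F j : nablap (fun j => c * F j) j = c * nablap F j.
Proof. by rewrite /nablap; ring. Qed.

(** Three errors: the second order Taylor error of F over the [m] cells between x and x + h, the
    mismatch of at most [ep] between h and m cells, times the slope, and the distance between F and
    f at both ends. *)
Lemma discrete_taylor F (A B ep v : R) f x h : 0 < ep -> 0 <= h ->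
  (forall y, `|F (rnd ep y) - f y| <= v) ->
  (forall j, `|nablap F j| <= B * ep) ->
  (forall j, `|nablap (nablap F) j| <= A * ep ^+ 2) ->
  `|h * (nablap F (rnd ep x) / ep) - (f (x + h) - f x)| <= A * (h + ep) ^+ 2 + B * ep + 2 * v.
Proof.
move=> e0 h0 Ff hB hA; have xh : x <= x + h by rewrite lerDl.
have [m rE mh] := rnd_diff e0 xh.
have A0 : 0 <= A.
  have := le_trans (normr_ge0 _) (hA 0); rewrite pmulr_lge0// exprn_gt0//.
have := rnd_itv x e0; have := rnd_itv (x + h) e0; rewrite rE rmorphD/= => /andP[a1 a2] /andP[a3 a4].
set j := rnd ep x in rE a1 a2 a3 a4 *.
have mm : `|h - m%:R * ep| <= ep.
  rewrite !mulrDr in a1 a2 a3 a4; rewrite ler_norml; apply/andP; split; lra.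
have T : `|m%:R * nablap F j - (F (j + m%:Z) - F j)| <= A * (h + ep) ^+ 2.
  have -> : m%:R * nablap F j - (F (j + m%:Z) - F j) =
     - \sum_(0 <= i < m) diff i (nablap F) j.
    rewrite -[F _ - _]/(diff m F j) (diff_telescope m) /diff [in RHS]sumrB sumr_const_nat subn0.
    by rewrite -mulr_natl; ring.
  rewrite normrN (le_trans (ler_norm_sum _ _ _))//.
  apply: (@le_trans _ _ (\sum_(0 <= i < m) (m%:R * (A * ep ^+ 2)))).
    rewrite !big_nat; apply: ler_sum => i /andP[_ im].
    rewrite diff_telescope (le_trans (ler_norm_sum _ _ _))//.
    apply: (@le_trans _ _ (\sum_(0 <= k < i) (A * ep ^+ 2))).
      by apply: ler_sum => k _; exact: hA.
    rewrite sumr_const_nat subn0 -[leLHS]mulr_natl ler_wpM2r ?ler_nat ?(ltnW im)//.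
    by rewrite mulr_ge0// sqr_ge0.
  rewrite sumr_const_nat subn0 -[leLHS]mulr_natl.
  have -> : m%:R * (m%:R * (A * ep ^+ 2)) = A * (m%:R * ep) ^+ 2 by ring.
  rewrite ler_wpM2l// ler_sqr ?nnegrE ?mulr_ge0 ?(ltW e0)//; last by rewrite addr_ge0// ltW.
  by apply: (le_trans mh); lra.
have -> : h * (nablap F j / ep) - (f (x + h) - f x) =
  (m%:R * nablap F j - (F (j + m%:Z) - F j)) + (h - m%:R * ep) * (nablap F j / ep) +
  ((F (j + m%:Z) - f (x + h)) - (F j - f x)).
  by field; rewrite gt_eqF.
rewrite (le_trans (ler_normD _ _))// lerD//; last first.
  rewrite (le_trans (ler_normB _ _))// mulr2n mulrDl mul1r lerD//.
    by rewrite -rE.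
  exact: Ff.
rewrite (le_trans (ler_normD _ _))// lerD// normrM mulrC ler_pM//.
by rewrite normrM normfV (gtr0_norm e0) ler_pdivrMr.
Qed.

End difference_quotients.

(** * Derivatives as limits of lattice difference quotients *)

Section uniform_difference_quotients.
Context {R : realType}.
Variables (e v : nat -> R) (F : nat -> int -> R) (f : R -> R) (A B : R).
Hypotheses (e0 : forall n, 0 < e n) (e1 : forall n, e n <= 1).
Hypotheses (ce : e n @[n --> \oo] --> (0 : R)) (cv : v n @[n --> \oo] --> (0 : R)).
Hypothesis Ff : forall n x, `|F n (rnd (e n) x) - f x| <= v n.
Hypothesis FB : forall n j, `|nablap (F n) j| <= B * e n.
Hypothesis FA : forall n j, `|nablap (nablap (F n)) j| <= A * e n ^+ 2.

Let g n x := nablap (F n) (rnd (e n) x) / e n.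

(** The Taylor estimates of quotient and limit are compared over the step h = sqrt(e + v), for which
    all errors are of order h^2; division by h leaves this. In 5 A, the part 4 A comes from (h +
    e)^2 <= 4 h^2 and the rest from the limit. *)
Definition quotient_error n := (5 * A + B + 2) * Num.sqrt (e n + v n).

Let A0 : 0 <= A.
Proof.
by have := le_trans (normr_ge0 _) (FA 0 0); rewrite pmulr_lge0// exprn_gt0.
Qed.

Let B0 : 0 <= B.
Proof. by have := le_trans (normr_ge0 _) (FB 0 0); rewrite pmulr_lge0. Qed.

Let v0 n : 0 <= v n. Proof. by rewrite (le_trans _ (Ff n 0)). Qed.

Let star n x h : 0 <= h ->
  `|h * g n x - (f (x + h) - f x)| <= A * (h + e n) ^+ 2 + B * e n + 2 * v n.
Proof. by move=> h0; apply: discrete_taylor => //. Qed.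

Let star_cvg (h : R) :
  A * (h + e n) ^+ 2 + B * e n + 2 * v n @[n --> \oo] --> A * h ^+ 2.
Proof.
rewrite -[X in _ --> X]addr0 -[X in _ + X](mulr0 2); apply: cvgD; last first.
  by apply: cvgM => //; exact: cvg_cst.
rewrite -[X in _ --> X]addr0 -[X in _ + X](mulr0 B); apply: cvgD; last first.
  by apply: cvgM => //; exact: cvg_cst.
apply: cvgM; first exact: cvg_cst.
have ch : h + e n @[n --> \oo] --> h.
  by rewrite -[X in _ --> X]addr0; apply: cvgD => //; exact: cvg_cst.
by rewrite expr2; apply: cvgM.
Qed.

Let g_cvg x : cvg (g n x @[n --> \oo]).
Proof.
apply/cauchy_cvgP/cauchy_exP => ep ep0.
pose h := ep / (2 * (A + 1) + 1) / 2.
have A1 : 0 < 2 * (A + 1) + 1 by rewrite !addr_gt0 ?mulr_gt0// ltr_wpDl.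
have h0 : 0 < h by rewrite !divr_gt0.
have hep : 2 * (A + 1) * h < ep.
  have h2 : (2 * (A + 1) + 1) * h = ep / 2 by rewrite /h; field; rewrite gt_eqF.
  have : 2 * (A + 1) * h <= (2 * (A + 1) + 1) * h by rewrite ler_wpM2r ?(ltW h0)// lerDl.
  by rewrite h2; move=> /le_lt_trans; apply; rewrite ltr_pdivrMr// mulr_natr mulr2n ltrDl.
have lt1 : A * h ^+ 2 < (A + 1) * h ^+ 2.
  by rewrite ltr_pM2r ?exprn_gt0// ltrDl.
have /cvgrPdist_lt /(_ _ (_ : 0 < (A + 1) * h ^+ 2 - A * h ^+ 2)) := star_cvg (h := h).
rewrite subr_gt0 lt1 => /(_ isT) [N _ hN].
have hs n : (N <= n)%N -> `|h * g n x - (f (x + h) - f x)| <= (A + 1) * h ^+ 2.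
  move=> Nn; apply: (le_trans (star n x (ltW h0))).
  by have := hN n Nn; rewrite /= distrC => /ltr_normlW; lra.
exists (g N x); exists N => // n Nn; rewrite /ball/=.
have h1 := hs n Nn; have h2 := hs N (leqnn N).
rewrite -(ltr_pM2l h0) -[X in X * _ < _](gtr0_norm h0) -normrM.
have -> : h * (g N x - g n x) = (h * g N x - (f (x + h) - f x)) -
   (h * g n x - (f (x + h) - f x)) by ring.
rewrite (le_lt_trans (ler_normB _ _))// (le_lt_trans (lerD h2 h1))//.
rewrite -mulr2n -mulr_natl (_ : 2 * _ = h * (2 * (A + 1) * h)); last by ring.
by rewrite ltr_pM2l.
Qed.

Lemma quotient_error_cvg0 : quotient_error n @[n --> \oo] --> (0 : R).
Proof.
rewrite -[X in _ --> X](mulr0 (5 * A + B + 2)); apply: cvgM; first exact: cvg_cst.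
have cs : e n + v n @[n --> \oo] --> (0 : R).
  by rewrite -[X in _ --> X]addr0; apply: cvgD.
apply: (@cvg_comp _ _ _ (fun n => e n + v n) (@Num.sqrt R)); first exact: cs.
by apply: cvg0_eps; [exact: sqrt_continuous|exact: sqrtr0].
Qed.

(** For a fixed step h, two late quotients differ by at most 2 (A + 1) h, so they form a Cauchy
    sequence. The limit inherits the Taylor estimate and is the derivative. The explicit rate allows
    the lemma to be applied again to the quotients. *)
Lemma uniform_difference_quotient : exists g : R -> R,
  [/\ forall n x, `|nablap (F n) (rnd (e n) x) / e n - g x| <= quotient_error n,
      forall x y, `|g x - g y| <= A * `|x - y| &
      forall x : R, is_derive x 1 f (g x)].
Proof.
pose gg x := limn (g ^~ x).
have cg x : g n x @[n --> \oo] --> gg x by exact: g_cvg.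
have T x h : 0 <= h -> `|h * gg x - (f (x + h) - f x)| <= A * h ^+ 2.
  move=> h0.
  have c1 : `|h * g n x - (f (x + h) - f x)| @[n --> \oo] --> `|h * gg x - (f (x + h) - f x)|.
    apply: cvg_norm; apply: cvgB; last exact: cvg_cst.
    by apply: cvgM; [exact: cvg_cst|exact: cg].
  by apply: ler_cvg_to c1 (star_cvg (h := h)) _; apply: nearW => n; exact: star.
have L x y : `|gg x - gg y| <= A * `|x - y|.
  wlog xy : x y / x <= y.
    by move=> H; have [/H//|/ltW/H] := leP x y; rewrite distrC (distrC y).
  have c1 : `|g n x - g n y| @[n --> \oo] --> `|gg x - gg y|.
    by apply: cvg_norm; apply: cvgB; exact: cg.
  have c2 : A * (`|x - y| + e n) @[n --> \oo] --> A * (`|x - y| + 0).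
    by apply: cvgM; [exact: cvg_cst|apply: cvgD => //; exact: cvg_cst].
  rewrite addr0 in c2; apply: ler_cvg_to c1 c2 _; apply: nearW => n.
  have [m rE mh] := rnd_diff (e0 n) xy.
  rewrite /g rE -mulrBl normrM normfV (gtr0_norm (e0 n)) ler_pdivrMr// distrC.
  rewrite -[X in `|X|]/(diff m (nablap (F n)) _) diff_telescope (le_trans (ler_norm_sum _ _ _))//.
  apply: (@le_trans _ _ (\sum_(0 <= k < m) (A * e n ^+ 2))).
    by apply: ler_sum => k _; exact: FA.
  rewrite sumr_const_nat subn0 -[leLHS]mulr_natl distrC ger0_norm ?subr_ge0//.
  have -> : m%:R * (A * e n ^+ 2) = A * (m%:R * e n) * e n by ring.
  by rewrite ler_wpM2r ?(ltW (e0 n))// ler_wpM2l.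
exists gg; split => // [n x|x]; last first.
  by apply: (@taylor_is_derive _ f gg x 1 A) => // y h *; exact: T.
set h := Num.sqrt (e n + v n).
have ev : 0 < e n + v n by rewrite ltr_wpDr// v0.
have h0 : 0 < h by rewrite sqrtr_gt0.
have hh : h ^+ 2 = e n + v n by rewrite sqr_sqrtr// ltW.
have eh : e n <= h.
  rewrite -[leLHS]ger0_norm ?(ltW (e0 n))// -sqrtr_sqr ler_wsqrtr//.
  by rewrite expr2 (le_trans (_ : _ <= e n))// ?ler_piMl ?(ltW (e0 n)) ?lerDl.
have s := star n x (ltW h0); have t := T x h (ltW h0).
rewrite -(ler_pM2l h0) -[X in X * _ <= _](gtr0_norm h0) -normrM.
rewrite -/(g n x) (_ : h * (g n x - gg x) = (h * g n x - (f (x + h) - f x)) -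
   (h * gg x - (f (x + h) - f x))); last by ring.
rewrite (le_trans (ler_normB _ _))// (le_trans (lerD s t))//.
rewrite /quotient_error -/h (_ : h * _ = (5 * A + B + 2) * h ^+ 2); last by ring.
have h1 : A * (h + e n) ^+ 2 <= A * (4 * h ^+ 2).
  rewrite ler_wpM2l// (_ : 4 * h ^+ 2 = (2 * h) ^+ 2); last by ring.
  rewrite ler_sqr ?nnegrE ?addr_ge0 ?mulr_ge0 ?(ltW h0) ?(ltW (e0 n))//; lra.
have h2 : B * e n <= B * h ^+ 2 by rewrite ler_wpM2l// hh lerDl.
have h3 : v n <= h ^+ 2 by rewrite hh lerDr ltW.
lra.
Qed.

End uniform_difference_quotients.

Section pair_derivatives.
Context {R : realType}.
Variables (f : R * R -> R) (z : R * R) (l : R).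

Lemma is_derive_pair1 : is_derive z.1 1 (fun t => f (t, z.2)) l ->
  is_derive z ((1, 0) : R * R) f l.
Proof.
move=> h; have E : (fun h0 : R => h0^-1 *: ((f \o shift z) (h0 *: ((1, 0) : R * R)) - f z)) =
    (fun h0 => h0^-1 *: (((fun t => f (t, z.2)) \o shift z.1) (h0 *: 1) - f (z.1, z.2))).
  apply/funext => k /=; congr (_ *: (f _ - f _)); last by case: z.
  by case: (z) => a b; congr (_, _); rewrite /= /GRing.scale/= mulr0 add0r.
have [h1 h2] := h.
by apply: DeriveDef; [rewrite /derivable E|rewrite -h2 /derive E].
Qed.

Lemma is_derive_pair2 : is_derive z.2 1 (fun x => f (z.1, x)) l ->
  is_derive z ((0, 1) : R * R) f l.
Proof.
move=> h; have E : (fun h0 : R => h0^-1 *: ((f \o shift z) (h0 *: ((0, 1) : R * R)) - f z)) =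
    (fun h0 => h0^-1 *: (((fun x => f (z.1, x)) \o shift z.2) (h0 *: 1) - f (z.1, z.2))).
  apply/funext => k /=; congr (_ *: (f _ - f _)); last by case: z.
  by case: (z) => a b; congr (_, _); rewrite /= /GRing.scale/= mulr0 add0r.
have [h1 h2] := h.
by apply: DeriveDef; [rewrite /derivable E|rewrite -h2 /derive E].
Qed.

End pair_derivatives.

(** * Passage to the limit in the equation for q *)

Section heat_limit.
Context {R : realType}.
Variables (tfin d al : R) (e : nat -> R) (ts : nat -> nat -> \bar R).
Variables (p q : nat -> R -> int -> R) (K : nat -> nat) (S : nat -> nat -> R).
Hypothesis sd : scaled_data tfin d al e ts p q K S.
Variables (xi : R -> R) (Q Rf : R * R -> R) (er : nat -> R).
Hypothesis ld : limit_data tfin d al e q K S xi Q Rf er.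
Implicit Types (tau x y : R) (n m : nat) (j : int).
Let e0 n : 0 < e n := sd_e sd n.

Section positive_time.
Variable dl : R.
Hypothesis dl0 : 0 < dl.

(** The macroscopic bound for [m] further differences of the gradient at times from [dl] on. Each
    difference is granted the time dl / 4, which suffices for m <= 4. *)
Definition smoothing m : R := al / Num.sqrt (dl / 4) ^+ m.

Lemma smoothing_ge0 m : 0 <= smoothing m.
Proof. by rewrite divr_ge0 ?(sd_al sd)// exprn_ge0// sqrtr_ge0. Qed.

Lemma nablap_iter_le n m t j : (m <= 4)%N -> dl / e n ^+ 2 <= t ->
  `|iter m.+1 nablap (q n t) j| <= smoothing m * e n ^+ m.+1.
Proof.
move=> m4 ht; have en := e0 n; have e2 : 0 < e n ^+ 2 by rewrite exprn_gt0.
have s0 : 0 < dl / 4 / e n ^+ 2 by rewrite !divr_gt0.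
have hw := heat_sol_nablap (sd_q sd n t).
have := @heat_iter_grad_le R 0 t (fun t => nablap (q n t)) (al * e n) _ m hw (sd_grad sd n) s0 t j.
rewrite add0r lexx andbT iterSr => /(_ _)/le_trans; apply.
  apply: le_trans ht; rewrite (_ : dl / e n ^+ 2 = 4 * (dl / 4 / e n ^+ 2)); last first.
    by field; rewrite gt_eqF.
  by rewrite ler_wpM2r ?(ltW s0)// ler_nat.
have -> : Num.sqrt (dl / 4 / e n ^+ 2) = Num.sqrt (dl / 4) / e n.
  by rewrite sqrtrM ?divr_ge0 ?(ltW dl0)// sqrtrV ?(ltW e2)// sqrtr_sqr ger0_norm// ltW.
rewrite /smoothing expr_div_n invf_div exprS le_eqVlt; apply/orP; left; apply/eqP.
by rewrite mulrAC -!mulrA [_ * e n]mulrC !mulrA [_ * e n ^+ m]mulrC; ring.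
Qed.

Lemma lapl_nablap2 (F : int -> R) j : lapl F (j + 1) = nablap (nablap F) j.
Proof. by rewrite lapl_iter_nablap addrK. Qed.

Lemma macro_time_ge n tau : dl <= tau -> dl / e n ^+ 2 <= tau / e n ^+ 2.
Proof. by move=> h; rewrite ler_pM2r// invr_gt0 exprn_gt0. Qed.

(** [uniform_difference_quotient] is used for q and then for its difference quotients, the error of
    the first application being the data error of the second. Centring the Laplacian moves the
    second difference by one site, which costs a third difference. *)
Lemma Q_space_derivatives : exists (Q1 Q2 : R -> R -> R) (v2 : nat -> R),
  [/\ v2 n @[n --> \oo] --> (0 : R),
      forall tau x, dl <= tau <= tfin -> is_derive x 1 (fun x => Q (tau, x)) (Q1 tau x),
      forall tau x, dl <= tau <= tfin -> is_derive x 1 (Q1 tau) (Q2 tau x),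
      forall tau x y, dl <= tau <= tfin -> `|Q2 tau x - Q2 tau y| <= smoothing 2 * `|x - y| &
      forall n tau x, dl <= tau <= tfin ->
       `|lapl (q n (tau / e n ^+ 2)) (rnd (e n) x) / e n ^+ 2 - Q2 tau x| <= v2 n].
Proof.
pose v0 := er.
pose v1 := quotient_error e v0 (smoothing 1) (smoothing 0).
pose v2 := quotient_error e v1 (smoothing 2) (smoothing 1).
have cv1 : v1 n @[n --> \oo] --> (0 : R).
  by apply: quotient_error_cvg0; [exact: (sd_cvg sd)|exact: (ld_er ld)].
have cv2 : v2 n @[n --> \oo] --> (0 : R).
  by apply: quotient_error_cvg0; [exact: (sd_cvg sd)|exact: cv1].
pose F0 tau n j := q n (tau / e n ^+ 2) j.
pose F1 tau n j := (e n)^-1 * nablap (F0 tau n) j.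
have scale n (x b : R) m : `|x| <= b * e n ^+ m.+1 -> `|(e n)^-1 * x| <= b * e n ^+ m.
  have en := e0 n; move=> h; rewrite normrM normfV (gtr0_norm en) mulrC ler_pdivrMr//.
  by rewrite -mulrA -exprSr.
have F1E tau n : nablap (F1 tau n) = fun j => (e n)^-1 * nablap (nablap (F0 tau n)) j.
  by apply/funext => j; exact: nablapZ.
have F1E2 tau n : nablap (nablap (F1 tau n)) =
    fun j => (e n)^-1 * nablap (nablap (nablap (F0 tau n))) j.
  by rewrite F1E; apply/funext => j; exact: nablapZ.
have key tau : dl <= tau <= tfin -> exists g : (R -> R) * (R -> R),
  [/\ forall x, is_derive x 1 (fun x => Q (tau, x)) (g.1 x),
      forall x, is_derive x 1 g.1 (g.2 x),
      forall x y, `|g.2 x - g.2 y| <= smoothing 2 * `|x - y| &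
      forall n x, `|lapl (q n (tau / e n ^+ 2)) (rnd (e n) x) / e n ^+ 2 - g.2 x|
         <= v2 n + smoothing 2 * e n].
  move=> /andP[dt tt]; have tm n := macro_time_ge n dt.
  have Ot x : Omega tfin (tau, x).
    by apply/Omega_itv; rewrite /= tt (le_trans (ltW dl0)).
  have [g1 [g1a _ g1c]] := @uniform_difference_quotient _ e v0 (F0 tau) (fun x => Q (tau, x))
    (smoothing 1) (smoothing 0) e0 (sd_e1 sd) (sd_cvg sd) (ld_er ld)
    (fun n (x : R) => ld_Q ld n (Ot x)) (fun n j => nablap_iter_le (m := 0) j isT (tm n))
    (fun n j => nablap_iter_le (m := 1) j isT (tm n)).
  have [|n j|n j|g2 [g2a g2b g2c]] := @uniform_difference_quotient _ e v1 (F1 tau) g1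
    (smoothing 2) (smoothing 1) e0 (sd_e1 sd) (sd_cvg sd) cv1.
  - by move=> n x; rewrite /F1 mulrC; exact: g1a.
  - by rewrite F1E; apply: (scale n _ _ 1%N); exact: (nablap_iter_le (m := 1) j isT (tm n)).
  - by rewrite F1E2; apply: scale; exact: (nablap_iter_le (m := 2) j isT (tm n)).
  exists (g1, g2); split => // n x; set j := rnd (e n) x.
  have -> : lapl (q n (tau / e n ^+ 2)) j / e n ^+ 2 - g2 x =
     (nablap (F1 tau n) j / e n - g2 x) -
     (e n)^-1 * ((e n)^-1 * nablap (nablap (nablap (F0 tau n))) (j - 1)).
    rewrite F1E -[in LHS](subrK 1 j) lapl_nablap2 /nablap /F0 subrK.
    by field; rewrite gt_eqF.
  rewrite (le_trans (ler_normB _ _))// lerD//; first exact: g2a.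
  rewrite -[e n in leRHS]expr1; apply: (scale n _ _ 1%N); apply: (scale n _ _ 2%N).
  exact: (nablap_iter_le (m := 2) (j - 1) isT (tm n)).
pose D := [set tau | dl <= tau <= tfin].
have [g hg] : {g : R -> (R -> R) * (R -> R) | forall tau, D tau ->
  [/\ forall x : R, is_derive x 1 (fun x => Q (tau, x)) ((g tau).1 x),
      forall x : R, is_derive x 1 (g tau).1 ((g tau).2 x),
      forall x y, `|(g tau).2 x - (g tau).2 y| <= smoothing 2 * `|x - y| &
      forall n x, `|lapl (q n (tau / e n ^+ 2)) (rnd (e n) x) / e n ^+ 2 - (g tau).2 x|
         <= v2 n + smoothing 2 * e n]}.
  pose T (tau : R) (g : (R -> R) * (R -> R)) := D tau ->
  [/\ forall x : R, is_derive x 1 (fun x => Q (tau, x)) (g.1 x),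
      forall x : R, is_derive x 1 g.1 (g.2 x),
      forall x y, `|g.2 x - g.2 y| <= smoothing 2 * `|x - y| &
      forall n x, `|lapl (q n (tau / e n ^+ 2)) (rnd (e n) x) / e n ^+ 2 - g.2 x|
         <= v2 n + smoothing 2 * e n].
  have /choice[g hg] : forall tau, exists g, T tau g.
    move=> tau; have [Dt|nD] := pselect (D tau); last by exists (fun=> 0, fun=> 0).
    by have [g hg] := key tau Dt; exists g.
  by exists g.
exists (fun tau => (g tau).1), (fun tau => (g tau).2), (fun n => v2 n + smoothing 2 * e n).
split => [|tau x Dt|tau x Dt|tau x y Dt|n tau x Dt]; last 4 first.
- by have [] := hg _ Dt.
- by have [] := hg _ Dt.
- by have [] := hg _ Dt.
- by have [] := hg _ Dt.
rewrite -[X in _ --> X](addr0 0) -[X in _ + X](mulr0 (smoothing 2)).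
by apply: cvgD => //; apply: cvgM; [exact: cvg_cst|exact: (sd_cvg sd)].
Qed.

Lemma lapl2_le n t j : dl / e n ^+ 2 <= t ->
  `|lapl (lapl (q n t)) j| <= smoothing 3 * e n ^+ 4.
Proof.
move=> ht; rewrite lapl_iter_nablap.
have -> : lapl (q n t) = fun j => iter 2 nablap (q n t) (j - 1).
  by apply/funext => i; rewrite lapl_iter_nablap.
have E (F : int -> R) i : iter 2 nablap (fun j => F (j - 1)) i = iter 2 nablap F (i - 1).
  by rewrite /= /nablap !(addrAC _ 1).
by rewrite E -iterD; exact: nablap_iter_le.
Qed.

Lemma lapl_time_lipschitz n s t j : dl / e n ^+ 2 <= s -> s <= t ->
  `|lapl (q n t) j - lapl (q n s) j| <= smoothing 3 * e n ^+ 4 * (t - s).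
Proof.
move=> ds st; have s0 : 0 < s by rewrite (lt_le_trans _ ds)// divr_gt0// exprn_gt0.
have [_ cq dq] : heat_sol 0 t (fun t j => lapl (q n t) j).
  have := heat_sol_shift (-1) (heat_sol_iter_nablap 2 (sd_q sd n t)).
  congr heat_sol; apply/funext => u; apply/funext => i; by rewrite lapl_iter_nablap.
apply: (@derivative_bound _ (fun u => lapl (q n u) j) (fun u => lapl (lapl (q n u)) j)) => //.
- apply: continuous_subspaceW (cq j) => x /=; rewrite !in_itv/= => /andP[sx ->].
  by rewrite (le_trans (ltW s0) sx).
- by move=> x /andP[sx xt]; apply: dq; rewrite (lt_trans s0 sx).
- by move=> x /andP[sx xt]; apply: lapl2_le; rewrite (le_trans ds)// ltW.
Qed.

Lemma heat_time_taylor n s t j : dl / e n ^+ 2 <= s -> s <= t ->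
  `|q n t j - q n s j - (t - s) * lapl (q n s) j| <= smoothing 3 * e n ^+ 4 * (t - s) ^+ 2.
Proof.
move=> ds st; have s0 : 0 < s by rewrite (lt_le_trans _ ds)// divr_gt0// exprn_gt0.
have [_ cq dq] := sd_q sd n t.
pose f u := q n u j - u * lapl (q n s) j.
have -> : q n t j - q n s j - (t - s) * lapl (q n s) j = f t - f s by rewrite /f; ring.
rewrite expr2 mulrA.
apply: (derivative_bound (df := fun u => lapl (q n u) j - lapl (q n s) j)) => //.
- have cq' : {within `[s, t], continuous (fun u => q n u j)}.
    apply: continuous_subspaceW (cq j) => x /=; rewrite !in_itv/= => /andP[sx ->].
    by rewrite (le_trans (ltW s0) sx).
  apply: within_continuousD; first exact: cq'.
  apply: within_continuousN; apply: continuous_within.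
  by move=> x; apply: cvgM; [exact: cvg_id|exact: cvg_cst].
- move=> x /andP[sx xt]; have h := dq x j; rewrite (lt_trans s0 sx) xt in h.
  have {}h := h isT.
  have h2 : is_derive x 1 (fun u : R => u * lapl (q n s) j) (lapl (q n s) j).
    by apply: is_derive_eq; rewrite /GRing.scale/= mulr0 add0r mulr1.
  exact: is_deriveB h h2.
- move=> x /andP[sx xt]; rewrite (le_trans (lapl_time_lipschitz j ds (ltW sx)))//.
  rewrite ler_wpM2l ?lerD2r ?(ltW xt)// mulr_ge0 ?exprn_ge0 ?(ltW (e0 n))//.
  exact: smoothing_ge0.
Qed.

(** The lattice equation and the bound on the iterated Laplacian give a Taylor estimate in time with
    the Laplacian as slope; it survives in the limit and identifies [Q2] as the time derivative of
    Q. *)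
Lemma Q_time_estimates (Q2 : R -> R -> R) (v2 : nat -> R) :
  v2 n @[n --> \oo] --> (0 : R) ->
  (forall n tau x, dl <= tau <= tfin ->
       `|lapl (q n (tau / e n ^+ 2)) (rnd (e n) x) / e n ^+ 2 - Q2 tau x| <= v2 n) ->
  forall s t x, dl <= s -> s <= t -> t <= tfin ->
  `|Q2 t x - Q2 s x| <= smoothing 3 * (t - s) /\
  `|(t - s) * Q2 s x - (Q (t, x) - Q (s, x))| <= smoothing 3 * (t - s) ^+ 2.
Proof.
move=> cv h s t x ds st tt.
pose W n tau := lapl (q n (tau / e n ^+ 2)) (rnd (e n) x) / e n ^+ 2.
have cW tau : dl <= tau <= tfin -> W n tau @[n --> \oo] --> Q2 tau x.
  move=> Dt; apply/cvgrPdist_le => ep ep0; have /cvgrPdist_le /(_ _ ep0) := cv.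
  apply: filterS => n /=; rewrite sub0r normrN => /(le_trans (ler_norm _)) hn.
  by rewrite distrC (le_trans (h n tau x Dt)).
have cQ tau : dl <= tau <= tfin -> limQ e q n (tau, x) @[n --> \oo] --> Q (tau, x).
  move=> /andP[Dt tt']; apply/cvgrPdist_le => ep ep0; have /cvgrPdist_le /(_ _ ep0) := ld_er ld.
  apply: filterS => n /=; rewrite sub0r normrN => /(le_trans (ler_norm _)) hn.
  rewrite distrC (le_trans (ld_Q ld n _))//.
  by apply/Omega_itv; rewrite /= tt' (le_trans (ltW dl0)).
have Ds : dl <= s <= tfin by rewrite ds (le_trans st).
have Dt : dl <= t <= tfin by rewrite tt (le_trans ds).
have st' n : s / e n ^+ 2 <= t / e n ^+ 2 by rewrite ler_pM2r// invr_gt0 exprn_gt0.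
split.
  have c1 : `|W n t - W n s| @[n --> \oo] --> `|Q2 t x - Q2 s x|.
    by apply: cvg_norm; apply: cvgB; exact: cW.
  apply: ler_cvg_to c1 (cvg_cst _) _; apply: nearW => n; have en := e0 n.
  rewrite /W -mulrBl normrM normfV [X in _ / X]ger0_norm ?exprn_ge0 ?(ltW en)//.
  rewrite ler_pdivrMr ?exprn_gt0//.
  apply: (le_trans (lapl_time_lipschitz (rnd (e n) x) (macro_time_ge n ds) (st' n))).
  rewrite le_eqVlt; apply/orP; left; apply/eqP; field; by rewrite gt_eqF.
have c1 : `|(t - s) * W n s - (limQ e q n (t, x) - limQ e q n (s, x))| @[n --> \oo] -->
    `|(t - s) * Q2 s x - (Q (t, x) - Q (s, x))|.
  apply: cvg_norm; apply: cvgB; last by apply: cvgB; exact: cQ.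
  by apply: cvgM; [exact: cvg_cst|exact: cW].
apply: ler_cvg_to c1 (cvg_cst _) _; apply: nearW => n; have en := e0 n.
have := heat_time_taylor (rnd (e n) x) (macro_time_ge n ds) (st' n).
rewrite -normrN /limQ /W /=.
set A := q n _ _; set B := q n _ _; set L := lapl _ _.
have -> : - (A - B - (t / e n ^+ 2 - s / e n ^+ 2) * L) =
  (t - s) * (L / e n ^+ 2) - (A - B) by field; rewrite gt_eqF.
move=> /le_trans; apply.
rewrite le_eqVlt; apply/orP; left; apply/eqP; field; by rewrite gt_eqF.
Qed.

End positive_time.

Lemma Q_heat_solution : heat_solution tfin Q.
Proof.
move=> z [/= z1 _]; move: z1; rewrite in_itv/= => /andP[z0 zt].
pose dl := z.1 / 2; have dl0 : 0 < dl by rewrite divr_gt0.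
have [Q1 [Q2 [v2 [cv h1 h2 hL hv]]]] := Q_space_derivatives dl0.
have hT := Q_time_estimates dl0 cv hv.
set c3 := smoothing dl 3 in hT; set c2 := smoothing dl 2 in hL.
have c30 : 0 <= c3 by exact: smoothing_ge0.
have c20 : 0 <= c2 by exact: smoothing_ge0.
have dlz : dl < z.1 by rewrite /dl ltr_pdivrMr// mulr_natr mulr2n ltrDl.
have lipT s t x : dl <= s <= tfin -> dl <= t <= tfin -> `|Q2 t x - Q2 s x| <= c3 * `|t - s|.
  wlog st : s t / s <= t.
    by move=> H a b; have [st|/ltW st] := leP s t; [exact: H|rewrite distrC (distrC t) H].
  move=> /andP[a _] /andP[_ b]; rewrite (ger0_norm (_ : 0 <= t - s)) ?subr_ge0//.
  by have [] := hT s t x a st b.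
have dQt w : dl < w.1 < tfin -> is_derive w ((1, 0) : R * R) Q (Q2 w.1 w.2).
  move=> /andP[w0 wt]; apply: is_derive_pair1.
  pose r := Num.min (w.1 - dl) (tfin - w.1).
  have r0 : 0 < r by rewrite lt_min !subr_gt0 w0.
  apply: (@taylor_is_derive _ (fun t => Q (t, w.2)) (fun t => Q2 t w.2) w.1 r c3) => //.
    move=> y h; rewrite /r !lt_min !ltr_norml => /andP[/andP[a1 a2] /andP[a3 a4]] h0.
    move=> /andP[/andP[b1 b2] /andP[b3 b4]].
    have [||| _] := hT y (y + h) w.2; [lra|lra|lra|].
    by rewrite (_ : y + h - y = h)//; ring.
  move=> y; rewrite /r !lt_min !ltr_norml => /andP[/andP[a1 a2] /andP[a3 a4]].
  by apply: lipT; apply/andP; split; lra.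
have dQx w : dl < w.1 < tfin -> is_derive w ((0, 1) : R * R) Q (Q1 w.1 w.2).
  move=> /andP[w0 wt]; apply: is_derive_pair2; apply: h1; by rewrite !ltW.
have openD (w : R * R) : dl < w.1 < tfin -> \forall w' \near w, dl < w'.1 < tfin.
  move=> /andP[w0 wt].
  have r0 : 0 < Num.min (w.1 - dl) (tfin - w.1) by rewrite lt_min !subr_gt0 w0.
  near=> w'.
  have : ball w (Num.min (w.1 - dl) (tfin - w.1)) w' by near: w'; exact: nbhsx_ballx.
  move=> [/=]; rewrite /ball/= lt_min !ltr_norml => /andP[/andP[a1 a2] /andP[a3 a4]] _.
  by apply/andP; split; lra.
have nearz (r : R) : 0 < r -> \forall w \near z, `|z.1 - w.1| < r /\ `|z.2 - w.2| < r.
  by move=> r0; near=> w; near: w; exact: nbhsx_ballx.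
have Dz : dl < z.1 < tfin by rewrite dlz.
have dQxx : is_derive z ((0, 1) : R * R) (dxi Q) (Q2 z.1 z.2).
  apply: is_derive_pair2.
  have -> : (fun x => dxi Q (z.1, x)) = Q1 z.1.
    by apply/funext => x; have [_ <-] := dQx (z.1, x) Dz.
  by apply: h2; rewrite !ltW.
split.
- split; first by have [] := dQt z Dz.
    by have [] := dQx z Dz.
  by have [] := dQxx.
- have E : dtau Q z = Q2 z.1 z.2 by have [_ <-] := dQt z Dz.
  apply/cvgrPdist_le => ep ep0; rewrite E.
  have c0 : 0 < c2 + c3 + 1 by rewrite ltr_wpDl// addr_ge0.
  near=> w.
  have Dw : dl < w.1 < tfin by near: w; exact: openD.
  have [w1 w2] : `|z.1 - w.1| < ep / (c2 + c3 + 1) /\ `|z.2 - w.2| < ep / (c2 + c3 + 1).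
    by near: w; apply: nearz; exact: divr_gt0.
  have [_ Ew] := dQt w Dw; rewrite /dtau Ew.
  have -> : Q2 z.1 z.2 - Q2 w.1 w.2 = (Q2 z.1 z.2 - Q2 w.1 z.2) + (Q2 w.1 z.2 - Q2 w.1 w.2) by ring.
  have Iz : dl <= z.1 <= tfin by have /andP[a b] := Dz; rewrite !ltW.
  have Iw : dl <= w.1 <= tfin by have /andP[a b] := Dw; rewrite !ltW.
  rewrite (le_trans (ler_normD _ _))//.
  rewrite (le_trans (lerD (lipT _ _ _ Iw Iz) (hL _ _ _ Iw)))//.
  apply: (@le_trans _ _ (c3 * (ep / (c2 + c3 + 1)) + c2 * (ep / (c2 + c3 + 1)))).
    by apply: lerD; apply: ler_wpM2l => //; exact: ltW.
  rewrite -mulrDl mulrA ler_pdivrMr// mulrC ler_wpM2l ?(ltW ep0)//.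
  by rewrite [c3 + _]addrC lerDl.
- by have [_ E2] := dQxx; have [_ E1] := dQt z Dz; rewrite /dtau E1 -E2.
Unshelve. all: by end_near. Qed.

End heat_limit.

(** * Integrals over boxes *)

Section step_measurability.
Context {R : realType}.
Implicit Types (D : set R) (eps : R) (v : R -> int -> R).

Lemma rnd_preimage eps (j : int) : 0 < eps ->
  [set x | rnd eps x = j] = `[eps * (j%:~R - 2^-1), eps * (j%:~R + 2^-1)[%classic.
Proof.
move=> e0; apply/seteqP; split => x /=; rewrite in_itv/=.
  by move=> <-; exact: rnd_itv.
move=> /andP[h1 h2].
rewrite mulrC -ler_pdivlMr// in h1; rewrite mulrC -ltr_pdivrMr// in h2.
by apply: floor_def; rewrite rmorphD/=; apply/andP; split; lra.
Qed.

Lemma measurable_rnd_preimage eps (j : int) : 0 < eps ->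
  measurable ([set x | rnd eps x = j] : set R).
Proof. by move=> e0; rewrite rnd_preimage//; exact: measurable_itv. Qed.

Lemma measurable_rnd_comp D eps v : measurable D -> 0 < eps ->
  (forall j, measurable_fun D (v ^~ j)) ->
  measurable_fun (D `*` setT : set (R * R)) (fun z : R * R => v z.1 (rnd eps z.2)).
Proof.
move=> mD e0 mv _ Y mY.
have -> : (D `*` setT) `&` (fun z : R * R => v z.1 (rnd eps z.2)) @^-1` Y =
    \bigcup_j ((D `&` (v ^~ j) @^-1` Y) `*` [set x | rnd eps x = j]).
  apply/seteqP; split => [[t x] /= [[Dt _] Yt]|[t x] [j _ /= [[Dt Yt] xj]]].
    by exists (rnd eps x).
  by split => //; rewrite /= xj.
apply: countable_bigcupT_measurable; first exact: countableP.
move=> j.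
by apply: measurableX; [exact: mv|exact: measurable_rnd_preimage].
Qed.

Lemma rnd_dist eps x : 0 < eps -> `|eps * (rnd eps x)%:~R - x| <= eps.
Proof.
move=> e0; have /andP[a b] := rnd_itv x e0; rewrite !mulrDr in a b.
by rewrite ler_norml; apply/andP; split; lra.
Qed.

(** For the product sigma-algebra: rounding the second coordinate to cells of size 1 / (n+1) gives
    measurable functions that converge pointwise by continuity. *)
Lemma measurable_continuous2 (f : R * R -> R) : continuous f -> measurable_fun setT f.
Proof.
move=> cf; pose h n : R := n.+1%:R^-1.
have h0 n : 0 < h n by rewrite invr_gt0.
apply: (@measurable_fun_cvg _ _ _ _ (fun n z => f (z.1, h n * (rnd (h n) z.2)%:~R))).
  move=> n; rewrite -setXTT.
  apply: (@measurable_rnd_comp setT _ (fun t j => f (t, h n * j%:~R))) => // j.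
  apply: continuous_measurable_fun => t.
  apply: (@continuous_comp _ _ _ (fun t => (t, h n * j%:~R)) f); last exact: cf.
  exact: (cvg_pair (@cvg_id _ (nbhs t)) (cvg_cst _)).
move=> [t x] _ /=.
apply: (@cvg_comp _ _ _ (fun n => (t, h n * (rnd (h n) x)%:~R)) f _ (nbhs (t, x))); last exact: cf.
suff cx : h n * (rnd (h n) x)%:~R @[n --> \oo] --> x by exact: (cvg_pair (cvg_cst t) cx).
apply/cvgrPdist_le => ep ep0; have /cvgrPdist_le /(_ _ ep0) := @cvg_harmonic R.
apply: filterS => n /=; rewrite sub0r normrN => /(le_trans (ler_norm _)) hn.
by rewrite distrC (le_trans (rnd_dist _ (h0 n))).
Qed.

End step_measurability.

(** * Translation invariance of the Lebesgue measure *)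

Section translation.
Context {R : realType}.

Definition shift_by (a : R) (x : measurableTypeR R) : measurableTypeR R := x + a.

Lemma measurable_shift_by (a : R) : measurable_fun setT (shift_by a).
Proof.
by apply: continuous_measurable_fun => x; apply: cvgD; [exact: cvg_id|exact: cvg_cst].
Qed.

HB.instance Definition _ a := isMeasurableFun.Build _ _ _ _ (shift_by a) (measurable_shift_by a).

Lemma lebesgue_measure_shift (a : R) (A : set R) : measurable A ->
  pushforward leb1 (shift_by a) A = leb1 A.
Proof.
move=> mA; apply/esym; apply: (@lebesgue_measure_unique _ (pushforward leb1 (shift_by a))) => // _ [[x y]] _ <-.
transitivity (leb1 (`](x - a), (y - a)]%classic : set R)); last first.
  congr (lebesgue_measure _).
  by apply/seteqP; split => z /=; rewrite /shift_by !in_itv/= => /andP[h1 h2]; apply/andP; split; lra.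
rewrite !lebesgue_measure_itv/= !lte_fin ltrD2r.
by case: ifPn => // _; rewrite -!EFinB; congr EFin; ring.
Qed.

Lemma Rintegral_shift (a : R) (f : R -> R) : measurable_fun setT f ->
  leb1.-integrable setT (EFin \o (fun x => f (x + a))) ->
  \int[leb1]_x f (x + a) = \int[leb1]_x f x.
Proof.
move=> mf intf; congr fine.
transitivity (\int[pushforward leb1 (shift_by a)]_x (f x)%:E)%E.
  rewrite (@integral_pushforward _ _ _ _ _ (shift_by a) (measurable_shift_by a))//.
  exact/measurable_EFinP.
by apply: eq_measure_integral => //= A mA _; exact: lebesgue_measure_shift.
Qed.

End translation.

(** * Bounded functions supported in a box *)

Section box_functions.
Context {R : realType}.
Implicit Types (f g : R * R -> R) (X M : R).

Local Notation R2 := (measurableTypeR R * measurableTypeR R)%type.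

Definition box X : set R2 := `]-X, X[%classic `*` `]-X, X[%classic.

(** This class is closed under sums, multiples and translations up to a change of [X] and [M], and
    Fubini's theorem and dominated convergence hold in it without further conditions. *)
Definition box_fun X M f := [/\ measurable_fun (setT : set R2) f, forall z, `|f z| <= M &
  forall z, f z != 0 -> box X z].

Lemma boxE X z : box X z <-> `|z.1| < X /\ `|z.2| < X.
Proof. by rewrite /box /= !in_itv/= !ltr_norml; split. Qed.

Lemma measurable_box X : measurable (box X).
Proof. by apply: measurableX; exact: measurable_itv. Qed.

Lemma box_leb2 X : 0 < X -> leb2 (box X) = ((2 * X) ^+ 2)%:E.
Proof. by move=> X0; rewrite box_measure; [congr EFin; ring|lra|lra]. Qed.

Lemma box_lty X : (leb2 (box X) < +oo)%E.
Proof.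
have [X0|X0] := ltP 0 X; first by rewrite box_measure ?ltry//; lra.
suff -> : box X = set0 by rewrite measure0.
apply/seteqP; split => // z /boxE[/(le_lt_trans (normr_ge0 _)) h _].
by move: h; rewrite ltNge X0.
Qed.

Lemma box_fun_patch X M f : box_fun X M f -> f = f \_ (box X).
Proof.
move=> [_ _ fb]; apply/funext => z; rewrite patchE; case: ifPn => //.
move=> /negP h; apply/eqP; apply: contra_notT h => /fb bz; exact/mem_set.
Qed.

Lemma box_fun_integrable X M f : box_fun X M f -> leb2.-integrable setT (EFin \o f).
Proof.
move=> bf; have [mf fM _] := bf; rewrite (box_fun_patch bf).
rewrite (_ : EFin \o _ = (EFin \o f) \_ (box X)); last first.
  by apply/funext => z; rewrite /= !patchE; case: ifP.
apply/(integrable_mkcond _ (measurable_box X)).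
apply: measurable_bounded_integrable; [exact: measurable_box|exact: box_lty| |].
  exact: measurable_funTS.
rewrite /bounded_near; near=> N => z _ /=; apply: (le_trans (fM z)).
by near: N; apply: nbhs_pinfty_ge; exact: num_real.
Unshelve. all: by end_near. Qed.

Lemma compact_support_integrable X M (f : R -> R) : measurable_fun setT f -> (forall x, `|f x| <= M) ->
  (forall x, f x != 0 -> `|x| < X) -> leb1.-integrable setT (EFin \o f).
Proof.
move=> mf fM fb; pose Y := - X.
rewrite (_ : EFin \o _ = (EFin \o f) \_ `]Y, X[); last first.
  apply/funext => x; rewrite patchE /=; case: ifPn => // /negP xX; congr EFin.
  apply/eqP; apply: contra_notT xX => /fb h; apply/mem_set.
  by rewrite /= in_itv/= -ltr_norml.
have mI : measurable (`]Y, X[%classic : set (measurableTypeR R)) by exact: measurable_itv.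
apply/(integrable_mkcond _ mI); apply: measurable_bounded_integrable => //.
- have h : (lebesgue_measure (`]Y, X[%classic : set R) < +oo)%E.
    by rewrite lebesgue_measure_itv; case: ifP => //= _; rewrite -EFinB ltry.
  exact: h.
- exact: measurable_funTS.
rewrite /bounded_near; near=> N => z _ /=; apply: (le_trans (fM _)).
by near: N; apply: nbhs_pinfty_ge; exact: num_real.
Unshelve. all: by end_near. Qed.

Lemma box_fun_slice1 X M f t : box_fun X M f ->
  leb1.-integrable setT (EFin \o (fun x => f (t, x))).
Proof.
move=> [mf fM fb]; apply: (@compact_support_integrable X M) => [|x|x /fb/boxE[]//]; last exact: fM.
by apply: measurableT_comp mf _; exact: pair1_measurable.
Qed.

Lemma box_fun_swap X M f : box_fun X M f -> box_fun X M (fun z => f (z.2, z.1)).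
Proof.
move=> [mf fM fb]; split => //.
  apply: measurableT_comp mf _; apply: measurable_fun_pair.
    exact: measurable_snd.
  exact: measurable_fst.
by move=> z /fb /boxE[/= h1 h2]; apply/boxE.
Qed.

Lemma box_fun_slice2 X M f x : box_fun X M f ->
  leb1.-integrable setT (EFin \o (fun t => f (t, x))).
Proof. by move=> bf; have := box_fun_slice1 x (box_fun_swap bf). Qed.

Lemma box_fun_Fubini1 X M f : box_fun X M f ->
  \int[leb1]_t \int[leb1]_x f (t, x) = \int[leb2]_z f z.
Proof.
move=> bf; rewrite /Rintegral -(integral12_prod_meas1 (box_fun_integrable bf)).
congr fine; apply: eq_integral => t _; rewrite fineK//.
by apply: integrable_fin_num => //; exact: box_fun_slice1 bf.
Qed.

Lemma box_fun_Fubini2 X M f : box_fun X M f ->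
  \int[leb1]_x \int[leb1]_t f (t, x) = \int[leb2]_z f z.
Proof.
move=> bf; rewrite /Rintegral -(integral21_prod_meas1 (box_fun_integrable bf)).
congr fine; apply: eq_integral => t _; rewrite fineK//.
by apply: integrable_fin_num => //; exact: box_fun_slice2 bf.
Qed.

Lemma box_fun_patchM D X M N (F f : R * R -> R) : measurable (D : set R2) ->
  measurable_fun (D : set R2) F -> measurable_fun (setT : set R2) f -> 0 <= M ->
  (forall z, D z -> `|F z| <= M) -> (forall z, `|f z| <= N) ->
  (forall z, f z != 0 -> box X z) -> box_fun X (M * N) ((fun z => F z * f z) \_ D).
Proof.
move=> mD mF mf M0 hM hN hX; have N0 : 0 <= N by rewrite (le_trans _ (hN 0)).
split => [|z|z]; rewrite ?patchE.
- apply/(measurable_restrictT _ mD); apply: measurable_funM => //.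
  exact: measurable_funTS.
- case: ifPn => [/set_mem zD|_]; last by rewrite normr0 mulr_ge0.
  by rewrite normrM ler_pM// hM.
- by case: ifPn => _; rewrite ?eqxx// mulf_eq0 negb_or => /andP[_ /hX].
Qed.

Lemma box_funD X M N f g : box_fun X M f -> box_fun X N g ->
  box_fun X (M + N) (fun z => f z + g z).
Proof.
move=> [mf fM fb] [mg gN gb]; split => [|z|z].
- exact: measurable_funD.
- by rewrite (le_trans (ler_normD _ _))// lerD.
- by have [->|/fb//] := eqVneq (f z) 0; rewrite add0r; exact: gb.
Qed.

Lemma box_funZ X M (c : R) f : box_fun X M f -> box_fun X (`|c| * M) (fun z => c * f z).
Proof.
move=> [mf fM fb]; split => [|z|z]; rewrite ?normrM ?ler_wpM2l//.
  by apply: measurable_funM => //; exact: measurable_cst.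
by rewrite mulf_eq0 negb_or => /andP[_ /fb].
Qed.

Lemma box_fun_wider X Y M N f : X <= Y -> M <= N -> box_fun X M f -> box_fun Y N f.
Proof.
move=> XY MN [mf fM fb]; split => // z; first by rewrite (le_trans (fM z)).
move=> /fb/boxE[h1 h2]; apply/boxE; split; exact: lt_le_trans XY.
Qed.

Lemma box_fun_shift X M f (a : R) : box_fun X M f ->
  box_fun (X + `|a|) M (fun z => f (z.1, z.2 + a)).
Proof.
move=> [mf fM fb]; split => // [|z].
  apply: measurableT_comp mf _; apply: measurable_fun_pair; first exact: measurable_fst.
  exact: measurableT_comp (measurable_shift_by a) measurable_snd.
move=> /fb/boxE[/= h1 h2]; apply/boxE; split.
  by rewrite (lt_le_trans h1)// lerDl.
rewrite -[z.2](addrK a); apply: (le_lt_trans (ler_normB _ _)).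
by rewrite ltrD2r.
Qed.

Lemma box_fun_Rintegral_shift X M f a : box_fun X M f ->
  \int[leb2]_z f (z.1, z.2 + a) = \int[leb2]_z f z.
Proof.
move=> bf; have [mf _ _] := bf.
rewrite -(box_fun_Fubini1 (box_fun_shift a bf)) -(box_fun_Fubini1 bf).
apply: eq_Rintegral => t _; apply: (@Rintegral_shift _ a (fun x => f (t, x))).
  by apply: measurableT_comp mf _; exact: pair1_measurable.
exact: (box_fun_slice1 t (box_fun_shift a bf)).
Qed.

Lemma box_fun_RintegralD X M N f g : box_fun X M f -> box_fun X N g ->
  \int[leb2]_z (f z + g z) = \int[leb2]_z f z + \int[leb2]_z g z.
Proof. by move=> /box_fun_integrable h1 /box_fun_integrable h2; rewrite RintegralD. Qed.

Lemma box_fun_RintegralZ X M (c : R) f : box_fun X M f ->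
  \int[leb2]_z (c * f z) = c * \int[leb2]_z f z.
Proof. by move=> /box_fun_integrable h1; rewrite RintegralZl. Qed.

Lemma box_fun_cvg X M N (f : nat -> R * R -> R) g : (forall n, box_fun X M (f n)) ->
  box_fun X N g ->
  {ae leb2, forall z, f n z @[n --> \oo] --> g z} ->
  \int[leb2]_z f n z @[n --> \oo] --> \int[leb2]_z g z.
Proof.
move=> bf [mg gN gb] fg.
have bM : box_fun X M ((fun=> M) \_ (box X)).
  have M0 : 0 <= M by have [_ h _] := bf 0%N; rewrite (le_trans _ (h 0)).
  split => [|z|z]; rewrite ?patchE.
  - by apply/(measurable_restrictT _ (measurable_box X)); exact: measurable_cst.
  - by case: ifP => _; rewrite ?normr0// ger0_norm.
  - by case: ifPn => [/set_mem|]; rewrite ?eqxx.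
have iM := box_fun_integrable bM.
have [||||||_ _] := @dominated_convergence _ _ _ leb2 setT _ (fun n => EFin \o f n)
   (EFin \o g) (EFin \o ((fun=> M) \_ (box X))).
- exact: measurableT.
- by move=> n; have [mf _ _] := bf n; exact/measurable_EFinP.
- exact/measurable_EFinP.
- by apply: ae_imp fg => z fz _; apply: cvg_EFin => //; exact: nearW.
- exact: iM.
- apply: aeW => z n _ /=; have [_ fM fb] := bf n; rewrite lee_fin patchE.
  by case: ifPn => // /negP zX; rewrite [f n z](_ : _ = 0) ?normr0//;
    apply/eqP; apply: contra_notT zX => /fb ?; exact/mem_set.
- move=> h; apply: fine_cvg; rewrite fineK; first exact: h.
  apply: integrable_fin_num => //; apply: box_fun_integrable; exact: (And3 mg gN gb).
Qed.

(** The box is split into a window of small measure, where only the crude bound [b] is known, and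
    its complement, where the small bound [a] holds. *)
Lemma box_fun_window X M (a b w : R) (W : set R2) f : measurable W -> 0 < X -> 0 <= a -> 0 <= b ->
  (leb2 W <= w%:E)%E -> box_fun X M f -> (forall z, ~ W z -> `|f z| <= a) ->
  (forall z, W z -> `|f z| <= b) ->
  (\int[leb2]_z `|(f z)%:E| <= (a * (2 * X) ^+ 2 + b * w)%:E)%E.
Proof.
move=> mW X0 a0 b0 hw bf ha hb; have [mf fM fb] := bf.
pose h1 z := (a * \1_(box X) z)%:E; pose h2 z := (b * \1_W z)%:E.
have m1 : measurable_fun (setT : set R2) h1.
  by apply/measurable_EFinP; apply: measurable_funM; [exact: measurable_cst|exact: measurable_indic (measurable_box X)].
have m2 : measurable_fun (setT : set R2) h2.
  by apply/measurable_EFinP; apply: measurable_funM; [exact: measurable_cst|exact: measurable_indic].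
have p1 z : (0 <= h1 z)%E by rewrite lee_fin mulr_ge0.
have p2 z : (0 <= h2 z)%E by rewrite lee_fin mulr_ge0.
apply: (@le_trans _ _ (\int[leb2]_z (h1 z + h2 z))%E).
  apply: ge0_le_integral => //.
  - by apply: measurableT_comp => //; exact/measurable_EFinP.
  - exact: emeasurable_funD.
  - move=> z _ /=; rewrite -EFinD lee_fin !indicE.
    have [/mem_set zW|zW] := pselect (W z).
      rewrite zW mulr1 ler_wpDl ?mulr_ge0// hb//; exact/set_mem.
    rewrite (memNset zW) mulr0 addr0.
    have [->|/fb/mem_set ->] := eqVneq (f z) 0; first by rewrite normr0 mulr_ge0.
    by rewrite mulr1 ha.
rewrite ge0_integralD// EFinD; apply: leeD.
  under eq_integral do rewrite /h1 EFinM.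
  rewrite ge0_integralZl//; last first.
    by apply/measurable_EFinP; exact: measurable_indic (measurable_box X).
  rewrite integral_indic//; last exact: measurable_box.
  rewrite setIT [Y in (_ * Y)%E](_ : _ = ((2 * X) ^+ 2)%:E) ?EFinM//.
  exact: box_leb2.
under eq_integral do rewrite /h2 EFinM.
rewrite ge0_integralZl//; last first.
  by apply/measurable_EFinP; exact: measurable_indic.
by rewrite integral_indic// setIT EFinM lee_wpmul2l.
Qed.

End box_functions.

Lemma integrable_within_itv {R : realType} (f : R -> R) (a b : R) :
  {within `[a, b], continuous f} -> leb1.-integrable `[a, b] (EFin \o f).
Proof. by move=> cf; apply: continuous_compact_integrable => //; exact: segment_compact. Qed.

(** * The weak formulation *)

Section weak_pairs.
Context {R : realType}.
Variables (T : R) (phi dphi : R -> R).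
Hypothesis T0 : 0 < T.
Hypothesis dphiP : forall t : R, is_derive t 1 phi (dphi t).
Hypothesis dphi_cont : continuous dphi.
Hypotheses (phi0 : phi 0 = 0) (phiT : phi T = 0).
Implicit Types (u l w : R -> R) (a b : R).

Let phi_cont : continuous phi.
Proof. by move=> t; have [h _] := dphiP t; apply/differentiable_continuous/derivable1_diffP. Qed.

Lemma heat_by_parts w l a b : a < b -> phi b = 0 ->
  {within `[a, b], continuous w} -> {within `[a, b], continuous l} ->
  (forall t, a < t < b -> is_derive t 1 w (l t)) ->
  \int[leb1]_(t in `[a, b]) (w t * dphi t) =
  - w a * phi a - \int[leb1]_(t in `[a, b]) (l t * phi t).
Proof.
move=> ab pb cw cl dw.
have [w1 w2 w3] : [/\ {in `]a, b[, continuous w}, w x @[x --> a^'+] --> w a &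
    w x @[x --> b^'-] --> w b] by apply/continuous_within_itvP.
rewrite (@Rintegration_by_parts _ w phi l dphi a b)//.
- by rewrite pb mulr0 sub0r mulNr.
- split => //.
  by move=> t; rewrite in_itv/= => /dw[].
- by move=> t; rewrite in_itv/= => /dw[_ <-]; rewrite derive1E.
- exact: continuous_within.
- split; first by move=> t _; have [] := dphiP t.
    by apply: cvg_at_right_filter; exact: phi_cont.
  by apply: cvg_at_left_filter; exact: phi_cont.
- by move=> t _; rewrite derive1E; have [_ <-] := dphiP t.
Qed.

(** The derivative of u is l on (0, T) when tested against the one function phi; u may be a sum of
    parts with jumps. The relation is additive, so it can be verified kernel by kernel. *)
Definition weak_pair u l := [/\ leb1.-integrable `[0, T] (EFin \o (fun t => u t * dphi t)),
  leb1.-integrable `[0, T] (EFin \o (fun t => l t * phi t)) &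
  \int[leb1]_(t in `[0, T]) (u t * dphi t) = - \int[leb1]_(t in `[0, T]) (l t * phi t)].

Let mT : measurable (`[0, T]%classic : set (measurableTypeR R)).
Proof. exact: measurable_itv. Qed.

Lemma weak_pairD u l u' l' : weak_pair u l -> weak_pair u' l' ->
  weak_pair (fun t => u t + u' t) (fun t => l t + l' t).
Proof.
move=> [i1 i2 E] [j1 j2 E'].
have D (f g h : R -> R) : leb1.-integrable `[0, T] (EFin \o (fun t => f t * h t)) ->
    leb1.-integrable `[0, T] (EFin \o (fun t => g t * h t)) ->
    leb1.-integrable `[0, T] (EFin \o (fun t => (f t + g t) * h t)) /\
    \int[leb1]_(t in `[0, T]) ((f t + g t) * h t) =
    \int[leb1]_(t in `[0, T]) (f t * h t) + \int[leb1]_(t in `[0, T]) (g t * h t).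
  move=> k1 k2; have E0 : (fun t => (f t + g t) * h t) = (fun t => f t * h t + g t * h t).
    by apply/funext => t; rewrite mulrDl.
  rewrite E0; split; last by rewrite RintegralD.
  exact: (integrableD mT k1 k2).
have [a1 a2] := D _ _ _ i1 j1; have [b1 b2] := D _ _ _ i2 j2.
by split => //; rewrite a2 b2 E E' opprD.
Qed.

Lemma weak_pair_cst (c : R) : weak_pair (fun=> c) (fun=> 0).
Proof.
have ic : leb1.-integrable `[0, T] (EFin \o (fun t => c * dphi t)).
  apply: (@integrable_within_itv _ (fun t => c * dphi t)).
  apply: continuous_within => t.
  by apply: cvgM; [exact: cvg_cst|exact: dphi_cont].
have i0 : leb1.-integrable `[0, T] (EFin \o (fun t => 0 * phi t)).
  apply: (@integrable_within_itv _ (fun t => 0 * phi t)).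
  apply: continuous_within => t.
  by apply: cvgM; [exact: cvg_cst|exact: phi_cont].
split => //.
rewrite (@heat_by_parts (fun=> c) (fun=> 0) 0 T)// ?phi0 ?mulr0 ?sub0r//.
- by apply: continuous_within => t; exact: cvg_cst.
- by apply: continuous_within => t; exact: cvg_cst.
Qed.

Lemma weak_pair_eq u l u' l' : (forall t, 0 <= t <= T -> u t = u' t) ->
  (forall t, 0 <= t <= T -> l t = l' t) -> weak_pair u l -> weak_pair u' l'.
Proof.
move=> uu ll [i1 i2 E]; split.
- apply: eq_integrable i1 => // t; rewrite inE/= in_itv/= => t0.
  by rewrite /= uu.
- apply: eq_integrable i2 => // t; rewrite inE/= in_itv/= => t0.
  by rewrite /= ll.
- transitivity (\int[leb1]_(t in `[0, T]) (u t * dphi t)).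
    by apply: eq_Rintegral => t; rewrite inE/= in_itv/= => t0; rewrite uu.
  rewrite E; congr (- _).
  by apply: eq_Rintegral => t; rewrite inE/= in_itv/= => t0; rewrite ll.
Qed.

Lemma weak_pair_sum (I : eqType) (r : seq I) (u l : I -> R -> R) :
  {in r, forall i, weak_pair (u i) (l i)} ->
  weak_pair (fun t => \sum_(i <- r) u i t) (fun t => \sum_(i <- r) l i t).
Proof.
elim: r => [_|i r IH h].
  have -> : (fun t => \sum_(i <- [::]) u i t) = (fun=> 0) by apply/funext => t; rewrite big_nil.
  have -> : (fun t => \sum_(i <- [::]) l i t) = (fun=> 0) by apply/funext => t; rewrite big_nil.
  exact: weak_pair_cst.
have -> : (fun t => \sum_(i <- i :: r) u i t) = (fun t => u i t + \sum_(i <- r) u i t).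
  by apply/funext => t; rewrite big_cons.
have -> : (fun t => \sum_(i <- i :: r) l i t) = (fun t => l i t + \sum_(i <- r) l i t).
  by apply/funext => t; rewrite big_cons.
apply: weak_pairD; first by apply: h; rewrite inE eqxx.
by apply: IH => k kr; apply: h; rewrite inE kr orbT.
Qed.

(** A function switched on at time [a] produces no boundary term there if it starts from 0 or if phi
    vanishes; at the final time phi vanishes. *)
Lemma weak_pair_from w l a : 0 <= a < T -> (w a * phi a = 0) ->
  {within `[a, T], continuous w} -> {within `[a, T], continuous l} ->
  (forall t, a < t < T -> is_derive t 1 w (l t)) ->
  weak_pair (fun t => (a <= t)%R%:R * w t) (fun t => (a <= t)%R%:R * l t).
Proof.
move=> /andP[a0 aT] wa cw cl dw.
have ma : measurable (`[a, T]%classic : set (measurableTypeR R)) by exact: measurable_itv.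
have E (f h : R -> R) : (EFin \o (fun t => (a <= t)%R%:R * f t * h t)) \_ `[0, T] =
    (EFin \o (fun t => f t * h t)) \_ `[a, T].
  apply/funext => t; rewrite !patchE !mem_setE !in_itv/=.
  have [at_|ta] := leP a t; first by rewrite (le_trans a0 at_)/= (_ : true%:R = 1 :> R)// mul1r.
  by rewrite /= (_ : false%:R = 0 :> R)// !mul0r; case: ifP.
have key (f h : R -> R) : {within `[a, T], continuous f} -> continuous h ->
   leb1.-integrable `[0, T] (EFin \o (fun t => (a <= t)%R%:R * f t * h t)) /\
   \int[leb1]_(t in `[0, T]) ((a <= t)%R%:R * f t * h t) = \int[leb1]_(t in `[a, T]) (f t * h t).
  move=> cf ch; split.
    apply/(integrable_mkcond _ mT); rewrite E; apply/(integrable_mkcond _ ma).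
    apply: (@integrable_within_itv _ (fun t => f t * h t)).
    by apply: within_continuousM => //; exact: continuous_within.
  rewrite /Rintegral [in LHS]integral_mkcond [in RHS]integral_mkcond; congr fine.
  by apply: eq_integral => t _; rewrite -[RHS](congr1 (@^~ t) (E f h)).
have [k1 k2] := key w dphi cw dphi_cont; have [k3 k4] := key l phi cl phi_cont.
split => //; rewrite k2 k4 (heat_by_parts aT phiT cw cl dw).
by rewrite mulNr wa oppr0 sub0r.
Qed.

End weak_pairs.

(** * The weak equation at a single site *)

Section site_identity.
Context {R : realType}.
Variables (tfin eps : R) (q : R -> int -> R) (K : nat) (S : nat -> R).
Hypotheses (tfin_gt0 : 0 < tfin) (eps0 : 0 < eps).
Hypothesis qsol : forall b, heat_sol 0 b q.
Hypothesis S_itv : forall k, (1 <= k <= K)%N -> 0 < S k < tfin / eps ^+ 2.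
Variables (phi dphi : R -> R).
Hypothesis dphiP : forall t : R, is_derive t 1 phi (dphi t).
Hypothesis dphi_cont : continuous dphi.
Hypotheses (phi0 : phi 0 = 0) (phiT : phi tfin = 0).

(* sgn(xi - j) at a fixed site, written as its initial value plus jumps. *)
Definition site_sign (t : R) (j : int) : R :=
  (if (0 < j)%R then -1 else 1) + 2 * \sum_(1 <= k < K.+1) (S k <= t)%R%:R * (j == k%:Z)%:R.

Definition site_value (t : R) (j : int) : R :=
  q t j - 2 * \sum_(1 <= k < K.+1) zkernel (t - S k) (j - k%:Z).

Let e2 : 0 < eps ^+ 2. Proof. exact: exprn_gt0. Qed.

Lemma is_derive_scale (f : R -> R) (t l s : R) : is_derive (t / eps ^+ 2 - s) 1 f l ->
  is_derive t 1 (fun t => f (t / eps ^+ 2 - s)) ((eps ^+ 2)^-1 * l).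
Proof.
move=> h.
have h1 : is_derive t 1 (fun t : R => t / eps ^+ 2 - s) ((eps ^+ 2)^-1).
  apply: is_derive_eq; rewrite /GRing.scale/= mulr0 add0r mulr1 subr0//.
by have := @is_derive1_comp _ f _ t _ _ h h1; rewrite mulrC.
Qed.

Lemma within_scale (f : R -> R) (s a b : R) :
  {within `[a / eps ^+ 2 - s, b / eps ^+ 2 - s], continuous f} ->
  {within `[a, b], continuous (fun t => f (t / eps ^+ 2 - s))}.
Proof.
move=> /within_epsP h; apply/within_epsP => t tab ep ep0.
have sc x y : x <= y -> x / eps ^+ 2 - s <= y / eps ^+ 2 - s.
  by move=> xy; rewrite lerD2r ler_pM2r// invr_gt0.
have img y : `[a, b]%classic y -> `[a / eps ^+ 2 - s, b / eps ^+ 2 - s]%classic (y / eps ^+ 2 - s).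
  by rewrite /= !in_itv/= => /andP[/sc -> /sc ->].
have [dl dl0 hd] := h _ (img _ tab) _ ep0.
exists (dl * eps ^+ 2); first by rewrite mulr_gt0.
move=> y yab yt; apply: hd; first exact: img.
have -> : y / eps ^+ 2 - s - (t / eps ^+ 2 - s) = (y - t) / eps ^+ 2 by ring.
rewrite normrM normfV (gtr0_norm e2).
by rewrite ltr_pdivrMr.
Qed.

Lemma lapl_shift (F : int -> R) (k j : int) : lapl (fun j => F (j - k)) j = lapl F (j - k).
Proof. by rewrite /lapl (addrAC j 1) (addrAC j (-1)). Qed.

Lemma laplB (F G : int -> R) j : lapl (fun j => F j - G j) j = lapl F j - lapl G j.
Proof. by rewrite /lapl; ring. Qed.

Lemma lapl_sum (r : seq nat) (F : nat -> int -> R) j :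
  lapl (fun j => \sum_(k <- r) F k j) j = \sum_(k <- r) lapl (F k) j.
Proof. by rewrite /lapl mulr_sumr -sumrB -big_split. Qed.

(** At the k-th transition p jumps by -2 and the sign by 2, both at site k. Their sum, which is u,
    is continuous, so integration by parts leaves only the Laplacian. *)
Lemma site_weak_pair j : weak_pair tfin phi dphi
  (fun t => site_value (t / eps ^+ 2) j + site_sign (t / eps ^+ 2) j)
  (fun t => (eps ^+ 2)^-1 * lapl (site_value (t / eps ^+ 2)) j).
Proof.
have e20 := e2.
pose gk k t := heat_kernel (t / eps ^+ 2 - S k) (j - k%:Z).
pose lk k t := (eps ^+ 2)^-1 * lapl (heat_kernel (t / eps ^+ 2 - S k)) (j - k%:Z).
(* The jump of the sign is grouped with the kernel that starts at the same time; the difference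
   vanishes there, since the kernel starts as the Kronecker delta. *)
pose wk k t := -2 * (gk k t - (j == k%:Z)%:R).
pose uk k t := (eps ^+ 2 * S k <= t)%R%:R * wk k t.
pose vk k t := (eps ^+ 2 * S k <= t)%R%:R * (-2 * lk k t).
have dgk k (t : R) : is_derive t 1 (gk k) (lk k t).
  exact: (@is_derive_scale (fun s => heat_kernel s (j - k%:Z)) t _ (S k) (heat_kernel_derive _ _)).
have cgk (i : int) (s : R) : continuous (fun t : R => heat_kernel (t / eps ^+ 2 - s) i).
  move=> t; have [h _] := @is_derive_scale (fun s => heat_kernel s i) t _ s (heat_kernel_derive _ _).
  exact/differentiable_continuous/derivable1_diffP.
have cmul (c : R) (f : R -> R) : continuous f -> continuous (fun t => c * f t).
  by move=> cf t; apply: cvgM; [exact: cvg_cst|exact: cf].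
have clk k : continuous (lk k).
  apply: (cmul _) => t; rewrite /lapl; apply: cvgD; last exact: cgk.
  by apply: cvgB; [exact: cgk|exact: (cmul _ _ (cgk _ _))].
have kpair k : k \in index_iota 1 K.+1 -> weak_pair tfin phi dphi (uk k) (vk k).
  rewrite mem_index_iota ltnS => /S_itv/andP[S0 ST].
  apply: weak_pair_from => //.
  - by rewrite mulr_ge0 ?(ltW e20) ?(ltW S0)//= mulrC -ltr_pdivlMr.
  - have E : eps ^+ 2 * S k / eps ^+ 2 = S k by rewrite [_ * S k]mulrC mulfK// gt_eqF.
    by rewrite /wk /gk E subrr heat_kernel0 subr_eq0 subrr mulr0 mul0r.
  - apply: continuous_within; apply: (cmul _) => t; apply: cvgB; first exact: cgk.
    exact: cvg_cst.
  - by apply: continuous_within; apply: (cmul _); exact: clk.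
  - move=> t _; have h := is_deriveZ (-2) (is_deriveB (dgk k t) (is_derive_cst ((j == k%:Z)%:R : R) t 1)).
    by apply: is_derive_eq h _; rewrite subr0.
pose uq t := (0 <= t)%R%:R * q (t / eps ^+ 2) j.
pose vq t := (0 <= t)%R%:R * ((eps ^+ 2)^-1 * lapl (q (t / eps ^+ 2)) j).
have cq i : {within `[0, tfin], continuous (fun t => q (t / eps ^+ 2) i)}.
  have [_ cq _] := qsol (tfin / eps ^+ 2).
  have := @within_scale (fun t => q t i) 0 0 tfin; rewrite mul0r !subr0.
  move=> /(_ (cq i)); rewrite (_ : (fun t => q (t / eps ^+ 2 - 0) i) = (fun t => q (t / eps ^+ 2) i))//.
  by apply/funext => t; rewrite subr0.
have qpair : weak_pair tfin phi dphi uq vq.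
  apply: weak_pair_from => //.
  - by rewrite lexx.
  - by rewrite phi0 mulr0.
  - apply: within_continuousM; first exact: within_continuous_cst.
    rewrite /lapl; apply: within_continuousD; last exact: cq.
    apply: within_continuousD; first exact: cq.
    by apply: within_continuousN; apply: within_continuousM; [exact: within_continuous_cst|exact: cq].
  - move=> t /andP[t0 tt]; have [_ _ dq] := qsol (tfin / eps ^+ 2).
    have h := dq (t / eps ^+ 2) j; rewrite divr_gt0// ltr_pM2r ?invr_gt0// tt in h.
    have := @is_derive_scale (fun s => q s j) t _ 0; rewrite subr0 => /(_ _ (h isT)).
    rewrite (_ : (fun t => q (t / eps ^+ 2 - 0) j) = (fun t => q (t / eps ^+ 2) j))//.
    by apply/funext => s; rewrite subr0.
pose cs : R := if (0 < j)%R then -1 else 1.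
have := weak_pairD (weak_pairD qpair (weak_pair_cst tfin_gt0 dphiP dphi_cont phi0 phiT cs))
  (weak_pair_sum tfin_gt0 dphiP dphi_cont phi0 phiT kpair).
apply: weak_pair_eq => t /andP[t0 tt].
  rewrite /uq t0 (_ : true%:R = 1 :> R)// mul1r /site_value /site_sign -/cs.
  have -> : \sum_(i <- index_iota 1 K.+1) uk i t =
    2 * \sum_(1 <= k < K.+1) (S k <= t / eps ^+ 2)%R%:R * (j == k%:Z)%:R -
    2 * \sum_(1 <= k < K.+1) zkernel (t / eps ^+ 2 - S k) (j - k%:Z).
    rewrite -mulrBr -sumrB mulr_sumr; apply: eq_bigr => k _.
    rewrite /uk /wk /gk /zkernel subr_lt0 ltNge ler_pdivlMr// [S k * _]mulrC.
    move: (heat_kernel _ _) ((j == k%:Z)%:R : R) => g dl; case: (_ <= t) => /=.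
      by rewrite (_ : true%:R = 1 :> R)//; clear; ring.
    by rewrite (_ : false%:R = 0 :> R)//; clear; ring.
  move: (q _ _) cs (\sum_(_ <= _ < _) _) (\sum_(_ <= _ < _) _) => a b c d'; clear; ring.
rewrite /vq t0 (_ : true%:R = 1 :> R)// mul1r addr0 /site_value laplB laplZ lapl_sum.
rewrite mulrBr; congr (_ + _); rewrite mulrA -mulNr mulr_sumr; apply: eq_bigr => k _.
rewrite /vk /lk (@lapl_shift (zkernel _)).
have -> : zkernel (t / eps ^+ 2 - S k) = fun i => (eps ^+ 2 * S k <= t)%R%:R * heat_kernel (t / eps ^+ 2 - S k) i.
  apply/funext => i; rewrite /zkernel subr_lt0 ltNge ler_pdivlMr// [S k * _]mulrC.
  by move: (heat_kernel _ _) => g; case: (_ <= t) => /=;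
    [exact: esym (mul1r g)|exact: esym (mul0r g)].
rewrite laplZ; have alg (b c x : R) : b * (- 2 * (c * x)) = - (c * 2) * (b * x) by ring.
exact: alg.
Qed.

End site_identity.

(** * Test functions and their derivatives *)

Section test_functions.
Context {R : realType}.
Implicit Types (f g psi : R * R -> R) (z : R * R).

Lemma pair1_is_derive f (t x : R) : derivable f (t, x) ((1, 0) : R * R) ->
  is_derive t 1 (fun t => f (t, x)) (dtau f (t, x)).
Proof.
move=> h; have E : (fun h0 : R => h0^-1 *: ((f \o shift (t, x)) (h0 *: ((1, 0) : R * R)) - f (t, x))) =
    (fun h0 => h0^-1 *: (((fun t => f (t, x)) \o shift t) (h0 *: 1) - f (t, x))).
  apply/funext => k /=; congr (_ *: (f _ - f _)).
  by congr (_, _); rewrite /= /GRing.scale/= mulr0 add0r.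
by apply: DeriveDef; [rewrite /derivable -E|rewrite /dtau /derive -E].
Qed.

Lemma pair2_is_derive f (t x : R) : derivable f (t, x) ((0, 1) : R * R) ->
  is_derive x 1 (fun x => f (t, x)) (dxi f (t, x)).
Proof.
move=> h; have E : (fun h0 : R => h0^-1 *: ((f \o shift (t, x)) (h0 *: ((0, 1) : R * R)) - f (t, x))) =
    (fun h0 => h0^-1 *: (((fun x => f (t, x)) \o shift x) (h0 *: 1) - f (t, x))).
  apply/funext => k /=; congr (_ *: (f _ - f _)).
  by congr (_, _); rewrite /= /GRing.scale/= mulr0 add0r.
by apply: DeriveDef; [rewrite /derivable -E|rewrite /dxi /derive -E].
Qed.

Lemma derive_off_closed (K : set (R * R)) f (v : R * R) : closed K ->
  (forall z, ~ K z -> f z = 0) -> forall z, ~ K z -> 'D_v f z = 0.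
Proof.
move=> cK f0 z Kz.
have nz : \forall w \near z, f w = cst 0 w.
  have := closed_openC cK; rewrite openE => /(_ z Kz); apply: filterS => w; exact: f0.
by rewrite (near_eq_derive v nz) derive_cst.
Qed.

Record test_data (tfin X M : R) psi : Prop := {
  td_X : 0 < X;
  td_c : continuous psi;
  td_ct : continuous (dtau psi);
  td_cx : continuous (dxi psi);
  td_cxx : continuous (dxi (dxi psi));
  td_dt : forall t x : R, is_derive t 1 (fun t => psi (t, x)) (dtau psi (t, x));
  td_dx : forall t x : R, is_derive x 1 (fun x => psi (t, x)) (dxi psi (t, x));
  td_dxx : forall t x : R, is_derive x 1 (fun x => dxi psi (t, x)) (dxi (dxi psi) (t, x));
  td_supp : forall z, ~ (Omega_int tfin z /\ box X z) ->
    [/\ psi z = 0, dtau psi z = 0, dxi psi z = 0 & dxi (dxi psi) z = 0];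
  td_bound : forall z, [/\ `|psi z| <= M, `|dtau psi z| <= M, `|dxi psi z| <= M &
    `|dxi (dxi psi) z| <= M] }.

Lemma test_dataP (tfin : R) psi : test_function tfin psi ->
  exists X M, test_data tfin X M psi.
Proof.
move=> [Cpsi [K [cK KO K0]]].
have [dt1 dx1 ct [_ dx2 _ cxx]] := Cpsi 2%N.
have [_ _ _ cx] := Cpsi 1%N; have c := Cpsi 0%N.
have hK : closed K by apply: compact_closed.
have t0 := derive_off_closed ((1, 0) : R * R) hK K0.
have x0 := derive_off_closed ((0, 1) : R * R) hK K0.
have xx0 := derive_off_closed ((0, 1) : R * R) hK x0.
have ct' : continuous (dtau psi).
  by have [_ _ h _] := Cpsi 1%N.
have bnd g : continuous g -> (forall z, ~ K z -> g z = 0) -> exists2 M : R, 0 <= M & forall z, `|g z| <= M.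
  move=> cg g0.
  have : compact (g @` K) by apply: continuous_compact => //; exact: continuous_subspaceT.
  move=> /compact_bounded[M [_ hM]]; exists (`|M| + 1) => [|z]; first by rewrite addr_ge0.
  have [Kz|Kz] := pselect (K z).
    by apply: (hM (`|M| + 1)); [rewrite (le_lt_trans (ler_norm _))// ltrDl|exists z].
  by rewrite g0// normr0 addr_ge0.
have [M1 M10 h1] := bnd _ c K0; have [M2 M20 h2] := bnd _ ct' t0.
have [M3 M30 h3] := bnd _ cx x0; have [M4 M40 h4] := bnd _ cxx xx0.
have [X hX] : exists X : R, forall z, K z -> `|z| < X.
  have [M [_ hM]] := compact_bounded cK; exists (`|M| + 2) => z Kz.
  apply: (@le_lt_trans _ _ (`|M| + 1)); last by rewrite ltrD2l ltr1n.
  by apply: (hM (`|M| + 1)) => //; rewrite (le_lt_trans (ler_norm _))// ltrDl.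
exists (`|X| + 1), (M1 + M2 + M3 + M4); split.
- by rewrite ltr_wpDl.
- exact: c.
- exact: ct'.
- exact: cx.
- exact: cxx.
- by move=> t x; apply: pair1_is_derive; exact: dt1.
- by move=> t x; apply: pair2_is_derive; exact: dx1.
- by move=> t x; apply: pair2_is_derive; exact: dx2.
- move=> z hz; have Kz : ~ K z.
    move=> Kz; apply: hz; split; first exact: KO.
    have zX := hX z Kz; have XX : `|z| < `|X| + 1.
      by rewrite (lt_le_trans zX)// (le_trans (ler_norm _))// lerDl.
    apply/boxE; split; apply: le_lt_trans XX; rewrite prod_normE/= le_max lexx ?orbT//.
  by split; [exact: K0|exact: t0|exact: x0|exact: xx0].
- by move=> z; split; [apply: (le_trans (h1 z))|apply: (le_trans (h2 z))|
    apply: (le_trans (h3 z))|apply: (le_trans (h4 z))]; lra.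
Qed.

End test_functions.

(** * Second differences of smooth functions *)

Section second_difference.
Context {R : realType}.
Variables (f f1 f2 : R -> R).
Hypothesis df : forall x : R, is_derive x 1 f (f1 x).
Hypothesis df1 : forall x : R, is_derive x 1 f1 (f2 x).

(** The number [c] is free: with c = 0 this bounds the second difference quotient uniformly, with c
    = [f2 x] it proves its convergence. *)
Lemma second_difference (x h B c : R) : 0 <= h ->
  (forall y, x - h <= y <= x + h -> `|f2 y - c| <= B) ->
  `|f (x + h) - 2 * f x + f (x - h) - c * h ^+ 2| <= 2 * B * h ^+ 2.
Proof.
move=> h0 hB.
pose k1 y := f1 y - c * (y - x).
(* A quadratic polynomial with second derivative [c] and slope [f1 x] at [x] is subtracted; the
   derivative of [m] is then at most B h, and the second difference is that of [m]. *)
pose m y := f y - c * 2^-1 * ((y - x) * (y - x)) - f1 x * (y - x).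
have dsub (y : R) : is_derive y 1 (fun y : R => y - x) 1.
  by apply: is_derive_eq; rewrite subr0.
have dk1 (y : R) : is_derive y 1 k1 (f2 y - c).
  have := is_deriveB (df1 y) (is_deriveZ c (dsub y)).
  by rewrite /GRing.scale/= mulr1.
have dm (y : R) : is_derive y 1 m (k1 y - f1 x).
  have h1 := is_deriveZ (c * 2^-1) (is_deriveM (dsub y) (dsub y)).
  have h2 := is_deriveB (is_deriveB (df y) h1) (is_deriveZ (f1 x) (dsub y)).
  have -> : k1 y - f1 x = f1 y - (c * 2^-1) *: ((y - x) *: (1 : R) + (y - x) *: (1 : R)) - f1 x *: (1 : R).
    by rewrite /GRing.scale/= /k1; field.
  exact: h2.
have cont (g g' : R -> R) : (forall y : R, is_derive y 1 g (g' y)) -> continuous g.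
  by move=> dg y; have [hy _] := dg y; apply/differentiable_continuous/derivable1_diffP.
have k1B y : x - h <= y <= x + h -> `|k1 y - f1 x| <= B * h.
  have E : f1 x = k1 x by rewrite /k1 subrr mulr0 subr0.
  have B0 : 0 <= B by rewrite (le_trans _ (hB x _))//; apply/andP; split; lra.
  move=> /andP[y1 y2]; rewrite E; have [xy|/ltW yx] := leP x y.
    apply: (@le_trans _ _ (B * (y - x))); last by rewrite ler_wpM2l//; lra.
    apply: (derivative_bound xy (continuous_within (cont _ _ dk1)) (fun y _ => dk1 y)).
    by move=> w /andP[w1 w2]; apply: hB; apply/andP; split; lra.
  apply: (@le_trans _ _ (B * (x - y))); last by rewrite ler_wpM2l//; lra.
  rewrite distrC.
  apply: (derivative_bound yx (continuous_within (cont _ _ dk1)) (fun y _ => dk1 y)).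
  by move=> w /andP[w1 w2]; apply: hB; apply/andP; split; lra.
have mB a b : x - h <= a -> a <= b -> b <= x + h -> `|m b - m a| <= B * h * (b - a).
  move=> xa ab bx.
  apply: (derivative_bound ab (continuous_within (cont _ _ dm)) (fun y _ => dm y)).
  by move=> w /andP[w1 w2]; apply: k1B; apply/andP; split; lra.
have e1 := mB x (x + h); have e2 := mB (x - h) x.
have -> : f (x + h) - 2 * f x + f (x - h) - c * h ^+ 2 =
   (m (x + h) - m x) - (m x - m (x - h)) by rewrite /m; field.
apply: (le_trans (ler_normB _ _)).
have {}e1 := e1 (_ : x - h <= x) (_ : x <= x + h) (lexx _).
have {}e2 := e2 (lexx _) (_ : x - h <= x) (_ : x <= x + h).
have a1 : x - h <= x by lra.
have a2 : x <= x + h by lra.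
have := lerD (e1 a1 a2) (e2 a1 a2).
by move/le_trans; apply; rewrite le_eqVlt; apply/orP; left; apply/eqP; ring.
Qed.

Lemma second_difference_cvg (x : R) (e : nat -> R) : (forall n, 0 < e n) ->
  e n @[n --> \oo] --> (0 : R) -> {for x, continuous f2} ->
  (f (x + e n) - 2 * f x + f (x - e n)) / e n ^+ 2 @[n --> \oo] --> f2 x.
Proof.
move=> e0 ce /cvgrPdist_lt cf2; apply/cvgrPdist_le => ep ep0.
have [|r /= r0 hr] := cf2 (ep / 2); first by rewrite divr_gt0.
have /cvgrPdist_lt /(_ _ r0) := ce; apply: filterS => n /=.
rewrite sub0r normrN (gtr0_norm (e0 n)) => er; have en := e0 n.
have := @second_difference x (e n) (ep / 2) (f2 x) (ltW (e0 n)).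
have -> : f2 x - (f (x + e n) - 2 * f x + f (x - e n)) / e n ^+ 2 =
  - ((f (x + e n) - 2 * f x + f (x - e n) - f2 x * e n ^+ 2) / e n ^+ 2).
  by field; rewrite gt_eqF.
rewrite normrN normrM normfV (gtr0_norm (exprn_gt0 2 en)).
rewrite ler_pdivrMr ?exprn_gt0// (_ : 2 * (ep / 2) = ep); last by field.
apply=> y yx.
rewrite distrC; apply/ltW/hr => /=.
by apply: le_lt_trans er; rewrite ler_norml; apply/andP; split; lra.
Qed.

End second_difference.

(** * Measurability of the macroscopic functions *)

Section measurable_macro.
Context {R : realType}.
Variables (tfin d al : R) (e : nat -> R) (ts : nat -> nat -> \bar R).
Variables (p q : nat -> R -> int -> R) (K : nat -> nat) (S : nat -> nat -> R).
Hypothesis sd : scaled_data tfin d al e ts p q K S.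
Implicit Types (t tau x : R) (j : int) (n k : nat).
Local Notation R2 := (measurableTypeR R * measurableTypeR R)%type.
Local Notation site n := (site_value (q n) (K n) (S n)).
Local Notation sign n := (site_sign (K n) (S n)).

Let e0 n : 0 < e n := sd_e sd n.

Lemma measurable_Itau : measurable (Itau tfin : set R).
Proof. exact: measurable_itv. Qed.

Lemma measurable_Omega : measurable (Omega tfin : set R2).
Proof. by apply: measurableX; [exact: measurable_Itau|exact: measurableT]. Qed.

Lemma measurable_macro_comp n (v : R -> int -> R) :
  (forall j, measurable_fun (Itau tfin) (v ^~ j)) ->
  measurable_fun (Omega tfin : set R2) (fun z : R2 => v z.1 (rnd (e n) z.2)).
Proof. by move=> mv; exact: (measurable_rnd_comp measurable_Itau (e0 n) mv). Qed.

Lemma measurable_site_q n j : measurable_fun (Itau tfin) (fun t => q n (t / e n ^+ 2) j).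
Proof.
have [_ cq _] := sd_q sd n (tfin / e n ^+ 2).
have := @within_scale _ (e n) (e0 n) (fun t => q n t j) 0 0 tfin; rewrite mul0r !subr0.
move=> /(_ (cq j)); rewrite (_ : (fun t => q n (t / e n ^+ 2 - 0) j) =
  (fun t => q n (t / e n ^+ 2) j)); last by apply/funext => t; rewrite subr0.
by move=> h; apply: subspace_continuous_measurable_fun => //; exact: measurable_Itau.
Qed.

Lemma measurable_scale n (s : R) : measurable_fun setT (fun t : R => t / e n ^+ 2 - s).
Proof.
apply: continuous_measurable_fun => t; apply: cvgB; last exact: cvg_cst.
by apply: cvgM; [exact: cvg_id|exact: cvg_cst].
Qed.

Lemma measurable_zkernel j : measurable_fun setT (fun t : R => zkernel t j).
Proof.
apply: measurable_fun_if => //.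
- exact: measurable_fun_ltr.
- apply: measurable_funTS; apply: continuous_measurable_fun => t.
  have [h _] := heat_kernel_derive j t.
  exact/differentiable_continuous/derivable1_diffP.
Qed.

Lemma measurable_site n j : measurable_fun (Itau tfin) (fun t => site n (t / e n ^+ 2) j).
Proof.
apply: measurable_funB; first exact: measurable_site_q.
apply: measurable_funM; first exact: measurable_cst.
apply: measurable_sum => k; apply: measurable_funTS.
by apply: measurableT_comp (measurable_zkernel _) _; exact: measurable_scale.
Qed.

Lemma measurable_sign n j : measurable_fun (Itau tfin) (fun t => sign n (t / e n ^+ 2) j).
Proof.
apply: measurable_funD; first exact: measurable_cst.
apply: measurable_funM; first exact: measurable_cst.
apply: measurable_sum => k; apply: measurable_funTS.
apply: measurable_funM; last exact: measurable_cst.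
rewrite (_ : (fun _ => _) = (\1_(`[e n ^+ 2 * S n k, +oo[%classic) : R -> R)).
  exact: measurable_indic.
apply/funext => t; rewrite indicE mem_setE in_itv/= andbT.
by rewrite ler_pdivlMr ?exprn_gt0// mulrC.
Qed.

Lemma measurable_site_fluct n j : measurable_fun (Itau tfin)
  (fun t => fluct d (e n) (K n) (S n) (t / e n ^+ 2) j).
Proof.
apply: measurable_funM; first exact: measurable_cst.
apply: measurable_sum => k; apply: measurable_funTS.
have c0 : 0 < d / e n := scaled_c_gt0 sd n.
suff ch : continuous (fun t : R => hreg (d / e n) t (j - k%:Z)).
  apply: (measurableT_comp (continuous_measurable_fun ch)); exact: measurable_scale.
move=> t; set C := (qroot (d / e n) ^+ 3)^-1.
have hC u v : `|hreg (d / e n) v (j - k%:Z) - hreg (d / e n) u (j - k%:Z)| <= 12 * C * qroot `|v - u|.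
  wlog uv : u v / u <= v.
    by move=> H; have [/H//|/ltW/H] := leP u v; rewrite distrC (distrC u).
  apply: (le_trans (hreg_holder c0 (j - k%:Z) uv)).
  rewrite (ger0_norm (_ : 0 <= v - u)) ?subr_ge0//.
  have h1 := hwt_le c0 u; have h2 := hwt_le c0 v.
  have -> : 12 * C * qroot (v - u) = 6 * qroot (v - u) * (C + C) by ring.
  by rewrite ler_wpM2l ?mulr_ge0 ?qroot_ge0// lerD.
have C0 : 0 <= C by rewrite invr_ge0 exprn_ge0// qroot_ge0.
apply/cvgrPdist_lt => ep ep0.
have cq : {for 0, continuous (fun x : R => 12 * C * qroot x)}.
  by apply: cvgM; [exact: cvg_cst|exact: continuous_qroot].
have := cvg0_eps cq (_ : _ = 0); rewrite qroot0 mulr0 => /(_ erefl) /cvgrPdist_lt /(_ _ ep0).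
move=> [r /= r0 hr]; exists r => // v /= tv.
apply: (le_lt_trans (hC v t)); have := hr `|t - v|; rewrite /= !sub0r !normrN normr_id => /(_ tv).
by rewrite ger0_norm// mulr_ge0 ?qroot_ge0// mulr_ge0.
Qed.

Lemma measurable_limQ n : measurable_fun (Omega tfin : set R2) (limQ e q n).
Proof. exact: (measurable_macro_comp n (measurable_site_q n)). Qed.

Lemma measurable_limR n : measurable_fun (Omega tfin : set R2) (limR d e K S n).
Proof. exact: (measurable_macro_comp n (measurable_site_fluct n)). Qed.

Lemma limP_site n z : limP d e q K S n z = site n (z.1 / e n ^+ 2) (rnd (e n) z.2).
Proof. exact: limP_repr. Qed.

Lemma measurable_limP n : measurable_fun (Omega tfin : set R2) (limP d e q K S n).
Proof.
rewrite (_ : limP d e q K S n = fun z => site n (z.1 / e n ^+ 2) (rnd (e n) z.2)).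
  exact: (measurable_macro_comp n (measurable_site n)).
by apply/funext => z; exact: limP_site.
Qed.

Definition limS n (z : R * R) : R := sign n (z.1 / e n ^+ 2) (rnd (e n) z.2).

Lemma measurable_limS n : measurable_fun (Omega tfin : set R2) (limS n).
Proof. exact: (measurable_macro_comp n (measurable_sign n)). Qed.

Lemma tcount_ge0 n t : 0 <= tcount K S n t.
Proof. by apply: sumr_ge0 => k _. Qed.

Lemma tcount_homo n s t : s <= t -> tcount K S n s <= tcount K S n t.
Proof.
move=> st; apply: ler_sum => k _; rewrite ler_nat.
by case: (leP (S n k) s) => // h; rewrite (le_trans h st).
Qed.

Lemma tcount_lt n t (m : nat) : (1 <= m <= K n)%N -> t < S n m -> tcount K S n t < m%:R.
Proof.
move=> /andP[m1 mK] tS.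
apply: (@le_lt_trans _ _ (\sum_(1 <= k < (K n).+1) (k < m)%N%:R)).
  rewrite /tcount !big_nat; apply: ler_sum => k; rewrite ltnS => /andP[k1 kK]; rewrite ler_nat.
  case: (leP (S n k) t) => // Sk; case: (ltnP k m) => // mk.
  suff : S n m <= S n k by move=> h; have := lt_le_trans tS (le_trans h Sk); rewrite ltxx.
  move: mk; rewrite leq_eqVlt => /predU1P[->//|mk].
  rewrite (le_trans _ (gap_lt sd m1 mk kK))// lerDl mulr_ge0// ltW//.
  exact: (scaled_c_gt0 sd n).
rewrite (@sum_nat_prefix _ m.-1 (K n) _ (fun=> 1)).
- by rewrite sumr_const_nat subn1/= ltr_nat prednK.
- by rewrite (leq_trans (leq_pred _)).
- by move=> k /andP[k1 km]; rewrite (_ : (k < m)%N)//; move: km m1; clear; case: m.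
- move=> k /andP[km kK]; rewrite (_ : (k < m)%N = false)//.
  by apply/negbTE; rewrite -leqNgt; move: km m1; clear; case: m.
Qed.

(** Only the transition with the same index flips a site, from -1 to 1, and sites j <= 0 are
    positive from the start. As the times increase, the count reaches j exactly at the j-th
    transition. *)
Lemma site_signE n t j : sign n t j = if j%:~R <= tcount K S n t then 1 else -1.
Proof.
have sum0 : (forall k, (1 <= k <= K n)%N -> j != k%:Z) ->
    \sum_(1 <= k < (K n).+1) (S n k <= t)%R%:R * (j == k%:Z)%:R = 0 :> R.
  move=> h; rewrite big_nat_cond big1// => k; rewrite andbT ltnS => /h /negbTE ->.
  by rewrite mulr0.
rewrite /site_sign; have [j0|j0] := ltP 0 j; last first.
  rewrite sum0 ?mulr0 ?addr0.
    by rewrite (le_trans _ (tcount_ge0 n t))// -[0]/(0%:~R) ler_int.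
  by move=> k /andP[k1 _]; lia.
move: sum0; case: j j0 => // m m0 sum0; have m1 : (1 <= m)%N by lia.
have [mK|Km] := leqP m (K n); last first.
  rewrite sum0; last by move=> k; lia.
  rewrite mulr0 addr0 leNgt (_ : tcount K S n t < _)//.
  apply: (@le_lt_trans _ _ (K n)%:R); last by rewrite -[X in _ < X]/(m%:R) ltr_nat.
  apply: (@le_trans _ _ (\sum_(1 <= k < (K n).+1) 1)); last by rewrite sumr_const_nat subn1.
  by apply: ler_sum => k _; rewrite -[leRHS]/(1%:R) ler_nat; case: (_ <= _).
have mmK : (1 <= m <= K n)%N by rewrite m1.
rewrite (bigD1_seq m) ?iota_uniq//=; last by rewrite mem_index_iota ltnS.
rewrite big_seq_cond big1 ?addr0; last first.
  by move=> k /andP[_ km]; rewrite (_ : _ == _ = false) ?mulr0//; apply/eqP => -[E]; rewrite E eqxx in km.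
rewrite eqxx (_ : true%:R = 1 :> R)// mulr1 -[m%:~R]/(m%:R).
have [St|tS] := leP (S n m) t.
  rewrite -(tcount_transition sd mmK) tcount_homo// (_ : true%:R = 1 :> R)//; ring.
by rewrite leNgt (tcount_lt mmK tS)/= (_ : false%:R = 0 :> R)// mulr0 addr0.
Qed.

Variables (xi : R -> R) (Q Rf : R * R -> R) (er : nat -> R).
Hypothesis ld : limit_data tfin d al e q K S xi Q Rf er.
Let P z := Q z + Rf z.

Lemma limS_cvg z : Omega tfin z -> xi z.1 != z.2 ->
  limS n z @[n --> \oo] --> sgnp (xi z.1 - z.2).
Proof.
move=> /Omega_itv Dz xz; apply: (@near_cst_continuous _ _) || apply: cvg_near_cst.
have It : Itau tfin z.1 by rewrite /Itau /= in_itv.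
have g0 : 0 < `|xi z.1 - z.2| by rewrite normr_gt0 subr_eq0.
have c1 : er n + e n @[n --> \oo] --> (0 : R).
  rewrite -[X in _ --> X]addr0; apply: cvgD; [exact: (ld_er ld)|exact: (sd_cvg sd)].
have /cvgrPdist_lt /(_ _ g0) := c1; apply: filterS => n /=; rewrite sub0r normrN => /ltr_normlW hn.
have en := e0 n; have hX := ld_X ld n It; have hr := rnd_dist z.2 en.
rewrite /limS site_signE /sgnp -(ler_pM2l en).
rewrite -[e n * tcount K S n _]/(limX e K S n z.1).
move: hX hr; rewrite !ler_norml => /andP[a1 a2] /andP[b1 b2].
have [h|h] := ltP (xi z.1 - z.2) 0.
  rewrite ltr0_norm// in hn; rewrite leNgt (_ : limX e K S n z.1 < _)//; lra.
rewrite ger0_norm// in hn; rewrite (_ : _ <= limX e K S n z.1)//; lra.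
Qed.

Lemma measurable_Q : measurable_fun (Omega tfin : set R2) Q.
Proof.
apply: (@measurable_fun_cvg _ _ _ _ (fun n => limQ e q n)); first exact: measurable_limQ.
move=> z Dz; apply/cvgrPdist_le => ep ep0; have /cvgrPdist_le /(_ _ ep0) := ld_er ld.
apply: filterS => n /=; rewrite sub0r normrN => /(le_trans (ler_norm _)) h.
by rewrite distrC (le_trans (ld_Q ld n Dz)).
Qed.

Lemma measurable_Rf : measurable_fun (Omega tfin : set R2) Rf.
Proof.
apply: (@measurable_fun_cvg _ _ _ _ (fun n => limR d e K S n)); first exact: measurable_limR.
move=> z Dz; apply/cvgrPdist_le => ep ep0; have /cvgrPdist_le /(_ _ ep0) := ld_er ld.
apply: filterS => n /=; rewrite sub0r normrN => /(le_trans (ler_norm _)) h.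
by rewrite distrC (le_trans (ld_R ld n Dz)).
Qed.

Lemma measurable_xi : measurable_fun (Itau tfin) xi.
Proof.
apply: subspace_continuous_measurable_fun; first exact: measurable_Itau.
have dd := sd_d sd; apply/within_epsP => x Ix ep ep0; exists (ep * (2 * d)).
  by rewrite !mulr_gt0.
move=> y Iy yx; apply: (le_lt_trans (ld_Xmod ld Iy Ix)).
by rewrite mulrC ltr_pdivrMr// mulr_gt0.
Qed.

Lemma measurable_gap : measurable_fun (Omega tfin : set R2) (fun z => xi z.1 - z.2).
Proof.
apply: measurable_funB; last by apply: measurable_funTS; exact: measurable_snd.
have := @measurable_macro_comp 0 (fun t _ => xi t) (fun _ => measurable_xi); exact.
Qed.

Lemma measurable_mu : measurable_fun (Omega tfin : set R2) (fun z => sgnp (xi z.1 - z.2)).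
Proof.
have mS : measurable_fun setT (@sgnp R).
  apply: measurable_fun_if => //.
  exact: measurable_fun_ltr.
exact: (measurableT_comp mS measurable_gap).
Qed.

(** Every vertical slice of the graph of [xi] is a single point, so the graph is a null set. *)
Lemma interface_null : {ae leb2, forall z : R2, Omega tfin z -> xi z.1 != z.2}.
Proof.
pose N := Omega tfin `&` (fun z : R2 => xi z.1 - z.2) @^-1` [set 0].
have mN : measurable (N : set R2) by apply: measurable_gap; [exact: measurable_Omega|exact: measurable_set1].
exists N; split => //.
  rewrite /product_measure1; apply: integral0_eq => t _ /=.
  apply: (@subset_measure0 _ _ _ leb1 _ [set xi t]) => //.
  - exact: measurable_xsection.
  - move=> x; rewrite /xsection /= inE => -[_ /= /eqP]; rewrite subr_eq0 => /eqP ->//.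
  - exact: lebesgue_measure_set1.
move=> z /= h; apply: contrapT => Nz; apply: h => Oz; apply/eqP => E; apply: Nz.
by split => //=; rewrite E subrr.
Qed.

End measurable_macro.

(** * Smallness of R_2 in the mean *)

Section windows.
Context {R : realType}.
Variables (tfin d al : R) (e : nat -> R) (ts : nat -> nat -> \bar R).
Variables (p q : nat -> R -> int -> R) (K : nat -> nat) (S : nat -> nat -> R).
Hypothesis sd : scaled_data tfin d al e ts p q K S.
Implicit Types (t tau x X M : R) (j : int) (n k : nat).
Local Notation R2 := (measurableTypeR R * measurableTypeR R)%type.
Local Notation defect n := (defect d e K S n).
Let e0 n : 0 < e n := sd_e sd n.

Definition macro_defect n (z : R * R) : R := defect n (z.1 / e n ^+ 2) (rnd (e n) z.2).

(* Outside of these windows R_2 is small, because the kernel at time s is bounded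
   by s^(-1/2); after a transition the window has microscopic length eps^(-1/2). *)
Definition window_cell n X i : set R2 :=
  `[e n ^+ 2 * S n i.+1, e n ^+ 2 * S n i.+1 + e n * Num.sqrt (e n)[%classic `*` `]-X, X[%classic.

Definition window n X : set R2 := \big[setU/set0]_(i < K n) window_cell n X i.

Lemma measurable_window n X : measurable (window n X).
Proof.
apply: bigsetU_measurable => i _; apply: measurableX; exact: measurable_itv.
Qed.

(** There are at most tfin / (2 d eps) windows, each of macroscopic duration eps^(3/2) and of width
    2 X. *)
Definition window_size n X : R := tfin / (2 * d) * (2 * X) * Num.sqrt (e n).

Lemma window_measure n X : 0 < X -> (leb2 (window n X) <= (window_size n X)%:E)%E.
Proof.
move=> X0; have en := e0 n; have sn : 0 < Num.sqrt (e n) by rewrite sqrtr_gt0.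
pose A i : set R2 := window_cell n X i.
have mA i : measurable (A i) by apply: measurableX; exact: measurable_itv.
have E i : leb2 (A i) = (e n * Num.sqrt (e n) * (2 * X))%:E.
  rewrite /A /window_cell product_measure1E; [|exact: measurable_itv|exact: measurable_itv].
  rewrite EFinM; congr (_ * _)%E.
    apply: (etrans (lebesgue_measure_itv _)); rewrite /= lte_fin ltrDl mulr_gt0//.
    by rewrite -EFinB; congr EFin; ring.
  apply: (etrans (lebesgue_measure_itv _)); rewrite /= lte_fin ifT; last by lra.
  by rewrite -EFinB; congr EFin; ring.
apply: (le_trans (@Boole_inequality _ _ _ leb2 A (K n) (fun i _ => mA i))).
rewrite (eq_bigr (fun=> (e n * Num.sqrt (e n) * (2 * X))%:E)); last by move=> i _; exact: E.
rewrite sumEFin sumr_const card_ord lee_fin -[leLHS]mulr_natl.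
have := md_bound (sd_md sd n); have dd := sd_d sd.
move=> h; apply: (@le_trans _ _ (tfin / (2 * d * e n) * (e n * Num.sqrt (e n) * (2 * X)))).
  by rewrite ler_wpM2r// !mulr_ge0// ltW.
rewrite /window_size le_eqVlt; apply/orP; left; apply/eqP; field.
by rewrite !gt_eqF.
Qed.

Lemma window_size_cvg0 X : window_size n X @[n --> \oo] --> (0 : R).
Proof.
rewrite -[X in _ --> X](mulr0 (tfin / (2 * d) * (2 * X))); apply: cvgM; first exact: cvg_cst.
apply: (@cvg_comp _ _ _ e (@Num.sqrt R)); first exact: (sd_cvg sd).
by apply: cvg0_eps; [exact: sqrt_continuous|exact: sqrtr0].
Qed.

Lemma defect_off_window n X z : box X z -> ~ window n X z ->
  `|macro_defect n z| <= 2 * qroot (e n).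
Proof.
move=> bz nW; have en := e0 n; have sn : 0 < Num.sqrt (e n) by rewrite sqrtr_gt0.
have e2 : 0 < e n ^+ 2 by rewrite exprn_gt0.
have w0 : 0 < (Num.sqrt (e n))^-1 by rewrite invr_gt0.
have -> : qroot (e n) = (Num.sqrt (Num.sqrt (e n))^-1)^-1 by rewrite sqrtrV ?invrK// ltW.
apply: (defect_small sd _ w0) => k /andP[k1 kK].
have [h|h] := ltP (z.1 / e n ^+ 2) (S n k); first by left.
right; rewrite leNgt; apply/negP => h2; apply: nW.
rewrite /window -(bigcup_mkord _ (window_cell n X)); exists k.-1 => /=; first by rewrite prednK.
rewrite /window_cell prednK//; split; last by case: bz.
rewrite /= in_itv/= mulrC -ler_pdivlMr// h/=.
move: h2; rewrite ltr_pdivrMr// => /lt_le_trans; apply.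
rewrite mulrDl [S n k * _]mulrC lerD2l.
have : e n ^+ 2 = e n * Num.sqrt (e n) * Num.sqrt (e n).
  by rewrite -mulrA -expr2 sqr_sqrtr ?expr2// ltW.
by move=> ->; rewrite mulrC mulfK// gt_eqF.
Qed.

Lemma macro_defect_le2 n z : `|macro_defect n z| <= 2.
Proof. exact: (defect_le2 sd). Qed.

Lemma measurable_macro_defect n : measurable_fun (Omega tfin : set R2) (macro_defect n).
Proof.
rewrite (_ : macro_defect n = fun z => limP d e q K S n z - (limQ e q n z + limR d e K S n z)); last first.
  by apply/funext => z; rewrite /limP /macro_defect; ring.
apply: measurable_funB; first exact: (measurable_limP sd).
by apply: measurable_funD; [exact: (measurable_limQ sd)|exact: (measurable_limR sd)].
Qed.

Lemma defect_integral_cvg0 X N (f : nat -> R * R -> R) : 0 < X -> 0 <= N ->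
  (forall n, measurable_fun (setT : set R2) (f n)) -> (forall n z, `|f n z| <= N) ->
  (forall n z, f n z != 0 -> box X z) ->
  \int[leb2]_z ((fun z => macro_defect n z * f n z) \_ (Omega tfin)) z @[n --> \oo] --> (0 : R).
Proof.
move=> X0 N0 mf fN fX.
have bf n : box_fun X (2 * N) ((fun z => macro_defect n z * f n z) \_ (Omega tfin)).
  apply: box_fun_patchM => //.
  - exact: measurable_Omega.
  - exact: measurable_macro_defect.
  - by move=> z _; exact: macro_defect_le2.
  - exact: fX.
pose B n := 2 * qroot (e n) * N * (2 * X) ^+ 2 + 2 * N * window_size n X.
have cB : B n @[n --> \oo] --> (0 : R).
  rewrite -[X in _ --> X](addr0 0) -[X in _ + X](mulr0 (2 * N)).
  apply: cvgD; last by apply: cvgM; [exact: cvg_cst|exact: window_size_cvg0].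
  have cq : qroot (e n) @[n --> \oo] --> (0 : R).
    apply: (@cvg_comp _ _ _ e (@qroot R)); first exact: (sd_cvg sd).
    by apply: cvg0_eps; [exact: continuous_qroot|exact: qroot0].
  rewrite (_ : (fun n => _) = (fun n => 2 * N * (2 * X) ^+ 2 * qroot (e n))); last first.
    by apply/funext => n; ring.
  by rewrite -[X in _ --> X](mulr0 (2 * N * (2 * X) ^+ 2)); apply: cvgM => //; exact: cvg_cst.
apply/cvgrPdist_le => ep ep0; have /cvgrPdist_le /(_ _ ep0) := cB.
apply: filterS => n /=; rewrite !sub0r !normrN => /(le_trans (ler_norm _)); apply: le_trans.
have q0 : 0 <= 2 * qroot (e n) * N by rewrite !mulr_ge0// qroot_ge0.
have n2 : 0 <= 2 * N by rewrite mulr_ge0.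
rewrite -lee_fin (EFin_normr_Rintegral _ (box_fun_integrable (bf n)))//.
apply: (le_trans (le_abse_integral _ _ _)) => //.
  by have [mg _ _] := bf n; exact/measurable_EFinP.
apply: (box_fun_window (measurable_window n X) X0 q0 n2 (window_measure n X0) (bf n)).
- move=> z nW; rewrite patchE; case: ifPn => _; last by rewrite normr0.
  have [->|/fX bz] := eqVneq (f n z) 0; first by rewrite mulr0 normr0.
  by rewrite normrM ler_pM// (defect_off_window bz nW).
- move=> z _; rewrite patchE; case: ifPn => _; last by rewrite normr0.
  by rewrite normrM ler_pM// macro_defect_le2.
Qed.

End windows.

(** * Passage to the limit in the weak formulation *)

Section weak_formulation.
Context {R : realType}.
Variables (tfin d al : R) (e : nat -> R) (ts : nat -> nat -> \bar R).
Variables (p q : nat -> R -> int -> R) (K : nat -> nat) (S : nat -> nat -> R).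
Hypothesis sd : scaled_data tfin d al e ts p q K S.
Variables (xi : R -> R) (Q Rf : R * R -> R) (er : nat -> R).
Hypothesis ld : limit_data tfin d al e q K S xi Q Rf er.
Implicit Types (t tau x : R) (j : int) (n k : nat) (F f : R * R -> R) (z : R * R).
Local Notation R2 := (measurableTypeR R * measurableTypeR R)%type.
Local Notation lP := (limP d e q K S).
Local Notation lS := (limS e K S).
Local Notation limQR n := (fun z => limQ e q n z + limR d e K S n z).
Let P z := Q z + Rf z.
Let e0 n : 0 < e n := sd_e sd n.

Definition bulk F f : R := \int[leb2]_z ((fun z => F z * f z) \_ (Omega tfin)) z.

Variables (X M : R) (psi : R * R -> R).
Hypothesis td : test_data tfin X M psi.

Let M0 : 0 <= M. Proof. by have [h _ _ _] := td_bound td 0; exact: le_trans h. Qed.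
Let X0 : 0 < X := td_X td.

Lemma limQR_bounded : exists2 B, 0 <= B &
  forall n z, Omega tfin z -> `|limQR n z| <= B /\ `|P z| <= B.
Proof.
have [MQ hQ] := Q_bounded sd ld; have [MR hR] := Rf_bounded sd ld.
have [E hE] : exists E : R, forall n, er n <= E.
  have : bounded_fun er by apply: cvg_seq_bounded; apply/cvg_ex; exists 0; exact: (ld_er ld).
  move=> [E [_ hE]]; exists (`|E| + 1) => n.
  apply: (le_trans (ler_norm _)); apply: (hE (`|E| + 1)) => //.
  by rewrite (le_lt_trans (ler_norm _))// ltrDl.
exists (`|MQ + MR| + 2 * `|E|); first by rewrite addr_ge0// mulr_ge0.
move=> n z Dz; have h1 : `|P z| <= MQ + MR by rewrite (le_trans (ler_normD _ _))// lerD ?hQ ?hR.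
have h2 := limQR_le ld n Dz; have h3 := hE n; have h4 := ler_norm E; have h5 := ler_norm (MQ + MR).
have h6 := normr_ge0 E.
split; last by lra.
have -> : limQ e q n z + limR d e K S n z = (limQ e q n z + limR d e K S n z - P z) + P z by ring.
rewrite (le_trans (ler_normD _ _))//; lra.
Qed.

Let psi_supp f : (forall z, ~ (Omega_int tfin z /\ box X z) -> f z = 0) ->
  forall z, f z != 0 -> box X z.
Proof. by move=> h z; apply: contraNP => bz; rewrite h// => -[_]. Qed.

Lemma bulk_box F f N B Y : measurable_fun (Omega tfin : set R2) F -> continuous f -> 0 <= B ->
  (forall z, Omega tfin z -> `|F z| <= B) -> (forall z, `|f z| <= N) ->
  (forall z, f z != 0 -> box Y z) ->
  box_fun Y (B * N) ((fun z => F z * f z) \_ (Omega tfin)).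
Proof.
move=> mF cf B0 FB fN fY; apply: box_fun_patchM => //; first exact: measurable_Omega.
exact: measurable_continuous2.
Qed.

Lemma bulk_iterated F f N B Y : measurable_fun (Omega tfin : set R2) F -> continuous f -> 0 <= B ->
  (forall z, Omega tfin z -> `|F z| <= B) -> (forall z, `|f z| <= N) ->
  (forall z, f z != 0 -> box Y z) ->
  \int[leb1]_(tau in `[0, tfin]) \int[leb1]_x (F (tau, x) * f (tau, x)) = bulk F f /\
  \int[leb1]_x \int[leb1]_(tau in `[0, tfin]) (F (tau, x) * f (tau, x)) = bulk F f.
Proof.
move=> mF cf B0 FB fN fY; have bf := bulk_box mF cf B0 FB fN fY.
rewrite /bulk; split.
  rewrite -(box_fun_Fubini1 bf) Rintegral_mkcond; apply: eq_Rintegral => t _.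
  rewrite patchE; case: ifPn => [/set_mem It|/negP It].
    apply: eq_Rintegral => x _; rewrite patchE mem_set//.
  rewrite /Rintegral integral0_eq// => x _; rewrite patchE memNset//.
  by move=> [/= h _]; apply: It; exact/mem_set.
rewrite -(box_fun_Fubini2 bf); apply: eq_Rintegral => x _.
rewrite Rintegral_mkcond; apply: eq_Rintegral => t _; rewrite !patchE.
case: ifPn => [/set_mem It|/negP It]; first by rewrite mem_set.
by rewrite memNset// => -[/= h _]; apply: It; exact/mem_set.
Qed.

Lemma bulkDl F F' f N B B' Y : measurable_fun (Omega tfin : set R2) F ->
  measurable_fun (Omega tfin : set R2) F' -> continuous f -> 0 <= B -> 0 <= B' ->
  (forall z, Omega tfin z -> `|F z| <= B) -> (forall z, Omega tfin z -> `|F' z| <= B') ->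
  (forall z, `|f z| <= N) -> (forall z, f z != 0 -> box Y z) ->
  bulk (fun z => F z + F' z) f = bulk F f + bulk F' f.
Proof.
move=> mF mF' cf B0 B0' FB FB' fN fY.
rewrite /bulk -(box_fun_RintegralD (bulk_box mF cf B0 FB fN fY) (bulk_box mF' cf B0' FB' fN fY)).
by apply: eq_Rintegral => z _; rewrite !patchE; case: ifP => _; rewrite ?addr0// mulrDl.
Qed.

Definition psi_diff n z : R :=
  (psi (z.1, z.2 + e n) - 2 * psi z + psi (z.1, z.2 - e n)) / e n ^+ 2.

Let dx2 t (x : R) : is_derive x 1 (fun x => psi (t, x)) (dxi psi (t, x)) := td_dx td t x.
Let dxx2 t (x : R) : is_derive x 1 (fun x => dxi psi (t, x)) (dxi (dxi psi) (t, x)) := td_dxx td t x.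

Lemma psi_diff_le n z : `|psi_diff n z| <= 2 * M.
Proof.
have en := e0 n; case: z => t x; rewrite /psi_diff /=.
have := @second_difference _ (fun x => psi (t, x)) (fun x => dxi psi (t, x))
  (fun x => dxi (dxi psi) (t, x)) (dx2 t) (dxx2 t) x (e n) M 0 (ltW en).
rewrite mul0r subr0 normrM normfV (gtr0_norm (exprn_gt0 2 en)) ler_pdivrMr ?exprn_gt0//.
by apply=> y _; rewrite subr0; have [] := td_bound td (t, y).
Qed.

Lemma psi_diff_cvg z : psi_diff n z @[n --> \oo] --> dxi (dxi psi) z.
Proof.
case: z => t x; apply: (@second_difference_cvg _ (fun x => psi (t, x)) (fun x => dxi psi (t, x))
  (fun x => dxi (dxi psi) (t, x)) (dx2 t) (dxx2 t) x e e0 (sd_cvg sd)).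
apply: (@continuous_comp _ _ _ (fun x => (t, x)) (dxi (dxi psi))); last exact: (td_cxx td).
exact: (cvg_pair (cvg_cst _) (@cvg_id _ (nbhs x))).
Qed.

Let shift_cont (a : R) (f : R * R -> R) : continuous f -> continuous (fun z => f (z.1, z.2 + a)).
Proof.
move=> cf z; apply: (@continuous_comp _ _ _ (fun z : R * R => (z.1, z.2 + a)) f); last exact: cf.
have c2 : w.2 + a @[w --> z] --> z.2 + a by apply: cvgD; [exact: cvg_snd|exact: cvg_cst].
exact: (cvg_pair cvg_fst c2).
Qed.

Let shift_supp (a : R) (f : R * R -> R) : `|a| <= 1 -> (forall z, f z != 0 -> box X z) ->
  forall z, f (z.1, z.2 + a) != 0 -> box (X + 1) z.
Proof.
move=> a1 fX z /fX /boxE[/= h1 h2]; apply/boxE; split.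
  by rewrite (lt_le_trans h1)// lerDl.
rewrite -[z.2](addrK a) (le_lt_trans (ler_normB _ _))//.
exact: ltr_leD.
Qed.

Let psiX z : psi z != 0 -> box X z.
Proof. by apply: psi_supp => w /(td_supp td)[]. Qed.

Let psi_le z : `|psi z| <= M. Proof. by have [] := td_bound td z. Qed.

Lemma psi_diff_cont n : continuous (psi_diff n).
Proof.
move=> z; apply: cvgM; last exact: cvg_cst.
apply: cvgD; last exact: (@shift_cont (- e n) _ (td_c td)).
apply: cvgB; first exact: (@shift_cont (e n) _ (td_c td)).
by apply: cvgM; [exact: cvg_cst|exact: (td_c td)].
Qed.

Let e_le1 n : `|e n| <= 1. Proof. by rewrite gtr0_norm ?(sd_e1 sd). Qed.
Let Ne_le1 n : `|- e n| <= 1. Proof. by rewrite normrN. Qed.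
Let Zle1 : `|0 : R| <= 1. Proof. by rewrite normr0. Qed.

Lemma psi_diff_supp n z : psi_diff n z != 0 -> box (X + 1) z.
Proof.
apply: contraNP => nb; rewrite /psi_diff.
have h (a : R) : `|a| <= 1 -> psi (z.1, z.2 + a) = 0.
  by move=> a1; apply/eqP; apply: contra_notT nb => /(shift_supp a1 psiX).
have := h 0 Zle1; rewrite addr0 -surjective_pairing => ->.
by rewrite (h _ (e_le1 n)) (h _ (Ne_le1 n)) mulr0 subr0 addr0 mul0r.
Qed.

Lemma limP_bounded n : exists2 B, 0 <= B & forall z, Omega tfin z -> `|lP n z| <= B.
Proof.
have [B B0 hB] := limQR_bounded; exists (B + 2); first by rewrite addr_ge0.
move=> z Dz; have [h _] := hB n z Dz.
by rewrite /limP (le_trans (ler_normD _ _))// lerD// (defect_le2 sd).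
Qed.

Lemma rnd_shift n x : rnd (e n) (x + e n) = rnd (e n) x + 1.
Proof.
have := @rndB _ (e n) (x + e n) 1 (e0 n); rewrite mulr1 addrK => ->.
by rewrite subrK.
Qed.

Lemma rnd_shiftN n x : rnd (e n) (x - e n) = rnd (e n) x - 1.
Proof. by have := @rndB _ (e n) x 1 (e0 n); rewrite mulr1. Qed.

Lemma limP_lapl n z : (e n ^+ 2)^-1 * lapl (site_value (q n) (K n) (S n) (z.1 / e n ^+ 2)) (rnd (e n) z.2) =
  (e n ^+ 2)^-1 * (lP n (z.1, z.2 + e n) - 2 * lP n z + lP n (z.1, z.2 - e n)).
Proof. by rewrite !limP_site /lapl /= rnd_shift rnd_shiftN. Qed.

Lemma bulk_shift n (a : R) : `|a| <= 1 ->
  bulk (fun z => lP n (z.1, z.2 + a)) psi = bulk (lP n) (fun z => psi (z.1, z.2 - a)).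
Proof.
move=> a1; have [B B0 hB] := limP_bounded n.
have Na1 : `|- a| <= 1 by rewrite normrN.
have bf := @bulk_box (lP n) (fun z => psi (z.1, z.2 - a)) M B (X + 1) (measurable_limP sd n)
  (@shift_cont (- a) _ (td_c td)) B0 hB (fun z => psi_le _) (shift_supp Na1 psiX).
rewrite /bulk -(box_fun_Rintegral_shift a bf); apply: eq_Rintegral => -[t x] _.
rewrite !patchE; congr (if _ then _ else _); last by rewrite /= addrK.
Qed.

(** A translation by eps in space maps lattice cells onto lattice cells, so the neighbouring values
    of p are translates of the same step function and the translations can be moved to [psi]. *)
Lemma bulk_lapl n :
  bulk (fun z => (e n ^+ 2)^-1 * lapl (site_value (q n) (K n) (S n) (z.1 / e n ^+ 2)) (rnd (e n) z.2)) psi =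
  bulk (lP n) (psi_diff n).
Proof.
have [B B0 hB] := limP_bounded n; have mP := measurable_limP sd n.
have hBa (a : R) z : Omega tfin z -> `|lP n (z.1, z.2 + a)| <= B.
  by move=> Dz; apply: hB; case: Dz.
have mPa (a : R) : measurable_fun (Omega tfin : set R2) (fun z => lP n (z.1, z.2 + a)).
  move=> mO Y mY.
  have ms : measurable_fun (setT : set R2) (fun z : R2 => ((z.1, z.2 + a) : R2)).
    apply: measurable_fun_pair; first exact: measurable_fst.
    exact: measurableT_comp (measurable_shift_by a) measurable_snd.
  have := ms measurableT _ (mP mO Y mY); congr (measurable _).
  apply/seteqP; split => z /=; first by move=> [_ [[h _] h2]]; split.
  by move=> [[h _] h2]; split.
have bfa (a : R) := bulk_box (mPa a) (td_c td) B0 (hBa a) psi_le psiX.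
have bfn (a : R) (a1 : `|a| <= 1) := @bulk_box (lP n) (fun z => psi (z.1, z.2 + a)) M B (X + 1) mP
  (@shift_cont a _ (td_c td)) B0 hB (fun z => psi_le _) (shift_supp a1 psiX).
set c := (e n ^+ 2)^-1.
have lin Y N f1 f2 f3 : box_fun Y N f1 -> box_fun Y N f2 -> box_fun Y N f3 ->
    \int[leb2]_z (c * (f1 z + (-2 * f2 z + f3 z))) =
    c * (\int[leb2]_z f1 z + (-2 * \int[leb2]_z f2 z + \int[leb2]_z f3 z)).
  move=> b1 b2 b3; have b2' := box_funZ (-2) b2.
  rewrite (box_fun_RintegralZ _ (box_funD b1 (box_funD b2' b3))).
  rewrite (box_fun_RintegralD b1 (box_funD b2' b3)) (box_fun_RintegralD b2' b3).
  by rewrite (box_fun_RintegralZ _ b2).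
transitivity (c * (bulk (fun z => lP n (z.1, z.2 + e n)) psi + (-2 * bulk (lP n) psi +
   bulk (fun z => lP n (z.1, z.2 + - e n)) psi))).
  have b0 := bulk_box mP (td_c td) B0 hB psi_le psiX.
  rewrite /bulk -(lin _ _ _ _ _ (bfa (e n)) b0 (bfa (- e n))).
  apply: eq_Rintegral => z _; rewrite !patchE.
  by case: ifP => _; [rewrite limP_lapl -/c; ring|rewrite !(mulr0, addr0)].
rewrite (bulk_shift n (e_le1 n)) (bulk_shift n (Ne_le1 n)) opprK.
have X1 : X <= X + 1 by rewrite lerDl.
have b0 := box_fun_wider X1 (lexx _) (bulk_box mP (td_c td) B0 hB psi_le psiX).
rewrite /bulk -(lin _ _ _ _ _ (bfn (- e n) (Ne_le1 n)) b0 (bfn (e n) (e_le1 n))).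
apply: eq_Rintegral => z _; rewrite !patchE.
by case: ifP => _; [rewrite /psi_diff -/c; ring|rewrite !(mulr0, addr0)].
Qed.

Lemma limS_norm n z : `|lS n z| <= 1.
Proof. by rewrite /limS (site_signE sd); case: ifP => _; rewrite ?normrN normr1. Qed.

Lemma measurable_lapl n : measurable_fun (Omega tfin : set R2) (fun z =>
  (e n ^+ 2)^-1 * lapl (site_value (q n) (K n) (S n) (z.1 / e n ^+ 2)) (rnd (e n) z.2)).
Proof.
apply: (measurable_macro_comp sd n (v := fun t j =>
   (e n ^+ 2)^-1 * lapl (site_value (q n) (K n) (S n) (t / e n ^+ 2)) j)) => j.
apply: measurable_funM; first exact: measurable_cst.
rewrite /lapl; apply: measurable_funD; last exact: (measurable_site sd).
apply: measurable_funB; first exact: (measurable_site sd).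
by apply: measurable_funM; [exact: measurable_cst|exact: (measurable_site sd)].
Qed.

Let psit_le z : `|dtau psi z| <= M. Proof. by have [] := td_bound td z. Qed.
Let psitX z : dtau psi z != 0 -> box X z.
Proof. by apply: psi_supp => w /(td_supp td)[]. Qed.

(** For each real x the site containing it does not change in time, so the identity at that site is
    applied with the function psi(., x). The integral over x has to be the outer one for this,
    whence the use of Fubini's theorem. *)
Lemma discrete_weak_form n :
  bulk (fun z => lP n z + lS n z) (dtau psi) = - bulk (lP n) (psi_diff n).
Proof.
have [B B0 hB] := limP_bounded n; have mP := measurable_limP sd n.
have en := e0 n.
have B10 : 0 <= B + 1 by rewrite addr_ge0.
have hU z : Omega tfin z -> `|lP n z + lS n z| <= B + 1.
  by move=> Dz; rewrite (le_trans (ler_normD _ _))// lerD ?hB ?limS_norm.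
have mU : measurable_fun (Omega tfin : set R2) (fun z => lP n z + lS n z).
  by apply: measurable_funD => //; exact: (measurable_limS sd).
have [_ <-] := bulk_iterated mU (td_ct td) B10 hU psit_le psitX.
pose L z := (e n ^+ 2)^-1 * lapl (site_value (q n) (K n) (S n) (z.1 / e n ^+ 2)) (rnd (e n) z.2).
have hL z : Omega tfin z -> `|L z| <= (e n ^+ 2)^-1 * (4 * B).
  move=> Dz; rewrite /L limP_lapl normrM gtr0_norm ?invr_gt0 ?exprn_gt0//.
  rewrite ler_wpM2l ?invr_ge0 ?exprn_ge0 ?(ltW en)//.
  have a1 := hB (z.1, z.2 + e n) (OmegaE _ (proj1 Dz)).
  have a2 := hB (z.1, z.2 - e n) (OmegaE _ (proj1 Dz)); have a3 := hB z Dz.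
  rewrite (le_trans (ler_normD _ _))//; have := ler_normB (lP n (z.1, z.2 + e n)) (2 * lP n z).
  rewrite normrM (ger0_norm (ler0n _ 2)); lra.
have L0 : 0 <= (e n ^+ 2)^-1 * (4 * B).
  by rewrite mulr_ge0 ?mulr_ge0 ?invr_ge0 ?exprn_ge0 ?(ltW en).
have [_ EL] := bulk_iterated (measurable_lapl n) (td_c td) L0 hL psi_le psiX.
rewrite -bulk_lapl -EL.
have -> : \int[leb1]_x \int[leb1]_(tau in `[0, tfin]) ((lP n (tau, x) + lS n (tau, x)) * dtau psi (tau, x)) =
  \int[leb1]_x (- 1 * \int[leb1]_(tau in `[0, tfin]) (L (tau, x) * psi (tau, x))).
  apply: eq_Rintegral => x _; rewrite mulN1r.
  have psi0 (t : R) : ~ (0 < t < tfin) -> psi (t, x) = 0.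
    move=> nt; have [] // := td_supp td (z := (t, x)).
    by move=> [[/= h _] _]; apply: nt; move: h; rewrite in_itv.
  have cdt : continuous (fun t => dtau psi (t, x)).
    move=> t; apply: (@continuous_comp _ _ _ (fun t => (t, x)) (dtau psi)); last exact: (td_ct td).
    exact: (cvg_pair (@cvg_id _ (nbhs t)) (cvg_cst _)).
  have p0 : psi (0, x) = 0 by apply: psi0; rewrite ltxx.
  have pT : psi (tfin, x) = 0 by apply: psi0; rewrite ltxx andbF.
  have [_ _ E] := @site_weak_pair _ tfin (e n) (q n) (K n) (S n) (sd_tfin sd) en (sd_q sd n)
    (@md_itv _ _ _ _ _ _ _ _ _ (sd_md sd n)) (fun t => psi (t, x)) (fun t => dtau psi (t, x))
    (fun t => td_dt td t x) cdt p0 pT (rnd (e n) x).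
  rewrite -E; apply: eq_Rintegral => t _; by rewrite limP_site.
have bL := bulk_box (measurable_lapl n) (td_c td) L0 hL psi_le psiX.
rewrite RintegralZl ?mulN1r//.
have := integrable_fubini_F (box_fun_integrable (box_fun_swap bL)).
apply: eq_integrable => // x _; rewrite /fubini_F /= /Rintegral fineK; last first.
  have mI : measurable (`[0, tfin]%classic : set (measurableTypeR R)) by exact: measurable_itv.
  apply: integrable_fin_num => //; apply/(integrable_mkcond _ mI).
  have := box_fun_slice2 x bL; apply: eq_integrable => // t _.
  rewrite patchE /= patchE.
  have -> : (t \in `[0, tfin]%classic) = ((t, x) \in Omega tfin).
    by apply/idP/idP => /set_mem h; apply/mem_set; [split|case: h].
  by case: ifPn.
rewrite integral_mkcond; apply: eq_integral => t _; rewrite !patchE.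
have -> : (t \in `[0, tfin]%classic) = ((t, x) \in Omega tfin).
  by apply/idP/idP => /set_mem h; apply/mem_set; [split|case: h].
by case: ifPn.
Qed.

(** The part with q + R_1 converges uniformly, the signs converge off the interface, which is a null
    set, and the contribution of R_2 disappears together with its windows. *)
Lemma weak_limit : bulk (fun z => P z + sgnp (xi z.1 - z.2)) (dtau psi) =
  - bulk P (dxi (dxi psi)).
Proof.
have [B B0 hB] := limQR_bounded; have X1 : 0 < X + 1 by rewrite ltr_wpDl// ltW.
have mQR n : measurable_fun (Omega tfin : set R2) (limQR n).
  by apply: measurable_funD; [exact: (measurable_limQ sd)|exact: (measurable_limR sd)].
have mP : measurable_fun (Omega tfin : set R2) P.
  by apply: measurable_funD; [exact: (measurable_Q sd ld)|exact: (measurable_Rf sd ld)].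
have mD n := measurable_macro_defect sd n.
have D2 n z : Omega tfin z -> `|macro_defect d e K S n z| <= 2.
  by move=> _; exact: (macro_defect_le2 sd).
have B1 : 0 <= B + 1 by rewrite addr_ge0.
have mU n : measurable_fun (Omega tfin : set R2) (fun z => limQR n z + lS n z).
  by apply: measurable_funD => //; exact: (measurable_limS sd).
have hU n z : Omega tfin z -> `|limQR n z + lS n z| <= B + 1.
  move=> Dz; have [h _] := hB n z Dz.
  by rewrite (le_trans (ler_normD _ _))// lerD// limS_norm.
have mU0 : measurable_fun (Omega tfin : set R2) (fun z => P z + sgnp (xi z.1 - z.2)).
  by apply: measurable_funD => //; exact: (measurable_mu sd ld).
have sg1 (x : R) : `|sgnp x| <= 1 by rewrite /sgnp; case: ifP => _; rewrite ?normrN normr1.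
have hU0 z : Omega tfin z -> `|P z + sgnp (xi z.1 - z.2)| <= B + 1.
  move=> Dz; have [_ h] := hB 0%N z Dz.
  by rewrite (le_trans (ler_normD _ _))// lerD.
have hQR n z : Omega tfin z -> `|limQR n z| <= B by move=> /(hB n)[].
have hP z : Omega tfin z -> `|P z| <= B by move=> /(hB 0%N)[].
have cQR z : Omega tfin z -> limQR n z @[n --> \oo] --> P z.
  move=> Dz; apply/cvgrPdist_le => ep ep0.
  have c2 : 2 * er n @[n --> \oo] --> (0 : R).
    by rewrite -[X in _ --> X](mulr0 2); apply: cvgM; [exact: cvg_cst|exact: (ld_er ld)].
  have /cvgrPdist_le /(_ _ ep0) := c2.
  apply: filterS => n /=; rewrite sub0r normrN => /(le_trans (ler_norm _)) h.
  by rewrite distrC (le_trans (limQR_le ld n Dz)).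
have psixx_le z : `|dxi (dxi psi) z| <= M by have [] := td_bound td z.
have psixxX z : dxi (dxi psi) z != 0 -> box X z.
  by apply: psi_supp => w /(td_supp td)[].
have M2 : 0 <= 2 * M by rewrite mulr_ge0.
have L1 : bulk (fun z => lP n z + lS n z) (dtau psi) @[n --> \oo] -->
    bulk (fun z => P z + sgnp (xi z.1 - z.2)) (dtau psi).
  have E n : bulk (fun z => lP n z + lS n z) (dtau psi) =
      bulk (fun z => limQR n z + lS n z) (dtau psi) + bulk (macro_defect d e K S n) (dtau psi).
    rewrite -(bulkDl (mU n) (mD n) (td_ct td) B1 (ler0n _ 2) (hU n) (D2 n) psit_le psitX).
    congr (bulk _ _); apply/funext => z; rewrite /limP /macro_defect; ring.
  rewrite (_ : (fun n => _) = (fun n => bulk (fun z => limQR n z + lS n z) (dtau psi) +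
     bulk (macro_defect d e K S n) (dtau psi))); last by apply/funext => n; exact: E.
  rewrite -[X in _ --> X]addr0; apply: cvgD; last first.
    exact: (@defect_integral_cvg0 _ _ _ _ _ _ _ _ _ _ sd X M (fun=> dtau psi) X0 M0
      (fun=> measurable_continuous2 (td_ct td)) (fun _ => psit_le) (fun _ => psitX)).
  apply: (box_fun_cvg (fun n => bulk_box (mU n) (td_ct td) B1 (hU n) psit_le psitX)
    (bulk_box mU0 (td_ct td) B1 hU0 psit_le psitX)).
  apply: (ae_imp _ (interface_null sd ld)) => z xz.
  rewrite (_ : (fun n => _) = (fun n => if z \in Omega tfin then (limQR n z + lS n z) * dtau psi z else 0)); last first.
    by apply/funext => n; rewrite patchE.
  rewrite patchE; case: ifPn => [/set_mem Oz|_]; last exact: cvg_cst.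
  apply: cvgM; last exact: cvg_cst.
  by apply: cvgD; [exact: cQR|apply: (limS_cvg sd ld) => //; exact: xz].
have L2 : bulk (lP n) (psi_diff n) @[n --> \oo] --> bulk P (dxi (dxi psi)).
  have E n : bulk (lP n) (psi_diff n) =
      bulk (limQR n) (psi_diff n) + bulk (macro_defect d e K S n) (psi_diff n).
    by rewrite -(bulkDl (mQR n) (mD n) (@psi_diff_cont n) B0 (ler0n _ 2) (hQR n) (D2 n)
      (psi_diff_le n) (@psi_diff_supp n)).
  rewrite (_ : (fun n => _) = (fun n => bulk (limQR n) (psi_diff n) +
     bulk (macro_defect d e K S n) (psi_diff n))); last by apply/funext => n; exact: E.
  rewrite -[X in _ --> X]addr0; apply: cvgD; last first.
    exact: (@defect_integral_cvg0 _ _ _ _ _ _ _ _ _ _ sd (X + 1) (2 * M) psi_diff X1 M2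
      (fun n => measurable_continuous2 (@psi_diff_cont n)) psi_diff_le (@psi_diff_supp)).
  have bP := bulk_box mP (td_cxx td) B0 hP psixx_le psixxX.
  apply: (box_fun_cvg (fun n => bulk_box (mQR n) (@psi_diff_cont n) B0 (hQR n) (psi_diff_le n)
    (@psi_diff_supp n)) (box_fun_wider (_ : X <= X + 1) (lexx _) bP)); first by rewrite lerDl.
  apply: aeW => z.
  rewrite (_ : (fun n => _) = (fun n => if z \in Omega tfin then limQR n z * psi_diff n z else 0)); last first.
    by apply/funext => n; rewrite patchE.
  rewrite patchE; case: ifPn => [/set_mem Oz|_]; last exact: cvg_cst.
  by apply: cvgM; [exact: cQR|exact: psi_diff_cvg].
apply: (cvg_unique _ L1) => //.
rewrite (_ : (fun n => _) = (fun n => - bulk (lP n) (psi_diff n))); last first.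
  by apply/funext => n; exact: discrete_weak_form.
exact: cvgN.
Qed.

Lemma weak_identity :
  - (\int[leb1]_(tau in `[0, tfin]) \int[leb1]_x
      ((P (tau, x) + sgnp (xi tau - x)) * dtau psi (tau, x))) =
  \int[leb1]_(tau in `[0, tfin]) \int[leb1]_x (P (tau, x) * dxi (dxi psi) (tau, x)).
Proof.
have [B B0 hB] := limQR_bounded.
have mP : measurable_fun (Omega tfin : set R2) P.
  by apply: measurable_funD; [exact: (measurable_Q sd ld)|exact: (measurable_Rf sd ld)].
have mU0 : measurable_fun (Omega tfin : set R2) (fun z => P z + sgnp (xi z.1 - z.2)).
  by apply: measurable_funD => //; exact: (measurable_mu sd ld).
have sg1 (x : R) : `|sgnp x| <= 1 by rewrite /sgnp; case: ifP => _; rewrite ?normrN normr1.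
have hU0 z : Omega tfin z -> `|P z + sgnp (xi z.1 - z.2)| <= B + 1.
  move=> Dz; have [_ h] := hB 0%N z Dz.
  by rewrite (le_trans (ler_normD _ _))// lerD.
have hP z : Omega tfin z -> `|P z| <= B by move=> /(hB 0%N)[].
have psixx_le z : `|dxi (dxi psi) z| <= M by have [] := td_bound td z.
have psixxX z : dxi (dxi psi) z != 0 -> box X z.
  by apply: psi_supp => w /(td_supp td)[].
have B1 : 0 <= B + 1 by rewrite addr_ge0.
have [E1 _] := bulk_iterated mU0 (td_ct td) B1 hU0 psit_le psitX.
have [E2 _] := bulk_iterated mP (td_cxx td) B0 hP psixx_le psixxX.
transitivity (- bulk (fun z => P z + sgnp (xi z.1 - z.2)) (dtau psi)).
  by congr (- _); exact: E1.
transitivity (bulk P (dxi (dxi psi))); last exact: (esym E2).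
transitivity (- - bulk P (dxi (dxi psi))); last exact: opprK.
by congr (- _); exact: weak_limit.
Qed.

End weak_formulation.

Section weak_solution.
Context {R : realType}.
Variables (tfin d al : R) (e : nat -> R) (ts : nat -> nat -> \bar R).
Variables (p q : nat -> R -> int -> R) (K : nat -> nat) (S : nat -> nat -> R).
Hypothesis sd : scaled_data tfin d al e ts p q K S.
Variables (xi : R -> R) (Q Rf : R * R -> R) (er : nat -> R).
Hypothesis ld : limit_data tfin d al e q K S xi Q Rf er.

Lemma P_weak_solution : fbp_distributional_solution tfin (fun z => Q z + Rf z) xi.
Proof. by move=> psi /test_dataP[X [M td]]; exact: (weak_identity sd ld td). Qed.

End weak_solution.

(** * Convergence in L^s *)

Section norm_bounds.
Context {R : realType}.

Lemma measurable_norm : measurable_fun setT (fun x : R => `|x|).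
Proof. by apply: continuous_measurable_fun => x; exact: norm_continuous. Qed.

Lemma Lnorm_le d (T : measurableType d) (mu : {measure set T -> \bar R}) (s c : R) (f : T -> R) :
  0 < s -> 0 <= c -> (\int[mu]_x (`|f x| `^ s)%:E <= c%:E)%E ->
  ('N[mu]_(s%:E) [EFin \o f] <= (c `^ s^-1)%:E)%E.
Proof.
move=> s0 c0 h; rewrite unlock -poweR_EFin.
have I0 : (0 <= \int[mu]_x (`|(EFin \o f) x| `^ s))%E.
  by apply: integral_ge0 => x _; exact: poweR_ge0.
apply: gt0_ler_poweR.
- by rewrite invr_ge0 ltW.
- by rewrite in_itv/= I0 leey.
- by rewrite in_itv/= lee_fin c0 leey.
- exact: h.
Qed.

Lemma powR_cvg0 (a : nat -> R) (r : R) : (forall n, 0 <= a n) -> 0 < r ->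
  a n @[n --> \oo] --> (0 : R) -> a n `^ r @[n --> \oo] --> (0 : R).
Proof.
move=> a0 r0 ca; apply/cvgrPdist_lt => ep ep0.
have e1 : 0 < ep `^ r^-1 by rewrite powR_gt0.
have /cvgrPdist_lt /(_ _ e1) := ca; apply: filterS => n /=; rewrite !sub0r !normrN.
rewrite (ger0_norm (a0 n)) (ger0_norm (powR_ge0 _ _)) => h.
have -> : ep = (ep `^ r^-1) `^ r by rewrite -powRrM mulVf ?gt_eqF// powRr1// ltW.
by apply: gt0_ltr_powR => //; rewrite nnegrE ?a0// ltW.
Qed.

Lemma measurable_fun_off_finite (D F : set R) (f g : R -> R) : measurable D ->
  finite_set F -> measurable_fun D f -> (forall x, D x -> ~ F x -> g x = f x) ->
  measurable_fun D g.
Proof.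
move=> mD fF mf gf _ Y mY.
have mfin (A : set R) : A `<=` F -> measurable A.
  move=> AF; apply: countable_measurable; first by move=> t; exact: measurable_set1.
  by apply: finite_set_countable; exact: sub_finite_set fF.
have -> : D `&` g @^-1` Y = ((D `&` f @^-1` Y) `\` F) `|` (D `&` g @^-1` Y `&` F).
  apply/seteqP; split => x /=.
    move=> [Dx Yx]; have [Fx|Fx] := pselect (F x); first by right.
    by left; rewrite -gf.
  by move=> [[[Dx Yx] Fx]|[]//]; rewrite gf.
apply: measurableU; last by apply: mfin => x [].
by apply: measurableD; [exact: mf|exact: mfin].
Qed.

End norm_bounds.

Section planar_borel.
Context {R : realType}.
Local Notation R2 := (measurableTypeR R * measurableTypeR R)%type.

Lemma open_measurable2 (U : set (R * R)) : open U -> measurable (U : set R2).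
Proof.
move=> oU; pose Bx (i : rat * rat * (rat * rat)) : set R2 :=
  `](ratr i.1.1), (ratr i.1.2)[%classic `*` `](ratr i.2.1), (ratr i.2.2)[%classic.
have -> : U = \bigcup_i [set z | Bx i `<=` U /\ Bx i z].
  apply/seteqP; split => [z Uz|z [i _] /= [h Bz]]; last exact: h.
  have [r r0 zr] : exists2 r : R, 0 < r & ball z r `<=` U.
    by move: oU; rewrite openE => /(_ z Uz)/nbhs_ballP[r /= r0 h]; exists r.
  have rat_near (x : R) : exists a b : rat, [/\ x - r < ratr a, ratr a < x, x < ratr b & ratr b < x + r].
    have [|a] := @rat_in_itvoo R (x - r) x; first by lra.
    have [|b] := @rat_in_itvoo R x (x + r); first by lra.
    by rewrite !in_itv/= => /andP[b1 b2] /andP[a1 a2]; exists a, b.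
  have [a [b [a1 a2 b1 b2]]] := rat_near z.1; have [a' [b' [a1' a2' b1' b2']]] := rat_near z.2.
  exists ((a, b), (a', b')) => //; split.
    move=> w; rewrite /Bx /= !in_itv/= => -[/andP[w1 w2] /andP[w3 w4]].
    apply: zr; split; rewrite /ball/= ltr_norml; apply/andP; split; lra.
  by split; rewrite /= in_itv/=; apply/andP.
apply: countable_bigcupT_measurable; first exact: countableP.
move=> i; have [h|h] := pselect (Bx i `<=` U); last first.
  by rewrite (_ : [set z | _] = set0)//; apply/seteqP; split => // z [].
rewrite (_ : [set z | _] = Bx i); last by apply/seteqP; split => z // [].
by apply: measurableX; exact: measurable_itv.
Qed.

End planar_borel.

(** * Convergence of the unregularized solutions *)

Section microscopic_convergence.
Context {R : realType}.
Variables (tfin d al : R) (e : nat -> R) (ts : nat -> nat -> \bar R).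
Variables (p q : nat -> R -> int -> R) (K : nat -> nat) (S : nat -> nat -> R).
Hypothesis sd : scaled_data tfin d al e ts p q K S.
Variables (xi : R -> R) (Q Rf : R * R -> R) (er : nat -> R).
Hypothesis ld : limit_data tfin d al e q K S xi Q Rf er.
Implicit Types (t tau x : R) (j : int) (n k : nat).
Local Notation R2 := (measurableTypeR R * measurableTypeR R)%type.
Local Notation lP := (limP d e q K S).
Let P z := Q z + Rf z.
Let e0 n : 0 < e n := sd_e sd n.

(** Times at which the agreement of p with its representation is not supplied by [md_repr]; finitely
    many, hence negligible in the plane. *)
Definition exceptional n : set R :=
  tfin |` [set S n k * e n ^+ 2 | k in [set k | (k <= K n)%N]].

Lemma exceptional_finite n : finite_set (exceptional n).
Proof.
rewrite finite_setU; split; first exact: finite_set1.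
by apply: finite_image; apply: sub_finite_set (finite_II (K n).+1) => k /=; rewrite ltnS.
Qed.

Lemma macro_limP n tau x : Itau tfin tau -> ~ exceptional n tau ->
  p n (tau / e n ^+ 2) (rnd (e n) x) = lP n (tau, x).
Proof.
move=> /[dup] It; rewrite /Itau /= in_itv/= => /andP[t0 tt] nE.
have tl : tau < tfin.
  by rewrite lt_neqAle tt andbT; apply/eqP => tE; apply: nE; left.
have [] // := limP_micro sd (n := n) (tau := tau) x; first by rewrite t0.
move=> k /andP[_ kK] Sk; apply: nE; right; exists k => //.
by rewrite Sk divfK// gt_eqF// exprn_gt0.
Qed.

Lemma measurable_macro_p n : measurable_fun (Omega tfin : set R2) (macro (e n) (p n)).
Proof.
apply: (measurable_macro_comp sd n (v := fun t j => p n (t / e n ^+ 2) j)) => j.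
apply: (measurable_fun_off_finite (measurable_Itau tfin) (exceptional_finite n) (measurable_site sd n j)).
move=> t It nE; have := macro_limP (e n * j%:~R) It nE.
by rewrite limP_site /= rnd_nat.
Qed.

Lemma exceptional_null n : {ae leb2, forall z : R2, ~ exceptional n z.1}.
Proof.
have mE : measurable (exceptional n : set R).
  apply: countable_measurable; first by move=> t; exact: measurable_set1.
  by apply: finite_set_countable; exact: exceptional_finite.
exists (exceptional n `*` setT); split.
- by apply: measurableX.
- rewrite product_measure1E// [X in (X * _)%E](_ : _ = 0%E) ?mul0e//.
  exact: (@countable_lebesgue_measure0 R _ (finite_set_countable (exceptional_finite n))).
- by move=> z /= /contrapT h; split.
Qed.

(** Off the windows the error is at most [eta], which tends to 0; in the windows it is only bounded
    by [b], but their measure tends to 0. The estimates concern [g], defined by the representation,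
    which agrees with the given function [f] almost everywhere. *)
Lemma macro_Lsloc (s : R) : 1 <= s -> cvg_Lsloc s (Omega tfin) (fun n => macro (e n) (p n)) P.
Proof.
move=> s1 C cC CO; have s0 : 0 < s by rewrite (lt_le_trans ltr01).
have hC : closed C by apply: compact_closed.
have [X X0 CX] : exists2 X : R, 0 < X & forall z, C z -> box X z.
  have [M [_ hM]] := compact_bounded cC; exists (`|M| + 2); first by rewrite ltr_wpDl.
  move=> z Cz; have zX : `|z| < `|M| + 2.
    apply: (@le_lt_trans _ _ (`|M| + 1)); last by rewrite ltrD2l ltr1n.
    by apply: (hM (`|M| + 1)) => //; rewrite (le_lt_trans (ler_norm _))// ltrDl.
  by apply/boxE; split; apply: le_lt_trans zX; rewrite prod_normE/= le_max lexx ?orbT.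
have mC : measurable (C : set R2).
  by rewrite -[C]setCK; apply: measurableC; apply: open_measurable2; exact: closed_openC.
have [B B0 hB] := limQR_bounded sd ld.
have [E E0 hE] : exists2 E : R, 0 <= E & forall n, er n <= E.
  have : bounded_fun er by apply: cvg_seq_bounded; apply/cvg_ex; exists 0; exact: (ld_er ld).
  move=> [E [_ hE]]; exists (`|E| + 1) => [|n]; first by rewrite addr_ge0.
  apply: (le_trans (ler_norm _)); apply: (hE (`|E| + 1)) => //.
  by rewrite (le_lt_trans (ler_norm _))// ltrDl.
pose f n := (fun z => macro (e n) (p n) z - P z) \_ C.
pose g n := (fun z => lP n z - P z) \_ C.
pose h n (z : R2) := `|g n z| `^ s.
pose eta n := 2 * er n + 2 * qroot (e n).
pose b : R := 2 * E + 2.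
have er0 n : 0 <= er n := er_ge0 sd ld n.
have eta0 n : 0 <= eta n by rewrite addr_ge0 ?mulr_ge0 ?qroot_ge0.
have b0 : 0 <= b by rewrite addr_ge0// mulr_ge0.
have mP : measurable_fun (Omega tfin : set R2) P.
  by apply: measurable_funD; [exact: (measurable_Q sd ld)|exact: (measurable_Rf sd ld)].
have mres (F : R2 -> R) : measurable_fun (Omega tfin : set R2) F -> measurable_fun (setT : set R2) (F \_ C).
  move=> mF; apply/(measurable_restrictT _ mC); apply: measurable_funS mF => //.
  exact: measurable_Omega.
have mf n : measurable_fun (setT : set R2) (f n).
  by apply: mres; apply: measurable_funB => //; exact: measurable_macro_p.
have mg n : measurable_fun (setT : set R2) (g n).
  by apply: mres; apply: measurable_funB => //; exact: (measurable_limP sd).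
have gdef n z : C z -> `|lP n z - P z| <= 2 * er n + `|macro_defect d e K S n z|.
  move=> Cz; have -> : lP n z - P z = (limQ e q n z + limR d e K S n z - P z) + macro_defect d e K S n z.
    by rewrite /limP /macro_defect; ring.
  by rewrite (le_trans (ler_normD _ _))// lerD// (limQR_le ld n (CO _ Cz)).
have gb n z : `|g n z| <= b.
  rewrite /g patchE; case: ifPn => [/set_mem Cz|_]; last by rewrite normr0.
  have := gdef n z Cz; have := macro_defect_le2 sd n z; have := hE n; rewrite /b; lra.
have gW n z : ~ window e K S n X z -> `|g n z| <= eta n.
  move=> nW; rewrite /g patchE; case: ifPn => [/set_mem Cz|_]; last by rewrite normr0.
  have := gdef n z Cz; have := defect_off_window sd (CX _ Cz) nW; rewrite /eta; lra.
have mh n : measurable_fun (setT : set R2) (h n).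
  apply: (measurableT_comp (measurable_powR s)).
  by apply: measurableT_comp (mg n); exact: measurable_norm.
have pw (x y : R) : 0 <= x -> x <= y -> x `^ s <= y `^ s.
  by move=> x0 xy; apply: ge0_ler_powR => //; rewrite ?nnegrE ?(le_trans x0 xy) ?(ltW s0).
have bh n : box_fun X (b `^ s) (h n).
  split => // [z|z].
    by rewrite ger0_norm ?powR_ge0// pw.
  rewrite /h /g patchE; case: ifPn => [/set_mem Cz _|_]; first exact: CX.
  by rewrite normr0 powR0 ?eqxx// gt_eqF.
pose c n := eta n `^ s * (2 * X) ^+ 2 + b `^ s * window_size tfin d e n X.
have ws0 n : 0 <= window_size tfin d e n X.
  by rewrite /window_size !mulr_ge0 ?sqrtr_ge0 ?invr_ge0 ?mulr_ge0 ?(ltW X0) ?(ltW (sd_tfin sd)) ?(ltW (sd_d sd)).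
have c0 n : 0 <= c n.
  apply: addr_ge0; apply: mulr_ge0; rewrite ?powR_ge0 ?ws0//.
  by rewrite exprn_ge0// mulr_ge0// ltW.
have hI n : (\int[leb2]_z (`|f n z| `^ s)%:E <= (c n)%:E)%E.
  apply: (@le_trans _ _ (\int[leb2]_z `|(h n z)%:E|)%E).
    rewrite le_eqVlt; apply/orP; left; apply/eqP.
    apply: ae_eq_integral => //.
    - apply/measurable_EFinP; apply: (measurableT_comp (measurable_powR s)).
      by apply: measurableT_comp (mf n); exact: measurable_norm.
    - by apply: measurableT_comp => //; exact/measurable_EFinP.
    apply: (ae_imp _ (exceptional_null n)) => -[t x] nE _ /=.
    have -> : f n (t, x) = g n (t, x).
      rewrite /f /g !patchE; case: ifPn => // /set_mem Cz.
      by rewrite /macro (macro_limP x _ nE)//; case: (CO _ Cz).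
    by rewrite [in RHS]ger0_norm// powR_ge0.
  apply: (box_fun_window (measurable_window e K S n X) X0 _ _ (window_measure sd n X0) (bh n)).
  - exact: powR_ge0.
  - exact: powR_ge0.
  - by move=> z nW; rewrite ger0_norm ?powR_ge0// pw// gW.
  - by move=> z _; rewrite ger0_norm ?powR_ge0// pw.
have cer2 : 2 * er n @[n --> \oo] --> (0 : R).
  by rewrite -[X in _ --> X](mulr0 2); apply: cvgM; [exact: cvg_cst|exact: (ld_er ld)].
have ceta : eta n @[n --> \oo] --> (0 : R).
  rewrite -[X in _ --> X](addr0 0); apply: cvgD => //.
  rewrite -[X in _ --> X](mulr0 2); apply: cvgM; first exact: cvg_cst.
  apply: (@cvg_comp _ _ _ e (@qroot R)); first exact: (sd_cvg sd).
  by apply: cvg0_eps; [exact: continuous_qroot|exact: qroot0].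
have cc : c n @[n --> \oo] --> (0 : R).
  rewrite -[X in _ --> X](addr0 0); apply: cvgD.
    rewrite -[X in _ --> X](mul0r ((2 * X) ^+ 2)); apply: cvgM; last exact: cvg_cst.
    exact: powR_cvg0.
  rewrite -[X in _ --> X](mulr0 (b `^ s)); apply: cvgM; first exact: cvg_cst.
  exact: (window_size_cvg0 sd X).
apply: (@squeeze_cvge _ _ _ _ (fun=> 0%E) _ (fun n => (c n `^ s^-1)%:E)).
- apply: nearW => n; rewrite Lnorm_ge0/=.
  by have := Lnorm_le s0 (c0 n) (hI n).
- exact: cvg_cst.
- apply: cvg_EFin; first exact: nearW.
  by apply: powR_cvg0 => //; rewrite invr_gt0.
Qed.

End microscopic_convergence.

(** * Integral bounds for limits of step functions *)

Section step_limits.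
Context {R : realType}.
Implicit Types (F : int -> R) (x : R) (g : R -> R).

Lemma step_integral_le (eps B : R) F (a b : R) : 0 < eps -> (forall j, 0 <= F j) ->
  (forall b n, eps * \sum_(i < n) F (b + (i : nat)%:Z) <= B) -> a <= b ->
  (\int[leb1]_(x in `[a, b]) (F (rnd eps x))%:E <= B%:E)%E.
Proof.
move=> e0 F0 hB ab; have [m rE _] := rnd_diff e0 ab.
pose c i : set (measurableTypeR R) := [set x | rnd eps x = rnd eps a + (i : nat)%:Z].
have mc i : measurable (c i) by exact: measurable_rnd_preimage.
pose f i x := ((F (rnd eps a + (i : nat)%:Z)) * \1_(c i) x)%:E.
have mf i : measurable_fun setT (f i).
  by apply/measurable_EFinP; apply: measurable_funM; [exact: measurable_cst|exact: measurable_indic (mc i)].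
have f0 i x : (0 <= f i x)%E by rewrite lee_fin mulr_ge0.
have mI : measurable (`[a, b]%classic : set (measurableTypeR R)) by exact: measurable_itv.
apply: (@le_trans _ _ (\int[leb1]_(x in `[a, b]) (\sum_(i <- index_iota 0 m.+1) f i x))%E).
  apply: ge0_le_integral => //.
  - by move=> x _; rewrite lee_fin.
  - apply/measurable_EFinP; apply: measurable_funTS.
    have := @measurable_rnd_comp R setT eps (fun _ j => F j) measurableT e0 (fun j => measurable_cst _).
    rewrite setXTT => h; exact: (measurable_fun_pair2 (0 : R) h).
  - by apply: emeasurable_sum => i; apply: measurable_funTS; exact: mf.
  - move=> x; rewrite /= in_itv/= => /andP[ax xb].
    have [i Ei _] := rnd_diff e0 ax.
    have im : (i <= m)%N by have := le_rnd e0 xb; rewrite rE Ei lerD2l lez_nat.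
    rewrite (bigD1_seq i) ?iota_uniq ?mem_index_iota//=.
    rewrite -[leLHS]adde0 leeD//; last by apply: sume_ge0 => k _; exact: f0.
    by rewrite /f indicE mem_set/= ?Ei// mulr1.
rewrite ge0_integral_sum//; last by move=> i; apply: measurable_funTS; exact: mf.
apply: (@le_trans _ _ (\sum_(0 <= i < m.+1) (F (rnd eps a + (i : nat)%:Z) * eps)%:E)%E).
  apply: lee_sum => i _; rewrite /f.
  under eq_integral do rewrite EFinM.
  rewrite ge0_integralZl//; last 2 first.
    by apply/measurable_EFinP; apply: measurable_funTS; exact: measurable_indic (mc i).
    by rewrite lee_fin.
  rewrite integral_indic// EFinM lee_wpmul2l ?lee_fin//.
  apply: (@le_trans _ _ (leb1 (c i))).
    apply: le_measure; rewrite ?inE//; first exact: measurableI.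
  rewrite /c rnd_preimage//.
  set lo := eps * (_ - _); set hi := eps * (_ + _).
  have E : (lebesgue_measure (`[lo, hi[%classic : set R) <= eps%:E)%E.
    rewrite lebesgue_measure_itv/= lte_fin; case: ifP => _; last by rewrite lee_fin ltW.
    by rewrite -EFinB lee_fin /hi /lo le_eqVlt; apply/orP; left; apply/eqP; field.
  exact: E.
rewrite sumEFin lee_fin big_mkord -mulr_suml mulrC; exact: hB.
Qed.

Definition centered (N : nat) : set (measurableTypeR R) := `[- N%:R, N%:R]%classic.

Lemma ge0_integral_line_le g (B : R) : measurable_fun setT g -> (forall x, 0 <= g x) ->
  (forall N : nat, (\int[leb1]_(x in centered N) (g x)%:E <= B%:E)%E) ->
  (\int[leb1]_x (g x)%:E <= B%:E)%E.
Proof.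
move=> mg g0 hB.
have ndI : {homo centered : n m / (n <= m)%N >-> (n <= m)%O}.
  move=> n m nm; apply/subsetPset => x; rewrite /centered /= !in_itv/= => /andP[h1 h2].
  have nm' : n%:R <= m%:R :> R by rewrite ler_nat.
  by apply/andP; split; lra.
have mI i : measurable (centered i) by exact: measurable_itv.
have mgI i : measurable_fun (centered i) (EFin \o g) by apply/measurable_EFinP; exact: measurable_funTS.
have pg (i : nat) x : centered i x -> (0 <= (EFin \o g) x)%E by rewrite lee_fin.
have h := @ge0_nondecreasing_set_cvg_integral _ _ _ centered (EFin \o g) leb1 ndI mI mgI pg.
have U : \bigcup_i centered i = setT.
  apply/seteqP; split => // x _; exists (Num.truncn `|x|).+1 => //=.
  by rewrite /centered /= in_itv/= -ler_norml ltW// truncnS_gt.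
rewrite U in h; apply: cvge_le h; exact: nearW.
Qed.

(** The uniform error [k n] is not integrable over the line. On [-N, N] it costs only 2 N |k n|,
    which tends to 0 with n; N tends to infinity afterwards, by monotone convergence. *)
Lemma l1_limit (e k : nat -> R) (F : nat -> int -> R) g (B : R) : (forall n, 0 < e n) ->
  k n @[n --> \oo] --> (0 : R) -> (forall n j, 0 <= F n j) ->
  (forall n b m, e n * \sum_(i < m) F n (b + (i : nat)%:Z) <= B) ->
  measurable_fun setT g -> (forall x, 0 <= g x) ->
  (forall n x, g x <= F n (rnd (e n) x) + k n) ->
  (\int[leb1]_x (g x)%:E <= B%:E)%E.
Proof.
move=> e0 ck F0 hB mg g0 hg; apply: ge0_integral_line_le => // N.
have mI : measurable (centered N) by exact: measurable_itv.
have k0 n : 0 <= `|k n| by [].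
have NN : - N%:R <= N%:R :> R by rewrite ge0_cp//.
have mF n : measurable_fun (setT : set (measurableTypeR R)) (fun x => F n (rnd (e n) x)).
  have := @measurable_rnd_comp R setT (e n) (fun _ j => F n j) measurableT (e0 n) (fun j => measurable_cst _).
  rewrite setXTT => h; exact: (measurable_fun_pair2 (0 : R) h).
have key n : (\int[leb1]_(x in centered N) (g x)%:E <= (B + `|k n| * (2 * N%:R))%:E)%E.
  apply: (@le_trans _ _ (\int[leb1]_(x in centered N) ((F n (rnd (e n) x))%:E + `|k n|%:E))%E).
    apply: ge0_le_integral => //.
    - by move=> x _; rewrite lee_fin.
    - by apply/measurable_EFinP; exact: measurable_funTS.
    - apply: emeasurable_funD; last exact: measurable_cst.
      by apply/measurable_EFinP; exact: measurable_funTS.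
    - by move=> x _; rewrite -EFinD lee_fin (le_trans (hg n x))// lerD2l ler_norm.
  rewrite ge0_integralD//; try by [move=> x _; rewrite lee_fin|
    apply/measurable_EFinP; exact: measurable_funTS].
  rewrite EFinD leeD//; first exact: (step_integral_le (e0 n) (F0 n) (hB n) NN).
  rewrite integral_cst// EFinM lee_wpmul2l ?lee_fin//.
  have E : (lebesgue_measure (centered N) <= (2 * N%:R)%:E)%E.
    rewrite /centered lebesgue_measure_itv/= lte_fin; case: ifP => _; last by rewrite lee_fin mulr_ge0.
    by rewrite -EFinB lee_fin opprK; lra.
  exact: E.
have cb : (B + `|k n| * (2 * N%:R))%:E @[n --> \oo] --> B%:E.
  apply: cvg_EFin; first exact: nearW.
  rewrite -[X in _ --> X]addr0 -[X in _ + X](mul0r (2 * N%:R)).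
  apply: cvgD; first exact: cvg_cst.
  apply: cvgM; last exact: cvg_cst.
  have h : `|k n| @[n --> \oo] --> `|0 : R| by apply: cvg_norm.
  by rewrite normr0 in h.
by apply: cvge_ge cb; exact: nearW.
Qed.

End step_limits.

(** * The weak derivative of R *)

Section lower_upper_limits.
Context {R : realType}.
Implicit Types (u : nat -> \bar R) (a : \bar R).

Lemma limn_einf_ge0 u : (forall k, (0 <= u k)%E) -> (0 <= limn_einf u)%E.
Proof.
move=> u0; rewrite limn_einf_lim; apply: lime_ge; first exact: is_cvg_einfs.
by apply: nearW => n; apply: le_ereal_inf_tmp => _ [k _ <-].
Qed.

Lemma limn_esup_le u a : (forall k, (u k <= a)%E) -> (limn_esup u <= a)%E.
Proof.
move=> ua; rewrite limn_esup_lim; apply: lime_le; first exact: is_cvg_esups.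
by apply: nearW => n; apply: ge_ereal_sup => _ [k _ <-].
Qed.

End lower_upper_limits.

(** * Dyadic difference quotients *)

Section dyadic_quotients.
Context {R : realType}.
Variables (r : R -> R) (B c c2 : R).
Hypothesis mr : measurable_fun setT r.
Hypotheses (c0 : 0 <= c) (c20 : 0 <= c2).
Hypothesis rB : forall x, `|r x| <= B.
Hypothesis r_l1 : forall h : R, 0 < h ->
  (\int[leb1]_x `|r (x + h + h) - 2 * r (x + h) + r x|%:E <= (c * Num.sqrt h ^+ 3)%:E)%E.
Hypothesis r_l2 : forall h : R, 0 < h ->
  (\int[leb1]_x ((r (x + h) - r x) ^+ 2)%:E <= (c2 * h ^+ 2)%:E)%E.
Implicit Types (x h : R) (k n : nat).

Definition dyadic k : R := 2^-1 ^+ k.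
Definition dyadic_quotient (f : R -> R) k x : R := (f (x + dyadic k) - f x) / dyadic k.
(* Almost everywhere the upper limit is a limit; it is used because it is total
   and measurable. *)
Definition dyadic_derivative (f : R -> R) x : R :=
  fine (limn_esup (fun k => (dyadic_quotient f k x)%:E)).

Local Notation D k x := (dyadic_quotient r k x).
Local Notation DL := (dyadic_derivative r).

Lemma dyadic_gt0 k : 0 < dyadic k. Proof. by rewrite exprn_gt0// invr_gt0. Qed.

Lemma dyadicS k : dyadic k = 2 * dyadic k.+1.
Proof. by rewrite /dyadic exprS mulrA divff// mul1r. Qed.

Lemma dyadic_cvg0 : dyadic k @[k --> \oo] --> (0 : R).
Proof. by apply: cvg_expr; rewrite ger0_norm ?invr_ge0// invf_lt1// ltr1n. Qed.

Let ms (a : R) : measurable_fun setT (fun x => r (x + a)).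
Proof. exact: (measurableT_comp mr (measurable_shift_by a)). Qed.

Lemma measurable_dyadic_quotient k : measurable_fun setT (fun x => D k x).
Proof.
apply: measurable_funM; last exact: measurable_cst.
by apply: measurable_funB => //; exact: ms.
Qed.

Lemma measurable_dyadic_derivative : measurable_fun setT DL.
Proof.
apply: (measurableT_comp (fine_measurable measurableT)).
apply: measurable_fun_limn_esup => k; apply/measurable_EFinP; exact: measurable_dyadic_quotient.
Qed.

Definition variation k x : R := `|D k.+1 x - D k x|.

Lemma variation_ge0 k x : (0 <= (variation k x)%:E)%E.
Proof. by rewrite lee_fin; exact: normr_ge0. Qed.

Lemma measurable_variation k : measurable_fun setT (variation k).
Proof.
apply: (measurableT_comp measurable_norm).
by apply: measurable_funB; exact: measurable_dyadic_quotient.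
Qed.

Let rho : R := Num.sqrt 2^-1.

(** With h = 2^(-k-1), two consecutive quotients differ by a second difference with step h divided
    by 2 h. Its L^1 norm is at most (c / 2) h^(1/2), a geometric sequence with ratio 2^(-1/2). *)
Lemma variation_l1 k : (\int[leb1]_x (variation k x)%:E <= (geometric (c / 2 * rho) rho k)%:E)%E.
Proof.
set h := dyadic k.+1; have h0 : 0 < h := dyadic_gt0 k.+1.
have vE x : variation k x = (2 * h)^-1 * `|r (x + h + h) - 2 * r (x + h) + r x|.
  rewrite /variation /dyadic_quotient (dyadicS k) -/h.
  have -> : x + 2 * h = x + h + h by ring.
  have -> : (r (x + h) - r x) / h - (r (x + h + h) - r x) / (2 * h) =
     - ((2 * h)^-1 * (r (x + h + h) - 2 * r (x + h) + r x)) by field; rewrite gt_eqF.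
  by rewrite normrN normrM ger0_norm// invr_ge0 mulr_ge0// ltW.
under eq_integral do rewrite vE EFinM.
have i0 : 0 <= (2 * h)^-1 by rewrite invr_ge0 mulr_ge0// ltW.
rewrite ge0_integralZl_EFin//; last first.
  apply/measurable_EFinP; apply: (measurableT_comp measurable_norm).
  apply: measurable_funD => //; apply: measurable_funB.
    under eq_fun do rewrite -addrA; exact: ms.
  by apply: measurable_funM; [exact: measurable_cst|exact: ms].
apply: (@le_trans _ _ ((2 * h)^-1%:E * (c * Num.sqrt h ^+ 3)%:E)%E).
  by rewrite lee_wpmul2l// r_l1.
rewrite -EFinM lee_fin /geometric /=.
have sh : Num.sqrt h = rho ^+ k.+1.
    rewrite (_ : h = (rho ^+ k.+1) ^+ 2); last by rewrite exprAC sqr_sqrtr ?invr_ge0.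
    by rewrite sqrtr_sqr ger0_norm// exprn_ge0// sqrtr_ge0.
rewrite le_eqVlt; apply/orP; left; apply/eqP.
rewrite exprS sqr_sqrtr ?(ltW h0)// sh exprS.
by field; rewrite gt_eqF.
Qed.

Definition total_variation_sum x : \bar R := (\sum_(k <oo) (variation k x)%:E)%E.

Let rho0 : 0 < rho. Proof. by rewrite sqrtr_gt0 invr_gt0. Qed.
Let rho1 : `|rho| < 1.
Proof.
rewrite ger0_norm ?(ltW rho0)// -sqrtr1 ltr_sqrt//.
by rewrite invf_lt1// ltr1n.
Qed.

Lemma total_variation_sum_ge0 x : (0 <= total_variation_sum x)%E.
Proof. by apply: nneseries_ge0 => k _ _; exact: variation_ge0. Qed.

Lemma measurable_total_variation_sum : measurable_fun setT total_variation_sum.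
Proof.
apply: ge0_emeasurable_sum => [k x _ _|k _]; first exact: variation_ge0.
by apply/measurable_EFinP; exact: measurable_variation.
Qed.

Lemma total_variation_sum_integrable : leb1.-integrable setT total_variation_sum.
Proof.
apply/integrableP; split; first exact: measurable_total_variation_sum.
under eq_integral do rewrite gee0_abs ?total_variation_sum_ge0//.
rewrite integral_nneseries//; last 2 first.
  by move=> k; apply/measurable_EFinP; exact: measurable_variation.
  by move=> k x _; exact: variation_ge0.
apply: (@le_lt_trans _ _ (c / 2 * rho / (1 - rho))%:E); last exact: ltry.
apply: lime_le.
  by apply: is_cvg_nneseries => k _ _; apply: integral_ge0 => x _; exact: variation_ge0.
apply: nearW => n.
apply: (@le_trans _ _ (\sum_(0 <= k < n) (geometric (c / 2 * rho) rho k)%:E)%E).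
  by apply: lee_sum => k _; exact: variation_l1.
rewrite sumEFin lee_fin; apply: geometric_le_lim => //.
by rewrite mulr_ge0 ?divr_ge0 ?(ltW rho0).
Qed.

(** Telescoping from the quotient with step 1, which is at most 2 B. The bound does not depend on k
    and becomes integrable after multiplication by a test function. *)
Lemma quotient_dominated k x :
  (`|D k x|%:E <= (2 * B)%:E + total_variation_sum x)%E.
Proof.
have d0 : dyadic 0 = 1 by rewrite /dyadic expr0.
have h : `|D k x| <= 2 * B + \sum_(0 <= i < k) variation i x.
  elim: k => [|k IH].
    rewrite big_geq// addr0 /dyadic_quotient d0 divr1 (le_trans (ler_normB _ _))//.
    by rewrite mulr2n mulrDl !mul1r lerD.
  rewrite big_nat_recr//= addrA -[D k.+1 x](subrK (D k x)) addrC.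
  by rewrite (le_trans (ler_normD _ _))// lerD.
apply: (@le_trans _ _ ((2 * B)%:E + (\sum_(0 <= i < k) variation i x)%:E)%E).
  by rewrite -EFinD lee_fin.
rewrite leeD2l// -sumEFin; apply: (nneseries_lim_ge k) => i _ _.
exact: variation_ge0.
Qed.

Lemma quotient_cvg : {ae leb1, forall x, D k x @[k --> \oo] --> DL x}.
Proof.
have := integrable_ae measurableT total_variation_sum_integrable.
apply: ae_imp => x /(_ I) fx.
have cD : cvgn (fun k => D k x).
  have cs : cvgn (series (fun k => D k.+1 x - D k x)).
    apply: normed_cvg; apply: nondecreasing_is_cvgn.
      by apply: nondecreasing_series => k _ _; exact: normr_ge0.
    exists (fine (total_variation_sum x)) => _ [n _ <-].
    rewrite -lee_fin fineK// /series/= -sumEFin.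
    by apply: (nneseries_lim_ge n) => i _ _; exact: variation_ge0.
  have E : (fun k => D k x) = (fun k => D 0%N x + series (fun k => D k.+1 x - D k x) k).
    by apply/funext => k; rewrite /series/= telescope_sumr// addrC subrK.
  by rewrite E; apply: is_cvgD => //; exact: is_cvg_cst.
have cE : (D k x)%:E @[k --> \oo] --> (limn (fun k => D k x))%:E.
  by apply: cvg_EFin => //; exact: nearW.
have [_ h] := cvg_limn_einf_sup cE.
by rewrite /dyadic_derivative h.
Qed.

(** Fatou's lemma: each quotient has squared L^2 norm at most [c2], since the factor h^2 in the
    hypothesis on differences cancels with the division by h. *)
Lemma derivative_l2 : (\int[leb1]_x ((DL x) ^+ 2)%:E <= c2%:E)%E.
Proof.
have sq (f : R -> R) : measurable_fun setT f -> measurable_fun setT (fun x => (f x ^+ 2)%:E).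
  by move=> mf; apply/measurable_EFinP; apply: measurable_funX.
apply: (@le_trans _ _ (\int[leb1]_x limn_einf (fun k => ((D k x) ^+ 2)%:E))%E).
  apply: ae_ge0_le_integral => //.
  - by move=> x _; rewrite lee_fin sqr_ge0.
  - exact: (sq _ measurable_dyadic_derivative).
  - by move=> x _; apply: limn_einf_ge0 => k; rewrite lee_fin sqr_ge0.
  - rewrite (_ : (fun x => _) = (fun x => - limn_esup (fun k => - ((D k x) ^+ 2)%:E))%E); last first.
      by apply/funext => x; rewrite -[in LHS](oppeK (limn_einf _)) -limn_esupN.
    apply: measurableT_comp => //; apply: measurable_fun_limn_esup => k.
    by apply: measurableT_comp => //; exact: (sq _ (measurable_dyadic_quotient k)).
  apply: (ae_imp _ quotient_cvg) => x cx _.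
  have c2' : ((D k x) ^+ 2)%:E @[k --> \oo] --> ((DL x) ^+ 2)%:E.
    apply: cvg_EFin; first exact: nearW.
    by rewrite expr2; apply: cvgM.
  by have [-> _] := cvg_limn_einf_sup c2'.
apply: (le_trans (fatou _ measurableT _ _)).
- by move=> k; exact: (sq _ (measurable_dyadic_quotient k)).
- by move=> k x _; rewrite lee_fin sqr_ge0.
apply: (le_trans (limn_einf_sup _)); apply: limn_esup_le => k.
have h0 := dyadic_gt0 k.
have -> : (\int[leb1]_x ((D k x) ^+ 2)%:E)%E =
    ((dyadic k ^-2)%:E * \int[leb1]_x ((r (x + dyadic k) - r x) ^+ 2)%:E)%E.
  under eq_integral do rewrite /dyadic_quotient expr_div_n mulrC EFinM.
  rewrite ge0_integralZl_EFin//.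
  - by move=> x _; rewrite lee_fin sqr_ge0.
  - by apply: sq; apply: measurable_funB => //; exact: ms.
  - by rewrite invr_ge0 exprn_ge0// ltW.
apply: (@le_trans _ _ ((dyadic k ^-2)%:E * (c2 * dyadic k ^+ 2)%:E)%E).
  by apply: lee_wpmul2l; [rewrite lee_fin invr_ge0 exprn_ge0// ltW|exact: r_l2].
by rewrite -EFinM lee_fin mulrC mulfK// expf_neq0// gt_eqF.
Qed.

End dyadic_quotients.

(** * Integral bounds for R and its differences *)

Section fluctuation_integrals.
Context {R : realType}.
Variables (tfin d al : R) (e : nat -> R) (ts : nat -> nat -> \bar R).
Variables (p q : nat -> R -> int -> R) (K : nat -> nat) (S : nat -> nat -> R).
Hypothesis sd : scaled_data tfin d al e ts p q K S.
Variables (xi : R -> R) (Q Rf : R * R -> R) (er : nat -> R).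
Hypothesis ld : limit_data tfin d al e q K S xi Q Rf er.
Implicit Types (t tau x h : R) (j : int) (n k m : nat).
Local Notation R2 := (measurableTypeR R * measurableTypeR R)%type.
Let e0 n : 0 < e n := sd_e sd n.
Let fl n tau j := fluct d (e n) (K n) (S n) (tau / e n ^+ 2) j.
Let W := wconst tfin d.
Let rc := rconst tfin d.
Let W0 : 0 <= W. Proof. exact: wconst_ge0 (sd_d sd). Qed.

Lemma measurable_Rf_slice tau : Itau tfin tau -> measurable_fun setT (fun x => Rf (tau, x)).
Proof.
move=> It _ Y mY; have mR := measurable_Rf sd ld.
have := mR (measurable_Omega tfin) Y mY; rewrite setTI => mO.
have := measurable_xsection tau mO; congr (measurable _).
apply/seteqP; split => x; rewrite /xsection /= inE /=.
  by move=> [_].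
by move=> h; split => //; exact: OmegaE.
Qed.

Let macro_le n tau : tau <= tfin -> tau / e n ^+ 2 <= tfin / e n ^+ 2.
Proof. by move=> h; rewrite ler_pM2r// invr_gt0 exprn_gt0. Qed.

Let Itau_le tau : Itau tfin tau -> tau <= tfin.
Proof. by rewrite /Itau /= in_itv/= => /andP[]. Qed.

(** Every kernel has mass at most 1 and enters with the factor 2; there are at most tfin / (2 d eps)
    of them, and a cell has length eps. *)
Lemma Rf_l1 tau : Itau tfin tau -> (\int[leb1]_x `|Rf (tau, x)|%:E <= (tfin / d)%:E)%E.
Proof.
move=> It; have dd := sd_d sd.
apply: (@l1_limit _ e er (fun n j => `|fl n tau j|) (fun x => `|Rf (tau, x)|) _ e0 (ld_er ld)) => //.
- move=> n b m; have h := @fluct_l1 _ d (e n) (K n) (S n) dd (e0 n) (tau / e n ^+ 2) b m.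
  apply: (le_trans (ler_wpM2l (ltW (e0 n)) h)).
  have := md_bound (sd_md sd n); rewrite ler_pdivlMr ?mulr_gt0// => hK.
  by rewrite ler_pdivlMr//; lra.
- by apply: measurableT_comp (measurable_Rf_slice It); exact: measurable_norm.
- move=> n x; have := ld_R ld n (OmegaE x It); rewrite distrC => h.
  rewrite -[Rf (tau, x)](subrK (limR d e K S n (tau, x))) addrC.
  by rewrite (le_trans (ler_normD _ _))// lerD2l.
Qed.

Lemma Rf_Linfty_L1 : Linfty_Lp tfin 1%E Rf.
Proof.
split; first exact: (measurable_Rf sd ld).
exists (tfin / d); apply: aeW => tau It; rewrite Lnorm1.
by have := Rf_l1 It.
Qed.

Definition step_count n h : nat := Num.truncn (h / e n).

Lemma step_count_le n h : 0 <= h -> (step_count n h)%:R * e n <= h.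
Proof.
move=> h0; rewrite -ler_pdivlMr//.
by have /andP[] := @truncn_itv R (h / e n) (divr_ge0 h0 (ltW (e0 n))).
Qed.

Lemma step_count_gt n h : 0 <= h -> `|(step_count n h)%:R * e n - h| <= e n.
Proof.
move=> h0; have a := step_count_le n h0; have en := e0 n.
have /andP[_] := @truncn_itv R (h / e n) (divr_ge0 h0 (ltW en)).
rewrite -/(step_count n h) ltr_pdivrMr// -natr1 mulrDl mul1r => b.
by rewrite ler_norml; apply/andP; split; lra.
Qed.

Lemma rnd_add n x m : rnd (e n) (x + m%:R * e n) = rnd (e n) x + m%:Z.
Proof.
have := @rndB _ (e n) (x + m%:R * e n) m (e0 n).
by rewrite [e n * _]mulrC addrK => ->; rewrite subrK.
Qed.

(** The step h is not a multiple of eps and is replaced by its truncation. Even for the double step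
    this misplaces the argument by at most 2 eps, which is paid with the space modulus of R; [er n]
    is the distance to the approximation. *)
Let shift_err n : R := rc * Num.sqrt (2 * e n) + er n.

Lemma shift_err_ge0 n : 0 <= shift_err n.
Proof. by rewrite addr_ge0 ?(er_ge0 sd ld)// mulr_ge0 ?sqrtr_ge0 ?(rc_ge0 sd). Qed.

Lemma shift_err_cvg0 : shift_err n @[n --> \oo] --> (0 : R).
Proof.
rewrite -[X in _ --> X](addr0 0); apply: cvgD; last exact: (ld_er ld).
rewrite -[X in _ --> X](mulr0 rc); apply: cvgM; first exact: cvg_cst.
apply: (@cvg_comp _ _ _ (fun n => 2 * e n) (@Num.sqrt R)).
  have h : 2 * e n @[n --> \oo] --> 2 * (0 : R).
    by apply: cvgM; [exact: cvg_cst|exact: (sd_cvg sd)].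
  by rewrite mulr0 in h; exact: h.
by apply: cvg0_eps; [exact: sqrt_continuous|exact: sqrtr0].
Qed.

Lemma Rf_fluct_shift n tau x y m : Itau tfin tau -> `|x + m%:R * e n - y| <= 2 * e n ->
  `|Rf (tau, y) - fl n tau (rnd (e n) x + m%:Z)| <= shift_err n.
Proof.
move=> It h; have h1 := ld_R ld n (OmegaE (x + m%:R * e n) It).
have h2 := ld_Rmod ld (OmegaE (x + m%:R * e n) It) (OmegaE y It).
rewrite /limR /= rnd_add -/(fl n tau _) in h1; rewrite /= subrr normr0 qroot0 mulr0 add0r in h2.
have h3 : Num.sqrt `|x + m%:R * e n - y| <= Num.sqrt (2 * e n) by exact: ler_wsqrtr.
have h4 := ler_wpM2l (rc_ge0 sd) h3.
move: (Rf (tau, x + m%:R * e n)) h1 h2 => a h1 h2.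
rewrite distrC -[X in `|X|](_ : (fl n tau (rnd (e n) x + m%:Z) - a) + (a - Rf (tau, y)) = _); last by ring.
rewrite (le_trans (ler_normD _ _))// addrC /shift_err lerD// (le_trans h2)//.
Qed.

Lemma Rf_second_difference_l1 tau h : Itau tfin tau -> 0 < h ->
  (\int[leb1]_x `|Rf (tau, x + h + h) - 2 * Rf (tau, x + h) + Rf (tau, x)|%:E <=
    (4 * W * Num.sqrt h ^+ 3)%:E)%E.
Proof.
move=> It h0; have mR := measurable_Rf_slice It.
pose M n := step_count n h.
apply: (@l1_limit _ e (fun n => 4 * shift_err n) (fun n j => `|diff (M n) (diff (M n) (fl n tau)) j|)
  _ _ e0) => //.
- rewrite -[X in _ --> X](mulr0 4); apply: cvgM; first exact: cvg_cst.
  exact: shift_err_cvg0.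
- move=> n b m; have en := e0 n.
  have hh := @diff2_fluct_l1 _ tfin d (e n) (K n) (S n) (sd_tfin sd) (sd_d sd) en (sd_e1 sd n)
    (fun k => sd_S_gt0 sd (n := n) (k := k)) (md_gap (sd_md sd n)) (M n) (tau / e n ^+ 2)
    (macro_le n (Itau_le It)) b m.
  apply: (le_trans (ler_wpM2l (ltW en) hh)).
  have -> : e n * (4 * wconst tfin d * Num.sqrt (M n)%:R ^+ 3 * Num.sqrt (e n)) =
      4 * W * Num.sqrt ((M n)%:R * e n) ^+ 3.
    rewrite sqrtrM// exprMn [Num.sqrt (e n) ^+ 3]exprS sqr_sqrtr ?(ltW en)//.
    by rewrite /W; ring.
  rewrite ler_wpM2l ?mulr_ge0// lerXn2r ?nnegrE ?sqrtr_ge0// ler_wsqrtr//.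
  exact: step_count_le (ltW h0).
- have ms (a : R) : measurable_fun setT (fun x => Rf (tau, x + a)).
    exact: (measurableT_comp mR (measurable_shift_by a)).
  apply: (measurableT_comp measurable_norm); apply: measurable_funD => //.
  apply: measurable_funB.
    under eq_fun do rewrite -addrA; exact: ms.
  by apply: measurable_funM; [exact: measurable_cst|exact: ms].
- move=> n x; have hM := step_count_gt n (ltW h0); rewrite -/(M n) in hM.
  have en := e0 n; have [hl hr] : (M n)%:R * e n - h <= e n /\ h - (M n)%:R * e n <= e n.
    by move: hM; rewrite ler_norml => /andP[? ?]; split; lra.
  have A := @Rf_fluct_shift n tau x x 0%N It; rewrite mul0r !addr0 subrr normr0 in A.
  have {}A := A (mulr_ge0 _ (ltW en)).
  have B : `|Rf (tau, x + h) - fl n tau (rnd (e n) x + (M n)%:Z)| <= shift_err n.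
    by apply: Rf_fluct_shift => //; rewrite ler_norml; apply/andP; split; lra.
  have C : `|Rf (tau, x + h + h) - fl n tau (rnd (e n) x + (M n + M n)%:Z)| <= shift_err n.
    by apply: Rf_fluct_shift => //; rewrite natrD ler_norml; apply/andP; split; lra.
  rewrite /diff -[rnd (e n) x + (M n)%:Z + (M n)%:Z]addrA -PoszD.
  move: A B C (A (ler0n _ _)) => _.
  move: (Rf _) (Rf _) (Rf _) (fl n tau _) (fl n tau _) (fl n tau _) (shift_err n) => a c b f0 f2 f1 s.
  rewrite [c - _ + _](_ : _ = (f2 - f1 - (f1 - f0)) + ((c - f2) - 2 * (b - f1) + (a - f0))); last by ring.
  move=> B C A; rewrite (le_trans (ler_normD _ _))// lerD2l.
  rewrite (le_trans (ler_normD _ _))// (le_trans (lerD (ler_normB _ _) A))//.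
  by rewrite normrM ger0_norm//; lra.
Qed.

Let C0 : R := 2 * qroot (tfin + d) * W.

Lemma Rf_difference_l2 tau h : Itau tfin tau -> 0 < h ->
  (\int[leb1]_x ((Rf (tau, x + h) - Rf (tau, x)) ^+ 2)%:E <= (8 * W ^+ 2 * h ^+ 2)%:E)%E.
Proof.
move=> It h0; have mR := measurable_Rf_slice It.
pose M n := step_count n h.
have C00 : 0 <= C0 by rewrite !mulr_ge0// qroot_ge0.
have fC n j : `|fl n tau j| <= C0 by exact: (fluct_le sd n j (Itau_le It)).
(* The differences of R and of its approximation are within 2 s of each other, and the latter is at
   most 2 C0; expanding the square gives the error 8 C0 s + 4 s^2 with s = [shift_err n]. *)
apply: (@l1_limit _ e (fun n => 8 * C0 * shift_err n + 4 * shift_err n ^+ 2)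
  (fun n j => diff (M n) (fl n tau) j ^+ 2) _ _ e0) => //.
- rewrite -[X in _ --> X](addr0 0); apply: cvgD.
    rewrite -[X in _ --> X](mulr0 (8 * C0)); apply: cvgM; first exact: cvg_cst.
    exact: shift_err_cvg0.
  rewrite -[X in _ --> X](mulr0 4); apply: cvgM; first exact: cvg_cst.
  rewrite -[X in _ --> X](mulr0 0); under eq_fun do rewrite expr2.
  by apply: cvgM; exact: shift_err_cvg0.
- by move=> n j; exact: sqr_ge0.
- move=> n b m; have en := e0 n.
  have hh := @diff_fluct_l2 _ tfin d (e n) (K n) (S n) (sd_tfin sd) (sd_d sd) en (sd_e1 sd n)
    (fun k => sd_S_gt0 sd (n := n) (k := k)) (md_gap (sd_md sd n)) (M n) (tau / e n ^+ 2) b m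
    (macro_le n (Itau_le It)).
  apply: (le_trans (ler_wpM2l (ltW en) hh)).
  have -> : e n * (8 * wconst tfin d ^+ 2 * e n * (M n)%:R ^+ 2) =
      8 * W ^+ 2 * ((M n)%:R * e n) ^+ 2 by rewrite /W; ring.
  rewrite ler_wpM2l ?mulr_ge0 ?sqr_ge0// lerXn2r ?nnegrE ?mulr_ge0 ?(ltW en) ?(ltW h0)//.
  exact: step_count_le (ltW h0).
- apply: measurable_funX; apply: measurable_funB => //.
  exact: (measurableT_comp mR (measurable_shift_by h)).
- by move=> x; exact: sqr_ge0.
- move=> n x; have hM := step_count_gt n (ltW h0); rewrite -/(M n) in hM.
  have en := e0 n; have s0 := shift_err_ge0 n.
  have A := @Rf_fluct_shift n tau x x 0%N It; rewrite mul0r !addr0 subrr normr0 in A.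
  have {}A := A (mulr_ge0 (ler0n _ _) (ltW en)).
  have B : `|Rf (tau, x + h) - fl n tau (rnd (e n) x + (M n)%:Z)| <= shift_err n.
    by apply: Rf_fluct_shift => //; move: hM; rewrite !ler_norml => /andP[? ?]; apply/andP; split; lra.
  have := fC n (rnd (e n) x + (M n)%:Z); have := fC n (rnd (e n) x).
  rewrite /diff; move: (shift_err n) A B s0; move: (Rf _) (Rf _) (fl n tau _) (fl n tau _).
  move: C0 C00 => C Cp b a f1 f0 s; rewrite !ler_norml => /andP[a1 a2] /andP[b1 b2] s0.
  move=> /andP[c1 c2] /andP[c3 c4].
  have [u1 u2] : - (2 * s) <= (b - a) - (f1 - f0) /\ (b - a) - (f1 - f0) <= 2 * s by split; lra.
  have [v1 v2] : - (2 * C) <= f1 - f0 /\ f1 - f0 <= 2 * C by split; lra.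
  move: (b - a) (f1 - f0) u1 u2 v1 v2 => y z *.
  nra.
Qed.

End fluctuation_integrals.

Section dominated_real_integrals.
Context {R : realType}.

Lemma Rintegral_dominated_cvg (f_ : nat -> R -> R) (f : R -> R) (g : R -> \bar R) :
  (forall n, measurable_fun setT (f_ n)) -> measurable_fun setT f ->
  {ae leb1, forall x, f_ n x @[n --> \oo] --> f x} ->
  leb1.-integrable setT g -> (forall n x, (`|f_ n x|%:E <= g x)%E) ->
  \int[leb1]_x f_ n x @[n --> \oo] --> \int[leb1]_x f x.
Proof.
move=> mf_ mf cf ig fg.
have [||||||fi _ h] := @dominated_convergence _ _ _ leb1 setT _ (fun n => EFin \o f_ n) (EFin \o f) g.
- exact: measurableT.
- by move=> n; apply/measurable_EFinP; exact: mf_.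
- by apply/measurable_EFinP; exact: mf.
- by apply: ae_imp cf => z fz _; apply: cvg_EFin => //; exact: nearW.
- exact: ig.
- by apply: aeW => x n _ /=; exact: fg.
by apply: fine_cvg; rewrite fineK; [exact: h|exact: integrable_fin_num].
Qed.

End dominated_real_integrals.

(** * The limit of the dyadic quotients is a weak derivative *)

Section weak_dyadic_derivative.
Context {R : realType}.
Variables (r : R -> R) (B c : R).
Hypothesis mr : measurable_fun setT r.
Hypotheses (c0 : 0 <= c) (B0 : 0 <= B).
Hypothesis rB : forall x, `|r x| <= B.
Hypothesis r_l1 : forall h : R, 0 < h ->
  (\int[leb1]_x `|r (x + h + h) - 2 * r (x + h) + r x|%:E <= (c * Num.sqrt h ^+ 3)%:E)%E.
Variables (phi dphi : R -> R) (X M : R).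
Hypothesis phi_derive : forall x : R, is_derive x 1 phi (dphi x).
Hypothesis dphi_cont : continuous dphi.
Hypothesis phi_supp : forall x, phi x != 0 -> `|x| < X.
Hypothesis dphi_supp : forall x, dphi x != 0 -> `|x| < X.
Hypothesis phi_le : forall x, `|phi x| <= M.
Hypothesis dphi_le : forall x, `|dphi x| <= M.
Implicit Types (x h : R) (k n : nat).

Let M0 : 0 <= M. Proof. exact: le_trans (phi_le 0). Qed.

Let phi_cont : continuous phi.
Proof. by move=> x; have [h _] := phi_derive x; apply: differentiable_continuous; exact/derivable1_diffP. Qed.

Let mphi : measurable_fun setT phi. Proof. exact: continuous_measurable_fun. Qed.
Let mdphi : measurable_fun setT dphi. Proof. exact: continuous_measurable_fun. Qed.

Let ms (f : R -> R) (a : R) : measurable_fun setT f -> measurable_fun setT (fun x => f (x + a)).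
Proof. by move=> mf; exact: (measurableT_comp mf (measurable_shift_by a)). Qed.

Lemma phi_lipschitz x h : 0 <= h -> `|phi (x + h) - phi x| <= M * h.
Proof.
move=> h0; rewrite -[X in _ * X](_ : x + h - x = h); last by ring.
apply: (derivative_bound (df := dphi)) => //; rewrite ?lerDl//.
by apply: continuous_subspaceT => y; exact: phi_cont.
Qed.

Let backward k x := (phi (x - dyadic k) - phi x) / dyadic k.

Lemma backward_le k x : `|backward k x| <= M.
Proof.
have h0 := @dyadic_gt0 R k; rewrite normrM normfV (gtr0_norm h0) ler_pdivrMr// distrC.
by have := phi_lipschitz (x - dyadic k) (ltW h0); rewrite subrK.
Qed.

Lemma backward_cvg x : backward k x @[k --> \oo] --> - dphi x.
Proof.
have [dx dE] := phi_derive x.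
have hc : h^-1 *: (phi (h *: (1 : R) + x) - phi x) @[h --> (0 : R)^'] --> dphi x.
  by rewrite -dE; exact: dx.
have dk : - dyadic k @[k --> \oo] --> (0 : R)^'.
  have h : - dyadic k @[k --> \oo] --> (0 : R).
    by rewrite -[X in _ --> X]oppr0; apply: cvgN; exact: dyadic_cvg0.
  move=> U hU.
  have hU' : \forall k \near \oo, (- dyadic k : R) != 0 -> U (- dyadic k) := h _ hU.
  suff : \forall k \near \oo, U (- dyadic k) by [].
  by apply: filterS hU' => k; apply; rewrite oppr_eq0 gt_eqF// dyadic_gt0.
rewrite (_ : (fun k => _) = (fun k => - ((- dyadic k)^-1 *: (phi ((- dyadic k) *: (1 : R) + x) - phi x)))).
  by apply: cvgN; exact: (cvg_comp _ (fun h => h^-1 *: (phi (h *: (1 : R) + x) - phi x)) dk hc).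
apply/funext => k; rewrite /backward /GRing.scale/= mulr1 invrN mulNr opprK mulrC.
by rewrite [- _ + x]addrC.
Qed.

Lemma quotient_by_parts k : \int[leb1]_x (dyadic_quotient r k x * phi x) =
  \int[leb1]_x (r x * backward k x).
Proof.
have h0 := @dyadic_gt0 R k; set h := dyadic k in h0 *.
have i1 : leb1.-integrable setT (EFin \o (fun x => r (x + h) * phi x)).
  apply: (@compact_support_integrable _ X (B * M)).
  - by apply: measurable_funM => //; exact: ms.
  - by move=> x; rewrite normrM ler_pM.
  - by move=> x; rewrite mulf_eq0 negb_or => /andP[_ /phi_supp].
have i2 : leb1.-integrable setT (EFin \o (fun x => r x * phi x)).
  apply: (@compact_support_integrable _ X (B * M)).
  - exact: measurable_funM.
  - by move=> x; rewrite normrM ler_pM.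
  - by move=> x; rewrite mulf_eq0 negb_or => /andP[_ /phi_supp].
have i3 : leb1.-integrable setT (EFin \o (fun x => r x * phi (x - h))).
  apply: (@compact_support_integrable _ (X + h) (B * M)).
  - by apply: measurable_funM => //; exact: ms.
  - by move=> x; rewrite normrM ler_pM.
  - move=> x; rewrite mulf_eq0 negb_or => /andP[_ /phi_supp].
    by rewrite !ltr_norml => /andP[? ?]; apply/andP; split; lra.
have E (f1 f2 : R -> R) : leb1.-integrable setT (EFin \o f1) -> leb1.-integrable setT (EFin \o f2) ->
    \int[leb1]_x (h^-1 * (f1 x - f2 x)) = h^-1 * (\int[leb1]_x f1 x - \int[leb1]_x f2 x).
  move=> j1 j2; rewrite RintegralZl//; last by have := integrableB measurableT j1 j2.
  by rewrite RintegralB.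
transitivity (h^-1 * (\int[leb1]_x (r (x + h) * phi x) - \int[leb1]_x (r x * phi x))).
  rewrite -E//; apply: eq_Rintegral => x _; rewrite /dyadic_quotient -/h; ring.
have -> : \int[leb1]_x (r (x + h) * phi x) = \int[leb1]_x (r x * phi (x - h)).
  have := @Rintegral_shift _ h (fun x => r x * phi (x - h)).
  under eq_Rintegral do rewrite addrK.
  apply; first by apply: measurable_funM => //; exact: ms.
  by apply: eq_integrable i1 => // x _ /=; rewrite addrK.
by rewrite -E//; apply: eq_Rintegral => x _; rewrite /backward -/h; ring.
Qed.

(** A translation moves the quotient to [phi], and both sides converge by dominated convergence: one
    with the summed variations as dominating function, the other by the mean value bound for the
    quotients of [phi]. *)
Lemma dyadic_derivative_weak :
  \int[leb1]_x (r x * dphi x) = - \int[leb1]_x (dyadic_derivative r x * phi x).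
Proof.
have l1 : \int[leb1]_x (dyadic_quotient r k x * phi x) @[k --> \oo] -->
    \int[leb1]_x (dyadic_derivative r x * phi x).
  apply: (@Rintegral_dominated_cvg _ _ _ (fun x => M%:E * ((((fun=> 2 * B) \_ [set` `](- X), X[]) x)%:E +
     total_variation_sum r x))%E).
  - by move=> n; apply: measurable_funM => //; exact: measurable_dyadic_quotient.
  - by apply: measurable_funM => //; exact: measurable_dyadic_derivative.
  - have := quotient_cvg mr c0 r_l1; apply: ae_imp => x cx.
    by apply: cvgM => //; exact: cvg_cst.
  - apply: integrableZl => //; apply: integrableD => //.
      apply: (@compact_support_integrable _ X (2 * B)).
      - by apply/(measurable_restrictT _ (measurable_itv _)); exact: measurable_cst.
      - by move=> x; rewrite patchE; case: ifP => _; rewrite ?normr0 ?ger0_norm ?mulr_ge0.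
      - by move=> x; rewrite patchE; case: ifPn => [/set_mem|]; rewrite ?eqxx//= in_itv/= ltr_norml.
    exact: (total_variation_sum_integrable mr c0 r_l1).
  - move=> n x; have [->|px] := eqVneq (phi x) 0.
      rewrite mulr0 normr0 mule_ge0 ?adde_ge0 ?total_variation_sum_ge0// lee_fin//.
      by rewrite patchE; case: ifP => _; rewrite ?mulr_ge0.
    rewrite patchE ifT; last by apply/mem_set; rewrite /= in_itv/= -ltr_norml phi_supp.
    rewrite normrM mulrC EFinM; apply: lee_pmul => //; rewrite ?lee_fin//.
    exact: (quotient_dominated rB).
have l2 : \int[leb1]_x (r x * backward k x) @[k --> \oo] --> \int[leb1]_x (- 1 * (r x * dphi x)).
  (* Dyadic steps are at most 1, so the backward quotients of [phi] are all supported in the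
     interval enlarged by 1. *)
  apply: (@Rintegral_dominated_cvg _ _ _ (fun x => (((fun=> B * M) \_ [set` `](- X - 1), (X + 1)[]) x)%:E)).
  - by move=> n; apply: measurable_funM => //; apply: measurable_funM => //; apply: measurable_funB => //; exact: ms.
  - by apply: measurable_funM => //; exact: measurable_funM.
  - apply: aeW => x; rewrite mulN1r -mulrN; apply: cvgM; [exact: cvg_cst|exact: backward_cvg].
  - apply: (@compact_support_integrable _ (X + 1) (B * M)).
    + apply/(measurable_restrictT _ (measurable_itv _)); exact: measurable_cst.
    + by move=> x; rewrite patchE; case: ifP => _; rewrite ?normr0 ?ger0_norm ?mulr_ge0.
    + move=> x; rewrite patchE; case: ifPn => [/set_mem|_]; last by rewrite eqxx.
      by rewrite /= in_itv/= ltr_norml opprD.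
  - move=> n x; rewrite lee_fin patchE; case: ifPn => [_|xX].
      by rewrite normrM ler_pM// backward_le.
    have h0 := @dyadic_gt0 R n; have h1 : dyadic n <= 1 :> R.
      by rewrite exprn_ile1// ?invr_ge0// invf_le1// ler1n.
    have z y : ~ `|y| < X -> phi y = 0.
      by move=> yX; apply/eqP; apply: contra_notT yX => /phi_supp.
    have xX' : ~ (- X - 1 < x < X + 1).
      by move=> h; move/negP: xX; apply; apply/mem_set; rewrite /= in_itv.
    rewrite /backward !z ?subrr ?mul0r ?mulr0 ?normr0// => h; apply: xX'; move: h.
      by rewrite ltr_norml => /andP[? ?]; apply/andP; split; lra.
    by rewrite ltr_norml => /andP[? ?]; apply/andP; split; lra.
have E : \int[leb1]_x (-1 * (r x * dphi x)) = - \int[leb1]_x (r x * dphi x).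
  rewrite RintegralZl ?mulN1r//; apply: (@compact_support_integrable _ X (B * M)).
  - exact: measurable_funM.
  - by move=> x; rewrite normrM ler_pM.
  - by move=> x; rewrite mulf_eq0 negb_or => /andP[_ /dphi_supp].
rewrite -[LHS]opprK -E; congr (- _).
have l2' : \int[leb1]_x (dyadic_quotient r k x * phi x) @[k --> \oo] --> \int[leb1]_x (- 1 * (r x * dphi x)).
  by rewrite (funext quotient_by_parts).
by apply: (cvg_unique _ l2' l1); exact: Rhausdorff.
Qed.

End weak_dyadic_derivative.

(** No integrability is involved: [fine] sends infinite values to 0, so the sign also comes out when
    the integral is infinite. It serves for the outer integral in time. *)
Lemma Rintegral_opp d (T : measurableType d) (R : realType) (mu : {measure set T -> \bar R})
  (D : set T) (f : T -> R) : \int[mu]_(x in D) (- f x) = - \int[mu]_(x in D) f x.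
Proof.
rewrite /Rintegral (integralE mu D (EFin \o f)) (integralE mu D (fun x => (- f x)%:E)).
rewrite (_ : (fun x => (- f x)%:E)^\+%E = (EFin \o f)^\-%E).
  rewrite (_ : (fun x => (- f x)%:E)^\-%E = (EFin \o f)^\+%E).
    move: (integral mu D _) (integral mu D _) => [a| |] [b| |] //=; rewrite ?oppr0//.
    by rewrite opprB addrC.
  by apply/funext => x; rewrite funenegE funeposE/= opprK.
by apply/funext => x; rewrite funenegE funeposE/= EFinN.
Qed.

(** * The space derivative of R as a function of both variables *)

Section fluctuation_derivative.
Context {R : realType}.
Variables (tfin d al : R) (e : nat -> R) (ts : nat -> nat -> \bar R).
Variables (p q : nat -> R -> int -> R) (K : nat -> nat) (S : nat -> nat -> R).
Hypothesis sd : scaled_data tfin d al e ts p q K S.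
Variables (xi : R -> R) (Q Rf : R * R -> R) (er : nat -> R).
Hypothesis ld : limit_data tfin d al e q K S xi Q Rf er.
Implicit Types (t tau x h : R) (j : int) (n k m : nat).
Local Notation R2 := (measurableTypeR R * measurableTypeR R)%type.

Let DR (z : R * R) := dyadic_derivative (fun x => Rf (z.1, x)) z.2.

Let measurable_DR : measurable_fun (Omega tfin) DR.
Proof.
have mR := measurable_Rf sd ld.
have mRa (a : R) : measurable_fun (Omega tfin : set R2) (fun z => Rf (z.1, z.2 + a)).
  move=> mO Y mY.
  have ms : measurable_fun (setT : set R2) (fun z : R2 => ((z.1, z.2 + a) : R2)).
    apply: measurable_fun_pair; first exact: measurable_fst.
    exact: measurableT_comp (measurable_shift_by a) measurable_snd.
  have := ms measurableT _ (mR mO Y mY); congr (measurable _).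
  apply/seteqP; split => z /=; first by move=> [_ [[h _] h2]]; split.
  by move=> [[h _] h2]; split.
apply: (measurableT_comp (fine_measurable measurableT)).
apply: measurable_fun_limn_esup => k; apply/measurable_EFinP.
apply: measurable_funM; last exact: measurable_cst.
apply: measurable_funB; first exact: mRa.
by have := mRa 0; congr measurable_fun; apply/funext => z; rewrite addr0.
Qed.

Lemma Rf_weak_derivative : exists2 DR : R * R -> R, weak_dxi tfin Rf DR & Linfty_Lp tfin 2%:E DR.
Proof.
have [B hB] := Rf_bounded sd ld.
have rB tau : Itau tfin tau -> forall x, `|Rf (tau, x)| <= B.
  by move=> It x; apply: hB; exact: OmegaE.
pose W := wconst tfin d.
have W0 : 0 <= W := wconst_ge0 _ (sd_d sd).
have c0 : 0 <= 4 * W by rewrite mulr_ge0.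
exists DR.
  move=> psi /test_dataP[X [M td]].
  rewrite -Rintegral_opp; apply: eq_Rintegral => tau /set_mem It.
  have B0 : 0 <= B by exact: le_trans (rB _ It 0).
  apply: (@dyadic_derivative_weak _ _ B _ (measurable_Rf_slice sd ld It) c0 B0 (rB _ It) _
    _ _ X M (td_dx td tau)).
  - by move=> h h0; exact: (Rf_second_difference_l1 sd ld It h0).
  - move=> x; apply: (@continuous_comp _ _ _ (fun x => (tau, x)) (dxi psi)); last exact: (td_cx td).
    exact: (cvg_pair (cvg_cst _) (@cvg_id _ (nbhs x))).
  - move=> x /negP h; apply: contra_notT h => xX.
    have [] // := td_supp td (z := (tau, x)).
      by move=> [_ /boxE[_ /= h]]; move/negP: xX; apply.
    by move=> -> _ _ _.
  - move=> x /negP h; apply: contra_notT h => xX.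
    have [] // := td_supp td (z := (tau, x)).
      by move=> [_ /boxE[_ /= h]]; move/negP: xX; apply.
    by move=> _ _ -> _.
  - by move=> x; have [] := td_bound td (tau, x).
  - by move=> x; have [] := td_bound td (tau, x).
split; first exact: measurable_DR.
exists ((8 * W ^+ 2) `^ 2^-1); apply: aeW => tau It.
have c20 : 0 <= 8 * W ^+ 2 by rewrite mulr_ge0// sqr_ge0.
apply: Lnorm_le => //.
have h := derivative_l2 (measurable_Rf_slice sd ld It) c0
  (@Rf_second_difference_l1 _ _ _ _ _ _ _ _ _ _ sd _ _ _ _ ld tau ^~ It)
  (@Rf_difference_l2 _ _ _ _ _ _ _ _ _ _ sd _ _ _ _ ld tau ^~ It).
under eq_integral do rewrite powR_mulrn// real_normK ?num_real//.
exact: h.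
Qed.

End fluctuation_derivative.

(** * Differentiability of the interface *)

Section monotone_lipschitz.
Context {R : realType}.
Implicit Types (f : R -> R) (x y : R).

Lemma lebesgue_stieltjes_itv (F : cumulative R R) (a b : R) : a <= b ->
  lebesgue_stieltjes_measure F `]a, b] = (F b - F a)%:E.
Proof.
move=> ab; rewrite /lebesgue_stieltjes_measure/= /measure_extension/= measurable_mu_extE/=; last exact: is_ocitv.
by rewrite wlength_itv_bnd.
Qed.

(* [x - f x] is also a distribution function, and its Stieltjes measure and
   that of [f] add up to the Lebesgue measure. *)
Lemma contraction_ae_derivable f : {homo f : x y / x <= y} ->
  (forall x y, x <= y -> f y - f x <= y - x) ->
  {ae leb1, forall x, derivable f x 1}.
Proof.
move=> nf lf.
have cf : continuous f.
  move=> x; apply/cvgrPdist_le => ep ep0; near=> y.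
  have h : `|x - y| <= ep by near: y; apply: cvgr_dist_le.
  apply: le_trans h; have [xy|xy] := leP x y.
    rewrite distrC ger0_norm ?subr_ge0 ?nf// distrC ger0_norm ?subr_ge0//; exact: lf.
  rewrite ger0_norm ?subr_ge0 ?nf ?(ltW xy)// ger0_norm ?subr_ge0 ?(ltW xy)//.
  exact: lf (ltW xy).
pose g x := x - f x.
have ng : {homo g : x y / x <= y} by move=> x y xy; have := lf _ _ xy; rewrite /g; lra.
have cg : continuous g by move=> x; apply: cvgB; [exact: cvg_id|exact: cf].
pose F : cumulative R R := HB.pack f (isCumulative.Build R _ R f nf (right_continuousW cf)).
pose G : cumulative R R := HB.pack g (isCumulative.Build R _ R g ng (right_continuousW cg)).
pose mF : {measure set (measurableTypeR R) -> \bar R} := lebesgue_stieltjes_measure F.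
pose mG : {measure set (measurableTypeR R) -> \bar R} := lebesgue_stieltjes_measure G.
have mFle (A : set (measurableTypeR R)) : measurable A -> (mF A <= lebesgue_measure A)%E.
  move=> mA; have -> : lebesgue_measure A = measure_add mF mG A.
    apply: (@lebesgue_measure_unique _ (measure_add mF mG)) => //.
    move=> _ [[a b] _ <-]; pose I : set (measurableTypeR R) := `]a, b]%classic.
    transitivity (mF I + mG I)%E; last exact/esym/measure_addE.
    have [ab|ba] := leP a b; last by rewrite /I /= set_itv_ge ?measure0 ?adde0// -leNgt bnd_simp ltW.
    rewrite [mF _](lebesgue_stieltjes_itv F ab) [mG _](lebesgue_stieltjes_itv G ab)/=.
    rewrite lebesgue_measure_itv/= lte_fin /g; case: ltP => [_|ba].
      by rewrite -!EFinD; congr EFin; ring.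
    have -> : a = b by apply/le_anti; rewrite ab ba.
    by rewrite !subrr -EFinD addr0.
  rewrite [X in (_ <= X)%E](measure_addE mF mG A) leeDl//.
(* The line is cut into bounded intervals, on which the Stieltjes measure of [f] is finite and has
   an integrable density. *)
suff main (N : nat) : {ae leb1, forall x, - N%:R < x < N%:R -> derivable f x 1}.
  apply: ae_imp (ae_forall_nat main) => x h; apply: (h (Num.truncn `|x|).+1).
  by rewrite -ltr_norml truncnS_gt.
pose lo : R := - N%:R; pose hi : R := N%:R.
pose E : set (measurableTypeR R) := `]lo, hi]%classic.
have mE : measurable E by exact: measurable_itv.
have lohi : lo <= hi by rewrite /lo /hi ge0_cp.
have Eoo : (mF E < +oo)%E by rewrite [mF E](lebesgue_stieltjes_itv F lohi) ltry.
pose nu : {finite_measure set (measurableTypeR R) -> \bar R} := mfrestr mE Eoo.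
pose la : {sigma_finite_measure set (measurableTypeR R) -> \bar R} := @lebesgue_measure R.
have [|phi [phi0 phif phii phiE]] := @radon_nikodym_sigma_finite _ _ _ la nu.
  apply/null_content_dominatesP => A mA A0; rewrite /nu/= /mfrestr /mrestr.
  apply/eqP; rewrite eq_le measure_ge0 andbT -A0.
  apply: (@le_trans _ _ (mF A)); last exact: mFle.
  by apply: le_measure; rewrite ?inE//; exact: measurableI.
have phiR : la.-integrable setT (EFin \o (fine \o phi)).
  by apply: eq_integrable phii => // x _ /=; rewrite fineK.
have fE y : lo < y < hi -> \int[leb1]_(t in `]lo, y]) fine (phi t) = f y - f lo.
  move=> /andP[ly yh]; rewrite /Rintegral.
  pose I : set (measurableTypeR R) := `]lo, y]%classic.
  have mI : measurable I by exact: measurable_itv.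
  have -> : (\int[leb1]_(t in `]lo, y]) (fine (phi t))%:E = nu I)%E.
    by rewrite (phiE _ mI); apply: eq_integral => t _; rewrite fineK.
  rewrite [nu I](_ : _ = mF (I `&` E))// (_ : I `&` E = I).
    by rewrite [mF _](lebesgue_stieltjes_itv F (ltW ly)).
  apply/setIidPl => t; rewrite /I /E /= !in_itv/= => /andP[-> ty]/=.
  exact: le_trans ty (ltW yh).
have lphi : locally_integrable setT (fine \o phi).
  by apply: open_integrable_locally => //; exact: openT.
have iphi y : leb1.-integrable [set` Interval (BRight lo) (BRight y)] (EFin \o (fine \o phi)).
  by apply: integrableS phiR => //; exact: measurable_itv.
(* At almost every point the integral of the density is differentiable, and on []lo, hi[] it differs
   from [f] by the constant [f lo]. *)
have := FTC1 iphi lphi; apply: ae_imp => x h lxh.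
have lx : lo < x by case/andP: lxh.
have [dF _] := h lx.
apply: near_eq_derivable (derivableD dF (derivable_cst (f lo) _ _)).
have : x \in `]lo, hi[ by rewrite in_itv.
move=> /near_in_itvoo; apply: filterS => y; rewrite in_itv/= => yI.
by have := fE y yI; rewrite fctE /cst /= => ->; rewrite subrK.
Unshelve. all: by end_near. Qed.

End monotone_lipschitz.

Lemma nondecreasing_derive1_ge0 {R : realType} (f : R -> R) (a b x : R) : a < x < b ->
  (forall y z, a < y -> y <= z -> z < b -> f y <= f z) -> derivable f x 1 -> 0 <= derive1 f x.
Proof.
move=> /andP[ax xb] nf df; rewrite derive1E; apply: limr_ge; first exact: df.
near=> h; rewrite /GRing.scale/= mulr1 mulrC.
have h0 : h != 0 by near: h; exact: nbhs_dnbhs_neq.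
have hab : a < h + x < b.
  near: h; apply: nbhs_dnbhs; have : 0 \in `](a - x), (b - x)[ by rewrite in_itv/= subr_lt0 ax subr_gt0.
  by move=> /near_in_itvoo; apply: filterS => h; rewrite in_itv/= ltrBlDr ltrBrDr.
have /andP[ha hb] := hab; move: h0; rewrite neq_lt => /orP[h0|h0].
  by rewrite mulr_le0 ?invr_le0 ?(ltW h0)// subr_le0 nf// gerDr ltW.
by rewrite divr_ge0 ?(ltW h0)// subr_ge0 nf// lerDr ltW.
Unshelve. all: by end_near. Qed.

(** * The speed of the interface *)

Section interface_speed.
Context {R : realType}.
Variables (tfin L : R) (xi : R -> R).
Hypotheses (tfin0 : 0 < tfin) (L0 : 0 < L).
Hypothesis nxi : forall s t, Itau tfin s -> Itau tfin t -> s <= t -> xi s <= xi t.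
Hypothesis lxi : forall s t, Itau tfin s -> Itau tfin t -> `|xi s - xi t| <= L * `|s - t|.

Lemma monotone_lipschitz_ae_derivable : \forall tau \ae leb1, Itau tfin tau ->
  derivable xi tau 1 /\ 0 <= derive1 xi tau.
Proof.
(* Monotonicity and the Lipschitz bound are known on the time interval only. Composing [xi] with the
   projection onto it extends both to the line, and division by [L] makes the result a
   contraction. *)
pose cl (x : R) := Num.max 0 (Num.min x tfin).
have Icl x : Itau tfin (cl x).
  by rewrite /Itau /= in_itv/= /cl le_max lexx/= ge_max (ltW tfin0)/= ge_min lexx orbT.
have clid x : Itau tfin x -> cl x = x.
  by rewrite /Itau /= in_itv/= /cl => /andP[x0 xt]; rewrite min_l// max_r.
have ncl : {homo cl : x y / x <= y}.
  by move=> x y xy; rewrite /cl le_max2// le_min2.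
have lcl x y : x <= y -> cl y - cl x <= y - x.
  by move=> xy; rewrite /cl !maxElt !minElt; case: (ltP x tfin) => ?; case: (ltP y tfin) => ?; repeat case: ltP => ?; lra.
have nf : {homo (fun x => xi (cl x) / L) : x y / x <= y}.
  by move=> x y xy; rewrite ler_pM2r ?invr_gt0// nxi// ncl.
have := @contraction_ae_derivable _ _ nf.
have lf x y : x <= y -> xi (cl y) / L - xi (cl x) / L <= y - x.
  move=> xy; rewrite -mulrBl ler_pdivrMr// mulrC.
  apply: (le_trans (ler_norm _)); apply: (le_trans (lxi (Icl y) (Icl x))).
  rewrite ler_pM2l// ger0_norm ?subr_ge0 ?ncl//; exact: lcl.
have ends : {ae leb1, forall x : R, x != 0 /\ x != tfin}.
  exists [set 0; tfin]; split.
  - by apply: measurableU; exact: measurable_set1.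
  - by apply: countable_lebesgue_measure0; apply: finite_set_countable; exact: finite_set2.
  move=> x /= h; apply: contrapT => /not_orP[/eqP x0 /eqP xt]; exact: h.
move=> /(_ lf); apply: (ae_imp2 _ ends) => x [x0 xt] dx Ix.
have xI : 0 < x < tfin.
  by move: Ix; rewrite /Itau /= in_itv/= !le_eqVlt (negbTE xt) eq_sym (negbTE x0).
have dxi : derivable xi x 1.
  apply: near_eq_derivable (derivableM dx (derivable_cst L _ _)).
  have : x \in `]0, tfin[ by rewrite in_itv.
  move=> /near_in_itvoo; apply: filterS => y; rewrite in_itv/= => /andP[y0 yt].
  have Iy : Itau tfin y by rewrite /Itau /= in_itv/= !ltW.
  by rewrite fctE /cst (clid y Iy) divfK// gt_eqF.
split => //; apply: (nondecreasing_derive1_ge0 xI) => // y z y0 yz zt.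
by apply: nxi => //; rewrite /Itau /= in_itv/= ?(ltW y0) ?(ltW zt) ?(le_trans yz (ltW zt)) ?(le_trans (ltW y0) yz).
Qed.

End interface_speed.

Unset Implicit Arguments.

Theorem theorem3p16 (R : realType) (alpha beta tfin d eps_star : R)
    (u : R -> R -> int -> R) (ts : R -> nat -> \bar R) (q : R -> R -> int -> R)
    (e : nat -> R) (xi0 : R -> R) (Q0 R0 : R * R -> R)
  (tfin_gt0 : 0 < tfin)
  (u_sol : forall eps : R, 0 < eps -> single_interface_solution (u eps) (ts eps))
  (u_data : forall eps : R, 0 < eps ->
    macroscopic_data alpha beta eps (dPhi \o u eps 0))
  (q_sol : forall eps : R, 0 < eps ->
    bounded_heat_solution (dPhi \o u eps 0) (q eps))
  (d_gt0 : 0 < d) (eps_star_itv : 0 < eps_star <= 1)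
  (bounds : forall eps : R, 0 < eps <= eps_star ->
    transition_bounds tfin d eps (ts eps))
  (e_gt0 : forall n, 0 < e n) (e_cvg0 : e n @[n --> \oo] --> (0 : R))
  (xi_cvg : cvg_Linfty leb1 (Itau tfin)
    (fun n => interface_position (e n) (ts (e n))) xi0)
  (Q_cvg : cvg_Linfty leb2 (Omega tfin) (fun n => macro (e n) (q (e n))) Q0)
  (R_cvg : cvg_Linfty leb2 (Omega tfin)
    (fun n => regular_fluctuation tfin d (e n) (ts (e n))) R0) :
  exists (xi : R -> R) (Q Rf : R * R -> R),
  [/\ xi = xi0 %[ae leb1 in Itau tfin],
      Q = Q0 %[ae leb2 in Omega tfin] &
      Rf = R0 %[ae leb2 in Omega tfin]] /\
  let P := fun z => Q z + Rf z in
  [/\ (forall s : R, 1 <= s -> cvg_Lsloc s (Omega tfin)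
        (fun n => macro (e n) (fun t j => dPhi (u (e n) t j))) P),
      [/\ [lipschitz xi tau | tau in Itau tfin],
          [/\ bounded_locally_holder (Omega tfin) Q,
              bounded_locally_holder (Omega tfin) Rf &
              bounded_locally_holder (Omega tfin) P],
          Linfty_Lp tfin 1%E Rf &
          exists2 DR : R * R -> R, weak_dxi tfin Rf DR & Linfty_Lp tfin 2%:E DR],
      heat_solution tfin Q /\ (forall x, Q (0, x) = P (0, x)) &
      [/\ fbp_distributional_solution tfin P xi /\ initial_data_attained P xi,
          (forall tau x, Itau tfin tau ->
            -1 <= P (tau, x) /\ (xi tau <= x -> P (tau, x) <= 1)),
          (forall tau, Itau tfin tau -> -1 <= P (tau, xi tau) <= 1),
          (\forall tau \ae leb1, Itau tfin tau ->
            derivable xi tau 1 /\ 0 <= derive1 xi tau) &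
          (forall tau, Itau tfin tau -> P (tau, xi tau) <> 1 ->
            is_derive_within (Itau tfin) xi tau 0)]].
Proof.
have [es0 es1] : 0 < eps_star /\ eps_star <= 1 by apply/andP.
have [Nx [ex [cx hx]]] := cvg_Linfty_ae lebesgue_setT_gt0 xi_cvg.
have [Nq [eq_ [cq hq]]] := cvg_Linfty_ae lebesgue2_setT_gt0 Q_cvg.
have [Nr [er_ [cr hr]]] := cvg_Linfty_ae lebesgue2_setT_gt0 R_cvg.
have [Ne _ he] : \forall n \near \oo, e n <= eps_star.
  move/cvgrPdist_le: e_cvg0 => /(_ _ es0); apply: filterS => n.
  by rewrite sub0r normrN ger0_norm ?(ltW (e_gt0 n)).
(* A common index beyond which the three norms are finite and [e n <= eps_star]. The limits do not
   see the terms before it, so the argument runs along the shifted sequence. *)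
pose N := (Nx + Nq + Nr + Ne)%N.
have sh (f : nat -> R) : f n @[n --> \oo] --> (0 : R) -> f (n + N)%N @[n --> \oo] --> (0 : R).
  by move=> cf; rewrite (cvg_shiftn N).
pose e' n := e (n + N)%N.
have e'0 n : 0 < e' n by exact: e_gt0.
have e's n : e' n <= eps_star by apply: he => /=; rewrite /N; lia.
have mdex n : exists KS : nat * (nat -> R),
    micro_data tfin d (e' n) (ts (e' n)) (fun t j => dPhi (u (e' n) t j)) (q (e' n)) KS.1 KS.2.
  have [|K [S h]] := micro_dataP tfin_gt0 d_gt0 (e'0 n) (u_sol _ (e'0 n)) (q_sol _ (e'0 n)).
    by apply: bounds; rewrite e'0 e's.
  by exists (K, S).
have [KS md] := choice mdex.
have al0 : 0 <= alpha.
  have [_ h _] := u_data _ (e'0 0%N); have := le_trans (normr_ge0 _) (h 0).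
  by rewrite pmulr_lge0.
have sd : scaled_data tfin d alpha e' (fun n => ts (e' n)) (fun n t j => dPhi (u (e' n) t j))
    (fun n => q (e' n)) (fun n => (KS n).1) (fun n => (KS n).2).
  split => //.
  - by move=> n; exact: le_trans (e's n) es1.
  - exact: sh.
  - by move=> n b; exact: (bounded_heat_solution_sol b (q_sol _ (e'0 n))).
  - move=> n j; have [_ _ ->] := q_sol _ (e'0 n).
    by have [_ h _] := u_data _ (e'0 n); exact: h.
have [|||xi [Q [Rf [er [ld [xiE QE RfE]]]]]] := limit_dataP sd (xi0 := xi0) (Q0 := Q0) (R0 := R0)
   (sh _ cx) (sh _ cq) (sh _ cr).
- by move=> n; apply: hx; rewrite /N; lia.
- by move=> n; apply: hq; rewrite /N; lia.
- by move=> n; apply: hr; rewrite /N; lia.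
exists xi, Q, Rf; split; first by split.
move=> P; have [hQ hRf hP] := limit_regularity sd ld.
have Pge tau x : Itau tfin tau -> -1 <= P (tau, x) by exact: (P_ge sd ld).
have Ple tau x : Itau tfin tau -> xi tau <= x -> P (tau, x) <= 1 by exact: (P_le sd ld).
split.
- move=> s s1 C cC CO; have := macro_Lsloc sd ld s1 cC CO.
  by move=> h; rewrite -(cvg_shiftn N).
- split => //.
  + exact: (xi_lipschitz ld).
  + exact: (Rf_Linfty_L1 sd ld).
  + exact: (Rf_weak_derivative sd ld).
- split; first exact: (Q_heat_solution sd ld).
  by move=> x; exact: (initial_P sd ld).
split.
- split; first exact: (P_weak_solution sd ld).
  exact: (P_initial sd ld).
- by move=> tau x It; split; [exact: Pge|exact: Ple].
- by move=> tau It; rewrite Pge ?Ple.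
- apply: (@monotone_lipschitz_ae_derivable _ tfin (2 * d)^-1) => //.
  + by rewrite invr_gt0 mulr_gt0.
  + exact: (xi_nondecreasing sd ld).
  + by move=> s t Is It; exact: (ld_Xmod ld Is It).
- by move=> tau It; exact: (xi_derive0 sd ld).
Qed.
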